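(* Let $f$ be a transcendental entire function with a multiply connected wandering domain $U$, let $U_m=f^m(U)$ for $m\in\mathbb{N}$, and let $n \in \mathbb{N}$. Then (a) $c(U_n) = 2$ if and only if $\bigcup_{m=n}^{\infty}U_m$ contains no critical points of $f$; (b) $2 < c(U_n) < \infty$ if and only if $\bigcup_{m=n}^{\infty}U_m$ contains a finite non-zero number of critical points of $f$; (c) $U_n$ is infinitely connected (that is, $c(U_n)=\infty$) if and only if $\bigcup_{m=n}^{\infty}U_m$ contains infinitely many critical points of $f$.
   Context: For a domain $G\subset\mathbb{C}$, $c(G)$ denotes its connectivity, that is, the number of connected components of the complement of $G$ with respect to the Riemann sphere $\mathbb{C}\cup\{\infty\}$. A transcendental entire function is an entire function $f:\mathbb{C}\to\mathbb{C}$ that is not a polynomial; $f^n$ denotes its $n$-th iterate, and $\mathbb{N}=\{1,2,\dots\}$. The Fatou set $F(f)$ is the set of points of $\mathbb{C}$ having a neighbourhood on which the iterates $f^n$ form a normal family (locally uniform convergence to $\infty$ being allowed). A Fatou component is a connected component of $F(f)$. For a Fatou component $U$, $U_n$ denotes the Fatou component containing $f^n(U)$, with $U_0=U$; $U$ is a wandering domain if the sequence $(U_n)$ is not eventually periodic. A domain is multiply connected if it is not simply connected. By results of Baker, if $U$ is a multiply connected wandering domain then each $U_n$ is bounded and multiply connected, $U_n=f^n(U)$, for all large $n$ both $U_n$ and $0$ lie in a bounded complementary component of $U_{n+1}$, and $\mathrm{dist}(U_n,0)\to\infty$ as $n\to\infty$. *)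

(* Defs.v *)
From HB Require Import structures.
From mathcomp Require Import all_boot all_order all_algebra.
From mathcomp Require Import complex.
From mathcomp Require Import all_classical all_reals all_analysis.

Set Implicit Arguments.
Unset Strict Implicit.
Unset Printing Implicit Defensive.

Import Order.TTheory GRing.Theory Num.Theory.
Import numFieldNormedType.Exports.

Local Open Scope ring_scope.
Local Open Scope complex_scope.
Local Open Scope classical_set_scope.

(* Naming the structure, rather than working with the bare type [R[i]], gives
   access to the topology of the modulus and to complex differentiation, which
   the library provides for an arbitrary numClosedFieldType. *)
Definition cplx (R : realType) : numClosedFieldType := R[i].

Section entire_functions.
Context {R : realType}.
Local Notation C := (cplx R).
Implicit Types (f g : C -> C) (U V G : set C).

(* Differentiation over the scalar field [C], that is, complex
   differentiability. *)
Definition entire f := forall z, derivable f z 1.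

Definition transcendental_entire f :=
  entire f /\ ~ exists p : {poly C}, forall z, f z = p.[z].

Definition critical_points f : set C := [set z | f^`() z = 0].

Definition locally_uniform_cvg V (u : nat -> C -> C) g :=
  forall z, V z -> exists2 W, nbhs z W & {uniform W, u @ \oo --> g}.

Definition locally_uniform_cvg_infty V (u : nat -> C -> C) :=
  forall z, V z -> exists2 W, nbhs z W &
    forall M : R, \forall n \near \oo, forall w, W w -> (M%:C : C) < `|u n w|.

(* The finite limit [g] is automatically holomorphic when the family is. *)
Definition normal_family (F : set (C -> C)) V :=
  forall u : nat -> C -> C, (forall i, F (u i)) ->
  exists s : nat -> nat, {homo s : i j / (i < j)%N} /\
    ((exists g, locally_uniform_cvg V (u \o s) g) \/
     locally_uniform_cvg_infty V (u \o s)).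

Definition fatou_set f : set C :=
  [set z | exists2 V, open_nbhs z V &
    normal_family [set iter n f | n in [set n | (0 < n)%N]] V].

Definition fatou_component f U :=
  exists2 z, fatou_set f z & U = connected_component (fatou_set f) z.

(* The Fatou component containing [f^n(U)]; [get] is definite description, and
   there is at most one such component when [U] is nonempty. *)
Definition fatou_orbit f U (n : nat) : set C :=
  get [set V | fatou_component f V /\ iter n f @` U `<=` V].

Definition eventually_periodic (T : Type) (u : nat -> T) :=
  exists N p : nat, (0 < p)%N /\ forall n, (N <= n)%N -> u (n + p)%N = u n.

Definition wandering_domain f U :=
  fatou_component f U /\ ~ eventually_periodic (fatou_orbit f U).

Definition null_homotopic_in G (c : R -> C) :=
  exists H : R * R -> C,
    [/\ {within `[0, 1] `*` `[0, 1], continuous H},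
        forall s t, `[0, 1] s -> `[0, 1] t -> G (H (s, t)),
        forall t, `[0, 1] t -> H (0, t) = c t,
        forall t, `[0, 1] t -> H (1, t) = c 0 &
        forall s, `[0, 1] s -> H (s, 0) = c 0 /\ H (s, 1) = c 0].

(* For domains only: path-connectedness is not part of the definition. *)
Definition simply_connected G :=
  forall c : R -> C, {within `[0, 1], continuous c} ->
    (forall t, `[0, 1] t -> G (c t)) -> c 0 = c 1 -> null_homotopic_in G c.

Definition multiply_connected G := ~ simply_connected G.

(* The Riemann sphere is the one-point compactification of [C]. *)
Definition sphere_complement G : set (one_point_compactification C) :=
  ~` [set (Some z : one_point_compactification C) | z in G].

Definition connectivity G : \bar R :=
  counting (connected_component (sphere_complement G) @` sphere_complement G).

End entire_functions.

(* Main.v *)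
Require Import Defs.
From mathcomp Require Import all_boot all_order all_algebra.
From mathcomp Require Import complex.
From mathcomp Require Import all_classical all_reals all_analysis.
From mathcomp Require Import ring lra.
Set Implicit Arguments.
Unset Strict Implicit.
Unset Printing Implicit Defensive.
Import Order.TTheory GRing.Theory Num.Theory.
Import numFieldNormedType.Exports.
Local Open Scope ring_scope.
Local Open Scope classical_set_scope.
(* Inside a wandering domain V that surrounds a Julia point the iterates f^k tend to infinity, and for K' compact in
   V and k large the image f^k(V) contains the circle |w| = |f^k z| for every z in K'. Otherwise some multiples of
   iterates omit 0 and 1 on V; Schottky's theorem, a limit along an ultrafilter and Hurwitz' theorem then give
   |f| <= C |w| on the disc of radius c |w| for arbitrarily large |w|, and f would be affine. Hence the bounded part of
   the complement of V near K' lies in a low sublevel set of |f^k|, and the topology of V is read off from the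
   level sets of the single holomorphic function f^k.

   The bounded complementary components of V are counted by disjoint compact sets Q off V with V `|` Q open.
   By the maximum principle no point of Q is mapped into the next component, so such sets for f(V) pull back to
   such sets for V. If f has a critical point p in V, two directions of descent of |f^k| at p with the same image
   under f lead into different components of {|f^k| < |f^k(p)|}, because a connection between them would enclose one
   of the directions of ascent, against the maximum principle; both components contain preimages of the same zero,
   and one set is gained. If the forward orbit of V has no critical points, two sets Q would have to be merged at a first
   level of some |f^k|, necessarily at a saddle, so there is at most one Q; there is at least one since V surrounds
   a Julia point. If f^m(V) has only one such set, every set for V meets the finite preimage of one point of it. *)

(** The connectivities are compared by inequalities alone, which play the part of the
    Riemann-Hurwitz formula: disjoint sets pull back from [f(V)] to [V], a critical point in [V]
    gives at least one more, and a forward orbit free of critical points leaves exactly one. No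
    multiplicity is ever computed. Critical points are counted through the indices [m] whose domain
    contains one: the domains are disjoint and bounded and f' is not constant, so finitely many
    indices amount to finitely many points. An obstacle is that multiple connectivity is stated by
    loops that cannot be contracted, while the rest speaks of complementary components. The bridge
    is built in one direction: if no compact subset of the domain encloses a point outside it, a
    disc spanned by the loop is pushed into the domain square by square of a fine grid, and the loop
    contracts. Boundedness, surjectivity and escape of the domains are all derived from one object,
    a compact connected Fatou set surrounding a Julia point, on which the iterates are comparable in
    size while the maximum principle carries their bounds inside. *)

(* [lra] inspects every hypothesis; discarding first those that are not comparisons makes it much faster. *)
Ltac clear_nonarith :=
  repeat match goal with H : ?P |- _ =>
    lazymatch type of P with Prop =>
      lazymatch P with
      | is_true (_ \in _) => clear H
      | is_true (leq _ _) => clear H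
      | is_true (~~ (_ == _)) => clear H
      | is_true _ => fail
      | @eq (cplx _) _ _ => clear H
      | @eq _ _ _ => fail
      | _ /\ _ => fail
      | _ \/ _ => fail
      | _ => clear H
      end
    end
  end;
  repeat match goal with x := _ |- _ => clearbody x end.
Ltac lin := first [clear_nonarith; lra | lra].

(** * The plane with a real-valued modulus: topology, compactness, continuity *)

Section plane.
Context {R : realType}.
Local Notation C := (cplx R).
Implicit Types (x y : R) (z w : C).

Definition rc (x : R) : C := x%:C%C.
(** The library modulus takes values in [cplx R], which is only partially ordered. Its real part
    carries the same information and brings all estimates into [R], where linear arithmetic
    applies. *)
Definition nm (z : C) : R := complex.Re `|z|.
Definition reC (z : C) : R := complex.Re z.
Definition imC (z : C) : R := complex.Im z.
Definition iC : C := 'i%C.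

Lemma rcD x y : rc (x + y) = rc x + rc y. Proof. exact: (rmorphD (real_complex R)). Qed.
Lemma rcM x y : rc (x * y) = rc x * rc y. Proof. exact: (rmorphM (real_complex R)). Qed.
Lemma rcN x : rc (- x) = - rc x. Proof. exact: (rmorphN (real_complex R)). Qed.
Lemma rcB x y : rc (x - y) = rc x - rc y. Proof. by rewrite rcD rcN. Qed.
Lemma rc0 : rc 0 = 0. Proof. by []. Qed.
Lemma rc1 : rc 1 = 1. Proof. by []. Qed.
Lemma rcV x : rc x^-1 = (rc x)^-1. Proof. exact: (fmorphV (real_complex R)). Qed.
Lemma rcn (n : nat) : rc n%:R = n%:R. Proof. exact: (rmorph_nat (real_complex R)). Qed.
Lemma rcX x n : rc (x ^+ n) = rc x ^+ n. Proof. exact: (rmorphXn (real_complex R)). Qed.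
Lemma rc_inj : injective rc. Proof. by move=> x y []. Qed.
Lemma rc_le x y : (rc x <= rc y) = (x <= y). Proof. exact: lecR. Qed.
Lemma rc_lt x y : (rc x < rc y) = (x < y). Proof. exact: ltcR. Qed.
Lemma rc_eq0 x : (rc x == 0) = (x == 0). Proof. by rewrite -rc0 (inj_eq rc_inj). Qed.

Lemma rc_nm z : rc (nm z) = `|z|.
Proof. by rewrite /nm normc_def. Qed.

Lemma nm_ge0 z : 0 <= nm z. Proof. by rewrite -rc_le rc_nm rc0 normr_ge0. Qed.
Lemma nm0 : nm 0 = 0. Proof. by apply: rc_inj; rewrite rc_nm normr0. Qed.
Lemma nm1 : nm 1 = 1. Proof. by apply: rc_inj; rewrite rc_nm normr1. Qed.
Lemma nmM z w : nm (z * w) = nm z * nm w.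
Proof. by apply: rc_inj; rewrite rcM !rc_nm normrM. Qed.
Lemma nmN z : nm (- z) = nm z. Proof. by apply: rc_inj; rewrite !rc_nm normrN. Qed.
Lemma nmV z : nm z^-1 = (nm z)^-1.
Proof. by apply: rc_inj; rewrite rcV !rc_nm normfV. Qed.
Lemma nmX z n : nm (z ^+ n) = nm z ^+ n.
Proof. by apply: rc_inj; rewrite rcX !rc_nm normrX. Qed.
Lemma nm_eq0 z : (nm z == 0) = (z == 0).
Proof. by rewrite -rc_eq0 rc_nm normr_eq0. Qed.
Lemma nm0_eq z : nm z = 0 -> z = 0.
Proof. by move/eqP; rewrite nm_eq0 => /eqP. Qed.
Lemma nm_gt0 z : (0 < nm z) = (z != 0).
Proof. by rewrite lt_def nm_ge0 andbT nm_eq0. Qed.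
Lemma nmD z w : nm (z + w) <= nm z + nm w.
Proof. by rewrite -rc_le rcD !rc_nm ler_normD. Qed.
Lemma nmBC z w : nm (z - w) = nm (w - z). Proof. by rewrite -nmN opprB. Qed.
Lemma nmB z w : nm (z - w) <= nm z + nm w. Proof. by rewrite -(nmN w) nmD. Qed.
Lemma nmD3 u z w : nm (z - w) <= nm (z - u) + nm (u - w).
Proof. by have := nmD (z - u) (u - w); rewrite addrA subrK. Qed.
Lemma nmB_ge z w : nm z - nm w <= nm (z - w).
Proof. have := nmD (z - w) w; rewrite subrK; lin. Qed.
Lemma nmB_ge' z w : nm w - nm z <= nm (z - w).
Proof. rewrite nmBC; exact: nmB_ge. Qed.
Lemma nm_rc x : nm (rc x) = `|x|.
Proof. by apply: rc_inj; rewrite rc_nm /rc normc_def /= expr0n /= addr0 sqrtr_sqr. Qed.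
Lemma nm_nat n : nm (n%:R) = n%:R.
Proof. by rewrite -rcn nm_rc normr_nat. Qed.
Lemma nm_iC : nm iC = 1.
Proof. by apply: rc_inj; rewrite rc_nm normc_def /= expr0n /= add0r expr1n sqrtr1. Qed.
Lemma iC2 : iC * iC = -1. Proof. by rewrite -expr2 sqr_i. Qed.

Lemma reD z w : reC (z + w) = reC z + reC w. Proof. by case: z; case: w. Qed.
Lemma imD z w : imC (z + w) = imC z + imC w. Proof. by case: z; case: w. Qed.
Lemma reN z : reC (- z) = - reC z. Proof. by case: z. Qed.
Lemma imN z : imC (- z) = - imC z. Proof. by case: z. Qed.
Lemma reB z w : reC (z - w) = reC z - reC w. Proof. by rewrite reD reN. Qed.
Lemma imB z w : imC (z - w) = imC z - imC w. Proof. by rewrite imD imN. Qed.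
Lemma reM z w : reC (z * w) = reC z * reC w - imC z * imC w. Proof. by case: z; case: w. Qed.
Lemma imM z w : imC (z * w) = reC z * imC w + imC z * reC w. Proof. by case: z; case: w. Qed.
Lemma re_rc x : reC (rc x) = x. Proof. by []. Qed.
Lemma im_rc x : imC (rc x) = 0. Proof. by []. Qed.
Lemma re_iC : reC iC = 0. Proof. by []. Qed.
Lemma im_iC : imC iC = 1. Proof. by []. Qed.
Lemma reimE z : z = rc (reC z) + iC * rc (imC z). Proof. exact: complexE. Qed.
Lemma C_ext z w : reC z = reC w -> imC z = imC w -> z = w.
Proof. by case: z => a b; case: w => c d; rewrite /reC /imC /= => -> ->. Qed.
Lemma re0 : reC 0 = 0. Proof. by []. Qed.
Lemma im0 : imC 0 = 0. Proof. by []. Qed.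

Lemma nm_sqr z : nm z ^+ 2 = reC z ^+ 2 + imC z ^+ 2.
Proof. by apply: rc_inj; rewrite rcX rc_nm -add_Re2_Im2. Qed.
Lemma re_le_nm z : `|reC z| <= nm z.
Proof.
rewrite -(@ler_sqr _ `|_|) ?nnegrE ?nm_ge0 // nm_sqr real_normK ?num_real //.
by rewrite lerDl sqr_ge0.
Qed.
Lemma im_le_nm z : `|imC z| <= nm z.
Proof.
rewrite -(@ler_sqr _ `|_|) ?nnegrE ?nm_ge0 // nm_sqr real_normK ?num_real //.
by rewrite lerDr sqr_ge0.
Qed.
Lemma nm_le_reim z : nm z <= `|reC z| + `|imC z|.
Proof. by rewrite {1}(reimE z); apply: le_trans (nmD _ _) _; rewrite nmM nm_iC mul1r !nm_rc. Qed.
Lemma re_le z : reC z <= nm z. Proof. exact: le_trans (ler_norm _) (re_le_nm z). Qed.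

Lemma nbhsCP z (A : set C) :
  nbhs z A <-> exists2 e : R, 0 < e & forall w, nm (w - z) < e -> A w.
Proof.
split=> [/nbhs_ballP[e /= e0 eA]|[e e0 eA]].
  have er : e = rc (reC e).
    apply: C_ext => //; move: e0; rewrite ltcE => /andP[/eqP h _].
    by rewrite im_rc /imC h.
  exists (reC e); first by rewrite -rc_lt -er.
  move=> w wz; apply: eA; rewrite /ball /= /ball_ distrC -rc_nm er rc_lt //.
apply/nbhs_ballP; exists (rc e); first by rewrite /= -rc0 rc_lt.
by move=> w; rewrite /ball /= /ball_ distrC -rc_nm rc_lt => /eA.
Qed.

Definition disc (c : C) (r : R) : set C := [set z | nm (z - c) < r].
Definition cdisc (c : C) (r : R) : set C := [set z | nm (z - c) <= r].

Lemma openCP (A : set C) :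
  open A <-> forall z, A z -> exists2 e : R, 0 < e & disc z e `<=` A.
Proof.
rewrite openE; split=> h z Az; first by have /nbhsCP := h z Az.
by apply/nbhsCP; apply: h.
Qed.

Lemma disc_open c r : open (disc c r).
Proof.
apply/openCP => z zr; exists (r - nm (z - c)); first by move: zr; rewrite /disc /=; lin.
by move=> w; rewrite /disc /= => wz; have := nmD3 z w c; lin.
Qed.

Lemma disc_center c r : 0 < r -> disc c r c.
Proof. by rewrite /disc /= subrr nm0. Qed.

Lemma cdisc_closed c r : closed (cdisc c r).
Proof.
rewrite -openC; apply/openCP => z /negP; rewrite -ltNge => zr.
exists (nm (z - c) - r); first by lin.
by move=> w; rewrite /disc /cdisc /= => wz; apply/negP; rewrite -ltNge; have := nmD3 w z c; rewrite (nmBC z w); lin.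
Qed.

Lemma closureCP (A : set C) z :
  closure A z <-> forall e : R, 0 < e -> exists2 w, A w & nm (w - z) < e.
Proof.
split=> [h e e0|h B /nbhsCP[e e0 eB]].
  have [|w [Aw wz]] := h (disc z e); last by exists w.
  by apply/nbhsCP; exists e.
by have [w Aw wz] := h e e0; exists w; split => //; apply: eB.
Qed.

(** Epsilon-delta form, since moduli of continuity are combined by hand throughout; [cont_onP] leads
    back to the library notion when the image of a compact or connected set is wanted. *)
Definition cont_on (A : set C) (f : C -> C) := forall z, A z -> forall e : R, 0 < e ->
  exists2 d : R, 0 < d & forall w, A w -> nm (w - z) < d -> nm (f w - f z) < e.
Definition rcont_on (A : set C) (f : C -> R) := forall z, A z -> forall e : R, 0 < e ->
  exists2 d : R, 0 < d & forall w, A w -> nm (w - z) < d -> `|f w - f z| < e.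

Lemma cont_onP (A : set C) f : cont_on A f <-> {within A, continuous f}.
Proof.
split=> [h|/subspace_continuousP h z Az e e0].
  apply/subspace_continuousP => z Az B /nbhsCP[e e0 eB].
  have [d d0 dA] := h _ Az _ e0.
  by apply/nbhsCP; exists d => // w wz Aw; apply: eB; apply: dA.
have /nbhsCP[d d0 dA] := h _ Az (disc (f z) e) (proj2 (nbhsCP _ _) (ex_intro2 _ _ e e0 (fun _ => id))).
by exists d => // w Aw wz; apply: dA.
Qed.

Lemma rcont_onP (A : set C) f : rcont_on A f <-> {within A, continuous f}.
Proof.
split=> [h|/subspace_continuousP h z Az e e0].
  apply/subspace_continuousP => z Az B /nbhs_ballP[e /= e0 eB].
  have [d d0 dA] := h _ Az _ e0.
  by apply/nbhsCP; exists d => // w wz Aw; apply: eB; rewrite /ball /= distrC; apply: dA.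
have /nbhsCP[d d0 dA] := h _ Az _ (nbhsx_ballx (f z) e e0).
by exists d => // w Aw wz; rewrite distrC; apply: dA.
Qed.

Lemma rcont_nm A f : cont_on A f -> rcont_on A (fun z => nm (f z)).
Proof.
move=> h z Az e e0; have [d d0 dA] := h z Az e e0; exists d => // w Aw wz.
have := dA _ Aw wz; have := nmB_ge (f w) (f z); have := nmB_ge' (f w) (f z).
by rewrite ltr_norml; lin.
Qed.
Lemma rcont_re A f : cont_on A f -> rcont_on A (fun z => reC (f z)).
Proof.
move=> h z Az e e0; have [d d0 dA] := h z Az e e0; exists d => // w Aw wz.
by apply: le_lt_trans (dA _ Aw wz); rewrite -reB re_le_nm.
Qed.
Lemma rcont_im A f : cont_on A f -> rcont_on A (fun z => imC (f z)).
Proof.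
move=> h z Az e e0; have [d d0 dA] := h z Az e e0; exists d => // w Aw wz.
by apply: le_lt_trans (dA _ Aw wz); rewrite -imB im_le_nm.
Qed.
Lemma cont_on_sub (A B : set C) f : A `<=` B -> cont_on B f -> cont_on A f.
Proof.
by move=> AB h z Az e e0; have [d d0 dB] := h _ (AB _ Az) _ e0; exists d => // w /AB; apply: dB.
Qed.
Lemma cont_on_id A : cont_on A id.
Proof. by move=> z _ e e0; exists e. Qed.
Lemma cont_on_comp (A B : set C) f g : cont_on B f -> cont_on A g -> (forall z, A z -> B (g z)) ->
  cont_on A (fun z => f (g z)).
Proof.
move=> hf hg AB z Az e e0; have [d d0 dB] := hf _ (AB _ Az) _ e0.
by have [d' d'0 dA] := hg _ Az _ d0; exists d' => // w Aw wz; apply: dB; [exact: AB|exact: dA].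
Qed.
Lemma cont_on_ext A f g : (forall z, A z -> f z = g z) -> cont_on A g -> cont_on A f.
Proof.
by move=> fg h z Az e e0; have [d d0 dA] := h z Az e e0; exists d => // w Aw wz; rewrite !fg //; apply: dA.
Qed.

(** Heine-Borel: [A] is the image of a closed part of a compact real square under (x, y) -> x +
    iy. *)
Lemma closed_bounded_compact (A : set C) r : closed A -> (forall z, A z -> nm z <= r) -> compact A.
Proof.
move=> cA bA.
pose h (p : R * R) : C := rc p.1 + iC * rc p.2.
have ch : continuous h.
  move=> p B /nbhsCP[e e0 eB].
  have e20 : 0 < e / 2 by lin.
  have := @nbhsx_ballx _ (R * R)%type p _ e20; apply: filterS => q [/= q1 q2].
  apply: eB; have -> : h q - h p = rc (q.1 - p.1) + iC * rc (q.2 - p.2) by rewrite /h !rcB; ring.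
  apply: le_lt_trans (nmD _ _) _; rewrite nmM nm_iC mul1r !nm_rc.
  have q1' : `|p.1 - q.1| < e / 2 := q1. have q2' : `|p.2 - q.2| < e / 2 := q2.
  by move: q1' q2'; rewrite (distrC p.1) (distrC p.2); lin.
have -> : A = h @` ((`[-r, r] `*` `[-r, r]) `&` h @^-1` A).
  apply/seteqP; split=> [z Az|z [p [_ /= hA] <-] //].
  exists (reC z, imC z); last by rewrite /h -reimE.
  split; last by rewrite /= /h /= -reimE.
  by have := bA z Az; have := re_le_nm z; have := im_le_nm z;
    rewrite /= !in_itv /= -!ler_norml => ? ? ?; split; lin.
apply: continuous_compact; first exact: continuous_subspaceT.
apply: (@subclosed_compact _ _ (`[-r, r] `*` `[-r, r])); last by move=> p [].
  apply: closedI; last by apply: preimage_closed => // ? _; exact: ch.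
  by apply: compact_closed; [exact: norm_hausdorff|apply: compact_setX; exact: segment_compact].
by apply: compact_setX; exact: segment_compact.
Qed.

Lemma hausC : hausdorff_space C. Proof. exact: norm_hausdorff. Qed.

Lemma cdisc_compact c r : compact (cdisc c r).
Proof.
apply: (@closed_bounded_compact _ (r + nm c)); first exact: cdisc_closed.
by move=> z; rewrite /cdisc /=; have := nmB_ge z c; lin.
Qed.

Lemma rcompact_max (A : set C) (f : C -> R) : compact A -> A !=set0 -> rcont_on A f ->
  exists2 z, A z & forall w, A w -> f w <= f z.
Proof.
move=> cA [a Aa] /rcont_onP fc.
have cf := continuous_compact fc cA.
have nf : (f @` A) !=set0 by exists (f a), a.
have bf : has_sup (f @` A) by split => //; case: (compact_bounded cf) => M [_ /(_ (M + 1))]; rewrite ltrDl ltr01 => /(_ isT) h; exists (M + 1) => y /h; apply: le_trans; exact: ler_norm.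
have clf := compact_closed (@norm_hausdorff _ R) cf.
have /clf [z Az fz] := closure_sup nf (proj2 bf).
by exists z => // w Aw; rewrite fz; apply: sup_upper_bound => //; exists w.
Qed.

Lemma rcompact_min (A : set C) (f : C -> R) : compact A -> A !=set0 -> rcont_on A f ->
  exists2 z, A z & forall w, A w -> f z <= f w.
Proof.
move=> cA A0 fc; have [|z Az h] := @rcompact_max A (fun z => - f z) cA A0.
  move=> z Az e e0; have [d d0 dA] := fc z Az e e0; exists d => // w Aw wz.
  by rewrite -opprD normrN; exact: dA.
by exists z => // w /h; rewrite lerN2.
Qed.

Lemma compact_nm_bound (A : set C) f : compact A -> cont_on A f ->
  exists2 M : R, 0 < M & forall z, A z -> nm (f z) <= M.
Proof.
move=> cA fc; case: (pselect (A !=set0)) => [A0|/set0P/negP/negPn/eqP ->]; last by exists 1.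
have [z Az h] := rcompact_max cA A0 (rcont_nm fc).
by exists (nm (f z) + 1) => [|w /h]; [have := nm_ge0 (f z)|]; lin.
Qed.

Lemma compact_nm_min (A : set C) f : compact A -> cont_on A f -> (forall z, A z -> f z != 0) ->
  exists2 m : R, 0 < m & forall z, A z -> m <= nm (f z).
Proof.
move=> cA fc f0; case: (pselect (A !=set0)) => [A0|/set0P/negP/negPn/eqP ->]; last by exists 1.
have [z Az h] := rcompact_min cA A0 (rcont_nm fc).
by exists (nm (f z)) => [|w /h //]; rewrite nm_gt0 f0.
Qed.

Lemma compact_bdd (A : set C) : compact A -> exists2 M : R, 0 < M & forall z, A z -> nm z <= M.
Proof. by move=> cA; exact: compact_nm_bound cA (@cont_on_id A). Qed.

Lemma cont_compact (A : set C) f : compact A -> cont_on A f -> compact (f @` A).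
Proof. by move=> cA /cont_onP fc; exact: continuous_compact. Qed.

Lemma cont_connected (A : set C) f : connected A -> cont_on A f -> connected (f @` A).
Proof. by move=> cA /cont_onP fc; exact: connected_continuous_connected. Qed.

(* The pointwise scale [e] also bounds the radius of the neighbourhood: this is the Lebesgue number argument. *)
Lemma compact_local (K : set C) (Q : C -> R -> Prop) : compact K ->
  (forall z e e', 0 < e' -> e' <= e -> Q z e -> Q z e') ->
  (forall z, K z -> exists2 e, 0 < e & forall w, K w -> nm (w - z) < e -> Q w e) ->
  exists2 e, 0 < e & forall w, K w -> Q w e.
Proof.
move=> /compact_near_coveringP cK Qm Ql.
have : \forall e \near (0:R)^'+, K `<=` (fun w => K w -> Q w e).
  apply: cK => z /Ql[e e0 h].
  exists (disc z e, [set e' | 0 < e' <= e]); first split => /=.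
  - by apply/nbhsCP; exists e.
  - near=> e'; apply/andP; split => //; near: e'; exact: nbhs_right_le.
  - by move=> [w e'] /= [wz /andP[e'0 e'e]] Kw; apply: (@Qm w e) => //; apply: h.
move=> h; have [e [e0 eK]] := filter_ex (filterI (nbhs_right_gt (0:R)) h).
by exists e => // w Kw; apply: eK.
Unshelve. all: by end_near.
Qed.

Lemma compact_disc_nbhs (K U : set C) : compact K -> open U -> K `<=` U ->
  exists2 e : R, 0 < e & forall z w, K z -> nm (w - z) < e -> U w.
Proof.
move=> cK oU KU.
have [|z e e' e'0 le Q w wz|z Kz|e e0 h] := @compact_local K (fun z e => forall w, nm (w - z) < e -> U w) => //.
- by apply: Q; lin.
- have [e e0 eU] := (openCP U).1 oU _ (KU _ Kz).
  exists (e / 2) => [|w Kw wz v vw]; first lin.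
  by apply: eU; rewrite /disc /=; have := nmD3 w v z; lin.
by exists e => // z w Kz; apply: h.
Qed.

Lemma compact_ucont (K : set C) f : compact K -> cont_on K f -> forall e : R, 0 < e ->
  exists2 d : R, 0 < d & forall z w, K z -> K w -> nm (w - z) < d -> nm (f w - f z) < e.
Proof.
move=> cK fc e e0.
have [|z d d' d'0 le Q w Kw wz|z Kz|d d0 h] :=
  @compact_local K (fun z d => forall w, K w -> nm (w - z) < d -> nm (f w - f z) < e) => //.
- by apply: Q => //; lin.
- have e20 : 0 < e / 2 by lin.
  have [d d0 dK] := fc _ Kz _ e20.
  exists (d / 2) => [|w Kw wz v Kv vw]; first lin.
  have h1 : nm (f v - f z) < e / 2 by apply: dK => //; have := nmD3 w v z; lin.
  have h2 : nm (f w - f z) < e / 2 by apply: dK => //; lin.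
  by have := nmD3 (f z) (f v) (f w); rewrite (nmBC (f z)); lin.
by exists d => // z w Kz Kw; apply: h.
Qed.
End plane.

(** * Complex derivatives and the rules for them *)

Section calculus.
Context {R : realType}.
Local Notation C := (cplx R).
Implicit Types (x y e : R) (z w h : C) (f g : C -> C).

(** Increment form: without a division the increment 0 needs no separate case, and the errors in the
    product and chain rules add up as multiples of [nm h]. *)
Definition dC f z (d : C) := forall e : R, 0 < e -> exists2 r : R, 0 < r &
  forall h, nm h < r -> nm (f (z + h) - f z - d * h) <= e * nm h.

Definition hol_on (G : set C) f := forall z, G z -> exists d, dC f z d.
Definition dv f z : C := xget 0 [set d | dC f z d].

Lemma dC_ext f g z d r : 0 < r -> (forall w, nm (w - z) < r -> f w = g w) -> dC g z d -> dC f z d.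
Proof.
move=> r0 fg hg e e0; have [r' r'0 h] := hg e e0.
exists (Num.min r r') => [|k]; first by rewrite lt_min r0.
rewrite lt_min => /andP[k1 k2]; rewrite !fg ?subrr ?nm0 //; first exact: h.
by rewrite addrAC subrr add0r.
Qed.
Lemma dC_eq f z d d' : dC f z d' -> d = d' -> dC f z d. Proof. by move=> h ->. Qed.
Lemma dC_cst (c : C) z : dC (fun=> c) z 0.
Proof. by move=> e e0; exists 1 => // h _; rewrite subrr mul0r subrr nm0 mulr_ge0 ?nm_ge0 // ltW. Qed.
Lemma dC_id z : dC id z 1.
Proof.
move=> e e0; exists 1 => // h _; rewrite (_ : z + h - z - 1 * h = 0); last by ring.
by rewrite nm0 mulr_ge0 ?nm_ge0 // ltW.
Qed.
Lemma dC_add f g z a b : dC f z a -> dC g z b -> dC (fun w => f w + g w) z (a + b).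
Proof.
move=> hf hg e e0; have e20 : 0 < e / 2 by lin.
have [r r0 h1] := hf _ e20; have [r' r'0 h2] := hg _ e20.
exists (Num.min r r') => [|k]; first by rewrite lt_min r0.
rewrite lt_min => /andP[/h1 k1 /h2 k2].
rewrite (_ : _ - _ = (f (z + k) - f z - a * k) + (g (z + k) - g z - b * k)); last by ring.
by apply: le_trans (nmD _ _) _; lin.
Qed.
Lemma dC_cont f z d : dC f z d -> forall e, 0 < e -> exists2 r, 0 < r &
  forall w, nm (w - z) < r -> nm (f w - f z) < e.
Proof.
move=> hf e e0; have [r r0 h] := hf 1 ltr01.
have d1 : 0 < nm d + 1 by have := nm_ge0 d; lin.
exists (Num.min r (e / (nm d + 1))) => [|w]; first by rewrite lt_min r0 divr_gt0.
rewrite lt_min ltr_pdivlMr // => /andP[/h k1 k2].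
move: k1; rewrite [z + _]addrC subrK => k1.
have := nmB_ge (f w - f z) (d * (w - z)); rewrite nmM; lin.
Qed.
Lemma hol_cont (G : set C) f : hol_on G f -> cont_on G f.
Proof.
move=> h z Gz e e0; have [d /dC_cont/(_ e e0)[r r0 hr]] := h z Gz.
by exists r => // w _; apply: hr.
Qed.
Lemma dC_mul f g z a b : dC f z a -> dC g z b -> dC (fun w => f w * g w) z (a * g z + f z * b).
Proof.
move=> hf hg e e0.
set M := 1 + nm (f z) + nm (g z) + nm a + nm b.
have [f0 g0 a0 b0] := And4 (nm_ge0 (f z)) (nm_ge0 (g z)) (nm_ge0 a) (nm_ge0 b).
have M1 : 1 <= M by rewrite /M; lin.
have M0 : 0 < M by lin.
(* [M] dominates every factor that occurs, and the error of the product is split into three terms of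
   at most [e / 3 * nm h] each. The cap 1 on [e1] keeps [g (z + h)] below [M]. *)
set e1 := Num.min 1 (e / (3 * M)).
have e10 : 0 < e1 by rewrite lt_min ltr01 divr_gt0 // mulr_gt0.
have e11 : e1 <= 1 by rewrite ge_min lexx.
have e1M : e1 * M <= e / 3.
  have : e1 <= e / (3 * M) by rewrite ge_min lexx orbT.
  by rewrite ler_pdivlMr; nra.
have [r r0 h1] := hf _ e10; have [r' r'0 h2] := hg _ e10.
exists (Num.min (Num.min 1 (e / (3 * M * M))) (Num.min r r')) => [|h].
  by rewrite !lt_min ltr01 r0 r'0 divr_gt0 // !mulr_gt0.
rewrite !lt_min ltr_pdivlMr ?mulr_gt0 // => /andP[/andP[k1 k2]] /andP[/h1 k3 /h2 k4].
set A := _ - _ - a * h in k3; set B := _ - _ - b * h in k4.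
rewrite (_ : _ - _ = A * g (z + h) + (f z + a * h) * B + a * b * (h * h)); last first.
  by rewrite /A /B; ring.
have hn := nm_ge0 h.
have G : nm (g (z + h)) <= M.
  rewrite (_ : g (z + h) = B + (g z + b * h)); last by rewrite /B; ring.
  have := nmD B (g z + b * h); have := nmD (g z) (b * h); rewrite nmM.
  have : nm b * nm h <= nm b by rewrite ler_piMr // ltW.
  have : e1 * nm h <= 1 by rewrite mulr_ile1 // ltW.
  by rewrite /M; lin.
have F : nm (f z + a * h) <= M.
  have := nmD (f z) (a * h); rewrite nmM.
  have : nm a * nm h <= nm a by rewrite ler_piMr // ltW.
  by rewrite /M; lin.
have T1 : nm (A * g (z + h)) <= e / 3 * nm h.
  rewrite nmM; apply: (@le_trans _ _ (e1 * nm h * M)); first by rewrite ler_pM ?nm_ge0.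
  by rewrite mulrAC ler_wpM2r.
have T2 : nm ((f z + a * h) * B) <= e / 3 * nm h.
  rewrite nmM; apply: (@le_trans _ _ (M * (e1 * nm h))); first by rewrite ler_pM ?nm_ge0.
  by rewrite mulrA ler_wpM2r // mulrC.
have T3 : nm (a * b * (h * h)) <= e / 3 * nm h.
  rewrite !nmM mulrA ler_wpM2r //.
  apply: (@le_trans _ _ (M * M * nm h)); last by lin.
  by rewrite ler_wpM2r // ler_pM //; rewrite /M; lin.
have := nmD (A * g (z + h) + (f z + a * h) * B) (a * b * (h * h)).
by have := nmD (A * g (z + h)) ((f z + a * h) * B); lin.
Qed.
Lemma dC_comp f g z a b : dC f (g z) a -> dC g z b -> dC (fun w => f (g w)) z (a * b).
Proof.
move=> hf hg e e0.
have a1 : 0 < nm a + 1 by have := nm_ge0 a; lin.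
have b1 : 0 < nm b + 1 by have := nm_ge0 b; lin.
have e10 : 0 < e / (2 * (nm b + 1)) by rewrite divr_gt0 // mulr_gt0.
have [r r0 h1] := hf _ e10.
have e20 : 0 < Num.min 1 (e / (2 * (nm a + 1))) by rewrite lt_min ltr01 divr_gt0 // mulr_gt0.
have [r' r'0 h2] := hg _ e20.
exists (Num.min r' (r / (nm b + 1))) => [|h]; first by rewrite lt_min r'0 divr_gt0.
rewrite lt_min ltr_pdivlMr // => /andP[/h2 k1 k2].
set k := g (z + h) - g z in k1; have hn := nm_ge0 h.
have k1' : nm (k - b * h) <= nm h.
  by apply: le_trans k1 _; rewrite ler_piMl // ge_min lexx.
have k1'' : nm (k - b * h) * (2 * (nm a + 1)) <= e * nm h.
  rewrite -ler_pdivlMr ?mulr_gt0 // mulrAC; apply: le_trans k1 _.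
  by rewrite ler_wpM2r // ge_min lexx orbT.
have kb : nm k <= (nm b + 1) * nm h.
  by have := nmD (k - b * h) (b * h); rewrite subrK nmM; lin.
have kr : nm k < r by apply: le_lt_trans kb _; lin.
have := h1 _ kr; rewrite (_ : g z + k = g (z + h)); last by rewrite /k; ring.
set A := _ - _ - a * k => k3.
rewrite (_ : _ - _ = A + a * (k - b * h)); last by rewrite /A; ring.
apply: le_trans (nmD _ _) _; rewrite nmM.
have T1 : nm A <= e / 2 * nm h.
  apply: le_trans k3 _.
  rewrite (_ : e / 2 * nm h = e / (2 * (nm b + 1)) * ((nm b + 1) * nm h)); last by field; rewrite gt_eqF.
  by rewrite ler_wpM2l // ltW.
have : nm a * nm (k - b * h) <= (nm a + 1) * nm (k - b * h) by rewrite ler_wpM2r ?nm_ge0 // lerDl.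
by lin.
Qed.
Lemma dC_inv0 z : z != 0 -> dC (fun w => w^-1) z (- z^-2).
Proof.
move=> z0 e e0; have nz : 0 < nm z by rewrite nm_gt0.
exists (Num.min (nm z / 2) (e * nm z ^+ 3 / 2)) => [|h].
  by rewrite lt_min !divr_gt0 // mulr_gt0 // exprn_gt0.
rewrite lt_min => /andP[k1 k2]; have hn := nm_ge0 h.
have zh : nm z / 2 <= nm (z + h) by have := nmB_ge z (- h); rewrite opprK nmN; lin.
have zh0 : z + h != 0 by rewrite -nm_gt0; lin.
rewrite (_ : _ - _ = h * (h / (z ^+ 2 * (z + h)))); last by field; rewrite zh0.
rewrite nmM mulrC ler_wpM2r // nmM nmV nmM nmX ler_pdivrMr; last by rewrite mulr_gt0 ?exprn_gt0 //; lin.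
apply: (@le_trans _ _ (e * (nm z ^+ 2 * (nm z / 2)))); first by rewrite (_ : e * _ = e * nm z ^+ 3 / 2) ?ltW //; field.
by rewrite ler_wpM2l ?(ltW e0) // ler_wpM2l // exprn_ge0 // ltW.
Qed.
Lemma dC_inv f z d : dC f z d -> f z != 0 -> dC (fun w => (f w)^-1) z (- d / f z ^+ 2).
Proof.
move=> hf f0; apply: dC_eq (dC_comp (dC_inv0 f0) hf) _.
by rewrite !mulNr mulrC.
Qed.
Lemma dC_unique f z a b : dC f z a -> dC f z b -> a = b.
Proof.
move=> ha hb; apply/eqP; rewrite -subr_eq0 -nm_eq0; apply: contraT => ab.
have ab0 : 0 < nm (a - b) / 4 by rewrite divr_gt0 // lt_def ab nm_ge0.
have [r r0 h1] := ha _ ab0; have [r' r'0 h2] := hb _ ab0.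
pose k : R := Num.min r r' / 2.
have k0 : 0 < k by rewrite divr_gt0 // lt_min r0.
have kk : k < Num.min r r' by rewrite ltr_pdivrMr // ltr_pMr ?ltr1n // lt_min r0.
have nk : nm (rc k) = k by rewrite nm_rc gtr0_norm.
move: kk; rewrite lt_min -nk => /andP[/h1 k1 /h2 k2].
have := nmB (f (z + rc k) - f z - b * rc k) (f (z + rc k) - f z - a * rc k).
rewrite (_ : _ - _ = (a - b) * rc k); last by ring.
rewrite nmM nk; rewrite nk in k1 k2.
have : 0 < nm (a - b) * k by rewrite mulr_gt0 //; lin.
by lin.
Qed.
Lemma dvE f z d : dC f z d -> dv f z = d.
Proof. by move=> h; rewrite /dv; case: xgetP => [y _ /= hy|/(_ d)] //; exact: dC_unique hy h. Qed.
Lemma dvP f z : (exists d, dC f z d) -> dC f z (dv f z).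
Proof. by move=> [d h]; rewrite (dvE h). Qed.

Lemma dC_opp f z a : dC f z a -> dC (fun w => - f w) z (- a).
Proof.
move=> h; apply: (@dC_ext _ (fun w => -1 * f w) _ _ 1) => // [w _|]; first by ring.
by apply: dC_eq (dC_mul (dC_cst (-1) z) h) _; ring.
Qed.
Lemma dC_sub f g z a b : dC f z a -> dC g z b -> dC (fun w => f w - g w) z (a - b).
Proof. by move=> hf /dC_opp hg; exact: dC_add hf hg. Qed.
Lemma dC_scale (c : C) f z a : dC f z a -> dC (fun w => c * f w) z (c * a).
Proof. by move=> h; apply: dC_eq (dC_mul (dC_cst c z) h) _; ring. Qed.
Lemma dC_affine (a b : C) z : dC (fun w => a + b * w) z b.
Proof. by apply: dC_eq (dC_add (dC_cst a z) (dC_scale b (dC_id z))) _; ring. Qed.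
Lemma dC_shift (a : C) z : dC (fun w => w - a) z 1.
Proof. by apply: dC_eq (dC_sub (dC_id z) (dC_cst a z)) _; ring. Qed.
Lemma dC_pow f z d n : dC f z d -> dC (fun w => f w ^+ n) z (n%:R * d * f z ^+ n.-1).
Proof.
move=> h; elim: n => [|n IH].
  by apply: dC_eq (dC_cst 1 z) _; rewrite !mul0r.
apply: (@dC_ext _ (fun w => f w * f w ^+ n) _ _ 1) => // [w _|]; first by rewrite exprS.
apply: dC_eq (dC_mul h IH) _; rewrite succnK -addn1 natrD.
by case: n {IH} => [|n] /=; rewrite ?exprS; ring.
Qed.

Lemma hol_sub (A B : set C) f : A `<=` B -> hol_on B f -> hol_on A f.
Proof. by move=> AB h z /AB; apply: h. Qed.

Lemma is_derive_eps (phi : R -> R) x d : is_derive x 1 phi d -> forall e, 0 < e ->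
  exists2 r : R, 0 < r & forall t, `|t| < r -> `|phi (x + t) - phi x - d * t| <= e * `|t|.
Proof.
move=> [dphi dE] e e0.
have := dphi; rewrite /derivable => /cvg_ex[l hl].
have el : l = d by rewrite -dE /derive; apply/esym/cvg_lim.
rewrite el in hl.
have /nbhs_ballP[r /= r0 hr] := hl _ (nbhsx_ballx d e e0).
exists r => // t tr; have [->|t0] := eqVneq t 0; first by rewrite addr0 subrr mulr0 subrr normr0 mulr0.
have := hr t; rewrite /ball /= sub0r normrN => /(_ tr t0); rewrite /ball /= => h.
rewrite (_ : _ - _ = - (t * (d - t^-1 * (phi (t * 1 + x) - phi x)))).
  by rewrite normrN normrM mulrC ler_wpM2r // ltW.
by rewrite mulr1 (addrC t); field.
Qed.

End calculus.

(** * The complex exponential and integrals over the unit interval *)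

Section integral.
Context {R : realType}.
Local Notation C := (cplx R).
Implicit Types (x y e t : R) (z w h : C) (f g : C -> C).

Lemma eps_is_derive (phi : R -> R) x d :
  (forall e, 0 < e -> exists2 r : R, 0 < r &
    forall t, `|t| < r -> `|phi (x + t) - phi x - d * t| <= e * `|t|) -> is_derive x 1 phi d.
Proof.
move=> H.
have lim : (fun h : R => h^-1 *: (phi (h *: 1 + x) - phi x)) @ (0:R)^' --> d.
  move=> B /nbhs_ballP[e /= e0 eB].
  have e20 : 0 < e / 2 by lin.
  have [r r0 hr] := H _ e20.
  apply/nbhs_ballP; exists r => // t; rewrite /ball /= sub0r normrN => tr t0.
  apply: eB; rewrite /ball /=; have := hr _ tr.
  rewrite (_ : phi _ - _ - _ = - (t * (d - t^-1 * (phi (t *: 1 + x) - phi x)))); last first.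
    by rewrite /GRing.scale /= mulr1 (addrC t); field.
  rewrite normrN normrM mulrC ler_pM2r ?normr_gt0 //.
  by move=> h; apply: le_lt_trans h _; lin.
by apply: DeriveDef; [apply/cvg_ex; exists d|exact: cvg_lim].
Qed.

Definition cexp z : C := rc (expR (reC z)) * (rc (cos (imC z)) + iC * rc (sin (imC z))).

Lemma cexpD z w : cexp (z + w) = cexp z * cexp w.
Proof.
rewrite /cexp reD imD expRD cosD sinD !(rcM, rcD, rcB).
rewrite [LHS](_ : _ = rc (expR (reC z)) * rc (expR (reC w)) * (rc (cos (imC z)) * rc (cos (imC w))
   + iC * iC * rc (sin (imC z)) * rc (sin (imC w)) + iC * (rc (sin (imC z)) * rc (cos (imC w)) +
   rc (cos (imC z)) * rc (sin (imC w))))); last by rewrite iC2; ring.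
by ring.
Qed.
Lemma cexp0 : cexp 0 = 1.
Proof. by rewrite /cexp re0 im0 expR0 cos0 sin0 rc0 rc1; ring. Qed.
Lemma nm_cexp z : nm (cexp z) = expR (reC z).
Proof.
rewrite /cexp nmM nm_rc gtr0_norm ?expR_gt0 // -[RHS]mulr1; congr (_ * _).
apply/eqP; rewrite -(@eqrXn2 _ 2) ?nm_ge0 // nm_sqr reD imD reM imM !re_rc !im_rc re_iC im_iC expr1n.
by rewrite !(mul0r, mul1r, mulr0, subr0, addr0, add0r) cos2Dsin2.
Qed.
Lemma cexp_neq0 z : cexp z != 0.
Proof. by rewrite -nm_gt0 nm_cexp expR_gt0. Qed.
Lemma cexpN z : cexp (- z) = (cexp z)^-1.
Proof.
apply: (mulIf (cexp_neq0 z)); rewrite -cexpD addNr cexp0 mulVf //; exact: cexp_neq0.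
Qed.
Lemma cexpB z w : cexp (z - w) = cexp z / cexp w.
Proof. by rewrite cexpD cexpN. Qed.

Lemma dC_cexp0 : dC cexp 0 1.
Proof.
(* The error contains [e1 * nm h] seven times, six from the first term and one from the last, hence
   the 14; the middle term takes the other half of [e] through [nm h < e / 4]. *)
move=> e e0; set e1 := Num.min 1 (e / 14).
have e10 : 0 < e1 by rewrite lt_min ltr01 divr_gt0.
have e11 : e1 <= 1 by rewrite ge_min lexx.
have e1e : e1 <= e / 14 by rewrite ge_min lexx orbT.
have [r r0 hr] := is_derive_eps (is_derive_expR 0) e10.
have [r1 r10 hr1] := is_derive_eps (is_derive_cos (0 : R)) e10.
have [r2 r20 hr2] := is_derive_eps (is_derive_sin (0 : R)) e10.
exists (Num.min (Num.min 1 (e / 4)) (Num.min r (Num.min r1 r2))) => [|h].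
  by rewrite !lt_min ltr01 r0 r10 r20 divr_gt0.
rewrite !lt_min => /and3P[/andP[h1 h2] h3 /andP[h4 h5]].
set x := reC h; set y := imC h; have hn := nm_ge0 h.
have [xn yn] : `|x| <= nm h /\ `|y| <= nm h by rewrite re_le_nm im_le_nm.
have := hr x (le_lt_trans xn h3); have := hr1 y (le_lt_trans yn h4).
have := hr2 y (le_lt_trans yn h5).
rewrite !add0r expR0 cos0 sin0 mul1r oppr0 mul0r !subr0 mul1r !addr0.
set E := expR x; set c := cos y; set s := sin y => k1 k2 k3.
rewrite cexp0 (_ : _ - _ = rc E * (rc (c - 1) + iC * rc (s - y)) + rc (E - 1) * iC * rc y
   + rc (E - 1 - x)); last first.
  by rewrite /cexp -/x -/y -/E -/c -/s {1}(reimE h) -/x -/y !(rcD, rcN) rc1; ring.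
have e1x : e1 * `|x| <= `|x| by rewrite ler_piMl.
have Ex : `|E - 1| <= 2 * nm h by have := ler_normD (E - 1 - x) x; rewrite subrK; lin.
have E3 : `|E| <= 3 by have := ler_normD (E - 1) 1; rewrite subrK normr1; lin.
apply: le_trans (nmD _ _) _; rewrite nm_rc.
have T1 : nm (rc E * (rc (c - 1) + iC * rc (s - y))) <= 3 * (2 * (e1 * nm h)).
  rewrite nmM nm_rc ler_pM ?nm_ge0 //; apply: le_trans (nmD _ _) _; rewrite nmM nm_iC mul1r !nm_rc.
  by have : e1 * `|y| <= e1 * nm h; [rewrite ler_pM2l|lin].
have T2 : nm (rc (E - 1) * iC * rc y) <= 2 * nm h * (e / 4).
  by rewrite !nmM nm_iC mulr1 !nm_rc ler_pM //; lin.
have T3 : e1 * `|x| <= e1 * nm h by rewrite ler_pM2l.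
have T4 : e1 * nm h <= e / 14 * nm h by rewrite ler_wpM2r.
have := nmD (rc E * (rc (c - 1) + iC * rc (s - y))) (rc (E - 1) * iC * rc y).
by lin.
Qed.

Lemma dC_cexp z : dC cexp z (cexp z).
Proof.
apply: (@dC_ext _ _ (fun w => cexp z * cexp (w - z)) _ _ 1) => // [w _|].
  by rewrite -cexpD addrC subrK.
have h : dC cexp (z - z) 1 by rewrite subrr; exact: dC_cexp0.
by apply: dC_eq (dC_scale (cexp z) (@dC_comp _ cexp (fun w => w - z) z _ _ h (dC_shift z z))) _; rewrite !mulr1.
Qed.

(** Precomposition with this retraction onto [0, 1] makes a function that is continuous on [0, 1]
    continuous on the whole line, as the fundamental theorem of calculus wants it. *)
Definition clamp t : R := Num.max 0 (Num.min t 1).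
Lemma clamp_ge0 t : 0 <= clamp t. Proof. by rewrite le_max lexx. Qed.
Lemma clamp_le1 t : clamp t <= 1. Proof. by rewrite ge_max ler01 ge_min lexx orbT. Qed.
Lemma clampE t : 0 <= t <= 1 -> clamp t = t.
Proof. by move=> /andP[t0 t1]; rewrite /clamp min_l // max_r. Qed.
Lemma clamp_lip s t : `|clamp s - clamp t| <= `|s - t|.
Proof.
have h1 := ler_norm (s - t); have h2 := ler_norm (t - s); rewrite distrC in h2.
by rewrite /clamp; case: (leP s 1) => hs; case: (leP t 1) => ht; rewrite ?(max_r ler01); case: (leP 0 s) => hs'; case: (leP 0 t) => ht'; rewrite ler_norml; lin.
Qed.

Lemma antiderivative (phi : R -> R) : continuous phi ->
  exists Phi : R -> R, forall t, 0 <= t <= 1 -> is_derive t 1 Phi (phi t).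
Proof.
move=> cphi.
(* The interval of integration, from -1 up to 3, has [0, 1] in its interior, so that the derivatives
   at 0 and 1 are two-sided. *)
exists (fun x => \int[lebesgue_measure]_(s in `[-1, x]) phi s)%R => t t01.
have [||||H1 H2] := @continuous_FTC1_closed R phi (-1) t 3.
- lin.
- apply: continuous_compact_integrable; first exact: segment_compact.
  exact: continuous_subspaceT.
- lin.
- exact: cphi.
by apply: DeriveDef; [exact: H1|rewrite -derive1E; exact: H2].
Qed.

Definition unit_seg : set C := [set rc t | t in [set t | 0 <= t <= 1]].

(* Integrals over [0, 1] are differences of primitives of the real and imaginary parts; curves and integrands
   are functions of a complex parameter, evaluated at real points. *)
Definition is_int g (v : C) := exists A B : R -> R,
  [/\ forall t, 0 <= t <= 1 -> is_derive t 1 A (reC (g (rc t))),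
      forall t, 0 <= t <= 1 -> is_derive t 1 B (imC (g (rc t))) &
      v = rc (A 1 - A 0) + iC * rc (B 1 - B 0)].

Lemma real_mean_value (A : R -> R) (a : R -> R) M : (forall t, 0 <= t <= 1 -> is_derive t 1 A (a t)) ->
  (forall t, 0 <= t <= 1 -> a t <= M) -> A 1 - A 0 <= M.
Proof.
move=> dA aM.
have [||c c01 ->] := @MVT _ A a 0 1 ltr01.
- by move=> t; rewrite in_itv /= => /andP[t0 t1]; apply: dA; rewrite !ltW.
- apply: derivable_within_continuous => t; rewrite in_itv /= => t01.
  exact: (@ex_derive _ _ _ _ _ _ _ (dA t t01)).
by rewrite subr0 mulr1; apply: aM; move: c01; rewrite in_itv /= => /andP[c0 c1]; rewrite !ltW.
Qed.

Lemma is_int_lin g g' v v' (a : C) : is_int g v -> is_int g' v' -> is_int (fun z => a * g z + g' z) (a * v + v').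
Proof.
move=> [A [B [dA dB ->]]] [A' [B' [dA' dB' ->]]].
exists (fun t => reC a * A t - imC a * B t + A' t), (fun t => reC a * B t + imC a * A t + B' t); split.
- move=> t t01; rewrite reD reM; apply: is_deriveD (dA' t t01).
  by apply: is_deriveB; apply: is_deriveZ; [exact: dA|exact: dB].
- move=> t t01; rewrite imD imM; apply: is_deriveD (dB' t t01).
  by apply: is_deriveD; apply: is_deriveZ; [exact: dB|exact: dA].
apply: C_ext; rewrite !(reD, imD, reM, imM, re_rc, im_rc, re_iC, im_iC); ring.
Qed.

Lemma is_int0 : is_int (fun=> 0) 0.
Proof.
exists (fun=> 0), (fun=> 0); split => [t _|t _|]; try by rewrite ?re0 ?im0; apply: is_derive_cst.
by rewrite !subrr rc0; ring.
Qed.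
Lemma is_int_ext g g' v : (forall t, 0 <= t <= 1 -> g (rc t) = g' (rc t)) -> is_int g' v -> is_int g v.
Proof.
by move=> gg [A [B [dA dB ->]]]; exists A, B; split => // t t01; rewrite gg //; [apply: dA|apply: dB].
Qed.
Lemma is_intZ g v (a : C) : is_int g v -> is_int (fun z => a * g z) (a * v).
Proof.
move=> h; have := is_int_lin a h is_int0.
by rewrite addr0; apply: is_int_ext => t _; rewrite addr0.
Qed.
Lemma is_intD g g' v v' : is_int g v -> is_int g' v' -> is_int (fun z => g z + g' z) (v + v').
Proof.
move=> h h'; have := is_int_lin 1 h h'.
by rewrite mul1r; apply: is_int_ext => t _; rewrite mul1r.
Qed.
Lemma is_intB g g' v v' : is_int g v -> is_int g' v' -> is_int (fun z => g z - g' z) (v - v').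
Proof.
move=> h h'; have := is_int_lin (-1) h' h.
rewrite mulN1r addrC; apply: is_int_ext => t _; by rewrite mulN1r addrC.
Qed.

(** Multiplying by [rc (nm v) / v] turns the value into the real number [nm v]; the real mean value
    theorem then applies to the primitive of the real part. *)
Lemma is_int_bound g v M : is_int g v -> (forall t, 0 <= t <= 1 -> nm (g (rc t)) <= M) -> nm v <= M.
Proof.
move=> gv gM; have [->|v0] := eqVneq v 0.
  by rewrite nm0; apply: le_trans (nm_ge0 _) (gM 0 _); rewrite lexx ler01.
have [A [B [dA _ E]]] := is_intZ (rc (nm v) / v) gv.
have : A 1 - A 0 <= M.
  apply: (real_mean_value dA) => t t01; apply: le_trans (re_le _) _.
  rewrite nmM nmM nmV nm_rc ger0_norm ?nm_ge0 // divff ?nm_eq0 // mul1r; exact: gM.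
move: E => /(congr1 reC); rewrite divfK // !(reD, reM, re_rc, im_rc, re_iC, im_iC) => ->.
by rewrite mul0r mulr0 subrr addr0.
Qed.

Lemma is_int_unique g v v' : is_int g v -> is_int g v' -> v = v'.
Proof.
move=> h h'; apply/eqP; rewrite -subr_eq0 -nm_eq0 -(le_anti (introT andP (conj (nm_ge0 (v - v')) _))) //.
by apply: is_int_bound (is_intB h h') _ => t _; rewrite subrr nm0.
Qed.

Lemma is_int_ex g : cont_on unit_seg g -> exists v, is_int g v.
Proof.
move=> cg.
have key (p : C -> R) : rcont_on unit_seg (fun z => p (g z)) ->
    exists A : R -> R, forall t, 0 <= t <= 1 -> is_derive t 1 A (p (g (rc t))).
  move=> cp; have [t B /nbhs_ballP[e /= e0 eB]|A hA] := @antiderivative (fun t => p (g (rc (clamp t)))).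
    have st : unit_seg (rc (clamp t)) by exists (clamp t) => //=; rewrite clamp_ge0 clamp_le1.
    have [d d0 hd] := cp _ st _ e0.
    apply/nbhs_ballP; exists d => // s; rewrite /ball /= distrC => sd.
    apply: eB; rewrite /ball /= distrC; apply: hd.
      by exists (clamp s) => //=; rewrite clamp_ge0 clamp_le1.
    by rewrite -rcB nm_rc; apply: le_lt_trans (clamp_lip _ _) sd.
  by exists A => t t01; have := hA t t01; rewrite clampE.
have [A hA] := key _ (rcont_re cg); have [B hB] := key _ (rcont_im cg).
by exists (rc (A 1 - A 0) + iC * rc (B 1 - B 0)), A, B.
Qed.

Definition cint g : C := xget 0 (is_int g).
Lemma is_int_cint g v : is_int g v -> cint g = v.
Proof. by rewrite /cint; case: xgetP => [y _ h|/(_ v)] //; exact: is_int_unique. Qed.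
Lemma cintP g : cont_on unit_seg g -> is_int g (cint g).
Proof. by move=> /is_int_ex[v h]; rewrite (is_int_cint h). Qed.

Lemma dC_real f t d : dC f (rc t) d ->
  is_derive t 1 (fun s => reC (f (rc s))) (reC d) /\ is_derive t 1 (fun s => imC (f (rc s))) (imC d).
Proof.
move=> h; split; apply: eps_is_derive => e /h[r r0 hr]; exists r => // s sr; have := hr (rc s);
  rewrite nm_rc => /(_ sr); apply: le_trans; rewrite rcD.
  by apply: le_trans (re_le_nm _); rewrite !(reB, reM) re_rc im_rc mulr0 subr0.
by apply: le_trans (im_le_nm _); rewrite !(imB, imM) re_rc im_rc mulr0 add0r.
Qed.

Lemma is_int_FTC F g : (forall t, 0 <= t <= 1 -> dC F (rc t) (g (rc t))) -> is_int g (F 1 - F 0).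
Proof.
move=> h; exists (fun s => reC (F (rc s))), (fun s => imC (F (rc s))); split => [t /h/dC_real[]|t /h/dC_real[]|] //.
by rewrite rc0 rc1 -reB -imB -reimE.
Qed.
End integral.

(** * Integrals along segments and Goursat's theorem for triangles *)

Section goursat.
Context {R : realType}.
Local Notation C := (cplx R).
Implicit Types (x y e r : R) (z w h a b c p : C) (f g : C -> C).

Definition cvx (S : set C) := forall a b t, S a -> S b -> 0 <= t <= 1 -> S (a + rc t * (b - a)).
Definition segint f a b : C := cint (fun t => f (a + t * (b - a)) * (b - a)).

Lemma cont_on_mul (A : set C) f g : cont_on A f -> cont_on A g -> cont_on A (fun z => f z * g z).
Proof.
move=> cf cg z Az e e0.
have f1 : 0 < nm (f z) + 1 by have := nm_ge0 (f z); lin.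
have g1 : 0 < nm (g z) + 1 by have := nm_ge0 (g z); lin.
have e1 : 0 < Num.min 1 (e / (2 * (nm (g z) + 1))) by rewrite lt_min ltr01 divr_gt0 // mulr_gt0.
have e2 : 0 < e / (2 * (nm (f z) + 1)) by rewrite divr_gt0 // mulr_gt0.
have [d d0 hd] := cf z Az _ e1; have [d' d'0 hd'] := cg z Az _ e2.
exists (Num.min d d') => [|w Aw]; first by rewrite lt_min d0.
rewrite lt_min => /andP[/(hd _ Aw) h1 /(hd' _ Aw) h2].
move: h1; rewrite lt_min ltr_pdivlMr ?mulr_gt0 // => /andP[h3 h4].
move: h2; rewrite ltr_pdivlMr ?mulr_gt0 // => h5.
rewrite (_ : _ - _ = (f w - f z) * g z + f w * (g w - g z)); last by ring.
apply: le_lt_trans (nmD _ _) _; rewrite !nmM.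
have fw : nm (f w) <= nm (f z) + 1 by have := nmB_ge (f w) (f z); lin.
have : nm (f w) * nm (g w - g z) <= (nm (f z) + 1) * nm (g w - g z) by rewrite ler_wpM2r ?nm_ge0.
have : nm (f w - f z) * nm (g z) <= nm (f w - f z) * (nm (g z) + 1) by rewrite ler_wpM2l ?nm_ge0 // lerDl.
lin.
Qed.
Lemma cont_on_add (A : set C) f g : cont_on A f -> cont_on A g -> cont_on A (fun z => f z + g z).
Proof.
move=> cf cg z Az e e0; have e20 : 0 < e / 2 by lin.
have [d d0 hd] := cf z Az _ e20; have [d' d'0 hd'] := cg z Az _ e20.
exists (Num.min d d') => [|w Aw]; first by rewrite lt_min d0.
rewrite lt_min => /andP[/(hd _ Aw) h1 /(hd' _ Aw) h2].
by rewrite opprD addrACA; apply: le_lt_trans (nmD _ _) _; lin.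
Qed.
Lemma cont_on_cst (A : set C) c : cont_on A (fun=> c).
Proof. by move=> z _ e e0; exists 1 => // w _ _; rewrite subrr nm0. Qed.
Lemma cont_on_sub2 (A : set C) f g : cont_on A f -> cont_on A g -> cont_on A (fun z => f z - g z).
Proof.
move=> cf cg; apply: (@cont_on_ext _ _ _ (fun z => f z + (-1) * g z)) => [z _|]; first by ring.
by apply: cont_on_add => //; apply: cont_on_mul => //; exact: cont_on_cst.
Qed.
Lemma cont_on_inv (A : set C) f : cont_on A f -> (forall z, A z -> f z != 0) -> cont_on A (fun z => (f z)^-1).
Proof.
move=> cf f0; apply: (@cont_on_comp _ A [set w : C | w != 0] (fun w => w^-1)) => //.
by apply: hol_cont => z /dC_inv0 h; exists (- z^-2).
Qed.
Lemma cont_on_affine (A : set C) a b : cont_on A (fun z => a + z * b).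
Proof. by apply: cont_on_add; [exact: cont_on_cst|apply: cont_on_mul; [exact: cont_on_id|exact: cont_on_cst]]. Qed.

Lemma seg_cont (S : set C) f a b : cvx S -> cont_on S f -> S a -> S b ->
  cont_on unit_seg (fun t => f (a + t * (b - a)) * (b - a)).
Proof.
move=> vS cf Sa Sb; apply: cont_on_mul (@cont_on_cst _ _).
apply: (cont_on_comp cf (@cont_on_affine _ _ _)).
by move=> _ [t t01 <-]; apply: vS.
Qed.

(** A single primitive along the whole segment serves all its subsegments, so that subdivision and
    reversal become telescoping identities. *)
Lemma seg_primitive (S : set C) f a b : cvx S -> cont_on S f -> S a -> S b -> exists G : R -> C,
  forall p q : R, 0 <= p <= 1 -> 0 <= q <= 1 ->
    segint f (a + rc p * (b - a)) (a + rc q * (b - a)) = G q - G p.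
Proof.
move=> vS cf Sa Sb; have [v [A [B [dA dB _]]]] := is_int_ex (seg_cont vS cf Sa Sb).
exists (fun t => rc (A t) + iC * rc (B t)) => p q p01 q01; apply: is_int_cint.
have dl (t : R) : is_derive t 1 (fun s : R => p + s * (q - p)) (q - p).
  have h : is_derive t 1 (cst p + (q - p) \*: id) (0 + (q - p) *: 1).
    by apply: is_deriveD; apply: is_deriveZ.
  by move: h; rewrite add0r /GRing.scale /= mulr1; congr is_derive; apply/funext => s; rewrite /= mulrC.
have in01 t : 0 <= t <= 1 -> 0 <= p + t * (q - p) <= 1.
  move=> /andP[t0 t1]; move: p01 q01 => /andP[p0 p1] /andP[q0 q1].
  have [h1 h2] : 0 <= t * q /\ 0 <= (1 - t) * p by split; apply: mulr_ge0; lin.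
  have [h3 h4] : 0 <= t * (1 - q) /\ 0 <= (1 - t) * (1 - p) by split; apply: mulr_ge0; lin.
  by lin.
have E t : (f (a + rc p * (b - a) + rc t * (a + rc q * (b - a) - (a + rc p * (b - a)))) *
    (a + rc q * (b - a) - (a + rc p * (b - a)))) =
   rc (q - p) * (f (a + rc (p + t * (q - p)) * (b - a)) * (b - a)).
  by rewrite rcB [rc (p + _)]rcD rcM rcB [X in f X](_ : _ = a + (rc p + rc t * (rc q - rc p)) * (b - a)); ring.
exists (fun t => A (p + t * (q - p))), (fun t => B (p + t * (q - p))); split => [t t01|t t01|].
- rewrite E reM re_rc im_rc mul0r subr0 mulrC.
  by apply: (@is_derive1_comp _ A (fun s => p + s * (q - p))) (dl t); apply/dA/in01.
- rewrite E imM re_rc im_rc mul0r addr0 mulrC.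
  by apply: (@is_derive1_comp _ B (fun s => p + s * (q - p))) (dl t); apply/dB/in01.
- by rewrite !mul1r !mul0r !addr0 (addrC p) subrK !rcB; ring.
Qed.

Lemma segint_split (S : set C) f a b s : cvx S -> cont_on S f -> S a -> S b -> 0 <= s <= 1 ->
  segint f a b = segint f a (a + rc s * (b - a)) + segint f (a + rc s * (b - a)) b.
Proof.
move=> vS cf Sa Sb s01; have [G h] := seg_primitive vS cf Sa Sb.
have i0 : 0 <= (0:R) <= 1 by rewrite lexx ler01.
have i1 : 0 <= (1:R) <= 1 by rewrite lexx ler01.
have := h _ _ i0 s01; have := h _ _ s01 i1; have := h _ _ i0 i1.
by rewrite rc0 rc1 mul0r mul1r addr0 [a + (b - a)]addrC subrK => -> -> ->; ring.
Qed.

Lemma segint_rev (S : set C) f a b : cvx S -> cont_on S f -> S a -> S b -> segint f b a = - segint f a b.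
Proof.
move=> vS cf Sa Sb; have [G h] := seg_primitive vS cf Sa Sb.
have i0 : 0 <= (0:R) <= 1 by rewrite lexx ler01.
have i1 : 0 <= (1:R) <= 1 by rewrite lexx ler01.
have := h _ _ i1 i0; have := h _ _ i0 i1.
by rewrite rc0 rc1 mul0r mul1r addr0 [a + (b - a)]addrC subrK => -> ->; ring.
Qed.

Lemma seg_FTC F f a b : (forall t, 0 <= t <= 1 -> dC F (a + rc t * (b - a)) (f (a + rc t * (b - a)))) ->
  is_int (fun t => f (a + t * (b - a)) * (b - a)) (F b - F a).
Proof.
move=> h; have := @is_int_FTC _ (fun t => F (a + t * (b - a))) (fun t => f (a + t * (b - a)) * (b - a)).
rewrite mul1r mul0r addr0 [a + (b - a)]addrC subrK; apply => t t01.
apply: (@dC_comp _ F (fun t => a + t * (b - a))); first exact: h.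
apply: (@dC_ext _ _ (fun t => a + (b - a) * t) _ _ 1) (dC_affine _ _ _) => // w _; by rewrite mulrC.
Qed.

Lemma segint_bound (S : set C) f a b M : cvx S -> cont_on S f -> S a -> S b ->
  (forall t, 0 <= t <= 1 -> nm (f (a + rc t * (b - a))) <= M) -> nm (segint f a b) <= M * nm (b - a).
Proof.
move=> vS cf Sa Sb h; apply: is_int_bound (cintP (seg_cont vS cf Sa Sb)) _ => t t01.
by rewrite nmM ler_wpM2r ?nm_ge0 //; exact: h.
Qed.

Definition triint f a b c : C := segint f a b + segint f b c + segint f c a.

Lemma seq_cluster (K : set C) (u : nat -> C) : compact K -> (forall n, K (u n)) ->
  exists2 p, K p & forall e, 0 < e -> forall N, exists2 n, (N <= n)%N & nm (u n - p) < e.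
Proof.
move=> cK Ku; have [|p [Kp cp]] := cK (u @ \oo) _; first by exists 0%N => // n _; exact: Ku.
exists p => // e e0 N.
have [||z [[n /= Nn <-] zp]] := cp (u @` [set n | (N <= n)%N]) (disc p e).
- by exists N => // n /= Nn; exists n.
- by apply/nbhsCP; exists e.
- by exists n.
Qed.

Lemma cvx_tri a b (s : R) L p : 0 <= s <= 1 ->
  nm (a - p) <= L -> nm (b - p) <= L -> nm (a + rc s * (b - a) - p) <= L.
Proof.
move=> /andP[s0 s1] ha hb.
rewrite (_ : _ - p = rc (1 - s) * (a - p) + rc s * (b - p)); last by rewrite rcB rc1; ring.
apply: le_trans (nmD _ _) _; rewrite !nmM !nm_rc !ger0_norm ?subr_ge0 //.
have : (1 - s) * nm (a - p) <= (1 - s) * L by rewrite ler_wpM2l // subr_ge0.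
have : s * nm (b - p) <= s * L by rewrite ler_wpM2l.
lin.
Qed.

(** The affine part of [f] at [p] has the primitive [P], whose increments cancel around the
    triangle. On each side the remainder is at most [e * L] and the length at most [2 * L]; three
    sides give the factor 6. *)
Lemma tri_local (S : set C) f p d e : cvx S -> cont_on S f -> S p -> dC f p d -> 0 < e ->
  exists2 r, 0 < r & forall L a b c, L < r -> S a -> S b -> S c ->
    nm (a - p) <= L -> nm (b - p) <= L -> nm (c - p) <= L -> nm (triint f a b c) <= 6 * e * (L * L).
Proof.
move=> vS cf Sp hf e0; have [r r0 hr] := hf e e0; exists r => // L a b c Lr Sa Sb Sc ha hb hc.
pose P z := f p * z + d / 2 * (z - p) ^+ 2.
have dP z : dC P z (f p + d * (z - p)).
  apply: dC_eq (dC_add (dC_scale _ (dC_id z)) (dC_scale _ (dC_pow 2 (dC_shift p z)))) _.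
  by rewrite /= expr1; field.
have key u v : S u -> S v -> nm (u - p) <= L -> nm (v - p) <= L ->
    nm (segint f u v - (P v - P u)) <= 2 * e * (L * L).
  move=> Su Sv hu hv; have L0 : 0 <= L := le_trans (nm_ge0 _) hu.
  have I1 := cintP (seg_cont vS cf Su Sv).
  have I2 := @seg_FTC P (fun z => f p + d * (z - p)) u v (fun t _ => dP _).
  have uv : nm (v - u) <= 2 * L by have := nmD3 p v u; rewrite (nmBC p u); lin.
  apply: is_int_bound (is_intB I1 I2) _ => t t01; rewrite -mulrBl nmM.
  rewrite (_ : 2 * e * (L * L) = (e * L) * (2 * L)); last by ring.
  have hz := cvx_tri t01 hu hv; set z := u + _ in hz *.
  apply: ler_pM; rewrite ?nm_ge0 //.
  have := hr (z - p); rewrite (le_lt_trans hz Lr) => /(_ isT); rewrite [p + _]addrC subrK opprD addrA => h.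
  by apply: le_trans h _; rewrite ler_wpM2l // ltW.
rewrite /triint (_ : _ + _ = (segint f a b - (P b - P a)) + (segint f b c - (P c - P b)) +
  (segint f c a - (P a - P c))); last by ring.
have [h1 h2 h3] := And3 (key _ _ Sa Sb ha hb) (key _ _ Sb Sc hb hc) (key _ _ Sc Sa hc ha).
have := nmD (segint f a b - (P b - P a) + (segint f b c - (P c - P b))) (segint f c a - (P a - P c)).
have := nmD (segint f a b - (P b - P a)) (segint f b c - (P c - P b)).
lin.
Qed.

Definition mid a b : C := a + rc (2^-1) * (b - a).

Lemma tri_quarter (S : set C) f a b c : cvx S -> cont_on S f -> S a -> S b -> S c ->
  triint f a b c = triint f a (mid a b) (mid c a) + triint f (mid a b) b (mid b c) +
    triint f (mid c a) (mid b c) c + triint f (mid a b) (mid b c) (mid c a).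
Proof.
move=> vS cf Sa Sb Sc; have h2 : 0 <= (2^-1:R) <= 1 by lin.
have [Sab Sbc Sca] : [/\ S (mid a b), S (mid b c) & S (mid c a)] by split; apply: vS.
rewrite /triint (segint_split vS cf Sa Sb h2) (segint_split vS cf Sb Sc h2) (segint_split vS cf Sc Sa h2).
rewrite -/(mid a b) -/(mid b c) -/(mid c a).
rewrite (segint_rev vS cf Sab Sbc) (segint_rev vS cf Sbc Sca) (segint_rev vS cf Sca Sab).
ring.
Qed.

Lemma mid_bound a b c L : nm (b - a) <= L -> nm (c - b) <= L -> nm (a - c) <= L ->
  [/\ nm (mid a b - a) <= L / 2, nm (b - mid a b) <= L / 2 & nm (mid b c - mid a b) <= L / 2].
Proof.
move=> h1 h2 h3.
have h (x : C) : nm (rc (2^-1) * x) = nm x / 2 by rewrite nmM nm_rc ger0_norm ?invr_ge0 // mulrC.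
have e2 : 1 - rc (2^-1) = rc (2^-1) :> C by rewrite -rc1 -rcB; congr rc; lin.
split; rewrite /mid.
- by rewrite addrAC subrr add0r h; lin.
- rewrite (_ : _ - _ = (1 - rc (2^-1)) * (b - a)); [by rewrite e2 h; lin|ring].
- rewrite (_ : _ - _ = ((1 - rc (2^-1)) - rc (2^-1)) * b + rc (2^-1) * c - (1 - rc (2^-1)) * a); last by ring.
  by rewrite e2 subrr mul0r add0r -mulrBr h nmBC; lin.
Qed.

Lemma goursat (S : set C) f a b c : compact S -> cvx S -> hol_on S f -> S a -> S b -> S c ->
  triint f a b c = 0.
Proof.
move=> kS vS hf Sa Sb Sc; have cf := hol_cont hf.
apply/eqP; rewrite -nm_eq0; apply: contraT => T0.
set eta := nm (triint f a b c).
have eta0 : 0 < eta by rewrite lt_def T0 nm_ge0.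
pose L := nm (b - a) + nm (c - b) + nm (a - c) + 1.
have L0 : 0 < L by rewrite /L; have := nm_ge0 (b - a); have := nm_ge0 (c - b); have := nm_ge0 (a - c); lin.
pose good n (u : C * C * C) := [/\ [/\ S u.1.1, S u.1.2 & S u.2],
  [/\ nm (u.1.2 - u.1.1) <= L / 2 ^+ n, nm (u.2 - u.1.2) <= L / 2 ^+ n & nm (u.1.1 - u.2) <= L / 2 ^+ n] &
  eta / 4 ^+ n <= nm (triint f u.1.1 u.1.2 u.2)].
have step n u : good n u -> exists v, good n.+1 v /\ nm (v.1.1 - u.1.1) <= L / 2 ^+ n.
  case: u => [[x y] z] [/= [Sx Sy Sz] [h1 h2 h3] h4].
  have h : 0 <= (2^-1:R) <= 1 by lin.
  have [Sxy Syz Szx] : [/\ S (mid x y), S (mid y z) & S (mid z x)] by split; apply: vS.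
  have [x1 x2 x3] := mid_bound h1 h2 h3.
  have [y1 y2 y3] := mid_bound h2 h3 h1.
  have [z1 z2 z3] := mid_bound h3 h1 h2.
  have E2 : L / 2 ^+ n.+1 = L / 2 ^+ n / 2 by rewrite exprS; field; rewrite expf_neq0.
  have E4 : eta / 4 ^+ n.+1 = eta / 4 ^+ n / 4 by rewrite exprS; field; rewrite expf_neq0.
  have Ln : 0 <= L / 2 ^+ n by rewrite ltW // divr_gt0 ?exprn_gt0.
  have := tri_quarter vS cf Sx Sy Sz.
  set T1 := triint f x (mid x y) (mid z x); set T2 := triint f (mid x y) y (mid y z).
  set T3 := triint f (mid z x) (mid y z) z; set T4 := triint f (mid x y) (mid y z) (mid z x).
  move=> TE.
  have : nm (triint f x y z) <= nm T1 + nm T2 + nm T3 + nm T4.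
    by rewrite TE; have := nmD (T1 + T2 + T3) T4; have := nmD (T1 + T2) T3; have := nmD T1 T2; lin.
  have [k1|k1 ?] := lerP (eta / 4 ^+ n / 4) (nm T1).
    exists (x, mid x y, mid z x); rewrite /good /= E2 E4 subrr nm0; split => //; split => //; split => //.
    by rewrite nmBC.
  have [k2|k2] := lerP (eta / 4 ^+ n / 4) (nm T2).
    exists (mid x y, y, mid y z); rewrite /good /= E2 E4; split; [|lin]; split => //; split => //.
    by rewrite nmBC.
  have [k3|k3] := lerP (eta / 4 ^+ n / 4) (nm T3).
    exists (mid z x, mid y z, z); rewrite /good /= E2 E4; split.
      by split => //; split => //; rewrite nmBC.
    by have := z2; rewrite nmBC; lin.
  exists (mid x y, mid y z, mid z x); rewrite /good /= E2 E4; split; [|lin].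
  by split => //; lin.
pose st n u := if pselect (good n u) is left h then projT1 (cid (step n u h)) else u.
pose s := fix s n := if n is m.+1 then st m (s m) else (a, b, c).
have gs n : good n (s n).
  elim: n => [|n IH] /=.
    rewrite /good /= !expr0 !divr1 /L; split => //.
    by have := nm_ge0 (b - a); have := nm_ge0 (c - b); have := nm_ge0 (a - c); split; lin.
  by rewrite /st; case: pselect => // h; case: cid => /= v [].
have ds n : nm ((s n.+1).1.1 - (s n).1.1) <= L / 2 ^+ n.
  by rewrite /= /st; case: pselect => [h|/(_ (gs n))] //; case: cid => /= v [].
have dsk n k : nm ((s (n + k)%N).1.1 - (s n).1.1) <= (2 - 2 / 2 ^+ k) * (L / 2 ^+ n).
  elim: k => [|k IH]; first by rewrite addn0 subrr nm0 expr0 divr1 subrr mul0r.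
  rewrite addnS; have := nmD3 (s (n + k)%N).1.1 (s (n + k).+1).1.1 (s n).1.1.
  have := ds (n + k)%N; rewrite exprD.
  rewrite (_ : L / (2 ^+ n * 2 ^+ k) = 1 / 2 ^+ k * (L / 2 ^+ n)); last by field; rewrite !expf_neq0.
  rewrite (_ : 2 - 2 / 2 ^+ k.+1 = 2 - 1 / 2 ^+ k); last by rewrite exprS; field; rewrite expf_neq0.
  by move: (L / 2 ^+ n) IH => q; lin.
have Ss n : S (s n).1.1 by case: (gs n) => [[]].
have [p Sp cp] := seq_cluster kS Ss.
have ps n : nm ((s n).1.1 - p) <= 2 * (L / 2 ^+ n).
  apply/ler_addgt0Pr => e e0; have [m nm_ mp] := cp e e0 n.
  have := dsk n (m - n)%N; rewrite subnKC // => h.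
  have := nmD3 (s m).1.1 (s n).1.1 p; rewrite (nmBC (s n).1.1 (s m).1.1).
  have Q0 : 0 < L / 2 ^+ n by rewrite divr_gt0 // exprn_gt0.
  have : 0 <= 2 / 2 ^+ (m - n) * (L / 2 ^+ n) by rewrite mulr_ge0 // ?divr_ge0 ?exprn_ge0 // ltW.
  by move: h; rewrite mulrBl; lin.
have [d hd] := hf _ Sp.
(* At stage [n] the vertices are within [3 * Q] of [p], where [Q = L / 2 ^+ n]: twice [Q] for the
   first vertex and one side more for the others. So [tri_local] gives 6 * 9 = 54 times
   [e * Q ^+ 2], and this choice makes it half of the lower bound [eta / 4 ^+ n]. *)
have e0 : 0 < eta / (54 * (L * L)) / 2 by rewrite !divr_gt0 // !mulr_gt0.
have [r r0 hr] := tri_local vS cf Sp hd e0.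
have [n hn] : exists n, 3 * (L / 2 ^+ n) < r.
  exists (Num.trunc (3 * L / r)).+1; have := @truncnS_gt _ (3 * L / r).
  set N := (Num.trunc _).+1; rewrite ltr_pdivrMr // => h.
  have : (N%:R : R) <= 2 ^+ N by rewrite -natrX ler_nat ltnW // ltn_expl.
  rewrite mulrA ltr_pdivrMr ?exprn_gt0 // => h'; apply: lt_le_trans h _.
  by rewrite mulrC ler_pM2l.
have [[S1 S2 S3] [k1 k2 k3] k4] := gs n.
have := hr _ _ _ _ hn S1 S2 S3; have := ps n.
set Q := L / 2 ^+ n in k1 k2 k3 *; have Q0 : 0 < Q by rewrite divr_gt0 // exprn_gt0.
move=> h1 h2.
have {h2} : nm (triint f (s n).1.1 (s n).1.2 (s n).2) <= 6 * (eta / (54 * (L * L)) / 2) * (3 * Q * (3 * Q)).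
  apply: h2; first by lin.
  - by have := nmD3 (s n).1.1 (s n).1.2 p; lin.
  - by have := nmD3 (s n).1.1 (s n).2 p; rewrite (nmBC _ (s n).1.1); lin.
rewrite (_ : _ * (3 * Q * (3 * Q)) = eta / 4 ^+ n / 2); last first.
  rewrite /Q (_ : 4 ^+ n = 2 ^+ n * 2 ^+ n :> R).
    have X0 : 2 ^+ n != 0 :> R by rewrite expf_neq0.
    by move: (2 ^+ n) X0 => X X0; field; rewrite ?X0 ?(lt0r_neq0 L0).
  by rewrite -exprMn_comm; [congr (_ ^+ n); ring|exact: commr_refl].
have : 0 < eta / 4 ^+ n by rewrite divr_gt0 // exprn_gt0.
lin.
Qed.
End goursat.

(** * Primitives with one exceptional point, and Cauchy integrals on a circle *)

Section cauchy.
Context {R : realType}.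
Local Notation C := (cplx R).
Implicit Types (e r rho : R) (z w a b c p : C) (f g : C -> C).

Lemma cvx_disc c r : cvx (disc c r).
Proof.
move=> a b t ha hb /andP[t0 t1]; rewrite /disc /=.
rewrite (_ : _ - c = rc (1 - t) * (a - c) + rc t * (b - c)); last by rewrite rcB rc1; ring.
apply: le_lt_trans (nmD _ _) _; rewrite !nmM !nm_rc !ger0_norm ?subr_ge0 //.
have [->|t0'] := eqVneq t 0; first by rewrite subr0 mul1r mul0r addr0; exact: ha.
have : t * nm (b - c) < t * r by rewrite ltr_pM2l // lt_def t0'.
have : (1 - t) * nm (a - c) <= (1 - t) * r by rewrite ler_wpM2l ?subr_ge0 // ltW.
lin.
Qed.
Lemma cvx_cdisc c r : cvx (cdisc c r).
Proof. by move=> a b t ha hb ht; exact: cvx_tri ht ha hb. Qed.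

Definition dot a b : R := reC a * reC b + imC a * imC b.
Lemma dot_nm a : dot a a = nm a ^+ 2. Proof. by rewrite nm_sqr /dot !expr2. Qed.
Lemma dotD a b c : dot a (b + c) = dot a b + dot a c.
Proof. by rewrite /dot reD imD; ring. Qed.
Lemma dotZ a b x : dot a (rc x * b) = x * dot a b.
Proof. by rewrite /dot reM imM re_rc im_rc; ring. Qed.
Lemma dot_le a b : `|dot a b| <= nm a * nm b.
Proof.
rewrite -(@ler_sqr _ `|_|) ?nnegrE ?mulr_ge0 ?nm_ge0 // real_normK ?num_real // exprMn !nm_sqr /dot.
have := sqr_ge0 (reC a * imC b - imC a * reC b); nra.
Qed.

Lemma halfplane_closed a b x : closed [set z | x <= dot a (z - b)].
Proof.
rewrite -openC; apply/openCP => z /negP; rewrite -ltNge => zx.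
have a1 : 0 < nm a + 1 by have := nm_ge0 a; lin.
exists ((x - dot a (z - b)) / (nm a + 1)); first by rewrite divr_gt0 // subr_gt0.
move=> w; rewrite /disc /= ltr_pdivlMr // => wz; apply/negP; rewrite -ltNge.
have := ler_norm (dot a (w - z)); have := dot_le a (w - z).
have -> : dot a (w - b) = dot a (w - z) + dot a (z - b) by rewrite -dotD addrA subrK.
by have := nm_ge0 (w - z); lin.
Qed.

Lemma segint_diag f a : segint f a a = 0.
Proof.
apply: is_int_cint; apply: is_int_ext (@is_int0 _) => t _.
by rewrite subrr mulr0.
Qed.

(** Goursat for the triangle [a], [z], [w] when [h] is merely continuous at [a]. A small similar
    triangle is cut off at [a]; its contribution tends to 0 because [h] is bounded, and the rest
    consists of two triangles in a half plane that excludes [a]. The hypothesis on [nm (w - z)] is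
    what puts both [z] and [w] into such a half plane. *)
Lemma segint_apex (D : set C) (h : C -> C) a z w c rho : D = disc c rho -> cont_on D h ->
  (forall x, D x -> x != a -> exists d, dC h x d) ->
  D a -> D z -> D w -> nm (w - z) < nm (z - a) ->
  segint h a z + segint h z w = segint h a w.
Proof.
move=> DE ch hh Da Dz Dw wz.
have vD : cvx D by rewrite DE; exact: cvx_disc.
have za0 : 0 < nm (z - a) by have := nm_ge0 (w - z); lin.
pose m := nm (z - a) * (nm (z - a) - nm (w - z)).
have m0 : 0 < m by rewrite mulr_gt0 // subr_gt0.
have mz : m <= dot (z - a) (z - a).
  by rewrite dot_nm /m expr2 ler_pM2l //; have := nm_ge0 (w - z); lin.
have mw : m <= dot (z - a) (w - a).
  rewrite (_ : w - a = (w - z) + (z - a)); last by rewrite addrA subrK.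
  rewrite dotD dot_nm /m expr2 mulrBr; have := dot_le (z - a) (w - z).
  by have := ler_norm (- dot (z - a) (w - z)); rewrite normrN; lin.
pose r := Num.max (nm (a - c)) (Num.max (nm (z - c)) (nm (w - c))).
have rD : cdisc c r `<=` D.
  move=> x; rewrite DE /cdisc /disc /= => xr; apply: le_lt_trans xr _; rewrite /r !gt_max.
  by move: Da Dz Dw; rewrite DE /disc /= => -> -> ->.
have [M M0 hM] := compact_nm_bound (@cdisc_compact _ c r) (cont_on_sub rD ch).
have [Ka [Kz Kw]] : cdisc c r a /\ cdisc c r z /\ cdisc c r w.
  by rewrite /cdisc /= /r !le_max !lexx !orbT.
apply/eqP; rewrite -subr_eq0 -nm_eq0; apply: contraT => ne0.
set q := nm _ in ne0; have q0 : 0 < q by rewrite lt_def ne0 nm_ge0.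
pose L := M * (nm (z - a) + nm (w - z) + nm (w - a) + 1).
have L0 : 0 < L by rewrite mulr_gt0 //; have := nm_ge0 (w - z); have := nm_ge0 (w - a); lin.
have [e [e0 e1 eq]] : exists e : R, [/\ 0 < e, e <= 1 & e * L < q].
  have QL : 0 < q / (2 * L) := divr_gt0 q0 (mulr_gt0 (ltr0n _ 2) L0).
  exists (Num.min 1 (q / (2 * L))); rewrite lt_min ltr01 QL; split => //.
    by rewrite ge_min lexx.
  apply: (@le_lt_trans _ _ (q / (2 * L) * L)); first by rewrite ler_pM2r // ge_min lexx orbT.
  by rewrite (_ : _ * L = q / 2) ?ltr_pdivrMr //; [lin|field; rewrite (lt0r_neq0 L0)].
have e01 : 0 <= e <= 1 by rewrite (ltW e0).
pose az := a + rc e * (z - a); pose aw := a + rc e * (w - a).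
pose S := cdisc c r `&` [set x | e * m <= dot (z - a) (x - a)].
have kS : compact S.
  apply: (subclosed_compact _ (@cdisc_compact _ c r)); last by move=> x [].
  by apply: closedI; [exact: cdisc_closed|exact: halfplane_closed].
have vS : cvx S.
  move=> x y t [x1 x2] [y1 y2] t01; split; first exact: cvx_cdisc.
  move: x2 y2 t01 => /= x2 y2 /andP[t0 t1].
  rewrite (_ : _ - a = rc (1 - t) * (x - a) + rc t * (y - a)); last by rewrite rcB rc1; ring.
  rewrite dotD !dotZ.
  have : t * (e * m) <= t * dot (z - a) (y - a) by rewrite ler_wpM2l.
  have : (1 - t) * (e * m) <= (1 - t) * dot (z - a) (x - a) by rewrite ler_wpM2l // subr_ge0.
  lin.
have SD : S `<=` D by move=> x [/rD].
have hS : hol_on S h.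
  move=> x Sx; apply: hh; first exact: SD.
  apply/eqP => xa; case: Sx => _ /=; rewrite xa subrr.
  rewrite /dot re0 im0 !mulr0 addr0; have : 0 < e * m by rewrite mulr_gt0.
  lin.
have em : e * m <= m by rewrite ler_piMl // ltW.
have Sz : S z by split=> //=; lin.
have Sw : S w by split=> //=; lin.
have Saz : S az.
  split; first exact: cvx_cdisc.
  by rewrite /= /az addrAC subrr add0r dotZ ler_pM2l.
have Saw : S aw.
  split; first exact: cvx_cdisc.
  by rewrite /= /aw addrAC subrr add0r dotZ ler_pM2l.
have cS := hol_cont hS.
have := goursat kS vS hS Saz Sz Sw; have := goursat kS vS hS Saz Sw Saw.
rewrite /triint (segint_rev vS cS Saz Saw) (segint_rev vS cS Saz Sw) (segint_rev vS cS Saw Sw).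
move=> T1 T2.
have vK := @cvx_cdisc c r; have cK := cont_on_sub rD ch.
have E1 := segint_split vK cK Ka Kz e01; have E2 := segint_split vK cK Ka Kw e01.
rewrite -/az in E1; rewrite -/aw in E2.
have E : segint h a z + segint h z w - segint h a w = segint h a az + segint h az aw - segint h a aw.
  apply/eqP; rewrite -subr_eq0 E1 E2; apply/eqP.
  rewrite [LHS](_ : _ = (segint h az z + segint h z w + - segint h az w) +
    (segint h az w + - segint h aw w + - segint h az aw)); last by ring.
  by rewrite T1 T2 addr0.
have Kaz : cdisc c r az by case: Saz.
have Kaw : cdisc c r aw by case: Saw.
have sb u v : cdisc c r u -> cdisc c r v -> nm (segint h u v) <= M * nm (v - u).
  move=> Ku Kv; apply: (segint_bound vK cK Ku Kv) => t t01; apply: hM; exact: vK.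
have := sb _ _ Ka Kaz; have := sb _ _ Kaz Kaw; have := sb _ _ Ka Kaw.
have ne x : nm (rc e * x) = e * nm x by rewrite nmM nm_rc gtr0_norm.
rewrite (_ : aw - az = rc e * (w - z)); last by rewrite /aw /az; ring.
rewrite (_ : aw - a = rc e * (w - a)); last by rewrite /aw; ring.
rewrite (_ : az - a = rc e * (z - a)); last by rewrite /az; ring.
rewrite !ne => s1 s2 s3.
have : q <= nm (segint h a az) + nm (segint h az aw) + nm (segint h a aw).
  rewrite /q E; have := nmB (segint h a az + segint h az aw) (segint h a aw).
  by have := nmD (segint h a az) (segint h az aw); lin.
have : M * (e * nm (z - a)) + M * (e * nm (w - z)) + M * (e * nm (w - a)) <= e * L.
  rewrite /L; have : 0 < e * M by rewrite mulr_gt0.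
  by lin.
lin.
Qed.

(* Goursat with one exceptional point, which is taken as the base point of the primitive. *)
Lemma primitive_punctured (h : C -> C) a c rho : disc c rho a -> cont_on (disc c rho) h ->
  (forall x, disc c rho x -> x != a -> exists d, dC h x d) ->
  exists H, forall z, disc c rho z -> dC H z (h z).
Proof.
set D := disc c rho => Da ch hh.
have vD : cvx D by exact: cvx_disc.
exists (segint h a) => z Dz e e0.
have [d d0 hd] := ch z Dz e e0.
have [r r0 hr] := (openCP D).1 (@disc_open _ c rho) z Dz.
have [s s0 [sd sr sa]] : exists2 s : R, 0 < s & [/\ s <= d, s <= r & z != a -> s <= nm (z - a)].
  have [za|za] := eqVneq z a.
    by exists (Num.min d r) => //; [rewrite lt_min d0|split => //; rewrite ge_min lexx ?orbT].
  exists (Num.min (Num.min d r) (nm (z - a))); first by rewrite !lt_min d0 r0 nm_gt0 subr_eq0.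
  by split => [||_]; rewrite !ge_min lexx ?orbT.
exists s => // k ks; set w := z + k.
have Dw : D w by apply: hr; rewrite /disc /= /w addrAC subrr add0r; lin.
have -> : segint h a w - segint h a z = segint h z w.
  have [za|za] := eqVneq z a; first by rewrite za segint_diag subr0.
  rewrite -(@segint_apex D h a z w c rho) //; first by rewrite addrAC subrr add0r.
  by rewrite /w addrAC subrr add0r; have := sa za; lin.
have I1 := cintP (seg_cont vD ch Dz Dw).
have I2 : is_int (fun t => h z * (w - z)) (h z * (w - z)).
  have := @is_int_FTC _ (fun t => 0 + h z * (w - z) * t) (fun t => h z * (w - z)) (fun t _ => dC_affine _ _ _).
  by rewrite mulr1 mulr0 !add0r subr0.
have wk : w - z = k by rewrite /w addrAC subrr add0r.
have -> : h z * k = h z * (w - z) by rewrite wk.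
apply: (is_int_bound (is_intB I1 I2)) => t t01; rewrite -mulrBl nmM wk.
rewrite ler_wpM2r ?nm_ge0 // ltW //; apply: hd.
  by rewrite -wk; exact: vD.
rewrite addrAC subrr add0r nmM nm_rc; move: t01 => /andP[t0 t1]; rewrite ger0_norm //.
have : t * nm k <= nm k by rewrite ler_piMl // nm_ge0.
lin.
Qed.

Lemma hol_primitive f c rho : hol_on (disc c rho) f -> exists F, forall z, disc c rho z -> dC F z (f z).
Proof.
move=> hf; have [r0|r0] := ltrP 0 rho.
  apply: (@primitive_punctured f c c rho) => [|| x Dx _]; [exact: disc_center|exact: hol_cont|exact: hf].
by exists id => z; rewrite /disc /=; have := nm_ge0 (z - c); lin.
Qed.

Lemma deriv0_cst F c rho : (forall z, disc c rho z -> dC F z 0) ->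
  forall z w, disc c rho z -> disc c rho w -> F z = F w.
Proof.
move=> h z w Dz Dw.
have := @seg_FTC _ F (fun=> 0) w z (fun t t01 => h _ (cvx_disc Dw Dz t01)).
move/(@is_int_unique _ _ _ 0) => E; apply/eqP; rewrite -subr_eq0 E //.
by apply: is_int_ext (@is_int0 _) => t _; rewrite mul0r.
Qed.

Definition tpi : C := iC * rc (pi *+ 2).
Definition circ c r (t : C) : C := c + rc r * cexp (tpi * t).
Lemma cexp_tpi : cexp tpi = 1.
Proof.
rewrite /cexp /tpi reM imM re_iC im_iC re_rc im_rc !mul0r mulr0 subr0 add0r mul1r expR0.
by rewrite cos2pi sin2pi rc1 rc0 mulr0 addr0 mulr1.
Qed.
Lemma tpi_neq0 : tpi != 0.
Proof.
by rewrite /tpi mulf_neq0 // -?nm_gt0 ?nm_iC ?ltr01 // nm_rc normr_gt0 mulrn_eq0 /= gt_eqF // pi_gt0.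
Qed.
Lemma circ01 c r : circ c r 1 = circ c r 0.
Proof. by rewrite /circ mulr1 mulr0 cexp0 cexp_tpi. Qed.
Lemma dC_circ c r (t : C) : dC (circ c r) t (tpi * (circ c r t - c)).
Proof.
have h := @dC_comp _ cexp (fun s => 0 + tpi * s) t _ _ (dC_cexp _) (dC_affine 0 tpi t).
apply: dC_eq (dC_add (dC_cst c t) (dC_scale (rc r) (dC_ext ltr01 _ h))) _.
  by move=> w _; rewrite add0r.
by rewrite /circ !add0r; ring.
Qed.
Lemma nm_circ c r (t : R) : 0 < r -> nm (circ c r (rc t) - c) = r.
Proof.
move=> r0; rewrite /circ addrAC subrr add0r nmM nm_rc gtr0_norm // nm_cexp.
by rewrite /tpi !(reM, imM) re_iC im_iC !re_rc !im_rc !(mul0r, mulr0, subr0, addr0) expR0 mulr1.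
Qed.
Lemma circ_cont c r : cont_on unit_seg (circ c r).
Proof. by apply: hol_cont => t _; exists (tpi * (circ c r t - c)); exact: dC_circ. Qed.

(** Cauchy transform of a density on the circle; differentiation in [z] raises the exponent [n],
    which produces holomorphy without differentiating under an integral sign. *)
Definition cker c r (psi : C -> C) n z : C := cint (fun t => psi t / (circ c r t - z) ^+ n).

Lemma circ_far c r z (t : R) : 0 < r -> r - nm (z - c) <= nm (circ c r (rc t) - z).
Proof.
by move=> r0; have := nmD3 z (circ c r (rc t)) c; rewrite nm_circ //; lin.
Qed.
Lemma circ_neq c r z (t : R) : 0 < r -> disc c r z -> circ c r (rc t) - z != 0.
Proof. by rewrite /disc /= => r0 zr; rewrite -nm_gt0; have := circ_far c z t r0; lin. Qed.

Lemma cont_on_exp (A : set C) f n : cont_on A f -> cont_on A (fun z => f z ^+ n).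
Proof.
move=> cf; elim: n => [|n IH]; first exact: (@cont_on_cst _ A 1).
by apply: (@cont_on_ext _ A _ (fun z => f z * f z ^+ n)) => [z _|]; [rewrite exprS|exact: cont_on_mul].
Qed.

Lemma cker_cont c r psi n z : 0 < r -> cont_on unit_seg psi -> disc c r z ->
  cont_on unit_seg (fun t => psi t / (circ c r t - z) ^+ n).
Proof.
move=> r0 cp Dz; apply: cont_on_mul => //; apply: cont_on_inv.
  by apply: cont_on_exp; apply: cont_on_sub2; [exact: circ_cont|exact: cont_on_cst].
by move=> _ [t _ <-]; rewrite expf_neq0 //; exact: circ_neq.
Qed.

Lemma unit_seg_compact : compact (@unit_seg R).
Proof.
have -> : unit_seg = rc @` `[0, 1] :> set C.
  by apply/seteqP; split=> z [t /= ht <-]; exists t => //=; move: ht; rewrite in_itv.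
apply: continuous_compact; last exact: segment_compact.
apply: continuous_subspaceT => t B /nbhsCP[e e0 eB]; apply/nbhs_ballP; exists e => // s.
by rewrite /ball /= => ts; apply: eB; rewrite -rcB nm_rc distrC.
Qed.

Lemma psi_bound psi : cont_on unit_seg psi -> exists2 M : R, 0 < M & forall t : R, 0 <= t <= 1 -> nm (psi (rc t)) <= M.
Proof.
move=> /(compact_nm_bound unit_seg_compact)[M M0 h]; exists M => // t t01.
by apply: h; exists t.
Qed.

(** The kernel 1 / (g - z) leaves, after its affine part in [h], exactly h^2 / ((g - z)^2 (g - z -
    h)). The bound is kept explicit because it serves again as a quantitative Taylor estimate. *)
Lemma cker1_taylor c r psi z h M : 0 < r -> cont_on unit_seg psi ->
  (forall t : R, 0 <= t <= 1 -> nm (psi (rc t)) <= M) ->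
  nm (z - c) + nm h < r ->
  nm (cker c r psi 1 (z + h) - cker c r psi 1 z - cker c r psi 2 z * h) <=
    M * nm h ^+ 2 / ((r - nm (z - c)) ^+ 2 * (r - nm (z - c) - nm h)).
Proof.
move=> r0 cp hM zh.
have M0 : 0 <= M by apply: le_trans (nm_ge0 _) (hM 0 _); rewrite lexx ler01.
have Dz : disc c r z by rewrite /disc /=; have := nm_ge0 h; lin.
have Dzh : disc c r (z + h) by rewrite /disc /=; have := nmD (z - c) h; rewrite addrAC; lin.
have I1 := cintP (cker_cont 1 r0 cp Dzh); have I2 := cintP (cker_cont 1 r0 cp Dz).
have I3 := is_intZ h (cintP (cker_cont 2 r0 cp Dz)).
rewrite [_ * h]mulrC; apply: is_int_bound (is_intB (is_intB I1 I2) I3) _ => t t01.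
have n1 := circ_neq t r0 Dz; have n2 := circ_neq t r0 Dzh; set g := circ c r (rc t) in n1 n2 *.
rewrite (_ : _ - _ - _ = psi (rc t) * (h ^+ 2 / ((g - z) ^+ 2 * (g - (z + h))))); last by field; rewrite n1 n2.
rewrite nmM -mulrA ler_pM ?nm_ge0 //; first exact: hM.
rewrite nmM nmX nmV nmM nmX ler_wpM2l ?exprn_ge0 ?nm_ge0 //.
have d0 : 0 < r - nm (z - c) by have := nm_ge0 h; lin.
have d1 : 0 < r - nm (z - c) - nm h by lin.
rewrite lef_pV2 ?posrE; first last.
- by rewrite mulr_gt0 // exprn_gt0.
- by rewrite mulr_gt0 ?exprn_gt0 // nm_gt0.
have k1 : r - nm (z - c) <= nm (g - z) by exact: circ_far.
have k2 : r - nm (z - c) - nm h <= nm (g - (z + h)).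
  by have := circ_far c (z + h) t r0; have := nmD (z - c) h; rewrite [z + h - c]addrAC -/g; lin.
apply: ler_pM => //; [by rewrite exprn_ge0 // ltW|exact: ltW|].
by rewrite ler_sqr ?nnegrE ?nm_ge0 // ltW.
Qed.

Lemma quad_dC f z d r K : 0 < r -> 0 <= K ->
  (forall h, nm h < r -> nm (f (z + h) - f z - d * h) <= K * nm h ^+ 2) -> dC f z d.
Proof.
move=> r0 K0 H e e0.
have K1 : 0 < K + 1 by lin.
exists (Num.min r (e / (K + 1))) => [|h]; first by rewrite lt_min r0 divr_gt0.
rewrite lt_min ltr_pdivlMr // => /andP[/H k1 k2]; apply: le_trans k1 _.
rewrite expr2 mulrA ler_wpM2r ?nm_ge0 //; have := nm_ge0 h; lin.
Qed.

Lemma dC_cker1 c r psi z : 0 < r -> cont_on unit_seg psi -> disc c r z ->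
  dC (cker c r psi 1) z (cker c r psi 2 z).
Proof.
move=> r0 cp Dz; have [M M0 hM] := psi_bound cp.
set d := r - nm (z - c); have d0 : 0 < d by move: Dz; rewrite /disc /= /d; lin.
apply: (@quad_dC _ _ _ (d / 2) (M / (d ^+ 2 * (d / 2)))); first by lin.
  by rewrite divr_ge0 ?mulr_ge0 ?exprn_ge0 //; lin.
move=> h hd; have zh : nm (z - c) + nm h < r by rewrite /d in hd d0; lin.
apply: le_trans (cker1_taylor r0 cp hM zh) _; rewrite -/d mulrAC.
rewrite ler_wpM2r ?exprn_ge0 ?nm_ge0 // ler_wpM2l ?(ltW M0) // lef_pV2 ?posrE ?mulr_gt0 ?exprn_gt0 //; last by lin.
by rewrite ler_wpM2l ?exprn_ge0 //; lin.
Qed.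

Lemma dC_cker2 c r psi z : 0 < r -> cont_on unit_seg psi -> disc c r z ->
  dC (cker c r psi 2) z (2 * cker c r psi 3 z).
Proof.
move=> r0 cp Dz; have [M M0 hM] := psi_bound cp.
set d := r - nm (z - c); have d0 : 0 < d by move: Dz; rewrite /disc /= /d; lin.
have K0 : 0 < M * (3 * (d / 2)^-1 ^+ 4 + 2 * (d / 2)^-1 ^+ 4 ).
  by rewrite mulr_gt0 // addr_gt0 // mulr_gt0 // exprn_gt0 // invr_gt0; lin.
apply: (@quad_dC _ _ _ (d / 2) _ _ (ltW K0)); first by lin.
move=> h hd; have d2 : 0 < d / 2 by lin.
have Dzh : disc c r (z + h) by rewrite /disc /=; have := nmD (z - c) h; rewrite [z + h - c]addrAC; rewrite /d in hd d0; lin.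
have I1 := cintP (cker_cont 2 r0 cp Dzh); have I2 := cintP (cker_cont 2 r0 cp Dz).
have I3 := is_intZ (2 * h) (cintP (cker_cont 3 r0 cp Dz)).
rewrite (_ : 2 * cker c r psi 3 z * h = 2 * h * cker c r psi 3 z); last by ring.
apply: is_int_bound (is_intB (is_intB I1 I2) I3) _ => t t01.
have n1 := circ_neq t r0 Dz; have n2 := circ_neq t r0 Dzh; set g := circ c r (rc t) in n1 n2 *.
rewrite (_ : _ - _ - _ = psi (rc t) * (3 * ((g - z)^-1 ^+ 2 * (g - (z + h))^-1 ^+ 2)
   - 2 * h * ((g - z)^-1 ^+ 3 * (g - (z + h))^-1 ^+ 2)) * h ^+ 2); last by field; rewrite n1 n2.
rewrite nmM nmX ler_wpM2r ?exprn_ge0 ?nm_ge0 // nmM ler_pM ?nm_ge0 //; first exact: hM.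
have k1 : nm (g - z)^-1 <= (d / 2)^-1.
  rewrite nmV lef_pV2 ?posrE ?nm_gt0 //; have := circ_far c z t r0; rewrite -/d -/g; lin.
have k2 : nm (g - (z + h))^-1 <= (d / 2)^-1.
  rewrite nmV lef_pV2 ?posrE ?nm_gt0 //; have := circ_far c (z + h) t r0.
  by have := nmD (z - c) h; rewrite [z + h - c]addrAC -/g; rewrite /d in hd d0 *; lin.
have iv : 0 <= (d / 2)^-1 by rewrite invr_ge0; lin.
set X := (g - z)^-1 in k1 *; set Y := (g - (z + h))^-1 in k2 *.
have E1 : nm (3 * (X ^+ 2 * Y ^+ 2)) = 3 * (nm X ^+ 2 * nm Y ^+ 2) by rewrite nmM nmM !nmX nm_nat.
have E2 : nm (2 * h * (X ^+ 3 * Y ^+ 2)) = 2 * nm h * (nm X ^+ 3 * nm Y ^+ 2).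
  by rewrite nmM [nm (2 * h)]nmM [nm (X ^+ 3 * _)]nmM !nmX nm_nat.
apply: le_trans (nmB _ _) _; rewrite E1 E2; apply: lerD.
  rewrite ler_wpM2l // (_ : 4 = 2 + 2)%N // exprD ler_pM ?exprn_ge0 ?nm_ge0 // ler_sqr ?nnegrE ?nm_ge0 //.
rewrite -mulrA ler_wpM2l //.
have -> : (d / 2)^-1 ^+ 4 = d / 2 * ((d / 2)^-1 ^+ 3 * (d / 2)^-1 ^+ 2).
  by field; rewrite (lt0r_neq0 d0).
apply: ler_pM; rewrite ?nm_ge0 ?mulr_ge0 ?exprn_ge0 ?nm_ge0 //; first by lin.
by apply: ler_pM; rewrite ?exprn_ge0 ?nm_ge0 // lerXn2r ?nnegrE ?nm_ge0.
Qed.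
End cauchy.

(** * Cauchy's formula, local factorisation, maximum principle, identity theorem, open mapping *)

Section cauchy_consequences.
Context {R : realType}.
Local Notation C := (cplx R).
Implicit Types (e r rho : R) (z w a b c p : C) (f g : C -> C) (D G K S : set C).

(* The derivative of [circ c r] is [tpi * (circ c r - c)], so this is the density of a Cauchy integral divided
   by 2 pi i. *)
Definition cpsi c r f (j : nat) (t : C) : C := f (circ c r t) * (circ c r t - c) / (circ c r t - c) ^+ j.

Lemma cpsi_cont c r rho f j : 0 < r -> r < rho -> hol_on (disc c rho) f -> cont_on unit_seg (cpsi c r f j).
Proof.
move=> r0 rr hf; have cc := @circ_cont _ c r.
have cs : cont_on unit_seg (fun t => circ c r t - c) by apply: cont_on_sub2 => //; exact: cont_on_cst.
apply: cont_on_mul.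
  apply: cont_on_mul => //; apply: cont_on_comp (hol_cont hf) cc _.
  by move=> _ [t _ <-]; rewrite /disc /= nm_circ.
apply: cont_on_inv; first exact: cont_on_exp.
by move=> _ [t _ <-]; rewrite expf_neq0 // circ_neq //; exact: disc_center.
Qed.

(** The difference quotient at [z], completed by the derivative, is continuous on the disc and
    holomorphic off [z]. It therefore has a primitive, and its integral over the closed circle
    vanishes. *)
Lemma cauchy_formula c r rho f z : 0 < r -> r < rho -> hol_on (disc c rho) f -> disc c r z ->
  f z = cker c r (cpsi c r f 0) 1 z.
Proof.
move=> r0 rr hf Dz.
have rD : disc c r `<=` disc c rho by move=> w; rewrite /disc /=; lin.
have [d hd] := hf z (rD _ Dz).
pose h w := if w == z then d else (f w - f z) / (w - z).
have hE w : w != z -> h w = (f w - f z) / (w - z) by rewrite /h => /negbTE ->.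
have hh x : disc c rho x -> x != z -> exists d, dC h x d.
  move=> Dx xz; have [d' hd'] := hf x Dx.
  have q := dC_mul (dC_sub hd' (dC_cst (f z) x)) (dC_inv (dC_shift z x) _).
  eexists; apply: (@dC_ext _ _ (fun w => (f w - f z) / (w - z)) _ _ (nm (x - z))); last first.
  - by apply: q; rewrite subr_eq0.
  - move=> w wx; apply: hE; apply/eqP => E; move: wx; rewrite E nmBC ltxx //.
  - by rewrite nm_gt0 subr_eq0.
have ch : cont_on (disc c rho) h.
  move=> x Dx e e0; have [->|xz] := eqVneq x z; last first.
    by have [d' /dC_cont/(_ e e0)[s s0 hs]] := hh x Dx xz; exists s => // w _; exact: hs.
  have e20 : 0 < e / 2 by lin.
  have [s s0 hs] := hd _ e20; exists s => // w Dw wz.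
  have [->|wz'] := eqVneq w z; first by rewrite subrr nm0.
  rewrite hE // {1}/h eqxx; have := hs _ wz; rewrite [z + _]addrC subrK.
  rewrite (_ : _ - d = (f w - f z - d * (w - z)) / (w - z)); last by field; rewrite subr_eq0.
  have p0 : 0 < nm (w - z) by rewrite nm_gt0 subr_eq0.
  by rewrite nmM nmV => k; rewrite ltr_pdivrMr //; have := mulr_gt0 e20 p0; lin.
have [H hH] := primitive_punctured (rD _ Dz) ch hh.
have cD (t : R) : disc c rho (circ c r (rc t)) by rewrite /disc /= nm_circ.
have I0 : is_int (fun t => h (circ c r t) * (tpi * (circ c r t - c))) 0.
  have := @is_int_FTC _ (fun t => H (circ c r t)) (fun t => h (circ c r t) * (tpi * (circ c r t - c))).
  rewrite circ01 subrr; apply => t _.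
  by apply: (@dC_comp _ H (circ c r)) (dC_circ _ _ _); exact: hH.
(* The winding number of the circle about [z]: its derivative in [z] is the integral of an exact
   derivative over a closed curve, hence 0, and at the centre the integrand is 1. *)
have W1 : cker c r (fun t => circ c r t - c) 1 z = 1.
  have cs : cont_on unit_seg (fun t => circ c r t - c).
    by apply: cont_on_sub2; [exact: circ_cont|exact: cont_on_cst].
  rewrite (@deriv0_cst _ _ c r _ z c Dz (disc_center _ r0)).
    apply: is_int_cint; apply: (@is_int_ext _ _ (fun=> 1)) => [t _|].
      by rewrite expr1 mulfV // circ_neq //; exact: disc_center.
    have := @is_int_FTC R id (fun=> 1) (fun t _ => dC_id (rc t)).
    by rewrite subr0.
  move=> x Dx; apply: dC_eq (dC_cker1 r0 cs Dx) (esym _); apply: is_int_cint.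
  have := @is_int_FTC _ (fun t => - (tpi^-1 * (circ c r t - x)^-1)) (fun t => (circ c r t - c) / (circ c r t - x) ^+ 2).
  rewrite circ01 subrr; apply => t _.
  have n0 := circ_neq t r0 Dx.
  have q := dC_sub (dC_circ c r (rc t)) (dC_cst x _).
  apply: dC_eq (dC_opp (dC_scale tpi^-1 (dC_inv q n0))) _.
  by rewrite subr0; field; rewrite n0 tpi_neq0.
have I1 := cintP (cker_cont 1 r0 (cpsi_cont 0 r0 rr hf) Dz).
have I2 := is_intZ (f z) (cintP (cker_cont 1 r0 (cont_on_sub2 (@circ_cont _ c r) (@cont_on_cst _ _ c)) Dz)).
have I3 := is_intZ tpi^-1 I0.
have : is_int (fun t => cpsi c r f 0 t / (circ c r t - z) ^+ 1 - f z * ((circ c r t - c) / (circ c r t - z) ^+ 1)) 0.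
  rewrite mulr0 in I3; apply: is_int_ext I3 => t _.
  have n0 := circ_neq t r0 Dz.
  have n1 : circ c r (rc t) != z by rewrite -subr_eq0.
  rewrite (hE _ n1) /cpsi expr0 divr1 !expr1; have T0 := @tpi_neq0 R.
  by move: (circ c r (rc t)) (tpi : C) n0 T0 => X T n0 T0; field; rewrite n0 T0.
move/(is_int_unique (is_intB I1 I2)); rewrite -/(cker c r (fun t => circ c r t - c) 1 z) W1 mulr1.
by move/eqP; rewrite subr_eq0 => /eqP h1; rewrite -h1.
Qed.

Lemma hol_cker c r rho f z : 0 < r -> r < rho -> hol_on (disc c rho) f -> disc c r z ->
  dv f z = cker c r (cpsi c r f 0) 2 z /\ dC (dv f) z (2 * cker c r (cpsi c r f 0) 3 z).
Proof.
move=> r0 rr hf; have cp := cpsi_cont 0 r0 rr hf.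
have E w : disc c r w -> dv f w = cker c r (cpsi c r f 0) 2 w.
  move=> Dw; apply: dvE; have [s s0 hs] := (openCP _).1 (@disc_open _ c r) w Dw.
  apply: dC_ext s0 _ (dC_cker1 r0 cp Dw) => v vw.
  by apply: (cauchy_formula r0 rr hf); apply: hs.
move=> Dz; split; first exact: E.
have [s s0 hs] := (openCP _).1 (@disc_open _ c r) z Dz.
by apply: dC_ext s0 _ (dC_cker2 r0 cp Dz) => v vw; apply: E; apply: hs.
Qed.

Lemma hol_dv G f : open G -> hol_on G f -> hol_on G (dv f).
Proof.
move=> oG hf z Gz; have [r r0 hr] := (openCP G).1 oG z Gz.
have r20 : 0 < r / 2 by lin.
have r2r : r / 2 < r by lin.
have [_ h] := hol_cker r20 r2r (hol_sub hr hf) (disc_center z r20).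
by eexists; exact: h.
Qed.

Lemma cauchy_taylor c r rho f z h M : 0 < r -> r < rho -> hol_on (disc c rho) f ->
  (forall w, nm (w - c) = r -> nm (f w) <= M) -> nm (z - c) + nm h < r ->
  nm (f (z + h) - f z - dv f z * h) <= M * r * nm h ^+ 2 / ((r - nm (z - c)) ^+ 2 * (r - nm (z - c) - nm h)).
Proof.
move=> r0 rr hf hM zh.
have Dz : disc c r z by rewrite /disc /=; have := nm_ge0 h; lin.
have Dzh : disc c r (z + h) by rewrite /disc /=; have := nmD (z - c) h; rewrite [z + h - c]addrAC; lin.
rewrite (proj1 (hol_cker r0 rr hf Dz)) (cauchy_formula r0 rr hf Dz) (cauchy_formula r0 rr hf Dzh).
apply: cker1_taylor => // [|t t01]; first exact: cpsi_cont rr hf.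
by rewrite /cpsi expr0 divr1 nmM nm_circ // ler_wpM2r ?(ltW r0) //; apply: hM; rewrite nm_circ.
Qed.

Lemma cauchy_est c r rho f z M : 0 < r -> r < rho -> hol_on (disc c rho) f ->
  (forall w, nm (w - c) = r -> nm (f w) <= M) -> disc c r z ->
  nm (dv f z) <= M * r / (r - nm (z - c)) ^+ 2.
Proof.
move=> r0 rr hf hM Dz; rewrite (proj1 (hol_cker r0 rr hf Dz)).
apply: (is_int_bound (cintP (cker_cont 2 r0 (cpsi_cont 0 r0 rr hf) Dz))) => t t01.
have d0 : 0 < r - nm (z - c) by move: Dz; rewrite /disc /=; lin.
rewrite nmM nmV nmX /cpsi expr0 divr1 nmM nm_circ //.
apply: ler_pM; rewrite ?mulr_ge0 ?invr_ge0 ?exprn_ge0 ?nm_ge0 ?(ltW r0) //.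
  by rewrite ler_wpM2r ?(ltW r0) //; apply: hM; rewrite nm_circ.
have k := circ_far c z t r0.
rewrite lef_pV2 ?posrE ?exprn_gt0 //; last by lin.
by rewrite ler_sqr ?nnegrE ?nm_ge0 // ltW.
Qed.

(** The Cauchy integrals [g j] are the successive quotients of Taylor expansion at [c]. Either some
    [g j.+1] is nonzero at [c], and the first such one is the cofactor [k], or [f z - f c] is
    divisible by every power of [z - c]. *)
Lemma zero_factor c rho f : 0 < rho -> hol_on (disc c rho) f ->
  (exists2 r, 0 < r & forall z, disc c r z -> f z = f c) \/
  exists m k, exists2 r, [/\ (0 < m)%N, 0 < r & r <= rho] &
    hol_on (disc c r) k /\ forall z, disc c r z -> k z != 0 /\ f z = f c + (z - c) ^+ m * k z.
Proof.
move=> rho0 hf; set r := rho / 2.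
have r0 : 0 < r by rewrite /r; lin.
have rr : r < rho by rewrite /r; lin.
pose g j := cker c r (cpsi c r f j) 1.
have cp j := cpsi_cont j r0 rr hf; have Dc := disc_center c r0.
have gS j z : disc c r z -> g j z = g j c + (z - c) * g j.+1 z.
  move=> Dz; apply/eqP; rewrite -subr_eq0; apply/eqP.
  have I1 := cintP (cker_cont 1 r0 (cp j) Dz); have I2 := cintP (cker_cont 1 r0 (cp j) Dc).
  have I3 := is_intZ (z - c) (cintP (cker_cont 1 r0 (cp j.+1) Dz)).
  apply: (is_int_unique (is_intB I1 (is_intD I2 I3))); apply: is_int_ext (@is_int0 _) => t _.
  have n1 := circ_neq t r0 Dz; have n2 := circ_neq t r0 Dc.
  by rewrite /cpsi !expr1 exprS; field; rewrite n1 n2 expf_neq0.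
have g0 z : disc c r z -> f z = g 0%N z by move=> Dz; exact: cauchy_formula rr hf Dz.
case: (pselect (exists j, g j.+1 c != 0)) => [ex|nex].
  right; pose m := ex_minn ex.
  have hm : g m.+1 c != 0 by rewrite /m; case: ex_minnP.
  have lm j : (j < m)%N -> g j.+1 c = 0.
    by rewrite /m; case: ex_minnP => i _ mi ij; apply/eqP; apply: contraTT ij => /mi; rewrite -leqNgt.
  have E z : disc c r z -> f z = f c + (z - c) ^+ m.+1 * g m.+1 z.
    move=> Dz; have : forall j, (j <= m)%N -> f z = f c + (z - c) ^+ j.+1 * g j.+1 z.
      elim=> [_|j IH jm]; first by rewrite expr1 (g0 _ Dz) (g0 _ Dc) -gS.
      by rewrite (IH (ltnW jm)) (gS j.+1) // lm // add0r mulrA -exprSr.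
    by apply.
  have hg : hol_on (disc c r) (g m.+1) by move=> z Dz; eexists; exact: dC_cker1.
  have n0 : 0 < nm (g m.+1 c) by rewrite nm_gt0.
  have [s s0 hs] := hol_cont hg Dc n0.
  exists m.+1, (g m.+1), (Num.min r s); first by split => //; rewrite ?lt_min ?r0 // ge_min (ltW rr).
  split=> [z|z]; rewrite /disc /= lt_min => /andP[zr zs]; first exact: hg.
  split; last exact: E.
  have := hs z zr zs; have := nmB_ge' (g m.+1 z) (g m.+1 c) => k1 k2.
  by rewrite -nm_gt0; lin.
(* On the disc of half the radius, divisibility by the power [j] gives a bound of order 2^-j,
   whereas a nonzero value of [f z - f c] would be a fixed lower bound. *)
left; have z0 j : g j.+1 c = 0 by apply/eqP; apply: contraPT nex => h; case; exists j.
have [M M0 hM] := psi_bound (cp 0%N).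
exists (r / 2); first by lin.
move=> z Dz; have Dz' : disc c r z by move: Dz; rewrite /disc /=; lin.
have E j : f z - f c = (z - c) ^+ j * g j z - (j == 0)%:R * f c.
  elim: j => [|j IH]; first by rewrite expr0 !mul1r -g0.
  rewrite IH (gS j) //; case: j {IH} => [|j] /=; last by rewrite z0 !mul0r !subr0 add0r mulrA -exprSr.
  by rewrite expr0 expr1 -g0 //; ring.
apply/eqP; rewrite -subr_eq0 -nm_eq0; apply: contraT => ne; set q := nm _ in ne.
have q0 : 0 < q by rewrite lt_def ne nm_ge0.
set d := r - nm (z - c); have d0 : 0 < d by move: Dz'; rewrite /disc /= /d; lin.
have bd j : q <= (1 / 2) ^+ j.+1 * (M / d).
  rewrite /q (E j.+1) /= mul0r subr0 nmM nmX.
  have : nm (g j.+1 z) <= M / r ^+ j.+1 / d.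
    apply: (is_int_bound (cintP (cker_cont 1 r0 (cp j.+1) Dz'))) => t t01.
    rewrite expr1 nmM nmV ler_pM ?nm_ge0 ?invr_ge0 ?nm_ge0 //.
      rewrite /cpsi nmM nmV nmX nm_circ // ler_wpM2r ?invr_ge0 ?exprn_ge0 ?(ltW r0) //.
      by have := hM t t01; rewrite /cpsi expr0 divr1.
    have k := circ_far c z t r0; rewrite -/d in k.
    by rewrite lef_pV2 ?posrE // (lt_le_trans d0).
  move=> h; apply: le_trans (ler_wpM2l (exprn_ge0 _ (nm_ge0 _)) h) _.
  have : nm (z - c) ^+ j.+1 <= (1 / 2 * r) ^+ j.+1.
    by rewrite lerXn2r ?nnegrE ?nm_ge0 ?mulr_ge0 ?(ltW r0) //; move: Dz; rewrite /disc /=; lin.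
  rewrite exprMn; have Md : 0 < M / r ^+ j.+1 / d by rewrite !divr_gt0 // exprn_gt0.
  move=> k; apply: le_trans (ler_wpM2r (ltW Md) k) _.
  rewrite (_ : _ * _ * _ = (1 / 2) ^+ j.+1 * (M / d)) //; field.
  by rewrite (lt0r_neq0 d0) expf_neq0 // lt0r_neq0.
have Mq0 : 0 < M / d / q by rewrite !divr_gt0.
have := bd (Num.trunc (M / d / q)); have := @truncnS_gt _ (M / d / q).
set N := (Num.trunc _).+1; rewrite ltr_pdivrMr // => h1 h2.
have : (N%:R : R) <= 2 ^+ N by rewrite -natrX ler_nat ltnW // ltn_expl.
have N2 : 0 < 2 ^+ N :> R by rewrite exprn_gt0.
have {}h2 : q * 2 ^+ N <= M / d.
  by rewrite -ler_pdivlMr // (_ : _ / 2 ^+ N = (1 / 2) ^+ N * (M / d)) // expr_div_n expr1n mul1r mulrC.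
move=> h3.
have : N%:R * q <= 2 ^+ N * q by rewrite ler_wpM2r // ltW.
lin.
Qed.

(** Otherwise f = f c + (z - c)^m k with [k c] nonzero. An m-th root [u] turns u^m k c into a
    positive multiple of [f c], and the modulus increases in the direction [u]. *)
Lemma local_max_const c rho f : 0 < rho -> hol_on (disc c rho) f ->
  (forall z, disc c rho z -> nm (f z) <= nm (f c)) -> exists2 r, 0 < r & forall z, disc c r z -> f z = f c.
Proof.
move=> rho0 hf hmax; have [//|[m [k [r [m0 r0 rr] [hk h]]]]] := zero_factor rho0 hf; exfalso.
have Dc := disc_center c r0.
have [k0 _] := h c Dc.
have fc0 : 0 < nm (f c).
  rewrite nm_gt0; apply/eqP => f0.
  have Dz : disc c r (c + rc (r / 2)) by rewrite /disc /= addrAC subrr add0r nm_rc gtr0_norm; lin.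
  have [kz fz] := h _ Dz.
  have := hmax (c + rc (r / 2)); rewrite f0 nm0 fz f0 add0r addrAC subrr add0r nmM nmX nm_rc.
  have : 0 < `|r / 2| ^+ m * nm (k (c + rc (r / 2))).
    by rewrite mulr_gt0 // ?nm_gt0 // exprn_gt0 // normr_gt0 gt_eqF //; lin.
  move=> h1 h2; have : disc c rho (c + rc (r / 2)) by move: Dz; rewrite /disc /=; lin.
  by move/h2; lin.
pose q := k c / f c; have q0 : 0 < nm q by rewrite nm_gt0 mulf_neq0 // invr_eq0 -nm_gt0.
pose u : C := m.-root (rc (nm q) / q).
have um : u ^+ m = rc (nm q) / q by rewrite rootCK.
have nu : nm u = 1.
  apply/eqP; rewrite -(@pexpr_eq1 _ _ m) ?nm_ge0 //.
  by rewrite -nmX um nmM nmV nm_rc gtr0_norm // divff // gt_eqF.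
have e0 : 0 < nm (k c) / 2 by rewrite divr_gt0 // nm_gt0.
have [s s0 hs] := hol_cont hk Dc e0.
pose t : R := Num.min r s / 2; have ms : 0 < Num.min r s by rewrite lt_min r0.
have t0 : 0 < t by rewrite /t; lin.
have [tr ts] : t < r /\ t < s by apply/andP; rewrite -lt_min /t; lin.
pose z := c + rc t * u.
have zc : z - c = rc t * u by rewrite /z addrAC subrr add0r.
have nz : nm (z - c) = t by rewrite zc nmM nu mulr1 nm_rc gtr0_norm.
have Dz : disc c r z by rewrite /disc /= nz.
have := hmax z; rewrite /disc /= nz => /(_ (lt_le_trans tr rr)).
have [_ ->] := h z Dz.
have := hs z Dz; rewrite nz => /(_ ts) kz.
rewrite (_ : _ + _ = f c * rc (1 + t ^+ m * nm q) + (z - c) ^+ m * (k z - k c)); last first.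
  rewrite zc exprMn um rcD rcM rcX rc1 /q.
  by field; rewrite k0 -nm_gt0 fc0.
move=> A; have := nmB_ge (f c * rc (1 + t ^+ m * nm q)) (- ((z - c) ^+ m * (k z - k c))).
rewrite opprK nmN nmM [nm ((z - c) ^+ m * _)]nmM nmX nz nm_rc.
have tm : 0 < t ^+ m by rewrite exprn_gt0.
rewrite gtr0_norm ?addr_gt0 ?mulr_gt0 //.
have nq : nm q * nm (f c) = nm (k c) by rewrite /q nmM nmV divfK // gt_eqF.
have : t ^+ m * nm (k z - k c) < t ^+ m * (nm (k c) / 2) by rewrite ltr_pM2l.
have : 0 < t ^+ m * nm (k c) by rewrite mulr_gt0 // nm_gt0.
have -> : nm (f c) * (1 + t ^+ m * nm q) = nm (f c) + t ^+ m * nm (k c) by rewrite -nq; ring.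
lin.
Qed.

Lemma closure_disc c r : closure (disc c r) `<=` cdisc c r.
Proof.
rewrite closureE => z; apply; split; first exact: cdisc_closed.
by move=> w; rewrite /disc /cdisc /=; lin.
Qed.

Lemma closureC_bounded D M : (forall z, D z -> nm z <= M) -> forall z, closure D z -> nm z <= M.
Proof.
move=> DM z /closureCP h; apply/ler_addgt0Pr => e /h[w /DM wM].
have := nmB_ge' w z; lin.
Qed.

(* Among the points of maximal modulus, one of maximal real part cannot be interior. *)
Lemma max_modulus D f M B : open D -> (forall z, D z -> nm z <= B) -> cont_on (closure D) f -> hol_on D f ->
  (forall z, closure D z -> ~ D z -> nm (f z) <= M) -> forall z, D z -> nm (f z) <= M.
Proof.
move=> oD bD cf hf hM z0 Dz0.
have kD : compact (closure D).
  by apply: closed_bounded_compact (@closed_closure _ D) (closureC_bounded bD).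
have cDz0 : closure D z0 by apply: subset_closure.
have [m cm hm] := rcompact_max kD (ex_intro _ _ cDz0) (rcont_nm cf).
pose Z := [set z | closure D z /\ nm (f z) = nm (f m)].
have kZ : compact Z.
  apply: (subclosed_compact _ kD); last by move=> z [].
  move=> z /closureCP cz; have cDz : closure D z.
    by apply/closureCP => e /cz[w [cw _]] wz; have [v Dv vw] := (closureCP _ _).1 cw (e - nm (w - z)) ltac:(lin);
      exists v => //; have := nmD3 w v z; lin.
  split => //; apply/eqP; rewrite eq_le hm //=; apply/ler_addgt0Pr => e e0.
  have [d d0 hd] := rcont_nm cf cDz e0; have [w [cw E] wz] := cz _ d0.
  by have := hd _ cw wz; rewrite E ltr_norml; lin.
have [p [cp Ep] hp] := rcompact_max kZ (ex_intro _ m (conj cm erefl)) (rcont_re (@cont_on_id _ Z)).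
case: (pselect (D p)) => [Dp|nDp]; last first.
  by apply: le_trans (hm _ cDz0) _; rewrite -Ep; exact: hM.
have [r r0 hr] := (openCP D).1 oD p Dp.
have [|s s0 hs] := local_max_const r0 (hol_sub hr hf).
  by move=> z /hr Dz; rewrite Ep; apply: hm; apply: subset_closure.
pose t : R := Num.min r s / 2; have ms : 0 < Num.min r s by rewrite lt_min r0.
have t0 : 0 < t by rewrite /t; lin.
have [tr ts] : t < r /\ t < s by apply/andP; rewrite -lt_min /t; lin.
have np : nm (p + rc t - p) = t by rewrite addrAC subrr add0r nm_rc gtr0_norm.
have : Z (p + rc t).
  split; last by rewrite hs // /disc /= np.
  by apply: subset_closure; apply: hr; rewrite /disc /= np.
by move/hp; rewrite reD re_rc; lin.
Qed.

(** Connectedness in the form in which continuation arguments use it: the conclusion spreads from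
    one point because [P] is open and closed relative to [G]. *)
Lemma connected_ind G (P : C -> Prop) : connected G -> (exists2 c, G c & P c) ->
  (forall z, G z -> P z -> exists2 r, 0 < r & forall w, G w -> disc z r w -> P w) ->
  (forall z, G z -> (forall r, 0 < r -> exists w, [/\ G w, disc z r w & P w]) -> P z) ->
  forall z, G z -> P z.
Proof.
move=> cG [c Gc Pc] Po Pc' z Gz.
suff : G `&` P = G by move=> E; move: Gz; rewrite -E => -[].
apply: cG; first by exists c.
  exists [set w | exists2 r, 0 < r & forall v, G v -> disc w r v -> P v].
    apply/openCP => w [r r0 hr]; exists (r / 2); first by lin.
    move=> v; rewrite /disc /= => vw; exists (r / 2) => [|x Gx]; first by lin.
    rewrite /disc /= => xv; apply: hr => //; rewrite /disc /=; have := nmD3 v x w; lin.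
  apply/seteqP; split=> [w [Gw Pw]|w [Gw [r r0 hr]]]; first by split => //; exact: Po.
  by split => //; apply: hr => //; exact: disc_center.
exists (closure (G `&` P)); first exact: closed_closure.
apply/seteqP; split=> [w [Gw Pw]|w [Gw /closureCP cw]].
  by split => //; apply: subset_closure.
by split => //; apply: Pc' => // r /cw[v [Gv Pv] vw]; exists v.
Qed.

(** The property that propagates is constancy near the point, with value [f c]. At a limit of such
    points the factorisation with nonvanishing cofactor would isolate the point among those of value
    [f c]. *)
Lemma identity_theorem G f c r : open G -> connected G -> hol_on G f -> G c -> 0 < r ->
  (forall z, G z -> disc c r z -> f z = f c) -> forall z, G z -> f z = f c.
Proof.
move=> oG cG hf Gc r0 h.
suff H : forall z, G z -> exists2 s, 0 < s & forall w, G w -> disc z s w -> f w = f c.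
  by move=> z Gz; have [s s0 hs] := H z Gz; apply: hs => //; exact: disc_center.
apply: (connected_ind cG); first by exists c => //; exists r.
  move=> z Gz [s s0 hs]; exists (s / 2); first by lin.
  move=> w Gw; rewrite /disc /= => wz; exists (s / 2) => [|v Gv]; first by lin.
  rewrite /disc /= => vw; apply: hs => //; rewrite /disc /=; have := nmD3 w v z; lin.
move=> z Gz hz; have [rho rho0 hrho] := (openCP G).1 oG z Gz.
have fz : f z = f c.
  apply/eqP; rewrite -subr_eq0 -nm_eq0; apply: contraT => ne.
  have q0 : 0 < nm (f z - f c) by rewrite lt_def ne nm_ge0.
  have [d d0 hd] := hol_cont hf Gz q0; have [w [Gw wz [s s0 hs]]] := hz _ d0.
  by have := hd _ Gw wz; rewrite (hs w Gw (disc_center w s0)) nmBC ltxx.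
have [[s s0 hs]|[m [k [s [m0 s0 srho] [hk hs]]]]] := zero_factor rho0 (hol_sub hrho hf).
  by exists s => // w _ wz; rewrite hs.
exfalso; have [w [Gw wz [q q0 hq]]] := hz (s / 2) ltac:(lin).
have [w' [Gw' w'z w's w'n]] : exists w', [/\ G w', disc w q w', disc z s w' & w' != z].
  have [wzE|wzn] := eqVneq w z; last first.
    by exists w; split => //; [exact: disc_center|move: wz; rewrite /disc /=; lin].
  pose t : R := Num.min q s / 2; have ms : 0 < Num.min q s by rewrite lt_min q0.
  have t0 : 0 < t by rewrite /t; lin.
  have [tr ts] : t < q /\ t < s by apply/andP; rewrite -lt_min /t; lin.
  have nt : nm (z + rc t - z) = t by rewrite addrAC subrr add0r nm_rc gtr0_norm.
  exists (z + rc t); rewrite wzE /disc /= nt; split => //; first by apply: hrho; rewrite /disc /= nt; lin.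
  by rewrite -subr_eq0 -nm_gt0 nt.
have [k0] := hs w' w's; rewrite (hq w' Gw' w'z) fz => /eqP.
rewrite -subr_eq0 opprD addrA subrr add0r oppr_eq0 mulf_eq0 (negbTE k0) orbF expf_eq0 subr_eq0 (negbTE w'n) andbF //.
Qed.

(** Minimum principle: without a zero the maximum principle applies to 1 / f and contradicts the
    small value at the centre. It takes the place of Rouché's theorem below. *)
Lemma zero_in_disc c r rho f m : 0 < r -> r < rho -> hol_on (disc c rho) f ->
  (forall w, nm (w - c) = r -> m <= nm (f w)) -> nm (f c) < m -> exists2 z, disc c r z & f z = 0.
Proof.
move=> r0 rr hf hm fcm; apply: contrapT => nz.
have f0 z : cdisc c r z -> f z != 0.
  rewrite /cdisc /= => zr; apply/eqP => fz.
  have [zr'|zr'] := ltrP (nm (z - c)) r; first by apply: nz; exists z.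
  have := hm z; rewrite fz nm0; have := nm_ge0 (f c) => h1 h2.
  by have : m <= 0 by [apply: h2; lin]; lin.
have cr : cdisc c r `<=` disc c rho by move=> z; rewrite /cdisc /disc /=; lin.
have dr : disc c r `<=` cdisc c r by move=> z; rewrite /cdisc /disc /=; lin.
have hi : hol_on (cdisc c r) (fun z => (f z)^-1).
  move=> z zr; have [d hd] := hf z (cr _ zr); eexists; exact: dC_inv hd (f0 _ zr).
have m0 : 0 < m by have := nm_ge0 (f c); lin.
have := @max_modulus (disc c r) (fun z => (f z)^-1) m^-1 (r + nm c) (@disc_open _ c r).
move=> /(_ _ _ _ _ c (disc_center c r0)) H.
have : nm (f c)^-1 <= m^-1.
  apply: H.
  - by move=> z; rewrite /disc /=; have := nmB_ge z c; lin.
  - by apply: cont_on_sub (hol_cont hi); exact: closure_disc.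
  - exact: hol_sub hi.
  move=> z /closure_disc zr nzr; have zE : nm (z - c) = r.
    by apply/eqP; rewrite eq_le zr /= leNgt; apply/negP.
  rewrite nmV lef_pV2 ?posrE ?hm // nm_gt0; exact: f0.
rewrite nmV lef_pV2 ?posrE //; first by lin.
by rewrite nm_gt0; apply: f0; exact: dr (disc_center c r0).
Qed.

Definition loc_const f c := exists2 r, 0 < r & forall z, disc c r z -> f z = f c.

Lemma isolated_value G f c : open G -> hol_on G f -> G c -> ~ loc_const f c -> forall rho, 0 < rho ->
  exists r m, [/\ 0 < r, r < rho, 0 < m, cdisc c r `<=` G & forall z, nm (z - c) = r -> m <= nm (f z - f c)].
Proof.
move=> oG hf Gc nl rho rho0; have [s s0 hs] := (openCP G).1 oG c Gc.
have [//|[m [k [r [m0 r0 rr] [hk hr]]]]] := zero_factor s0 (hol_sub hs hf).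
pose t : R := Num.min r rho / 2; have ms : 0 < Num.min r rho by rewrite lt_min r0.
have t0 : 0 < t by rewrite /t; lin.
have [tr ts] : t < r /\ t < rho by apply/andP; rewrite -lt_min /t; lin.
have sub : cdisc c t `<=` disc c r by move=> z; rewrite /cdisc /disc /=; lin.
have [q q0 hq] := compact_nm_min (@cdisc_compact _ c t) (cont_on_sub sub (hol_cont hk))
  (fun z zt => proj1 (hr z (sub _ zt))).
exists t, (t ^+ m * q); split => //.
- by rewrite mulr_gt0 // exprn_gt0.
- by move=> z /sub zr; apply: hs; move: zr; rewrite /disc /=; lin.
- move=> z zt; have zc : cdisc c t z by rewrite /cdisc /= zt.
  have [_ ->] := hr z (sub _ zc); rewrite addrAC subrr add0r nmM nmX zt ler_wpM2l ?hq //.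
  by rewrite exprn_ge0 // ltW.
Qed.

Lemma open_mapping G f c : open G -> hol_on G f -> G c -> ~ loc_const f c -> forall rho, 0 < rho ->
  exists2 d, 0 < d & forall b, disc (f c) d b -> exists z, [/\ G z, disc c rho z & f z = b].
Proof.
move=> oG hf Gc nl rho rho0.
have [r [m [r0 rr m0 sub hm]]] := isolated_value oG hf Gc nl rho0.
exists (m / 2); first by lin.
move=> b bm.
have [e e0 he] := compact_disc_nbhs (@cdisc_compact _ c r) oG sub.
have dG : disc c (r + e) `<=` G.
  move=> z; rewrite /disc /= => zr; have [zr'|zr'] := lerP (nm (z - c)) r; first exact: sub.
  have zc0 : 0 < nm (z - c) by lin.
  apply: (he (c + rc (r / nm (z - c)) * (z - c))).
    rewrite /cdisc /= addrAC subrr add0r nmM nm_rc gtr0_norm ?divr_gt0 // divfK //; exact: lt0r_neq0.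
  rewrite (_ : z - _ = rc (1 - r / nm (z - c)) * (z - c)); last by rewrite rcB rc1; ring.
  rewrite nmM nm_rc ger0_norm; last by rewrite subr_ge0 ler_pdivrMr //; lin.
  by rewrite mulrBl mul1r divfK ?lt0r_neq0 //; lin.
have hb : hol_on (disc c (r + e)) (fun z => f z - b).
  by move=> z /dG /hf[d hd]; eexists; exact: dC_sub hd (dC_cst b z).
have [|w wr||z zr /eqP] := zero_in_disc r0 _ hb (m := m / 2); first by lin.
- have := hm w wr; have := nmD3 b (f w) (f c); move: bm; rewrite /disc /=; lin.
- by move: bm; rewrite /disc /= nmBC.
- rewrite subr_eq0 => /eqP E; exists z; split => //.
    by apply: sub; move: zr; rewrite /disc /cdisc /=; lin.
  by move: zr; rewrite /disc /=; lin.
Qed.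
End cauchy_consequences.

(** * Entire functions of linear growth, and limits of holomorphic families along filters *)

Section families.
Context {R : realType}.
Local Notation C := (cplx R).
Implicit Types (e r rho : R) (z w a b c p : C) (f g : C -> C) (D G K S : set C).

Definition nonconst f := exists a b, f a != f b.

Lemma nonconst_not_loc f c : hol_on setT f -> nonconst f -> ~ loc_const f c.
Proof.
move=> hf [a [b ab]] [r r0 hr].
have H := @identity_theorem R setT f c r openT _ hf I r0 (fun z _ => hr z).
have cT : connected [set: C].
  have -> : [set: C] = \bigcup_(x in [set: C]) ((fun t : C => t * x) @` unit_seg).
    apply/seteqP; split=> // x _; exists x => //; exists 1; last by rewrite mul1r.
    by exists 1 => //=; rewrite lexx ler01.
  apply: bigcup_connected.
    by exists 0 => x _; exists 0; [exists 0 => //=; rewrite lexx ler01|rewrite mul0r].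
  move=> x _; apply: cont_connected.
    have -> : unit_seg = rc @` `[0, 1] :> set C.
      by apply/seteqP; split=> z [t /= ht <-]; exists t => //=; move: ht; rewrite in_itv.
    apply: connected_continuous_connected; first exact: segment_connected.
    apply: continuous_subspaceT => t B /nbhsCP[e e0 eB]; apply/nbhs_ballP; exists e => // s.
    by rewrite /ball /= => ts; apply: eB; rewrite -rcB nm_rc distrC.
  by apply: cont_on_mul; [exact: cont_on_id|exact: cont_on_cst].
by move: ab; rewrite (H cT a) // (H cT b) // eqxx.
Qed.

Definition bdd D := exists2 M : R, 0 < M & forall z, D z -> nm z <= M.

Lemma closure_compact D : bdd D -> compact (closure D).
Proof.
move=> [M _ hM]; apply: closed_bounded_compact (@closed_closure _ D) (closureC_bounded hM).
Qed.

Lemma compact_closedC K : compact K -> closed K.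
Proof. by move=> cK; apply: compact_closed => //; exact: hausC. Qed.

(* A connected set that meets [f(D)] but avoids [f] of the boundary of [D] lies in [f(D)]. *)
Lemma swallow f D S : hol_on setT f -> nonconst f -> open D -> bdd D -> connected S ->
  (forall z, closure D z -> ~ D z -> ~ S (f z)) -> (exists2 z, D z & S (f z)) ->
  forall w, S w -> exists2 z, D z & f z = w.
Proof.
move=> hf nf oD bD cS hb [z0 Dz0 Sz0].
have hD : hol_on D f by exact: hol_sub hf.
apply: (connected_ind cS); first by exists (f z0) => //; exists z0.
  move=> w Sw [z Dz zw].
  have [d d0 hd] := open_mapping oD hD Dz (nonconst_not_loc hf nf) ltr01.
  by exists d => // v Sv; rewrite -zw => /hd[x [Dx _ xv]]; exists x.
move=> w Sw hw.
have cf : cont_on (closure D) f by exact: cont_on_sub (hol_cont hf).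
have clf := compact_closedC (cont_compact (closure_compact bD) cf).
have : closure (f @` closure D) w.
  apply/closureCP => e /hw[v [Sv vw [z Dz zv]]]; exists v => //; exists z => //.
  exact: subset_closure.
rewrite -(closure_id _).1 // => -[z cz zw]; exists z => //.
by apply: contrapT => nz; apply: (hb z cz nz); rewrite zw.
Qed.

(** Liouville in degree one: on the circle of radius [rho] the remainder of order two at [z] is at
    most M |z|^2 / (rho - |z|). Arbitrarily large radii suffice, not all of them. *)
Lemma affine_growth f M : hol_on setT f -> 0 < M ->
  (forall N, exists2 rho, N <= rho & forall z, nm z <= rho -> nm (f z) <= M * rho) ->
  forall z, f z = f 0 + dv f 0 * z.
Proof.
move=> hf M0 h z; apply/eqP; rewrite -subr_eq0 -nm_eq0; apply: contraT => ne.
have q0 : 0 < nm (f z - (f 0 + dv f 0 * z)) by rewrite lt_def ne nm_ge0.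
set q := nm _ in q0; have nz := nm_ge0 z.
have [rho hN hrho] := h (nm z + 1 + (M * nm z ^+ 2 + 1) / q).
have Q0 : 0 < (M * nm z ^+ 2 + 1) / q.
  by rewrite divr_gt0 //; have : 0 <= M * nm z ^+ 2 by [rewrite mulr_ge0 ?exprn_ge0 // ltW|]; lin.
have r0 : 0 < rho by lin.
have := @cauchy_taylor R 0 rho (rho + 1) f 0 z (M * rho) r0.
rewrite !subr0 nm0 subr0 !add0r => H.
have {H} : nm (f z - f 0 - dv f 0 * z) <= M * rho * rho * nm z ^+ 2 / (rho ^+ 2 * (rho - nm z)).
  apply: H; first by lin.
  - exact: hol_sub hf.
  - by move=> w; rewrite subr0 => wr; apply: hrho; rewrite wr.
  - by lin.
rewrite -addrA -opprD -/q (_ : _ / _ = M * nm z ^+ 2 / (rho - nm z)); last first.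
  field; rewrite (lt0r_neq0 r0) andbT; apply: lt0r_neq0; lin.
have d0 : 0 < rho - nm z by lin.
rewrite ler_pdivlMr // => H.
have : (M * nm z ^+ 2 + 1) / q < rho - nm z by lin.
by rewrite ltr_pdivrMr //; lin.
Qed.

Section filters.
Context {I : Type} {F : set_system I}.

Definition fcvg (u : I -> C -> C) G Phi := forall K, compact K -> K `<=` G -> forall e, 0 < e ->
  F [set i | forall z, K z -> nm (u i z - Phi z) < e].

Lemma fcvg_cont (FF : ProperFilter F) u G Phi K : F [set i | hol_on G (u i)] -> fcvg u G Phi ->
  compact K -> K `<=` G -> cont_on K Phi.
Proof.
move=> hu cu cK KG z Kz e e0; have e30 : 0 < e / 3 by lin.
have [i [hi hui]] := filter_ex (filterI (cu K cK KG _ e30) hu).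
have [d d0 hd] := hol_cont (hol_sub KG hui) Kz e30.
exists d => // w Kw wz; have := hd w Kw wz; have := hi _ Kw; have := hi _ Kz.
have := nmD3 (u i w) (Phi w) (Phi z); have := nmD3 (u i z) (u i w) (Phi z).
rewrite (nmBC (Phi w) (u i w)); lin.
Qed.

(** The Cauchy formula on a small circle passes to the uniform limit, and a Cauchy integral of a
    continuous density is differentiable. *)
Lemma weierstrass (FF : ProperFilter F) u G Phi : open G -> F [set i | hol_on G (u i)] ->
  fcvg u G Phi -> hol_on G Phi.
Proof.
move=> oG hu cu z Gz; have [s s0 hs] := (openCP G).1 oG z Gz.
have [r r0 rs] : exists2 r : R, 0 < r & r < s by exists (s / 2); lin.
have KG : cdisc z r `<=` G by move=> w wr; apply: hs; move: wr; rewrite /disc /cdisc /=; lin.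
have cK := @cdisc_compact _ z r.
have cPhi := fcvg_cont FF hu cu cK KG.
have KS (t : R) : cdisc z r (circ z r (rc t)) by rewrite /cdisc /= nm_circ.
have cp : cont_on unit_seg (cpsi z r Phi 0).
  apply: (@cont_on_ext _ _ _ (fun t => Phi (circ z r t) * (circ z r t - z))) => [t _|].
    by rewrite /cpsi expr0 divr1.
  apply: cont_on_mul; last by apply: cont_on_sub2; [exact: circ_cont|exact: cont_on_cst].
  by apply: cont_on_comp cPhi (@circ_cont _ z r) _ => _ [t _ <-].
have E w : disc z r w -> Phi w = cker z r (cpsi z r Phi 0) 1 w.
  move=> Dw; apply/eqP; rewrite -subr_eq0 -nm_eq0; apply: contraT => ne.
  set q := nm _ in ne; have q0 : 0 < q by rewrite lt_def ne nm_ge0.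
  have d0 : 0 < r - nm (w - z) by move: Dw; rewrite /disc /=; lin.
  set d := r - nm (w - z) in d0.
  have e0 : 0 < q / (2 * (1 + r / d)).
    by rewrite divr_gt0 // mulr_gt0 // addr_gt0 // divr_gt0.
  set e := q / _ in e0.
  have [i [hi hui]] := filter_ex (filterI (cu _ cK KG _ e0) hu).
  have hui' : hol_on (disc z s) (u i) by exact: hol_sub hui.
  have I1 := cintP (cker_cont 1 r0 (cpsi_cont 0 r0 rs hui') Dw).
  have I2 := cintP (cker_cont 1 r0 cp Dw).
  have : nm (cker z r (cpsi z r (u i) 0) 1 w - cker z r (cpsi z r Phi 0) 1 w) <= e * r / d.
    apply: (is_int_bound (is_intB I1 I2)) => t t01.
    rewrite /cpsi expr0 !divr1 expr1 -mulrBl -mulrBl !nmM nmV nm_circ //.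
    have k := circ_far z w t r0; rewrite -/d in k.
    rewrite ler_pM ?mulr_ge0 ?invr_ge0 ?nm_ge0 ?(ltW r0) //.
      by rewrite ler_wpM2r ?(ltW r0) // ltW //; apply: hi; exact: KS.
    by rewrite lef_pV2 ?posrE // (lt_le_trans d0).
  rewrite -(cauchy_formula r0 rs hui' Dw) => h1.
  have h2 : nm (u i w - Phi w) < e by apply: hi; move: Dw; rewrite /disc /cdisc /=; lin.
  have h3 := nmD3 (u i w) (Phi w) (cker z r (cpsi z r Phi 0) 1 w); rewrite -/q (nmBC (Phi w)) in h3.
  have : e * (2 * (1 + r / d)) = q.
    by rewrite /e divfK // mulf_neq0 // gt_eqF // addr_gt0 // divr_gt0.
  by rewrite mulrDr mulr1 mulrDr mulrCA mulrA => h4; have := mulr_gt0 e0 (divr_gt0 r0 d0); nra.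
exists (cker z r (cpsi z r Phi 0) 2 z).
exact: (dC_ext r0 E (dC_cker1 r0 cp (disc_center z r0))).
Qed.

(** Around an isolated zero of [Phi] there is a circle with |Phi| at least [m]. A member of the
    family within [m / 3] exceeds [m / 2] on the circle and stays below it at the centre, so
    [zero_in_disc] gives it a zero. *)
Lemma hurwitz (FF : ProperFilter F) u G Phi : open G -> connected G -> F [set i | hol_on G (u i)] ->
  fcvg u G Phi -> F [set i | forall z, G z -> u i z != 0] ->
  (forall z, G z -> Phi z != 0) \/ (forall z, G z -> Phi z = 0).
Proof.
move=> oG cG hu cu nz; have hPhi := weierstrass FF oG hu cu.
case: (pselect (exists2 c, G c & Phi c = 0)) => [[c Gc Pc]|nex]; last first.
  by left=> z Gz; apply/eqP => Pz; apply: nex; exists z.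
right=> z Gz; case: (pselect (loc_const Phi c)) => [[r r0 hr]|nl].
  by rewrite (identity_theorem oG cG hPhi Gc r0) // => w _; exact: hr.
exfalso; have [r [m [r0 _ m0 sub hm]]] := isolated_value oG hPhi Gc nl ltr01.
have m30 : 0 < m / 3 by lin.
have [e e0 he] := compact_disc_nbhs (@cdisc_compact _ c r) oG sub.
have dG : disc c (r + e) `<=` G.
  move=> x; rewrite /disc /= => xr; have [xr'|xr'] := lerP (nm (x - c)) r; first exact: sub.
  have xc0 : 0 < nm (x - c) by lin.
  apply: (he (c + rc (r / nm (x - c)) * (x - c))).
    rewrite /cdisc /= addrAC subrr add0r nmM nm_rc gtr0_norm ?divr_gt0 // divfK //; exact: lt0r_neq0.
  rewrite (_ : x - _ = rc (1 - r / nm (x - c)) * (x - c)); last by rewrite rcB rc1; ring.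
  rewrite nmM nm_rc ger0_norm; last by rewrite subr_ge0 ler_pdivrMr //; lin.
  by rewrite mulrBl mul1r divfK ?lt0r_neq0 //; lin.
have [i [[hi hui] nzi]] := filter_ex (filterI (filterI (cu _ (@cdisc_compact _ c r) sub _ m30) hu) nz).
have [||w wr||x xr ux] := @zero_in_disc R c r (r + e) (u i) (m / 2) r0.
- by lin.
- exact: hol_sub hui.
- have := hm w wr; rewrite Pc subr0 => h1.
  have := hi w; rewrite /cdisc /= wr lexx => /(_ isT); rewrite nmBC => h2.
  by have := nmB_ge (Phi w) (u i w); lin.
- have := hi c; rewrite /cdisc /= subrr nm0 (ltW r0) Pc subr0 => /(_ isT); lin.
have /nzi : G x by apply: sub; move: xr; rewrite /disc /cdisc /=; lin.
by rewrite ux eqxx.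
Qed.

(** On the circle of radius 2r the Cauchy estimate bounds the derivative in the disc of radius r by
    M * 2r / r^2, which is the constant. *)
Lemma hol_lip c r f M : 0 < r -> hol_on (disc c (3 * r)) f -> (forall z, disc c (3 * r) z -> nm (f z) <= M) ->
  forall z w, disc c r z -> disc c r w -> nm (f z - f w) <= 2 * M / r * nm (z - w).
Proof.
move=> r0 hf hM z w Dz Dw.
have M0 : 0 <= M by apply: le_trans (nm_ge0 _) (hM c _); apply: disc_center; lin.
have I1 := @seg_FTC R f (dv f) w z.
have sub : disc c r `<=` disc c (3 * r) by move=> v; rewrite /disc /=; lin.
have {}I1 := I1 (fun t t01 => dvP (hf _ (sub _ (cvx_disc Dw Dz t01)))).
apply: (is_int_bound I1) => t t01; rewrite nmM ler_wpM2r ?nm_ge0 //.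
have Dt := cvx_disc Dw Dz t01; set v := w + _ in Dt *.
have h : nm (dv f v) <= M * (2 * r) / (2 * r - nm (v - c)) ^+ 2.
  apply: (@cauchy_est _ c (2 * r) (3 * r)) => //; try lin.
  - by move=> x xr; apply: hM; rewrite /disc /=; lin.
  - by move: Dt; rewrite /disc /=; lin.
apply: le_trans h _.
rewrite (_ : 2 * M / r = M * (2 * r) / r ^+ 2); last by field; rewrite lt0r_neq0.
rewrite ler_wpM2l ?mulr_ge0 ?(ltW r0) //.
have k : r <= 2 * r - nm (v - c) by move: Dt; rewrite /disc /=; lin.
by rewrite lef_pV2 ?posrE ?exprn_gt0 ?ler_sqr ?nnegrE //; lin.
Qed.

Definition loc_bounded (u : I -> C -> C) G := forall z, G z -> exists r M, 0 < r /\
  forall i w, disc z r w -> nm (u i w) <= M.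

(* Along an ultrafilter no diagonal extraction is needed. *)
Lemma montel (UF : UltraFilter F) u G : open G -> (forall i, hol_on G (u i)) -> loc_bounded u G ->
  exists Phi, fcvg u G Phi.
Proof.
move=> oG hu lb.
have PF : ProperFilter F by exact: ultra_proper.
have lim z : G z -> exists p, forall e, 0 < e -> F [set i | nm (u i z - p) < e].
  move=> Gz; have [r [M [r0 hM]]] := lb z Gz.
  have [|p [_ cp]] := @cdisc_compact _ 0 M (u^~ z @ F) _.
    by apply: (@filterE _ F) => i; rewrite /cdisc /= subr0; apply: hM; exact: disc_center.
  exists p => e e0; have [//|h] := in_ultra_setVsetC [set i | nm (u i z - p) < e] UF.
  have [//||w [/= ]] := cp (~` disc p e) (disc p e).
  - by apply/nbhsCP; exists e.
  - by [].
pose Phi z := if pselect (G z) is left Gz then projT1 (cid (lim z Gz)) else 0.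
have PhiP z : G z -> forall e, 0 < e -> F [set i | nm (u i z - Phi z) < e].
  by move=> Gz; rewrite /Phi; case: pselect => // Gz'; case: cid.
exists Phi => K cK KG e e0.
(* Equicontinuity makes the pointwise limits uniform on [K]. The error budget is [e / 5] five times:
   one for [u i] between [w] and [z], one for [u i z - Phi z], and three for [Phi] between [z] and
   [w]. *)
move/compact_near_coveringP: cK => /(_ I F (fun i z => nm (u i z - Phi z) < e)) H.
apply: H => z Kz; have Gz := KG z Kz.
have [s s0 hs] := (openCP G).1 oG z Gz; have [r [M [r0 hM]]] := lb z Gz.
pose q := Num.min r s / 3; have ms : 0 < Num.min r s by rewrite lt_min r0.
have q0 : 0 < q by rewrite /q; lin.
have q3 : disc z (3 * q) `<=` disc z r `&` disc z s.
  by move=> w; rewrite /disc /= => wq; apply/andP; rewrite -lt_min; rewrite /q in wq; lin.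
have lip i := hol_lip q0 (hol_sub (fun w wq => hs w (proj2 (q3 w wq))) (hu i)) (fun w wq => hM i w (proj1 (q3 w wq))).
have M0 : 0 <= M.
  have [i _] := filter_ex (PhiP z Gz 1 ltr01).
  by apply: le_trans (nm_ge0 _) (hM i z _); exact: disc_center.
pose L := 2 * M / q + 1; have L0 : 0 < L by rewrite /L; have := divr_ge0 (mulr_ge0 (ler0n _ 2) M0) (ltW q0); lin.
have e40 : 0 < e / 5 by lin.
have d0 : 0 < Num.min q (e / 5 / L) by rewrite lt_min q0 divr_gt0.
set d := Num.min _ _ in d0.
have dq : d <= q by rewrite ge_min lexx.
have dL : L * d <= e / 5 by rewrite mulrC -ler_pdivlMr // ge_min lexx orbT.
have Dz : disc z q z by exact: disc_center.
have near i w : disc z d w -> nm (u i w - u i z) <= e / 5.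
  move=> wd; have Dw : disc z q w by move: wd; rewrite /disc /=; lin.
  apply: le_trans (lip i w z Dw Dz) _; apply: le_trans dL.
  have hq : 0 <= 2 * M / q by apply: divr_ge0; [rewrite mulr_ge0|exact: ltW].
  by apply: (ler_pM hq (nm_ge0 _) _ (ltW wd)); rewrite /L; lin.
exists (disc z d, [set i | nm (u i z - Phi z) < e / 5]).
  by split; [apply/nbhsCP; exists d|exact: PhiP].
move=> [w i] [/= wd hi].
have Gw : G w by apply: hs; apply: (proj2 (q3 w _)); move: wd; rewrite /disc /=; lin.
have [j [/= j1 j2]] := filter_ex (filterI (PhiP z Gz _ e40) (PhiP w Gw _ e40)).
have h : nm (Phi w - Phi z) <= 3 * (e / 5).
  have := near j w wd; have := nmD3 (u j w) (Phi w) (Phi z); have := nmD3 (u j z) (u j w) (Phi z).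
  rewrite (nmBC (Phi w) (u j w)); lin.
have := near i w wd; have := nmD3 (u i z) (u i w) (Phi w); have := nmD3 (Phi z) (u i z) (Phi w).
rewrite (nmBC (Phi z)); lin.
Qed.
End filters.
End families.

(** * Logarithms, a weak Bloch theorem and a dense set of omitted values *)

Section schottky.
Context {R : realType}.
Local Notation C := (cplx R).
Implicit Types (e r rho : R) (z w a b c p : C) (f g : C -> C) (D G K S : set C).

Lemma cexp_surj w : w != 0 -> exists l, [/\ cexp l = w, reC l = ln (nm w) & `|imC l| <= pi].
Proof.
move=> w0; have n0 : 0 < nm w by rewrite nm_gt0.
set x := reC w / nm w; set y := imC w / nm w.
have xy : x ^+ 2 + y ^+ 2 = 1.
  by rewrite !expr_div_n -mulrDl -nm_sqr divff // expf_neq0 // gt_eqF.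
have x1 : -1 <= x <= 1.
  have : x ^+ 2 <= 1 by rewrite -xy lerDl sqr_ge0.
  by rewrite -ler_norml -(@ler_sqr _ `|x|) ?nnegrE // real_normK ?num_real // expr1n.
have [c0 cpi] : 0 <= acos x /\ acos x <= pi by rewrite acos_ge0 ?acos_lepi.
have sy : Num.sqrt (1 - x ^+ 2) = `|y|.
  by rewrite -xy addrAC subrr add0r sqrtr_sqr.
pose th : R := if 0 <= y then acos x else - acos x.
have ct : cos th = x by rewrite /th; case: ifP => _; rewrite ?cosN acosK.
have st : sin th = y.
  rewrite /th; case: ifP => y0; rewrite ?sinN sin_acos // sy; first by rewrite ger0_norm.
  by rewrite ltr0_norm ?opprK // ltNge y0.
exists (rc (ln (nm w)) + iC * rc th).
have re : reC (rc (ln (nm w)) + iC * rc th) = ln (nm w).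
  by rewrite reD reM re_rc re_iC im_iC re_rc im_rc mul0r mulr0 subrr addr0.
have im : imC (rc (ln (nm w)) + iC * rc th) = th.
  by rewrite imD imM im_rc re_iC im_iC re_rc im_rc mul0r mul1r !add0r.
split => //; last by rewrite im /th; case: ifP => _; rewrite ?normrN ger0_norm.
rewrite /cexp re im ct st lnK // /x /y !rcM !rcV.
rewrite [RHS]reimE; have : rc (nm w) != 0 by rewrite rc_eq0 gt_eqF.
by move=> h; field.
Qed.

(** A primitive [L] of f' / f makes f exp(-L) a function of derivative 0; the additive constant is
    fixed by the value at the centre. *)
Lemma hol_log f c rho w0 : hol_on (disc c rho) f -> 0 < rho -> (forall z, disc c rho z -> f z != 0) ->
  cexp w0 = f c -> exists L, [/\ hol_on (disc c rho) L, forall z, disc c rho z -> cexp (L z) = f z & L c = w0].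
Proof.
move=> hf rho0 f0 ew; have hd := hol_dv (@disc_open _ c rho) hf.
have hq : hol_on (disc c rho) (fun z => dv f z / f z).
  move=> z Dz; have [d h] := hd z Dz; have [d' h'] := hf z Dz.
  by eexists; apply: dC_mul h (dC_inv h' (f0 z Dz)).
have [L0 hL0] := hol_primitive hq.
have Dc := disc_center c rho0.
pose L z := L0 z - L0 c + w0.
have dL z : disc c rho z -> dC L z (dv f z / f z).
  by move=> Dz; apply: dC_eq (dC_add (dC_sub (hL0 z Dz) (dC_cst (L0 c) z)) (dC_cst w0 z)) _; rewrite subr0 addr0.
exists L; split => [z Dz|z Dz|]; first by eexists; exact: dL.
  have key x : disc c rho x -> dC (fun y => f y * cexp (- L y)) x 0.
    move=> Dx; have hx := dvP (hf x Dx).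
    have h1 := @dC_comp _ cexp (fun y => - L y) x _ _ (dC_cexp _) (dC_opp (dL x Dx)).
    by apply: dC_eq (dC_mul hx h1) _; field; exact: f0.
  have := deriv0_cst key Dz Dc.
  rewrite {2}/L subrr add0r !cexpN -ew divff ?cexp_neq0 // => /(congr1 (fun x => x * cexp (L z))).
  by rewrite divfK ?cexp_neq0 // mul1r.
by rewrite /L subrr add0r.
Qed.

Lemma hol_sqrt f c rho : hol_on (disc c rho) f -> 0 < rho -> (forall z, disc c rho z -> f z != 0) ->
  exists2 s, hol_on (disc c rho) s & forall z, disc c rho z -> s z ^+ 2 = f z.
Proof.
move=> hf rho0 f0; have [l [el _ _]] := cexp_surj (f0 c (disc_center c rho0)).
have [L [hL eL _]] := hol_log hf rho0 f0 el.
exists (fun z => cexp (L z / 2)) => [z Dz|z Dz].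
  have [d hd] := hL z Dz; eexists.
  exact: (@dC_comp _ cexp (fun z => L z / 2) z _ _ (dC_cexp _) (dC_mul hd (dC_cst 2^-1 z))).
rewrite expr2 -cexpD -eL //; congr cexp; by field.
Qed.

(** The derivative has Lipschitz constant 12 mu / rho near [a]. On the circle of radius t = rho / 24
    this costs 12 mu t^2 / rho = mu t / 2, so [h] moves by at least mu t / 2 there, and every value
    within mu t / 4 = mu rho / 96 of [h a] is attained. *)
Lemma disc_image_cover h a rho mu : 0 < rho -> 0 < mu -> hol_on (disc a rho) h -> nm (dv h a) = mu ->
  (forall z, disc a rho z -> nm (dv h z) <= 2 * mu) ->
  forall b, nm (b - h a) < mu * rho / 96 -> exists2 z, disc a rho z & h z = b.
Proof.
move=> rho0 mu0 hh ha hb b bh.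
pose t : R := rho / 24; have t0 : 0 < t by rewrite /t; lin.
have r30 : 0 < rho / 3 by lin.
have e3 : 3 * (rho / 3) = rho by lin.
have hd : hol_on (disc a (3 * (rho / 3))) (dv h) by rewrite e3; apply: hol_dv => //; exact: disc_open.
have lip z : disc a (rho / 3) z -> nm (dv h z - dv h a) <= 12 * mu / rho * nm (z - a).
  move=> Dz; have := hol_lip r30 hd (M := 2 * mu); rewrite e3 => /(_ hb z a Dz (disc_center a r30)).
  by rewrite (_ : 2 * (2 * mu) / (rho / 3) = 12 * mu / rho) //; field; rewrite lt0r_neq0.
have lin z : nm (z - a) = t -> mu * t / 2 <= nm (h z - h a).
  move=> zt.
  have Da : disc a (rho / 3) a by exact: disc_center.
  have Dz : disc a (rho / 3) z by rewrite /disc /= zt /t; lin.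
  have sub : disc a (rho / 3) `<=` disc a rho by move=> w; rewrite /disc /=; lin.
  have I1 := @seg_FTC R h (dv h) a z (fun s s01 => dvP (hh _ (sub _ (cvx_disc Da Dz s01)))).
  have I2 := @seg_FTC R (fun w => 0 + dv h a * w) (fun=> dv h a) a z (fun s _ => dC_affine _ _ _).
  have k : nm ((h z - h a) - (dv h a * (z - a))) <= 12 * mu / rho * t * t.
    rewrite (_ : dv h a * (z - a) = 0 + dv h a * z - (0 + dv h a * a)); last by ring.
    apply: (is_int_bound (is_intB I1 I2)) => s s01; rewrite -mulrBl nmM zt ler_wpM2r ?(ltW t0) //.
    apply: le_trans (lip _ (cvx_disc Da Dz s01)) _.
    rewrite ler_wpM2l ?divr_ge0 ?mulr_ge0 ?(ltW mu0) ?(ltW rho0) //.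
    rewrite addrAC subrr add0r nmM nm_rc zt; move: s01 => /andP[s0 s1].
    by rewrite ger0_norm // ler_piMl // ltW.
  have := nmB_ge' (h z - h a) (dv h a * (z - a)); rewrite nmM ha zt.
  have kE : 12 * mu / rho * t * t = mu * t / 2 by rewrite /t; field; rewrite lt0r_neq0.
  rewrite kE in k.
  lin.
have tr : t < rho by rewrite /t; lin.
have hb' : hol_on (disc a rho) (fun z => h z - b).
  by move=> z /hh[d hd']; eexists; exact: dC_sub hd' (dC_cst b z).
have mt : mu * rho / 96 = mu * t / 4 by rewrite /t; field.
have [w wt|/=|z zr /eqP E] := zero_in_disc t0 tr hb' (m := mu * t / 4).
- have := lin w wt; have := nmD3 b (h w) (h a); lin.
- by rewrite nmBC -mt.
- exists z; first by move: zr; rewrite /disc /=; lin.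
  by apply/eqP; rewrite -subr_eq0.
Qed.

(** Landau's device: where (r - |z - c|) |h'(z)| is maximal, say with factors [d] and [mu], the
    derivative is at most 2 mu on the disc of radius d / 2. The image then contains a disc of radius
    mu d / 192, which cannot exceed the density 7 of omitted values: 7 * 192 = 42 * 32. *)
Lemma weak_bloch h c rho : 0 < rho -> hol_on (disc c rho) h ->
  (forall b, exists2 b', nm (b' - b) <= 7 & forall z, disc c rho z -> h z != b') ->
  nm (dv h c) * rho <= 42 * 32.
Proof.
move=> rho0 hh om.
suff H r : 0 < r -> r < rho -> nm (dv h c) * r <= 42 * 32.
  have [->|n0] := eqVneq (nm (dv h c)) 0; first by rewrite mul0r mulr_ge0.
  have n0' : 0 < nm (dv h c) by rewrite lt_def n0 nm_ge0.
  rewrite mulrC -ler_pdivlMr //; apply/ler_addgt0Pr => e e0.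
  pose r := Num.max (rho / 2) (rho - e).
  have := H r; rewrite lt_max gt_max /r; have -> : 0 < rho / 2 by lin.
  have -> : rho / 2 < rho by lin.
  have -> : rho - e < rho by lin.
  move=> /(_ isT isT); rewrite mulrC -ler_pdivlMr // ge_max => /andP[_]; lin.
move=> r0 rr.
have sub : cdisc c r `<=` disc c rho by move=> z; rewrite /cdisc /disc /=; lin.
have hd := hol_dv (@disc_open _ c rho) hh.
have cphi : cont_on (cdisc c r) (fun z => rc (r - nm (z - c)) * dv h z).
  apply: cont_on_mul; last exact: hol_cont (hol_sub sub hd).
  move=> z _ e e0; exists e => // w _ wz; rewrite -rcB nm_rc.
  apply: le_lt_trans wz; have := nmD3 z w c; have := nmD3 w z c; rewrite (nmBC z w) ler_norml; lin.
have cc : cdisc c r c by rewrite /cdisc /= subrr nm0 ltW.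
have [a ca ha] := rcompact_max (@cdisc_compact _ c r) (ex_intro _ c cc) (rcont_nm cphi).
have phiE z : cdisc c r z -> nm (rc (r - nm (z - c)) * dv h z) = (r - nm (z - c)) * nm (dv h z).
  by move=> cz; rewrite nmM nm_rc ger0_norm // subr_ge0.
have hm z : cdisc c r z -> (r - nm (z - c)) * nm (dv h z) <= (r - nm (a - c)) * nm (dv h a).
  by move=> cz; rewrite -!phiE //; exact: ha.
have := hm c cc; rewrite subrr nm0 subr0 mulrC => m1; apply: le_trans m1 _.
set d := r - nm (a - c); set mu := nm (dv h a).
have [d0 mu0] : 0 <= d /\ 0 <= mu by rewrite /d subr_ge0 nm_ge0.
have [->|dn] := eqVneq d 0; first by rewrite mul0r mulr_ge0.
have [->|mun] := eqVneq mu 0; first by rewrite mulr0 mulr_ge0.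
have {d0 dn}d0 : 0 < d by rewrite lt_def dn.
have {mu0 mun}mu0 : 0 < mu by rewrite lt_def mun.
have d20 : 0 < d / 2 by lin.
have sd : disc a (d / 2) `<=` cdisc c r.
  by move=> z; rewrite /disc /cdisc /= => zd; have := nmD3 a z c; rewrite /d in zd *; move: d0; rewrite /d; lin.
have bnd z : disc a (d / 2) z -> nm (dv h z) <= 2 * mu.
  move=> zd; have := hm z (sd z zd); rewrite -/d -/mu.
  have h1 : d / 2 <= r - nm (z - c).
    by move: zd; rewrite /disc /= => zd; have := nmD3 a z c; rewrite /d in zd *; move: d0; rewrite /d; lin.
  have : d / 2 * nm (dv h z) <= (r - nm (z - c)) * nm (dv h z) by rewrite ler_wpM2r ?nm_ge0.
  move=> h2 h3; have : d * nm (dv h z) <= d * (2 * mu) by lin.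
  by rewrite ler_pM2l.
have [b' bb hb] := om (h a).
rewrite leNgt; apply/negP => big.
have [||z zd hz] := disc_image_cover d20 mu0 _ erefl bnd (b := b').
- exact: hol_sub (hol_sub sd (hol_sub sub hh)).
- by lin.
- by have := hb z (sub _ (sd _ zd)); rewrite hz eqxx.
Qed.

Lemma cexp_int (k : int) : cexp (tpi * k%:~R) = 1 :> C.
Proof.
have H (m : nat) : cexp (tpi * m%:R) = 1 :> C.
  elim: m => [|m IH]; first by rewrite mulr0 cexp0.
  by rewrite -addn1 natrD mulrDr cexpD IH mul1r mulr1 cexp_tpi.
case: k => m; first exact: H.
by rewrite NegzE mulrNz mulrN cexpN H invr1.
Qed.
Lemma double_int_pi (k : int) : iC * rc (k%:~R * pi) + iC * rc (k%:~R * pi) = tpi * k%:~R :> C.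
Proof.
have ki : rc (k%:~R) = k%:~R :> C by exact: (rmorph_int (real_complex R)).
by rewrite rcM ki /tpi mulr2n rcD; ring.
Qed.

(** The points sought solve cosh^2 = n. They include the numbers with real part plus or minus
    arcosh(sqrt n) and imaginary part k pi; real parts can be matched within 2 and imaginary parts
    within 4. *)
Lemma omitted_lattice (b : C) : exists b', nm (b' - b) <= 7 /\ exists n : nat, [/\ (0 < n)%N &
  (cexp b' + (cexp b')^-1) ^+ 2 = 4 * n%:R].
Proof.
pose x : R := `|reC b|; have x0 : 0 <= x by exact: normr_ge0.
have E1 : 1 <= expR x by rewrite -expR0 ler_expR.
have E0 : 0 < expR x by exact: expR_gt0.
pose ch := (expR x + (expR x)^-1) / 2.
have iE : 0 < (expR x)^-1 <= 1 by rewrite invr_gt0 E0 invf_le1.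
have ch1 : 1 <= ch ^+ 2.
  have -> : ch ^+ 2 = 1 + ((expR x - (expR x)^-1) / 2) ^+ 2 by rewrite /ch; field; rewrite lt0r_neq0.
  by rewrite lerDl sqr_ge0.
have ch0 : 0 <= ch ^+ 2 by lin.
(* [ch] is cosh of |Re b|, so n is the integer part of its square. Below, [t = ln (s + s')] is
   arcosh(sqrt n), and the reciprocal of its exponential is [s - s']. *)
pose n := Num.trunc (ch ^+ 2).
have /andP[n1 n2] : (n%:R <= ch ^+ 2 < n.+1%:R) by rewrite truncn_itv.
have n0 : (0 < n)%N by rewrite /n truncn_gt0.
have nR : 1 <= n%:R :> R by rewrite ler1n.
pose s := Num.sqrt (n%:R : R); pose s' := Num.sqrt (n%:R - 1 : R).
have ss : s ^+ 2 = n%:R by rewrite sqr_sqrtr.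
have ss' : s' ^+ 2 = n%:R - 1 by rewrite sqr_sqrtr // subr_ge0.
have s0 : 0 <= s by exact: sqrtr_ge0.
have s'0 : 0 <= s' by exact: sqrtr_ge0.
have s1 : 1 <= s by rewrite -(@ler_sqr _ 1) ?nnegrE // expr1n ss.
have s's : s' <= s by rewrite -ler_sqr ?nnegrE // ss ss'; lin.
have chp : 0 <= ch by rewrite /ch; lin.
have sch : s <= ch by rewrite -ler_sqr ?nnegrE // ss.
have chs : ch <= 3 / 2 * s.
  rewrite -ler_sqr ?nnegrE //; last by lin.
  have -> : (3 / 2 * s) ^+ 2 = 9 / 4 * n%:R by rewrite -ss; field.
  by move: n2; rewrite -natr1; lin.
pose t := ln (s + s').
have et : expR t = s + s' by rewrite lnK // posrE; lin.
have e2 : 3 <= expR 2 :> R by have := @expR_ge1Dx R 2; lin.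
have tx : `|t - x| <= 2.
  rewrite ler_norml; apply/andP; split.
    rewrite lerBrDr addrC -ler_expR expRB et ler_pdivrMr ?expR_gt0 //.
    have : expR x <= 3 * s by rewrite /ch in chs; lin.
    have : 3 * s <= (s + s') * expR 2 by rewrite mulrC; apply: ler_pM => //; lin.
    lin.
  rewrite lerBlDr -ler_expR expRD et.
  have : s + s' <= 2 * expR x by rewrite /ch in sch; lin.
  have : 2 * expR x <= expR 2 * expR x by rewrite ler_pM2r //; lin.
  lin.
have t0 : 0 <= t by rewrite ln_ge0 //; lin.
pose sg : R := if 0 <= reC b then t else - t.
have sgb : `|sg - reC b| <= 2.
  rewrite /sg; move: tx; rewrite /x; case: ifP => b0; first by rewrite (ger0_norm b0).
  have bn : reC b < 0 by rewrite ltNge b0.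
  by rewrite (ltr0_norm bn) opprK -(normrN (- t - _)) opprD !opprK.
pose k := Num.floor (imC b / pi).
have pp : 0 < pi :> R by exact: pi_gt0.
have p4 : pi <= 4 :> R.
  have := @pihalf_ge1 R; have := @pi_ge2 R; have := @pihalf_lt2 R; lin.
have kb : `|k%:~R * pi - imC b| <= 4.
  have /andP[k1 k2] := floor_itv (imC b / pi).
  move: k1 k2; rewrite -/k ler_pdivlMr // ltr_pdivrMr // intrD mulrDl mul1r => k1 k2.
  by rewrite ler_norml; lin.
pose u : C := rc ((k%:~R : R) * pi).
pose b' : C := rc sg + iC * u.
exists b'; split.
  have -> : b' - b = rc (sg - reC b) + iC * rc (k%:~R * pi - imC b).
    by rewrite /b' /u {1}(reimE b) !rcB; ring.
  by apply: le_trans (nmD _ _) _; rewrite nmM nm_iC mul1r !nm_rc; lin.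
exists n; split => //.
have q2 : cexp (iC * u) ^+ 2 = 1.
  rewrite expr2 -cexpD.
  by rewrite /u double_int_pi cexp_int.
set Q := cexp (iC * u) in q2.
have Q0 : Q != 0 by exact: cexp_neq0.
have QV : Q^-1 = Q by apply: (mulfI Q0); rewrite mulfV // -expr2.
rewrite /b' cexpD -/Q invfM QV (_ : _ + _ = (cexp (rc sg) + (cexp (rc sg))^-1) * Q); last by ring.
rewrite exprMn q2 mulr1.
have er v : cexp (rc v) = rc (expR v).
  by rewrite /cexp re_rc im_rc cos0 sin0 rc0 rc1 mulr0 addr0 mulr1.
have stt : (expR t)^-1 = s - s'.
  apply: (mulIf (lt0r_neq0 (expR_gt0 t))); rewrite mulVf ?lt0r_neq0 ?expR_gt0 // et.
  by rewrite -subr_sqr ss ss' opprB addrC subrK.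
have -> : cexp (rc sg) + (cexp (rc sg))^-1 = rc (2 * s).
  rewrite er -rcV -rcD; congr rc; rewrite /sg; case: ifP => _; rewrite ?expRN ?invrK stt et; ring.
by rewrite -rcX exprMn ss rcM rcn rcX rcn; congr (_ * _); ring.
Qed.
End schottky.

(** * Schottky's theorem and its propagation along compact connected sets *)

Section schottky_control.
Context {R : realType}.
Local Notation C := (cplx R).
Implicit Types (e r rho : R) (z w a b c p : C) (f g : C -> C) (D G K S : set C).

Lemma le_one_sqr (x y : R) : 0 <= y -> x ^+ 2 <= y -> x <= 1 + y.
Proof. by move=> y0; nra. Qed.

(** Landau's chain: A = log F / (2 pi i) omits all integers, so the square roots of A and A - 1
    exist; v is their difference and B = log v satisfies 2 sqrt A = e^B + e^-B. Hence B omits the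
    points of [omitted_lattice], and [weak_bloch] bounds its derivative. *)
Lemma schottky (M : R) : exists M' : R, forall F c rho, 0 < rho -> hol_on (disc c rho) F ->
  (forall z, disc c rho z -> F z != 0 /\ F z != 1) -> `|ln (nm (F c))| <= M ->
  forall z, disc c (rho / 2) z -> `|ln (nm (F z))| <= M'.
Proof.
(* [T] bounds both moduli of the square roots together at the centre, where |A| is at most [M + 4],
   hence also |log|v||. [beta] bounds |B z|: [T], plus 4 for the angle, plus the increment [42 * 32]
   from Bloch. The factor 8 bounds 2 pi in the way back from A to log F. *)
pose T : R := 3 + 2 * (M + 4); pose beta : R := T + 4 + 42 * 32.
exists (8 * expR beta ^+ 2) => F c rho rho0 hF om FM z Dz.
have p4 : pi <= 4 :> R by have := @pihalf_lt2 R; lin.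
have p2 : 2 <= pi :> R by exact: pi_ge2.
have Dc := disc_center c rho0.
have F0 x : disc c rho x -> F x != 0 by move=> /om[].
have M0 : 0 <= M by exact: le_trans FM.
have [l0 [el0 rl0 il0]] := cexp_surj (F0 c Dc).
have [L [hL eL Lc]] := hol_log hF rho0 F0 el0.
have nl0 : nm l0 <= M + 4 by have := nm_le_reim l0; rewrite rl0; lin.
have ntpi : nm tpi = pi *+ 2 :> R.
  by rewrite /tpi nmM nm_iC mul1r nm_rc ger0_norm // mulrn_wge0 //; lin.
pose A x := L x / tpi.
have hA : hol_on (disc c rho) A.
  by move=> x Dx; have [d hd] := hL x Dx; eexists; exact: dC_mul hd (dC_cst _ x).
have nA x (n : nat) : disc c rho x -> A x != n%:R.
  move=> Dx; apply/eqP => E; have [_ /eqP] := om x Dx; apply.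
  rewrite -eL // (_ : L x = tpi * n%:R); first exact: (cexp_int n).
  by rewrite -E /A mulrC divfK // tpi_neq0.
have Ac : nm (A c) <= M + 4.
  have tp : 0 < pi *+ 2 :> R by rewrite mulr2n; lin.
  rewrite /A nmM nmV ntpi Lc ler_pdivrMr //.
  apply: le_trans nl0 _; rewrite ler_peMr ?mulr2n; lin.
have [s0 hs0 s0A] := hol_sqrt hA rho0 (fun x Dx => nA x 0%N Dx).
have hA1 : hol_on (disc c rho) (fun x => A x - 1).
  by move=> x /hA[d hd]; eexists; exact: dC_sub hd (dC_cst _ x).
have [|s1 hs1 s1A] := hol_sqrt hA1 rho0 _.
  by move=> x Dx; rewrite subr_eq0 (nA x 1%N).
pose v x := s0 x - s1 x.
have vv x : disc c rho x -> v x * (s0 x + s1 x) = 1.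
  by move=> Dx; rewrite /v -subr_sqr s0A // s1A // opprB addrC subrK.
have v0 x : disc c rho x -> v x != 0.
  move=> /vv h; apply/eqP => v0; move: h; rewrite v0 mul0r => /eqP.
  by rewrite eq_sym oner_eq0.
have vi x : disc c rho x -> (v x)^-1 = s0 x + s1 x.
  by move=> Dx; apply: (mulfI (v0 x Dx)); rewrite vv // mulfV // v0.
have hv : hol_on (disc c rho) v.
  by move=> x Dx; have [d hd] := hs0 x Dx; have [d' hd'] := hs1 x Dx; eexists; exact: dC_sub hd hd'.
have [l1 [el1 rl1 il1]] := cexp_surj (v0 c Dc).
have [B [hB eB Bc]] := hol_log hv rho0 v0 el1.
have s0B x : disc c rho x -> 2 * s0 x = cexp (B x) + (cexp (B x))^-1.
  by move=> Dx; rewrite eB // vi // /v; ring.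
have omB b : exists2 b', nm (b' - b) <= 7 & forall x, disc c rho x -> B x != b'.
  have [b' [bb [n [n0 hn]]]] := omitted_lattice b; exists b' => // x Dx.
  apply/eqP => E; move: hn; rewrite -E -s0B // exprMn s0A //.
  rewrite (_ : 2 ^+ 2 = 4 :> C); last by ring.
  by move/(mulfI (_ : 4 != 0 :> C)); rewrite pnatr_eq0 => /(_ isT)/eqP; apply/negP; exact: nA.
have dB x : disc c (rho / 2) x -> nm (dv B x) <= 42 * 32 / (rho / 2).
  move=> Dx; have r20 : 0 < rho / 2 by lin.
  have sub : disc x (rho / 2) `<=` disc c rho.
    by move=> w; move: Dx; rewrite /disc /=; have := nmD3 x w c; lin.
  rewrite ler_pdivlMr //; apply: weak_bloch r20 (hol_sub sub hB) _ => b.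
  by have [b' bb hb] := omB b; exists b' => // w /sub; exact: hb.
have r20 : 0 < rho / 2 by lin.
have Dc2 := disc_center c r20.
have sub2 : disc c (rho / 2) `<=` disc c rho by move=> w; rewrite /disc /=; lin.
have Bz : nm (B z - B c) <= 42 * 32.
  have I1 := @seg_FTC R B (dv B) c z (fun t t01 => dvP (hB _ (sub2 _ (cvx_disc Dc2 Dz t01)))).
  apply: (is_int_bound I1) => t t01; rewrite nmM.
  rewrite (_ : 42 * 32 = 42 * 32 / (rho / 2) * (rho / 2)); last by rewrite divfK // lt0r_neq0.
  apply: ler_pM; rewrite ?nm_ge0 //; [exact: dB (cvx_disc Dc2 Dz t01)|exact: ltW Dz].
have T0 : 3 <= T by rewrite /T; lin.
have nA0 := nm_ge0 (A c).
have sc0 : nm (s0 c) <= 1 + nm (A c) by apply: le_one_sqr => //; rewrite -nmX s0A.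
have sc1 : nm (s1 c) <= 1 + (nm (A c) + 1).
  apply: le_one_sqr; first by lin.
  by rewrite -nmX s1A //; have := nmB (A c) 1; rewrite nm1.
have lnT x : x != 0 :> C -> nm x <= T -> ln (nm x) <= T.
  move=> x0 xT; rewrite -(expRK T) ler_ln ?posrE ?expR_gt0 ?nm_gt0 //.
  by apply: le_trans xT _; have := @expR_ge1Dx R T; lin.
have lv : `|ln (nm (v c))| <= T.
  rewrite ler_norml; apply/andP; split.
    rewrite lerNl -lnV ?posrE ?nm_gt0 ?v0 // -nmV; apply: lnT; first by rewrite invr_eq0 v0.
    by rewrite vi //; have := nmD (s0 c) (s1 c); rewrite /T; lin.
  by apply: lnT; rewrite ?v0 // /v; have := nmB (s0 c) (s1 c); rewrite /T; lin.
have nl1 : nm l1 <= T + 4 by have := nm_le_reim l1; rewrite rl1; lin.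
have nB : nm (B z) <= beta.
  by have := nmB_ge (B z) (B c); rewrite Bc /beta in Bz *; lin.
have Dz' := sub2 _ Dz.
have reB := re_le_nm (B z).
have b1 : reC (B z) <= beta by have := ler_norm (reC (B z)); lin.
have b2 : - reC (B z) <= beta by have := ler_norm (- reC (B z)); rewrite normrN; lin.
have ns0 : nm (s0 z) <= expR beta.
  have : nm (2 * s0 z) <= expR beta + expR beta.
    rewrite s0B //; apply: le_trans (nmD _ _) _; rewrite nmV nm_cexp -expRN.
    by apply: lerD; rewrite ler_expR.
  by rewrite nmM nm_nat; lin.
have nAz : nm (A z) <= expR beta ^+ 2.
  by rewrite -s0A // nmX lerXn2r ?nnegrE ?nm_ge0 ?expR_ge0.
have nL : nm (L z) <= 8 * expR beta ^+ 2.
  have -> : L z = tpi * A z by rewrite /A mulrC divfK // tpi_neq0.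
  rewrite nmM ntpi mulr2n; apply: (@le_trans _ _ (8 * nm (A z))); last by rewrite ler_wpM2l.
  by rewrite ler_wpM2r ?nm_ge0 //; lin.
by rewrite -eL // nm_cexp expRK; apply: le_trans (re_le_nm _) nL.
Qed.

(** A Harnack chain: local comparisons, uniform in the member of the family, are composed along [K].
    Both directions relative to a base point [a0] are propagated, so that any two points are
    compared through [a0]. *)
Lemma chain_control (I : Type) (P : I -> Prop) (q : I -> C -> R) K : compact K -> connected K ->
  (forall z, K z -> exists2 r, 0 < r & forall M : R, exists M' : R, forall i, P i -> forall a b,
     K a -> K b -> disc z r a -> disc z r b -> q i a <= M -> q i b <= M') ->
  forall M : R, exists M' : R, forall i, P i -> forall a b, K a -> K b -> q i a <= M -> q i b <= M'.
Proof.
move=> cK conK loc M.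
case: (pselect (exists a0, K a0)) => [[a0 Ka0]|nK]; last first.
  by exists 0 => i _ a b Ka; case: nK; exists a.
pose S b := exists2 r, 0 < r & forall M : R, exists M' : R, forall i, P i -> forall b', K b' -> disc b r b' ->
  (q i a0 <= M -> q i b' <= M') /\ (q i b' <= M -> q i a0 <= M').
have SK : forall b, K b -> S b.
  apply: (connected_ind conK).
  - exists a0 => //; have [r r0 h] := loc a0 Ka0; exists r => // M1; have [M' hM] := h M1; exists M' => i Pi b Kb Db.
    by split; apply: hM => //; exact: disc_center.
  - move=> b Kb [r r0 h]; exists (r / 2); first by lin.
    move=> w Kw wb; exists (r / 2) => [|M1]; first by lin.
    have [M' hM] := h M1; exists M' => i Pi b' Kb' b'w; apply: hM => //.
    by move: wb b'w; rewrite /disc /=; have := nmD3 w b' b; lin.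
  - move=> b Kb lim; have [r r0 h] := loc b Kb; have [w [Kw wb [s s0 hs]]] := lim r r0.
    exists r => // M1; have [M2 h2] := hs M1; have [M3 h3] := h M2; have [M4 h4] := h M1; have [M5 h5] := hs M4.
    exists (Num.max M3 M5) => i Pi b' Kb' Db'; have ws := disc_center w s0; rewrite !le_max.
    have [k1 _] := h2 i Pi w Kw ws; have [_ k5] := h5 i Pi w Kw ws.
    split=> k; [rewrite (h3 i Pi w b') //|rewrite [X in _ || X](_ : _ = true) ?orbT //].
      exact: k1.
    by apply: k5; apply: (h4 i Pi b' w).
(* The constants obtained so far depend on the point; compactness makes them uniform, with the
   filter at plus infinity as the direction of weakening. *)
have unif (M1 : R) : exists M' : R, forall b, K b -> forall i, P i -> (q i a0 <= M1 -> q i b <= M') /\ (q i b <= M1 -> q i a0 <= M').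
  have : \forall M' \near +oo, K `<=` (fun b => K b -> forall i, P i -> (q i a0 <= M1 -> q i b <= M') /\ (q i b <= M1 -> q i a0 <= M')).
    move/compact_near_coveringP: cK; apply => z Kz.
    have [r r0 h] := SK z Kz; have [M' hM] := h M1.
    exists (disc z r, [set x | M' < x]).
      by split; [apply/nbhsCP; exists r|exact: nbhs_pinfty_gt (num_real _)].
    move=> [b x] /= [Db Mx] Kb i Pi; have [k1 k2] := hM i Pi b Kb Db.
    by split=> /[dup] => [/k1 k _|/k2 k _]; apply: le_trans k (ltW _).
  by move=> /filter_ex[M' h]; exists M' => b Kb; exact: h.
have [M1 h1] := unif M; have [M2 h2] := unif M1.
exists M2 => i Pi a b Ka Kb qa.
by apply: (h2 b Kb i Pi).1; apply: (h1 a Ka i Pi).2.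
Qed.

Lemma schottky_control G K : open G -> compact K -> connected K -> K `<=` G -> forall M : R, exists M' : R,
  forall F, hol_on G F -> (forall z, G z -> F z != 0 /\ F z != 1) -> forall a b, K a -> K b ->
  `|ln (nm (F a))| <= M -> `|ln (nm (F b))| <= M'.
Proof.
move=> oG cK conK KG M.
have [|M' h] := @chain_control (C -> C) (fun F => hol_on G F /\ forall z, G z -> F z != 0 /\ F z != 1)
  (fun F z => `|ln (nm (F z))|) K cK conK _ M; last first.
  by exists M' => F hF om; exact: h.
move=> z Kz; have [r r0 hr] := (openCP G).1 oG z (KG z Kz).
exists (r / 8) => [|M1]; first by lin.
have [M2 h2] := schottky M1; exists M2 => F [hF om] a b _ _ Da Db.
have r20 : 0 < r / 2 by lin.
have sub : disc a (r / 2) `<=` G.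
  by move=> w wa; apply: hr; move: wa Da; rewrite /disc /=; have := nmD3 a w z; lin.
move=> Fa; apply: (h2 F a (r / 2) r20 (hol_sub sub hF)) => //; first by move=> w /sub; exact: om.
by move: Da Db; rewrite /disc /=; have := nmD3 z b a; rewrite (nmBC z a); lin.
Qed.
End schottky_control.

(** * Paths, components, continuous logarithms and unicoherence of the plane *)

Section plane_topology.
Context {R : realType}.
Local Notation C := (cplx R).
Implicit Types (e r rho : R) (z w a b c p : C) (f g : C -> C) (D G K S O P : set C).

Lemma pif_true (T : Type) (Q : Prop) (x y : T) : Q -> (if pselect Q then x else y) = x.
Proof. by case: pselect. Qed.
Lemma pif_false (T : Type) (Q : Prop) (x y : T) : ~ Q -> (if pselect Q then x else y) = y.
Proof. by case: pselect. Qed.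

Lemma rc_continuous : continuous (rc : R -> C).
Proof.
move=> t B /nbhsCP[e e0 eB]; apply/nbhs_ballP; exists e => // s.
by rewrite /ball /= => ts; apply: eB; rewrite -rcB nm_rc distrC.
Qed.
Lemma clamp_continuous : continuous (clamp : R -> R).
Proof.
move=> t B /nbhs_ballP[e /= e0 eB]; apply/nbhs_ballP; exists e => // s.
by rewrite /ball /= => ts; apply: eB; rewrite /ball /=; apply: le_lt_trans ts; exact: clamp_lip.
Qed.
Lemma clamp0 : clamp (0:R) = 0. Proof. by rewrite clampE // lexx ler01. Qed.
Lemma clamp1 : clamp (1:R) = 1. Proof. by rewrite clampE // lexx ler01. Qed.
Lemma clamp_idem (t : R) : clamp (clamp t) = clamp t.
Proof. by rewrite clampE // clamp_ge0 clamp_le1. Qed.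

Definition path_in G a b := exists p : R -> C,
  [/\ continuous p, p 0 = a, p 1 = b & forall t, 0 <= t <= 1 -> G (p t)].

Lemma path_in_refl G a : G a -> path_in G a a.
Proof. by move=> Ga; exists (fun=> a); split => // t; exact: cvg_cst. Qed.

Lemma path_in_snoc G a b c : path_in G a b -> (forall t : R, 0 <= t <= 1 -> G (b + rc t * (c - b))) -> path_in G a c.
Proof.
move=> [p [cp p0 p1 h]] hs.
exists (fun t => p (clamp (2 * t)) + rc (clamp (2 * t - 1)) * (c - b)).
have e1 : clamp (2 * 0 - 1) = 0 :> R by rewrite /clamp mulr0 sub0r min_l ?max_l; lin.
have e2 : clamp (2 * 1) = 1 :> R by rewrite /clamp mulr1 min_r ?max_r; lin.
split.
- have c2 : continuous (fun t : R => 2 * t) by move=> t; apply: cvgM; [exact: cvg_cst|exact: cvg_id].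
  have c3 : continuous (fun t : R => 2 * t - 1) by move=> t; apply: cvgB; [exact: c2|exact: cvg_cst].
  move=> t; apply: cvgD.
    apply: (@continuous_comp _ _ _ (fun t : R => clamp (2 * t)) p); last exact: cp.
    by apply: (@continuous_comp _ _ _ (fun t : R => 2 * t) clamp); [exact: c2|exact: clamp_continuous].
  apply: cvgM; last exact: cvg_cst.
  apply: (@continuous_comp _ _ _ (fun t : R => clamp (2 * t - 1)) rc); last exact: rc_continuous.
  by apply: (@continuous_comp _ _ _ (fun t : R => 2 * t - 1) clamp); [exact: c3|exact: clamp_continuous].
- by rewrite e1 mulr0 clamp0 rc0 mul0r addr0.
- rewrite e2 mulr1 (_ : 2 - 1 = 1 :> R); last by lin.
  by rewrite clamp1 rc1 mul1r p1 addrC subrK.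
- move=> t t01; have [t2|t2] := lerP t (2^-1).
    rewrite [X in rc X](_ : _ = 0); last by rewrite /clamp min_l ?max_l; lin.
    by rewrite rc0 mul0r addr0; apply: h; rewrite clamp_ge0 clamp_le1.
  rewrite [X in p X](_ : _ = 1); last by rewrite /clamp min_r ?max_r; lin.
  by rewrite p1; apply: hs; rewrite clamp_ge0 clamp_le1.
Qed.

Lemma open_connected_path G a b : open G -> connected G -> G a -> G b -> path_in G a b.
Proof.
move=> oG cG Ga; apply: (connected_ind cG (P := path_in G a)).
- by exists a => //; exact: path_in_refl.
- move=> z Gz Pz; have [r r0 hr] := (openCP G).1 oG z Gz; exists r => // w Gw Dw.
  apply: path_in_snoc Pz _ => t t01; apply: hr; exact: cvx_disc (disc_center z r0) Dw t01.
- move=> z Gz h; have [r r0 hr] := (openCP G).1 oG z Gz; have [w [Gw Dw Pw]] := h r r0.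
  apply: path_in_snoc Pw _ => t t01; apply: hr; exact: cvx_disc Dw (disc_center z r0) t01.
Qed.

Lemma path_image_compact (p : R -> C) : continuous p -> compact (p @` `[0, 1]).
Proof. by move=> cp; apply: continuous_compact; [exact: continuous_subspaceT|exact: segment_compact]. Qed.
Lemma path_image_connected (p : R -> C) : continuous p -> connected (p @` `[0, 1]).
Proof.
by move=> cp; apply: connected_continuous_connected; [exact: segment_connected|exact: continuous_subspaceT].
Qed.

Definition linked G a b := exists K, [/\ compact K, connected K, K `<=` G, K a & K b].
Lemma path_linked G a b : path_in G a b -> linked G a b.
Proof.
move=> [p [cp p0 p1 h]]; exists (p @` `[0, 1]); split.
- exact: path_image_compact.
- exact: path_image_connected.
- by move=> _ [t /= t01 <-]; apply: h; move: t01; rewrite in_itv.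
- by exists 0 => //; rewrite /= in_itv /= lexx ler01.
- by exists 1 => //; rewrite /= in_itv /= lexx ler01.
Qed.

(** If [Q K] failed, the sets [B] with [Q (K \ B)] would form a proper filter containing [K], and a
    cluster point in [K] contradicts the local hypothesis. This replaces explicit finite
    subcovers. *)
Lemma compact_induction K (Q : set C -> Prop) : compact K -> Q set0 ->
  (forall A B, Q A -> Q B -> Q (A `|` B)) -> (forall A B, A `<=` B -> Q B -> Q A) ->
  (forall z, K z -> exists2 r, 0 < r & Q (disc z r)) -> Q K.
Proof.
move=> cK Q0 QU Qs Ql; apply: contrapT => nQ.
pose F : set_system C := [set B | Q (K `\` B)].
have FF : Filter F.
  split; rewrite /F /=; first by rewrite setDT.
  - by move=> A B /= QA QB; rewrite /= setDIr; exact: QU.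
  - by move=> A B AB; apply: Qs; exact: setDS.
have PF : ProperFilter F by split => //; rewrite /F /= setD0.
have FK : F K by rewrite /F /= setDv.
have [p [Kp cp]] := cK F PF FK.
have [r r0 hr] := Ql p Kp.
have [||w [nw Dw]] := cp (~` disc p r) (disc p r).
- by rewrite /F /=; apply: Qs hr => x [_]; exact: contrapT.
- by apply/nbhsCP; exists r.
- exact: nw.
Qed.

Lemma convex_connected S : cvx S -> connected S.
Proof.
move=> vS; case: (pselect (exists a, S a)) => [[a Sa]|nS]; last first.
  by rewrite (_ : S = set0); [exact: connected0|apply/seteqP; split => // z Sz; case: nS; exists z].
have -> : S = \bigcup_(x in S) ((fun t : R => a + rc t * (x - a)) @` `[0, 1]).
  apply/seteqP; split=> [x Sx|x [y Sy [t t01 <-]]].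
    exists x => //; exists 1; first by rewrite /= in_itv /= lexx ler01.
    by rewrite rc1 mul1r addrC subrK.
  by apply: vS => //; move: t01; rewrite /= in_itv.
apply: bigcup_connected.
  by exists a => x _; exists 0; rewrite ?rc0 ?mul0r ?addr0 //= in_itv /= lexx ler01.
move=> x _; apply: path_image_connected => t; apply: cvgD; first exact: cvg_cst.
by apply: cvgM; [exact: rc_continuous|exact: cvg_cst].
Qed.

Lemma connectedUU (A B : set C) c : A c -> B c -> connected A -> connected B -> connected (A `|` B).
Proof. by move=> Ac Bc; apply: connectedU; exists c. Qed.

Lemma compact_connected_hull G K a : open G -> connected G -> G a -> compact K -> K `<=` G ->
  exists K', [/\ compact K', connected K', K `<=` K', K' `<=` G & K' a].
Proof.
move=> oG cG Ga cK KG.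
have [||||K' [h1 h2 h3 h4 h5]] := @compact_induction K (fun A => exists K', [/\ compact K', connected K', A `<=` K', K' `<=` G & K' a]) cK.
- exists [set a]; split => //; [exact: compact_set1|exact: connected1|by move=> _ ->].
- move=> A B [K1 [c1 d1 A1 G1 a1]] [K2 [c2 d2 A2 G2 a2]]; exists (K1 `|` K2); split.
  + exact: compactU.
  + exact: connectedUU a1 a2 d1 d2.
  + by move=> z [/A1|/A2]; [left|right].
  + by move=> z [/G1|/G2].
  + by left.
- by move=> A B AB [K1 [c1 d1 A1 G1 a1]]; exists K1; split => // z /AB/A1.
- move=> z Kz; have [r r0 hr] := (openCP G).1 oG z (KG z Kz).
  exists (r / 2); first by lin.
  have [L [cL dL LG La Lz]] := path_linked (open_connected_path oG cG Ga (KG z Kz)).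
  exists (L `|` cdisc z (r / 2)); split.
  + by apply: compactU => //; exact: cdisc_compact.
  + apply: (@connectedUU _ _ z) => //; last exact: convex_connected (@cvx_cdisc _ z (r / 2)).
    by rewrite /cdisc /= subrr nm0; lin.
  + by move=> w; rewrite /disc /= => wr; right; rewrite /cdisc /=; lin.
  + by move=> w [/LG//|]; rewrite /cdisc /= => wr; apply: hr; rewrite /disc /=; lin.
  + by left.
- by exists K'.
Qed.

Definition comp G z := connected_component G z.

Lemma comp_conn G z : connected (comp G z). Proof. exact: component_connected. Qed.
Lemma comp_sub G z : comp G z `<=` G. Proof. exact: connected_component_sub. Qed.
Lemma comp_refl G z : G z -> comp G z z. Proof. exact: connected_component_refl. Qed.
Lemma comp_max G S z : S z -> S `<=` G -> connected S -> S `<=` comp G z.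
Proof. exact: connected_component_max. Qed.
Lemma comp_eq G z w : comp G z w -> comp G z = comp G w.
Proof. exact: same_connected_component. Qed.
Lemma comp_meet G S z w : connected S -> S `<=` G -> S w -> comp G z w -> S `<=` comp G z.
Proof. by move=> cS SG Sw /comp_eq ->; exact: comp_max. Qed.

Lemma comp_open G z : open G -> open (comp G z).
Proof.
move=> oG; apply/openCP => w cw; have [r r0 hr] := (openCP G).1 oG w (comp_sub cw).
exists r => //; apply: (comp_meet _ hr (disc_center w r0) cw).
exact: convex_connected (@cvx_disc _ w r).
Qed.

Lemma comp_closure G z w : open G -> closure (comp G z) w -> G w -> comp G z w.
Proof.
move=> oG /closureCP cl Gw; have [r r0 hr] := (openCP G).1 oG w Gw.
have [v cv vw] := cl r r0.
apply: (comp_meet _ hr _ cv) => //; last exact: disc_center.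
exact: convex_connected (@cvx_disc _ w r).
Qed.

(** The exterior of a disc is the image of a half plane under the exponential. *)
Lemma exterior_connected (M : R) : 0 < M -> connected [set z : C | M < nm z].
Proof.
move=> M0; have -> : [set z : C | M < nm z] = cexp @` [set w : C | ln M < reC w].
  apply/seteqP; split=> [z /= Mz|_ [w /= hw <-]].
    have z0 : z != 0 by rewrite -nm_gt0; lin.
    by have [l [el rl _]] := cexp_surj z0; exists l => //=; rewrite rl ltr_ln ?posrE //; lin.
  by rewrite nm_cexp -[M]lnK ?posrE // ltr_expR.
apply: cont_connected; last by apply: hol_cont => w _; exists (cexp w); exact: dC_cexp.
apply: convex_connected => a b t /= ha hb /andP[t0 t1].
rewrite reD reM re_rc im_rc mul0r subr0 reB.
have [->|tn] := eqVneq t 0; first by rewrite mul0r addr0.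
have : t * ln M < t * reC b by rewrite ltr_pM2l // lt_def tn.
have : (1 - t) * ln M <= (1 - t) * reC a by rewrite ler_wpM2l ?subr_ge0 // ltW.
lin.
Qed.

Lemma unbounded_comp_eq K a b : bdd K -> ~ bdd (comp (~` K) a) -> ~ bdd (comp (~` K) b) ->
  comp (~` K) a = comp (~` K) b.
Proof.
move=> [M M0 hM] na nb.
have sub : [set z | M < nm z] `<=` ~` K by move=> z /= Mz Kz; have := hM z Kz; lin.
have far c : ~ bdd (comp (~` K) c) -> exists2 z, M < nm z & comp (~` K) c z.
  move=> nc; apply: contrapT => h; apply: nc; exists M => // z cz; rewrite leNgt; apply/negP => Mz.
  by apply: h; exists z.
have [z za cz] := far a na; have [w wb cw] := far b nb.
have h := comp_meet (exterior_connected M0) sub za cz.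
by rewrite (comp_eq (h w wb)) -(comp_eq cw).
Qed.

(** The frontier of a component of the complement lies in [K]; were the component bounded, the
    maximum principle would carry the bound [s] to [a]. *)
Lemma mod_gt_unbounded K f a (s : R) : compact K -> hol_on setT f -> (forall z, K z -> nm (f z) <= s) ->
  s < nm (f a) -> ~ bdd (comp (~` K) a).
Proof.
move=> cK hf hs sa [M M0 hM].
have oK : open (~` K) by rewrite openC; exact: compact_closedC.
have Ka : (~` K) a by move=> /hs; lin.
have : nm (f a) <= s; last by lin.
apply: (max_modulus (comp_open (z := a) oK) hM _ (hol_sub (fun _ _ => I) hf)); last exact: comp_refl.
  exact: cont_on_sub (hol_cont hf).
move=> z cz nz; apply: hs; apply: contrapT => Kz; apply: nz.
exact: comp_closure.
Qed.

Lemma cexp_eq1_small : exists2 d : R, 0 < d & forall h : C, nm h < d -> cexp h = 1 -> h = 0.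
Proof.
have [r r0 hr] := @dC_cexp0 R (1 / 2) ltac:(lin).
exists r => // h hh e1; have := hr h hh; rewrite add0r e1 cexp0 subrr sub0r nmN mul1r => k.
by apply: nm0_eq; have := nm_ge0 h; lin.
Qed.

Lemma cexp1_const K f : connected K -> cont_on K f -> (forall z, K z -> cexp (f z) = 1) ->
  forall a b, K a -> K b -> f a = f b.
Proof.
move=> cK cf e1 a b Ka Kb; have [d d0 hd] := cexp_eq1_small.
have loc z w : K z -> K w -> nm (f w - f z) < d -> f w = f z.
  move=> Kz Kw h; apply/eqP; rewrite -subr_eq0; apply/eqP; apply: hd => //.
  by rewrite cexpB !e1 // divr1.
suff H : forall z, K z -> f z = f a by rewrite (H b Kb).
apply: (connected_ind cK); first by exists a.
  move=> z Kz fz; have [r r0 hr] := cf z Kz d d0; exists r => // w Kw wz.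
  by rewrite -fz; apply: loc => //; exact: hr.
move=> z Kz h; have [r r0 hr] := cf z Kz d d0; have [w [Kw wz fw]] := h r r0.
by rewrite -fw; apply/esym/loc => //; exact: hr.
Qed.

Lemma log_near1 : exists L : C -> C, [/\ hol_on (disc 1 1) L & forall z, disc 1 1 z -> cexp (L z) = z].
Proof.
have [||z||L [h1 h2 _]] := @hol_log R id 1 1 0.
- by move=> z _; exists 1; exact: dC_id.
- exact: ltr01.
- by rewrite /disc /= => h; apply/eqP => z0; move: h; rewrite z0 sub0r nmN nm1 ltxx.
- exact: cexp0.
- by exists L.
Qed.

(** The disc is contracted to its centre in [n] steps, through the maps z -> f((k / n) z). By
    uniform continuity consecutive ones have a ratio in the disc of radius 1 about 1, where a
    logarithm exists, and the logarithms are summed. *)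
Lemma log_lift (M : R) f : 0 < M -> cont_on (cdisc 0 M) f -> (forall z, cdisc 0 M z -> f z != 0) ->
  exists2 l, cont_on (cdisc 0 M) l & forall z, cdisc 0 M z -> cexp (l z) = f z.
Proof.
move=> M0 cf f0; set K := cdisc 0 M; have cK : compact K by exact: cdisc_compact.
have [m m0 hm] := compact_nm_min cK cf f0.
have [d d0 hd] := compact_ucont cK cf m0.
have [L [hL eL]] := log_near1.
pose n := (Num.trunc (M / d)).+1.
have n0 : 0 < n%:R :> R by rewrite ltr0n.
have nd : M / n%:R < d.
  have := @truncnS_gt _ (M / d); rewrite -/n ltr_pdivrMr // => h.
  by rewrite ltr_pdivrMr // mulrC.
have Kt (t : R) z : 0 <= t <= 1 -> K z -> K (rc t * z).
  move=> /andP[t0 t1]; rewrite /K /cdisc /= !subr0 nmM nm_rc ger0_norm // => zM.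
  by apply: le_trans zM; rewrite ler_piMl // nm_ge0.
have [|l0 [el0 _ _]] := cexp_surj (f0 0 _); first by rewrite /cdisc /= subrr nm0 ltW.
have H : forall k, (k <= n)%N -> exists2 l, cont_on K l & forall z, K z -> cexp (l z) = f (rc (k%:R / n%:R) * z).
  elim=> [_|k IH kn].
    by exists (fun=> l0) => [|z _]; [exact: cont_on_cst|rewrite mul0r rc0 mul0r].
  have [l cl el] := IH (ltnW kn).
  have t01 j : (j <= n)%N -> 0 <= (j%:R / n%:R : R) <= 1.
    by move=> jn; rewrite divr_ge0 //= ler_pdivrMr // mul1r ler_nat.
  have cfk j : (j <= n)%N -> cont_on K (fun z => f (rc (j%:R / n%:R) * z)).
    move=> jn; apply: (cont_on_comp cf) => [|z]; last by apply: Kt; exact: t01.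
    by apply: cont_on_mul; [exact: cont_on_cst|exact: cont_on_id].
  pose q z := f (rc (k.+1%:R / n%:R) * z) / f (rc (k%:R / n%:R) * z).
  have nz j z : (j <= n)%N -> K z -> f (rc (j%:R / n%:R) * z) != 0.
    by move=> jn Kz; apply: f0; apply: Kt => //; exact: t01.
  have qD z : K z -> disc 1 1 (q z).
    move=> Kz; have kn' := ltnW kn; rewrite /disc /=.
    have -> : q z - 1 = (f (rc (k.+1%:R / n%:R) * z) - f (rc (k%:R / n%:R) * z)) / f (rc (k%:R / n%:R) * z).
      by rewrite /q; field; exact: nz.
    rewrite nmM nmV ltr_pdivrMr ?nm_gt0 ?nz // mul1r.
    apply: lt_le_trans (hm _ (Kt _ _ (t01 _ kn') Kz)); apply: hd; try by apply: Kt => //; exact: t01.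
    rewrite -mulrBl -rcB nmM nm_rc -mulrBl -natrB // subSnn.
    rewrite ger0_norm ?divr_ge0 // mul1r mulrC; apply: le_lt_trans nd.
    by rewrite ler_wpM2r ?invr_ge0 //; move: Kz; rewrite /K /cdisc /= subr0.
  exists (fun z => l z + L (q z)).
    apply: cont_on_add => //; apply: (cont_on_comp (hol_cont hL)) => //.
    by apply: cont_on_mul; [exact: cfk|apply: cont_on_inv; [apply: cfk; exact: ltnW|move=> z; apply: nz; exact: ltnW]].
  by move=> z Kz; rewrite cexpD (el z Kz) (eL _ (qD z Kz)) /q mulrC divfK //; apply: nz => //; exact: ltnW.
have [l cl el] := H n (leqnn n); exists l => // z Kz.
by rewrite el // divff ?gt_eqF // rc1 mul1r.
Qed.

Definition cdist (F : set C) z : R := inf [set nm (z - w) | w in F].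
Lemma cdist_has_inf F z : F !=set0 -> has_inf [set nm (z - w) | w in F].
Proof.
by move=> [w Fw]; split; [exists (nm (z - w)), w|exists 0 => _ [v _ <-]; exact: nm_ge0].
Qed.
Lemma cdist_ge0 F z : F !=set0 -> 0 <= cdist F z.
Proof.
by move=> F0; apply: lb_le_inf; [case: F0 => w Fw; exists (nm (z - w)), w|move=> _ [v _ <-]; exact: nm_ge0].
Qed.
Lemma cdist_le F z w : F w -> cdist F z <= nm (z - w).
Proof. by move=> Fw; apply: inf_lbound; [exact: (cdist_has_inf z (ex_intro _ w Fw)).2|exists w]. Qed.
Lemma cdist0 F z : F z -> cdist F z = 0.
Proof.
move=> Fz; apply/eqP; rewrite eq_le cdist_ge0 ?andbT; last by exists z.
by have := cdist_le z Fz; rewrite subrr nm0.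
Qed.
Lemma cdist_gt0 F z : F !=set0 -> closed F -> ~ F z -> 0 < cdist F z.
Proof.
move=> F0 clF nF; have [r r0 hr] := (openCP _).1 (closed_openC clF) z nF.
apply: lt_le_trans r0 _; apply: lb_le_inf; first by case: F0 => w Fw; exists (nm (z - w)), w.
move=> _ [v Fv <-]; rewrite leNgt; apply/negP => vz; apply: (hr v) => //.
by rewrite /disc /= nmBC.
Qed.
Lemma cdist_lip F z w : F !=set0 -> cdist F z <= cdist F w + nm (z - w).
Proof.
move=> F0; rewrite -lerBlDr; apply: lb_le_inf; first by case: F0 => v Fv; exists (nm (w - v)), v.
by move=> _ [v Fv <-]; have := cdist_le z Fv; have := nmD3 w z v; lin.
Qed.
Lemma cdist_cont F S : F !=set0 -> cont_on S (fun z => rc (cdist F z)).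
Proof.
move=> F0 z _ e e0; exists e => // w _ wz; rewrite -rcB nm_rc ltr_norml.
by have := cdist_lip z w F0; have := cdist_lip w z F0; rewrite (nmBC z w); lin.
Qed.

Lemma open_disconnected G : open G -> ~ connected G ->
  exists A B, [/\ open A, open B, A !=set0, B !=set0 & A `&` B = set0 /\ G = A `|` B].
Proof.
move=> oG /connectedPn[E [E0 GE [s1 s2]]].
exists (E false), (E true).
have d x : E false x -> E true x -> False.
  by move=> h1 h2; have : (E false `&` closure (E true)) x by [split => //; exact: subset_closure]; rewrite s2.
have Eo (b : bool) : open (E b).
  have -> : E b = G `&` ~` closure (E (~~ b)); last by apply: openI => //; exact: closed_openC (@closed_closure _ _).
  apply/seteqP; split=> [x Ex|x [Gx nx]].
    split; first by rewrite GE; case: b Ex; [right|left].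
    case: b Ex => /= Ex cx.
      by have : (closure (E false) `&` E true) x by []; rewrite s1.
    by have : (E false `&` closure (E true)) x by []; rewrite s2.
  move: Gx; rewrite GE; case: b nx => /= nx [] // Ex; exfalso; apply: nx; exact: subset_closure.
split => //; split => //; apply/seteqP; split => // x []; exact: d.
Qed.

(* If O and P overlapped in two pieces, a function gluing 0 and 2 pi i would give a
   nonvanishing map of the plane without a logarithm. *)
Lemma plane_unicoherent O P : open O -> open P -> connected O -> connected P ->
  (forall z, O z \/ P z) -> connected (O `&` P).
Proof.
move=> oO oP cO cP OP; apply: contrapT => nc.
have [A [B [oA oB [a Aa] [b Bb] [AB OPE]]]] := open_disconnected (openI oO oP) nc.
have [Oa Pa] : (O `&` P) a by rewrite OPE; left.
have [Ob Pb] : (O `&` P) b by rewrite OPE; right.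
have Ab : ~ A b by move=> Ab; have : (A `&` B) b by []; rewrite AB.
case: (pselect (~` O !=set0)) => [hO|nO]; last first.
  apply: nc; rewrite (_ : O `&` P = P) //; apply/seteqP; split=> [z []//|z Pz]; split => //.
  by apply: contrapT => h; apply: nO; exists z.
case: (pselect (~` P !=set0)) => [hP|nP]; last first.
  apply: nc; rewrite (_ : O `&` P = O) //; apply/seteqP; split=> [z []//|z Oz]; split => //.
  by apply: contrapT => h; apply: nP; exists z.
have clO : closed (~` O) by rewrite closedC.
have clP : closed (~` P) by rewrite closedC.
pose s z := cdist (~` O) z + cdist (~` P) z.
have s0 z : 0 < s z.
  rewrite /s; case: (OP z) => h.
    by apply: ltr_wpDr; [exact: cdist_ge0|apply: cdist_gt0 => //; exact].
  by apply: ltr_wpDl; [exact: cdist_ge0|apply: cdist_gt0 => //; exact].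
(* A Urysohn function: 0 off [P] and 1 off [O]. It makes [phi] continuous on [O] and [psi]
   continuous on [P]; on the overlap they differ by 2 pi i on [A] and agree on [B], so their
   exponentials define one map [h] on the plane. *)
pose lam z : C := rc (cdist (~` P) z) / rc (s z).
have clam : cont_on setT lam.
  apply: cont_on_mul; first exact: cdist_cont.
  apply: cont_on_inv; last by move=> z _; rewrite rc_eq0 gt_eqF.
  by apply: (@cont_on_ext _ _ _ (fun z => rc (cdist (~` O) z) + rc (cdist (~` P) z))) => [z _|];
    [rewrite rcD|apply: cont_on_add; exact: cdist_cont].
have lamP z : ~ P z -> lam z = 0 by move=> nP; rewrite /lam cdist0 // mul0r.
have lamO z : ~ O z -> lam z = 1.
  by move=> nO; rewrite /lam /s [cdist (~` O) z]cdist0 // add0r divff // rc_eq0 gt_eqF // cdist_gt0 //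
    => Pz; case: (OP z).
pose phi z := if pselect (A z) then tpi * lam z else 0.
pose psi z := if pselect (A z) then tpi * (lam z - 1) else 0.
have glue (u : C -> C) Q Q' : open Q -> (forall z, Q z -> ~ Q' z -> u z = 0) -> (forall z, Q z -> Q' z -> (O `&` P) z) ->
    cont_on setT u -> cont_on Q (fun z => if pselect (A z) then u z else 0).
  move=> oQ uQ QQ cu z Qz e e0.
  have [d d0 hd] := cu z I e e0.
  have [Q'z|nQ'] := pselect (Q' z).
    have := QQ z Qz Q'z; rewrite OPE => -[Az|Bz].
      have [r r0 hr] := (openCP A).1 oA z Az.
      exists (Num.min d r) => [|w _]; first by rewrite lt_min d0.
      rewrite lt_min => /andP[wd wr]; have Aw := hr w wr.
      by rewrite !pif_true //; exact: hd.
    have [r r0 hr] := (openCP B).1 oB z Bz.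
    exists r => // w _ wr; have Bw := hr w wr.
    have nA x : B x -> ~ A x by move=> Bx Ax; have : (A `&` B) x by []; rewrite AB.
    by rewrite (pif_false _ _ (nA _ Bw)) (pif_false _ _ (nA _ Bz)) subrr nm0.
  have uz := uQ z Qz nQ'.
  exists d => // w _ wz; have := hd w I wz; rewrite uz subr0 => h.
  rewrite [X in _ - X](_ : _ = 0) ?subr0; last by case: pselect.
  by have [Aw|nAw] := pselect (A w); [rewrite pif_true|rewrite pif_false ?nm0].
have cphi : cont_on O phi.
  apply: (@glue (fun z => tpi * lam z) O P) => //; last by apply: cont_on_mul => //; exact: cont_on_cst.
  by move=> z _ /lamP ->; rewrite mulr0.
have cpsi : cont_on P psi.
  apply: (@glue (fun z => tpi * (lam z - 1)) P O) => //.
  - by move=> z _ /lamO ->; rewrite subrr mulr0.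
  - by apply: cont_on_mul; [exact: cont_on_cst|apply: cont_on_sub2 => //; exact: cont_on_cst].
pose h z := cexp (phi z).
have hpsi z : h z = cexp (psi z).
  rewrite /h /phi /psi; have [Az|nAz] := pselect (A z); last by rewrite !pif_false.
  rewrite !pif_true //; by rewrite mulrBr mulr1 cexpB cexp_tpi divr1.
have cexpc S : cont_on S (cexp : C -> C).
  by apply: hol_cont => w _; exists (cexp w); exact: dC_cexp.
have ch : cont_on setT h.
  move=> z _ e e0; case: (OP z) => Q.
    have [d d0 hd] := @cont_on_comp _ O setT cexp phi (cexpc _) cphi (fun _ _ => I) z Q e e0.
    have [r r0 hr] := (openCP O).1 oO z Q.
    exists (Num.min d r) => [|w _]; first by rewrite lt_min d0.
    by rewrite lt_min => /andP[wd wr]; apply: hd => //; exact: hr.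
  have [d d0 hd] := @cont_on_comp _ P setT cexp psi (cexpc _) cpsi (fun _ _ => I) z Q e e0.
  have [r r0 hr] := (openCP P).1 oP z Q.
  exists (Num.min d r) => [|w _]; first by rewrite lt_min d0.
  by rewrite lt_min !hpsi => /andP[wd wr]; apply: hd => //; exact: hr.
(* A logarithm [l] of [h] on a large disc differs from [phi] by a constant along a path from [a] to
   [b] in [O], and from [psi] by a constant along one in [P]. So [phi - psi] would be equal at [a]
   and [b], where it is 2 pi i and 0. *)
have [K1 [k1 n1 K1O K1a K1b]] := path_linked (open_connected_path oO cO Oa Ob).
have [K2 [k2 n2 K2P K2a K2b]] := path_linked (open_connected_path oP cP Pa Pb).
have [M M0 hM] := compact_bdd (compactU k1 k2).
have K1M : K1 `<=` cdisc 0 M by move=> z Kz; rewrite /cdisc /= subr0; apply: hM; left.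
have K2M : K2 `<=` cdisc 0 M by move=> z Kz; rewrite /cdisc /= subr0; apply: hM; right.
have [l cl el] := log_lift M0 (cont_on_sub (fun _ _ => I) ch) (fun z _ => cexp_neq0 (phi z)).
have E1 : l a - phi a = l b - phi b.
  apply: (@cexp1_const K1 (fun z => l z - phi z)) => //.
    apply: cont_on_sub2; [exact: cont_on_sub cl|exact: cont_on_sub cphi].
  by move=> z Kz; rewrite cexpB el ?divff ?cexp_neq0 //; exact: K1M.
have E2 : l a - psi a = l b - psi b.
  apply: (@cexp1_const K2 (fun z => l z - psi z)) => //.
    apply: cont_on_sub2; [exact: cont_on_sub cl|exact: cont_on_sub cpsi].
  by move=> z Kz; rewrite cexpB el ?hpsi ?divff ?cexp_neq0 //; exact: K2M.
have : phi a - psi a = phi b - psi b.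
  have -> : phi a - psi a = (l a - psi a) - (l a - phi a) by ring.
  by rewrite E1 E2; ring.
rewrite /phi /psi !(pif_true _ _ Aa) !(pif_false _ _ Ab).
rewrite subrr mulrBr mulr1 opprB addrC subrK => /eqP.
by rewrite (negbTE tpi_neq0).
Qed.
End plane_topology.

(** * The principal argument and the crosscut lemma *)

Section sectors.
Context {R : realType}.
Local Notation C := (cplx R).
Implicit Types (e r rho : R) (z w a b c p x : C) (f g : C -> C) (D G K S O P : set C).

(** The principal argument by the tangent of the half angle: one formula, continuous on the whole of
    [slit], the plane without the closed negative real axis. *)
Definition argC w : R := 2 * atan (imC w / (nm w + reC w)).
Definition slit : set C := [set w | 0 < nm w + reC w].

Lemma slit_im w : imC w != 0 -> slit w.
Proof.
move=> h; rewrite /slit /=; have h2 : reC w ^+ 2 < nm w ^+ 2.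
  by rewrite nm_sqr ltrDl lt_def sqr_ge0 andbT sqrf_eq0.
have : `|reC w| < nm w by rewrite -ltr_sqr ?nnegrE ?nm_ge0 // real_normK ?num_real.
by rewrite ltr_norml; lin.
Qed.

Lemma argC_cexp w : slit w -> w = rc (nm w) * cexp (iC * rc (argC w)).
Proof.
rewrite /slit /= => s0; set u := imC w / (nm w + reC w).
have -> : iC * rc (argC w) = iC * rc (atan u) + iC * rc (atan u).
  by rewrite /argC -/u rcM (rcn 2); ring.
rewrite cexpD; set E := cexp _.
have EE : E = rc (Num.sqrt (1 + u ^+ 2))^-1 * (1 + iC * rc u).
  rewrite /E /cexp reM imM re_iC im_iC re_rc im_rc !(mul0r, mul1r, mulr0, subr0, add0r) expR0 rc1 mul1r.
  have c0 : cos (atan u) != 0 by rewrite cos_atan invr_eq0 sqrtr_eq0 -ltNge ltr_pwDl ?sqr_ge0.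
  have -> : sin (atan u) = u * cos (atan u) by rewrite -{2}[u]atanK /tan divfK.
  by rewrite cos_atan rcM; ring.
have u1 : 0 < 1 + u ^+ 2 by rewrite ltr_pwDl ?sqr_ge0.
have -> : E * E = rc (1 + u ^+ 2)^-1 * ((1 + iC * rc u) * (1 + iC * rc u)).
  have -> : (1 + u ^+ 2)^-1 = (Num.sqrt (1 + u ^+ 2))^-1 * (Num.sqrt (1 + u ^+ 2))^-1.
    by rewrite -invfM -expr2 sqr_sqrtr // ltW.
  by rewrite EE [in RHS]rcM; ring.
have ur : u * (nm w + reC w) = imC w by rewrite /u divfK // gt_eqF.
have nn : nm w ^+ 2 = reC w ^+ 2 + imC w ^+ 2 by exact: nm_sqr.
(* As [u] is the tangent of half the angle, [key] and [key2] are the rational formulas for the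
   cosine and the sine of the angle. *)
have key : nm w * (1 - u ^+ 2) = reC w * (1 + u ^+ 2).
  apply: (mulIf (lt0r_neq0 s0)); apply: (mulIf (lt0r_neq0 s0)).
  have -> : nm w * (1 - u ^+ 2) * (nm w + reC w) * (nm w + reC w) =
    nm w * ((nm w + reC w) ^+ 2 - (u * (nm w + reC w)) ^+ 2) by ring.
  have -> : reC w * (1 + u ^+ 2) * (nm w + reC w) * (nm w + reC w) =
    reC w * ((nm w + reC w) ^+ 2 + (u * (nm w + reC w)) ^+ 2) by ring.
  have iw : imC w ^+ 2 = nm w ^+ 2 - reC w ^+ 2 by rewrite nn; ring.
  by rewrite ur iw; ring.
have key2 : nm w * (2 * u) = imC w * (1 + u ^+ 2).
  apply: (mulIf (lt0r_neq0 s0)).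
  have -> : nm w * (2 * u) * (nm w + reC w) = 2 * nm w * (u * (nm w + reC w)) by ring.
  have -> : imC w * (1 + u ^+ 2) * (nm w + reC w) = imC w * ((nm w + reC w) + u * (u * (nm w + reC w))) by ring.
  rewrite ur -[in u * imC w]ur; have : nm w * (1 - u ^+ 2) = reC w * (1 + u ^+ 2) := key.
  move=> k; have -> : nm w + reC w + u * (u * (nm w + reC w)) = 2 * nm w by lin.
  by ring.
have -> : (1 + iC * rc u) * (1 + iC * rc u) = rc (1 - u ^+ 2) + iC * rc (2 * u).
  rewrite rcB rc1 rcX rcM (rcn 2).
  by rewrite (_ : _ * _ = 1 + (iC * iC) * rc u ^+ 2 + iC * (2 * rc u)); [rewrite iC2; ring|ring].
have -> : rc (nm w) * (rc (1 + u ^+ 2)^-1 * (rc (1 - u ^+ 2) + iC * rc (2 * u))) =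
   rc (1 + u ^+ 2)^-1 * (rc (nm w * (1 - u ^+ 2)) + iC * rc (nm w * (2 * u))) by rewrite !rcM; ring.
rewrite key key2 rcM [rc (imC w * _)]rcM rcV {1}(reimE w).
have n0 : rc (1 + u ^+ 2) != 0 :> C by rewrite rc_eq0 gt_eqF.
by move: (rc (1 + u ^+ 2)) n0 => X n0; field.
Qed.

Lemma argC_cont : rcont_on slit argC.
Proof.
have h : cont_on slit (fun w => rc (imC w) / rc (nm w + reC w)).
  apply: cont_on_mul.
    move=> z _ e e0; exists e => // w _ wz; rewrite -rcB nm_rc -imB.
    exact: le_lt_trans (im_le_nm _) wz.
  apply: cont_on_inv; last by move=> z /= hz; rewrite rc_eq0 gt_eqF.
  move=> z _ e e0; exists (e / 2) => [|w _ wz]; first by lin.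
  rewrite -rcB nm_rc (_ : _ - _ = (nm w - nm z) + reC (w - z)); last by rewrite reB; ring.
  apply: le_lt_trans (ler_normD _ _) _; have := re_le_nm (w - z).
  have : `|nm w - nm z| <= nm (w - z) by rewrite ler_norml; have := nmB_ge w z; have := nmB_ge' w z; lin.
  lin.
move=> z sz e e0; set u := imC z / (nm z + reC z).
have e20 : 0 < e / 2 by lin.
have /nbhs_ballP[d /= d0 hd] := @continuous_atan R u _ (nbhsx_ballx (atan u) (e / 2) e20).
have [r r0 hr] := h z sz d d0; exists r => // w sw wz.
have := hr w sw wz; rewrite -!rcV -!rcM -rcB nm_rc => k.
have := hd (imC w / (nm w + reC w)); rewrite /ball /= distrC => /(_ k); rewrite distrC => k2.
rewrite /argC -mulrBr normrM ger0_norm //; lin.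
Qed.

Lemma argC_pos w : 0 < imC w -> reC w < 0 -> pi / 2 < argC w.
Proof.
move=> i0 r0; have s0 : slit w by apply: slit_im; rewrite gt_eqF.
have u1 : 1 < imC w / (nm w + reC w).
  rewrite ltr_pdivlMr // mul1r -ltr_sqr ?nnegrE ?(ltW i0) ?(ltW s0) //.
  have -> : imC w ^+ 2 = nm w ^+ 2 - reC w ^+ 2 by rewrite nm_sqr; ring.
  rewrite subr_sqr [X in X < _]expr2 ltr_pM2r //; lin.
have e : pi / 2 = 2 * atan 1 :> R by rewrite atan1; lin.
by rewrite /argC e ltr_pM2l // lt_atan.
Qed.
Lemma argC_neg w : imC w < 0 -> reC w < 0 -> argC w < - (pi / 2).
Proof.
move=> i0 r0; have s0 : slit w by apply: slit_im; rewrite lt_eqF.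
have u1 : 1 < - imC w / (nm w + reC w).
  rewrite ltr_pdivlMr // mul1r -ltr_sqr ?nnegrE ?oppr_ge0 ?(ltW i0) ?(ltW s0) //.
  have -> : (- imC w) ^+ 2 = nm w ^+ 2 - reC w ^+ 2 by rewrite nm_sqr; ring.
  rewrite subr_sqr [X in X < _]expr2 ltr_pM2r //; lin.
have : pi / 2 < - argC w; last by lin.
rewrite /argC -mulrN -atanN -mulNr.
have e : pi / 2 = 2 * atan 1 :> R by rewrite atan1; lin.
by rewrite e ltr_pM2l // lt_atan.
Qed.

(** The pole is moved from [a0] to [a1] within the component. A small move multiplies the quotient
    by a factor near 1 on [K], whose logarithm is added. *)
Lemma log_ratio K a0 a1 : compact K -> (~` K) a0 -> comp (~` K) a0 a1 ->
  exists2 L, cont_on K L & forall z, K z -> cexp (L z) = (z - a0) / (z - a1).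
Proof.
move=> cK Ka0; have oK : open (~` K) by rewrite openC; exact: compact_closedC.
have [L1 [hL eL]] := @log_near1 R.
pose Q a := exists2 L, cont_on K L & forall z, K z -> cexp (L z) = (z - a0) / (z - a).
have neK a z : (~` K) a -> K z -> z - a != 0.
  by move=> na Kz; rewrite subr_eq0; apply/eqP => E; apply: na; rewrite -E.
have step a a' r : (~` K) a -> (~` K) a' -> disc a' r `<=` ~` K -> nm (a' - a) < r -> Q a -> Q a'.
  move=> na na' sub aa [L cL e1].
  pose q z := (z - a) / (z - a').
  have qD z : K z -> disc 1 1 (q z).
    move=> Kz; have nz := neK a' z na' Kz; rewrite /disc /=.
    rewrite (_ : q z - 1 = (a' - a) / (z - a')); last by rewrite /q; field.
    rewrite nmM nmV ltr_pdivrMr ?nm_gt0 // mul1r; apply: lt_le_trans aa _.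
    by rewrite leNgt; apply/negP => h; apply: (sub z).
  exists (fun z => L z + L1 (q z)).
    apply: cont_on_add => //; apply: (cont_on_comp (hol_cont hL)) => //.
    apply: cont_on_mul; first by apply: cont_on_sub2; [exact: cont_on_id|exact: cont_on_cst].
    by apply: cont_on_inv => [|z Kz]; [apply: cont_on_sub2; [exact: cont_on_id|exact: cont_on_cst]|exact: neK].
  move=> z Kz; rewrite cexpD e1 // (eL _ (qD z Kz)) /q.
  by field; rewrite !neK.
apply: (connected_ind (comp_conn (G := ~` K) (z := a0)) (P := Q)).
- exists a0; first exact: comp_refl.
  by exists (fun=> 0) => [|z Kz]; [exact: cont_on_cst|rewrite cexp0 divff // neK].
- move=> a /comp_sub na Qa; have [r r0 hr] := (openCP _).1 oK a na.
  exists (r / 2) => [|a' /comp_sub na']; first by lin.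
  rewrite /disc /= => aa; apply: (step a a' (r / 2)) => // z; rewrite /disc /= => h.
  by apply: hr; rewrite /disc /=; have := nmD3 a' z a; lin.
- move=> a' /comp_sub na' h; have [r r0 hr] := (openCP _).1 oK a' na'.
  have [a [/comp_sub na aa Qa]] := h r r0.
  by apply: (step a a' r) => //; rewrite nmBC.
Qed.

(* If the segment from a0 to a1 crosses K only at x, transversally, and K stays connected
   after removing x, then the argument of (z - a0) / (z - a1) jumps by 2 pi at x. *)
Lemma crosscut K a0 a1 x : compact K -> (~` K) a0 -> (~` K) a1 -> comp (~` K) a0 a1 -> K x ->
  reC ((x - a0) / (x - a1)) < 0 ->
  (forall z, K z -> z != x -> slit ((z - a0) / (z - a1))) ->
  connected [set z | K z /\ z != x] ->
  (forall d : R, 0 < d -> exists z z', [/\ K z /\ z != x, K z' /\ z' != x, nm (z - x) < d, nm (z' - x) < d &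
     imC ((z - a0) / (z - a1)) < 0 /\ 0 < imC ((z' - a0) / (z' - a1))]) -> False.
Proof.
move=> cK na0 na1 ca Kx rx sl cx side.
have [L cL eL] := log_ratio cK na0 ca.
pose w z := (z - a0) / (z - a1).
have ne a z : (~` K) a -> K z -> z - a != 0.
  by move=> na Kz; rewrite subr_eq0; apply/eqP => E; apply: na; rewrite -E.
have cw : cont_on K w.
  apply: cont_on_mul; first by apply: cont_on_sub2; [exact: cont_on_id|exact: cont_on_cst].
  by apply: cont_on_inv => [|z Kz]; [apply: cont_on_sub2; [exact: cont_on_id|exact: cont_on_cst]|exact: ne].
set K' := [set z | K z /\ z != x] in cx.
(* Off [x] this is a locally constant multiple of 2 pi i, hence constant. But near [x] the argument
   is above pi / 2 on one side and below - pi / 2 on the other, while the imaginary part of [L]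
   varies by less than 2. *)
pose D z := iC * rc (imC (L z)) - iC * rc (argC (w z)).
have cD : cont_on K' D.
  have sub : K' `<=` K by move=> z [].
  apply: cont_on_sub2; apply: cont_on_mul; try exact: cont_on_cst.
    move=> z K'z e e0; have [d d0 hd] := cont_on_sub sub cL K'z e0; exists d => // v K'v vz.
    by rewrite -rcB nm_rc -imB; apply: le_lt_trans (im_le_nm _) _; exact: hd.
  move=> z [Kz zx] e e0; have [d d0 hd] := argC_cont (sl z Kz zx) e0.
  have [d' d'0 hd'] := cw z Kz d d0; exists d' => // v [Kv vx] vz.
  by rewrite -rcB nm_rc; apply: hd; [exact: sl|exact: hd'].
have eD z : K' z -> cexp (D z) = 1.
  move=> [Kz zx]; have sw := sl z Kz zx; rewrite /D cexpB.
  have w0 : w z != 0 by rewrite /w mulf_neq0 ?invr_eq0 ?ne.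
  have nw0 : rc (nm (w z)) != 0 by rewrite rc_eq0 nm_eq0.
  have E1 : w z = rc (nm (w z)) * cexp (iC * rc (imC (L z))).
    have E : cexp (L z) = w z := eL z Kz.
    rewrite -E nm_cexp {1}/cexp /cexp reM imM re_iC im_iC re_rc im_rc.
    by rewrite !(mul0r, mul1r, mulr0, subr0, add0r) expR0 rc1 mul1r.
  have E2 := argC_cexp sw; rewrite -/(w z) in E2.
  apply: (mulfI nw0); rewrite mulr1 mulrA -E1 {1}E2 mulfK //; exact: cexp_neq0.
have cst := cexp1_const cx cD eD.
have rx0 : 0 < - reC (w x) by rewrite oppr_gt0.
have [d1 d10 h1] := cw x Kx _ rx0.
have [d2 d20 h2] := cL x Kx 1 ltr01.
have d0 : 0 < Num.min d1 d2 by rewrite lt_min d10.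
have [z [z' [[Kz nz] [Kz' nz'] zx z'x [iz iz']]]] := side _ d0.
have rw v : K v -> nm (v - x) < d1 -> reC (w v) < 0.
  move=> Kv vx; have := h1 v Kv vx; have := re_le_nm (w v - w x); rewrite reB ler_norml; lin.
move: zx z'x; rewrite !lt_min => /andP[zx1 zx2] /andP[zx1' zx2'].
have A1 := argC_neg iz (rw z Kz zx1); have A2 := argC_pos iz' (rw z' Kz' zx1').
have := cst z z' (conj Kz nz) (conj Kz' nz') => /(congr1 imC).
rewrite /D !(imB, imM) !re_iC !im_iC !re_rc !im_rc !mul0r !mul1r !add0r => E.
have := h2 z Kz zx2; have := h2 z' Kz' zx2'.
have := im_le_nm (L z - L x); have := im_le_nm (L z' - L x); rewrite !imB !ler_norml.
by have := @pi_ge2 R; rewrite /w in E; lin.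
Qed.
End sectors.

(** * Valleys and mountains of a modulus at a saddle *)

Section sector_separation.
Context {R : realType}.
Local Notation C := (cplx R).
Implicit Types (e r rho : R) (z w a b c p x : C) (f g : C -> C) (D G K S O P : set C).

Lemma cos_lt_sym (u d : R) : 0 < u < pi -> 0 < d < pi -> cos (u + d) < cos (u - d).
Proof.
move=> u0 d0; rewrite cosD cosB; have := mulr_gt0 (sin_gt0_pi u0) (sin_gt0_pi d0); lin.
Qed.

Definition cis (t : R) : C := rc (cos t) + iC * rc (sin t).
Lemma cis_cexp t : cis t = cexp (iC * rc t).
Proof.
rewrite /cis /cexp reM imM re_iC im_iC re_rc im_rc !(mul0r, mul1r, mulr0, subr0, add0r) expR0 rc1.
by rewrite mul1r.
Qed.
Lemma nm_cis t : nm (cis t) = 1.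
Proof. by rewrite cis_cexp nm_cexp reM re_iC im_iC re_rc im_rc mul0r mulr0 subr0 expR0. Qed.
Lemma cisX t n : cis t ^+ n = cis (n%:R * t).
Proof.
elim: n => [|n IH]; first by rewrite expr0 mul0r cis_cexp mulr0 cexp0.
by rewrite exprS IH !cis_cexp -cexpD; congr cexp; rewrite -natr1 mulrDl mul1r rcD; ring.
Qed.
Lemma re_cis t : reC (cis t) = cos t.
Proof. by rewrite /cis reD reM re_iC im_iC !re_rc !im_rc mul0r mulr0 subrr addr0. Qed.

Definition realseg (I : set R) : set C := [set rc t | t in I].
Lemma realseg_connected (I : set R) : (forall s t u : R, I s -> I t -> 0 <= u <= 1 -> I (s + u * (t - s))) ->
  connected (realseg I).
Proof.
move=> cI; apply: convex_connected => _ _ u [s Is <-] [t It <-] u01.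
by exists (s + u * (t - s)); [exact: cI|rewrite rcD rcM rcB].
Qed.
Lemma ray_image_connected (I : set R) p v :
  (forall s t u : R, I s -> I t -> 0 <= u <= 1 -> I (s + u * (t - s))) ->
  connected [set p + rc s * v | s in I].
Proof.
move=> /realseg_connected cI.
have -> : [set p + rc s * v | s in I] = (fun z => p + z * v) @` realseg I.
  by apply/seteqP; split=> [_ [s Is <-]|_ [_ [s Is <-] <-]]; [exists (rc s) => //; exists s|exists s].
exact: cont_connected cI (@cont_on_affine _ _ _ _).
Qed.
Lemma itv_convex (l u s t q : R) : l <= s <= u -> l <= t <= u -> 0 <= q <= 1 -> l <= s + q * (t - s) <= u.
Proof.
move=> /andP[s1 s2] /andP[t1 t2] /andP[q0 q1].
have [a1 a2] : 0 <= q * (t - l) /\ 0 <= (1 - q) * (s - l) by split; apply: mulr_ge0; lin.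
have [a3 a4] : 0 <= q * (u - t) /\ 0 <= (1 - q) * (u - s) by split; apply: mulr_ge0; lin.
by apply/andP; split; lin.
Qed.
Lemma itv_convex_lt (u s t q : R) : s < u -> t < u -> 0 <= q <= 1 -> s + q * (t - s) < u.
Proof.
move=> s1 t1 /andP[q0 q1]; have [->|qn] := eqVneq q 0; first by rewrite mul0r addr0.
have a1 : 0 < q * (u - t) by apply: mulr_gt0; [rewrite lt_def qn|lin].
have a2 : 0 <= (1 - q) * (u - s) by apply: mulr_ge0; lin.
lin.
Qed.
Lemma ray_compact p v (T : R) : 0 <= T -> compact [set p + rc s * v | s in [set s : R | 0 <= s <= T]].
Proof.
move=> T0; have -> : [set p + rc s * v | s in [set s : R | 0 <= s <= T]] = (fun z => p + z * (rc T * v)) @` unit_seg.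
  apply/seteqP; split=> [_ [s /= /andP[s0 sT] <-]|_ [_ [s /= /andP[s0 s1] <-] <-]].
    have [T00|Tn] := eqVneq T 0.
      exists (rc 0); first by exists 0 => //=; rewrite lexx ler01.
      by have -> : s = 0 by [apply/eqP; rewrite eq_le s0 andbT -T00]; rewrite rc0 !mul0r.
    have Tp : 0 < T by rewrite lt_def Tn.
    exists (rc (s / T)); first by exists (s / T) => //=; rewrite divr_ge0 //= ler_pdivrMr // mul1r.
    by rewrite mulrA -rcM divfK.
  exists (s * T); first by rewrite /= mulr_ge0 //= ler_piMl.
  by rewrite rcM mulrA.
apply: cont_compact (@unit_seg_compact R) _; exact: cont_on_affine.
Qed.

Lemma cross_ratio_im (A B : R) : 0 < A ^+ 2 + B ^+ 2 ->
  imC ((rc A - iC * rc B) / (rc A + iC * rc B)) * (A ^+ 2 + B ^+ 2) = - (2 * A * B).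
Proof.
move=> AB; have E : (rc A - iC * rc B) * (rc A + iC * rc B) = rc (A ^+ 2 + B ^+ 2).
  rewrite rcD !rcX; transitivity (rc A ^+ 2 - (iC * iC) * rc B ^+ 2); first by ring.
  by rewrite iC2; ring.
have n2 : rc A + iC * rc B != 0.
  by apply/eqP => h; move: AB; rewrite -rc_lt rc0 -E h mulr0 ltxx.
have : (rc A - iC * rc B) / (rc A + iC * rc B) * rc (A ^+ 2 + B ^+ 2) = (rc A - iC * rc B) ^+ 2.
  by rewrite -E; move: n2; move: (rc A + _) => X n2; field.
move/(congr1 imC); rewrite imM re_rc im_rc mulr0 add0r => ->.
by rewrite expr2 imM !(reB, imB, reM, imM) re_iC im_iC !re_rc !im_rc; ring.
Qed.

(* In the coordinate z = p + zeta v the valley directions are the powers of omega and the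
   points a0, a1 lie on the mountains on either side of the valley zeta > 0. *)
Lemma cos_sector (j m : nat) : (0 < j < m)%N -> cos (2 * pi * j%:R / m%:R) < cos (3 / 4 * pi / m%:R) :> R.
Proof.
move=> /andP[j0 jm]; have p2 : 2 <= pi :> R := @pi_ge2 R.
have jR : 1 <= j%:R :> R by rewrite ler1n.
have jm' : j%:R + 1 <= m%:R :> R by rewrite natr1 ler_nat.
have mp : 0 < m%:R :> R by lin.
set al := 3 / 4 * pi / m%:R; set th := 2 * pi * j%:R / m%:R.
have al0 : 0 < al by rewrite divr_gt0 //; lin.
have b1 : 2 * pi / m%:R <= th.
  rewrite /th ler_pM2r ?invr_gt0 //; have : 0 <= pi * (j%:R - 1) :> R by rewrite mulr_ge0 //; lin.
  lin.
have b2 : th + 2 * pi / m%:R <= 2 * pi.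
  rewrite /th -mulrDl ler_pdivrMr //; have : 0 <= pi * (m%:R - j%:R - 1) :> R by rewrite mulr_ge0 //; lin.
  lin.
have b3 : al < 2 * pi / m%:R by rewrite /al ltr_pM2r ?invr_gt0 //; lin.
have := @cos_lt_sym ((th + al) / 2) ((th - al) / 2).
rewrite (_ : (th + al) / 2 + (th - al) / 2 = th); last by field.
rewrite (_ : (th + al) / 2 - (th - al) / 2 = al); last by field.
by apply; apply/andP; split; lin.
Qed.

Lemma sublevel_open f (s : R) : hol_on setT f -> open [set z | nm (f z) < s].
Proof.
move=> hf; apply/openCP => x /= Sx; have sx0 : 0 < s - nm (f x) by rewrite subr_gt0.
have [d d0 hd] := (rcont_nm (hol_cont hf) : rcont_on setT _) x I _ sx0; exists d => // y yx /=.
by have := hd y I yx; rewrite ltr_norml; lin.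
Qed.

(** The quotient maps the segment between the two points to the negative real axis; solving w = -l
    for [y] gives the parameter (1 - l) / (1 + l). *)
Lemma slit_segment (b d y : C) : y <> b + d -> y <> b - d -> ~ slit ((y - (b + d)) / (y - (b - d))) ->
  exists mu : R, `|mu| <= 1 /\ y = b + rc mu * d.
Proof.
move=> /eqP y0 /eqP y1; rewrite /slit /=; set w := _ / _ => /negP; rewrite -leNgt => ws.
have [na0 na1] : y - (b + d) != 0 /\ y - (b - d) != 0 by rewrite !subr_eq0.
have w0 : 0 < nm w by rewrite nm_gt0 mulf_neq0 // invr_eq0.
have re : reC w = - nm w by apply/eqP; rewrite eq_le; have := re_le_nm w; rewrite ler_norml; lin.
have im : imC w = 0.
  by apply/eqP; rewrite -sqrf_eq0; have := nm_sqr w; rewrite re sqrrN => h; apply/eqP; lin.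
have wl : w = - rc (nm w) by apply: C_ext; rewrite ?reN ?imN ?re_rc ?im_rc ?oppr0.
set l := nm w in wl w0; have l1 : 0 < 1 + l by lin.
have l1' : 1 + rc l != 0 by rewrite -rc1 -rcD rc_eq0 gt_eqF.
exists ((1 - l) / (1 + l)); split.
  by rewrite normrM normfV ler_pdivrMr ?normr_gt0 ?gt_eqF // mul1r (gtr0_norm l1) ler_norml; lin.
have E : y - (b + d) = - rc l * (y - (b - d)) by rewrite -wl /w divfK.
have E2 : (1 + rc l) * y = (1 + rc l) * b + (1 - rc l) * d.
  apply/eqP; rewrite -subr_eq0; apply/eqP.
  by move/eqP: E; rewrite -subr_eq0 => /eqP E; rewrite -[RHS]E; ring.
apply: (mulfI l1'); rewrite E2 rcM rcV rcB rcD rc1; field; exact: l1'.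
Qed.

(** Along the direction [v * q] the quotient g / g p equals 1 + t^m q^m (- n + eta) with [eta] at
    most a quarter of [n * c0], where -c0 = cos(3 pi / 4). So q^m = 1 gives descent and Re q^m = -c0
    gives ascent, uniformly for small t; [e <= n^-1] keeps 1 - t^m n nonnegative. *)
Lemma sector_local g p m k r0 v : hol_on setT g -> 0 < r0 -> hol_on (disc p r0) k ->
  (forall z, disc p r0 z -> g z = g p + (z - p) ^+ m * k z) -> k p != 0 -> g p != 0 -> (1 < m)%N ->
  nm v = 1 -> v ^+ m * (k p / g p) = - rc (nm (k p / g p)) ->
  exists2 e : R, 0 < e <= r0 & forall (t : R) q, 0 < t <= e -> nm q = 1 ->
    (q ^+ m = 1 -> nm (g (p + rc t * (v * q))) < nm (g p)) /\
    (reC (q ^+ m) = cos (3 / 4 * pi) -> nm (g p) < nm (g (p + rc t * (v * q)))).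
Proof.
move=> hg r00 hk gk k0 g0 m1 nv vm.
set n := nm (k p / g p) in vm; have n0 : 0 < n by rewrite nm_gt0 mulf_neq0 // invr_eq0.
have p2 : 2 <= pi :> R := @pi_ge2 R.
have c34 : cos (3 / 4 * pi) < 0 :> R.
  have := @cos_lt_sym (5 / 8 * pi) (pi / 8).
  rewrite (_ : 5 / 8 * pi + pi / 8 = 3 / 4 * pi); last by field.
  rewrite (_ : 5 / 8 * pi - pi / 8 = pi / 2); last by field.
  rewrite cos_pihalf; apply; lin.
set c0 := - cos (3 / 4 * pi) : R; have c00 : 0 < c0 by rewrite oppr_gt0.
have c01 : c0 <= 1 by rewrite /c0 lerNl cos_geN1.
have e10 : 0 < n * c0 / 4 * nm (g p) by rewrite !mulr_gt0 ?invr_gt0 // nm_gt0.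
have [d1 d10 h1] := hol_cont hk (disc_center p r00) e10.
pose e : R := Num.min (Num.min (r0 / 2) (d1 / 2)) (Num.min 1 n^-1).
have e0 : 0 < e by rewrite !lt_min ltr01 invr_gt0 n0 !divr_gt0.
have er : e <= r0 / 2 by rewrite !ge_min lexx.
have ed : e <= d1 / 2 by rewrite !ge_min lexx !orbT.
have e1 : e <= 1 by rewrite !ge_min lexx !orbT.
have en : e <= n^-1 by rewrite !ge_min lexx !orbT.
have pw (t : R) : 0 < t <= e -> 0 < t ^+ m /\ t ^+ m * n <= 1.
  move=> /andP[t0 te]; split; first exact: exprn_gt0.
  have t1 : t <= 1 := le_trans te e1.
  rewrite -ler_pdivlMr // div1r; apply: le_trans en; apply: le_trans te.
  by rewrite -{2}[t]expr1 ler_wiXn2l // ?(ltW t0) // ltnW.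
have val (t : R) q : 0 < t <= e -> nm q = 1 ->
    exists eta, nm eta <= n * c0 / 4 /\ g (p + rc t * (v * q)) = g p * (1 + rc (t ^+ m) * q ^+ m * (- rc n + eta)).
  move=> /andP[t0 te] nq; set z := p + _.
  have zp : z - p = rc t * (v * q) by rewrite /z addrAC subrr add0r.
  have nz : nm (z - p) = t by rewrite zp !nmM nv nq !mulr1 nm_rc gtr0_norm.
  have Dz : disc p r0 z by rewrite /disc /= nz; lin.
  exists (v ^+ m * ((k z - k p) / g p)); split.
    have := h1 z Dz; rewrite nz => /(_ ltac:(lin)) h.
    by rewrite nmM nmX nv expr1n mul1r nmM nmV ler_pdivrMr ?nm_gt0 // ltW.
  rewrite gk // zp !exprMn rcX -vm; field; exact: g0.
have val_lt (t : R) q : 0 < t <= e -> nm q = 1 -> q ^+ m = 1 -> nm (g (p + rc t * (v * q))) < nm (g p).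
  move=> te nq qm; have [eta [ne ->]] := val t q te nq; have [tm tn] := pw t te.
  rewrite nmM gtr_pMr ?nm_gt0 // qm mulr1.
  rewrite (_ : 1 + _ = rc (1 - t ^+ m * n) + rc (t ^+ m) * eta); last by rewrite rcB rc1 rcM; ring.
  apply: le_lt_trans (nmD _ _) _; rewrite nmM !nm_rc ger0_norm ?subr_ge0 // gtr0_norm //.
  have : t ^+ m * nm eta <= t ^+ m * (n * c0 / 4) by rewrite ler_pM2l.
  have : 0 < t ^+ m * n by rewrite mulr_gt0.
  have : t ^+ m * n * c0 <= t ^+ m * n by rewrite ler_piMr // ltW // mulr_gt0.
  lin.
have mnt_gt (t : R) q : 0 < t <= e -> nm q = 1 -> reC (q ^+ m) = cos (3 / 4 * pi) -> nm (g p) < nm (g (p + rc t * (v * q))).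
  move=> te nq qm; have [eta [ne ->]] := val t q te nq; have [tm tn] := pw t te.
  rewrite nmM ltr_pMr ?nm_gt0 //; apply: lt_le_trans (re_le _).
  rewrite reD (_ : reC 1 = 1) // -mulrA reM re_rc im_rc mul0r subr0 mulrDr reD reM reN imN re_rc im_rc oppr0 mulr0 subr0 qm -[cos _]opprK -/c0.
  have : t ^+ m * nm (q ^+ m * eta) <= t ^+ m * (n * c0 / 4) by rewrite nmM nmX nq expr1n mul1r ler_pM2l.
  have : - nm (q ^+ m * eta) <= reC (q ^+ m * eta).
    by have := re_le_nm (q ^+ m * eta); rewrite ler_norml => /andP[].
  have : 0 < t ^+ m * (n * c0) by rewrite !mulr_gt0.
  rewrite mulrNN => h2 h3 h4.
  have : t ^+ m * - nm (q ^+ m * eta) <= t ^+ m * reC (q ^+ m * eta) by rewrite ler_pM2l.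
  lin.
exists e; first by apply/andP; split => //; lin.
by move=> t q te nq; split=> h; [apply: val_lt|apply: mnt_gt].
Qed.

(** A connection of two valleys below the level of [p], closed up by two rays through [p], gives a
    compact set [K] where |g| is at most |g p|. Both mountain points next to the first valley lie in
    the unbounded component of its complement, yet the chord between them crosses [K] exactly once;
    [crosscut] excludes this. *)
Lemma sector_separation g p m k r0 v (j : nat) : hol_on setT g -> 0 < r0 -> hol_on (disc p r0) k ->
  (forall z, disc p r0 z -> g z = g p + (z - p) ^+ m * k z) -> k p != 0 -> g p != 0 -> (1 < m)%N ->
  nm v = 1 -> v ^+ m * (k p / g p) = - rc (nm (k p / g p)) -> (0 < j < m)%N ->
  exists2 e : R, 0 < e <= r0 & forall tau : R, 0 < tau <= e ->
    let z i := p + rc tau * (v * cis (i%:R * (pi *+ 2 / m%:R))) in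
    [/\ nm (g (z 0%N)) < nm (g p), nm (g (z j)) < nm (g p) &
       ~ comp [set z | nm (g z) < nm (g p)] (z 0%N) (z j)].
Proof.
move=> hg r00 hk gk k0 g0 m1 nv vm jm.
have [e /andP[e0 er] loc] := sector_local hg r00 hk gk k0 g0 m1 nv vm.
have val_lt (t : R) q : 0 < t <= e -> nm q = 1 -> q ^+ m = 1 -> nm (g (p + rc t * (v * q))) < nm (g p).
  by move=> te nq; have [] := loc t q te nq.
have mnt_gt (t : R) q : 0 < t <= e -> nm q = 1 -> reC (q ^+ m) = cos (3 / 4 * pi) -> nm (g p) < nm (g (p + rc t * (v * q))).
  by move=> te nq; have [] := loc t q te nq.
clear loc gk hk k0 vm; have p2 : 2 <= pi :> R := @pi_ge2 R.
have mR : 2 <= m%:R :> R by rewrite ler_nat.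
have mp : 0 < m%:R :> R by lin.
(* The angle [al] has [m * al] equal to 3 pi / 4, so both signs point to mountains beside valley 0.
   It is less than the spacing 2 pi / m of the valleys, whence the ray of valley [j] cannot reach
   the chord between these mountains. *)
pose al : R := 3 / 4 * pi / m%:R.
have mal : m%:R * al = 3 / 4 * pi by rewrite /al mulrC divfK // gt_eqF.
have al0 : 0 < al by rewrite divr_gt0 //; lin.
have al2 : al < pi / 2.
  rewrite /al ltr_pdivrMr //; have : 0 <= pi * (m%:R - 2) :> R by rewrite mulr_ge0 //; lin.
  lin.
have ca0 : 0 < cos al by apply: cos_gt0_pihalf; lin.
have ca1 : cos al <= 1 by exact: cos_le1.
have sa0 : 0 < sin al by apply: sin_gt0_pi; lin.
pose th (i : nat) : R := i%:R * (pi *+ 2 / m%:R).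
have thm i : cis (th i) ^+ m = 1.
  rewrite cisX /th mulrCA [m%:R * _]mulrC divfK ?gt_eqF // cis_cexp rcM.
  have -> : iC * (rc i%:R * rc (pi *+ 2)) = tpi * i%:R :> C by rewrite /tpi rcn; ring.
  exact: (cexp_int i).
have be : cos (th j) < cos al.
  rewrite (_ : th j = 2 * pi * j%:R / m%:R); last by rewrite /th mulr2n; ring.
  exact: cos_sector.
exists e; first by rewrite e0.
clear er p2 mR r0 r00.
move=> tau te z; have z0E : z 0%N = p + rc tau * v.
  by rewrite /z mul0r cis_cexp mulr0 cexp0 mulr1.
have l0 : nm (g (z 0%N)) < nm (g p) by apply: val_lt => //; rewrite ?nm_cis ?(thm 0%N).
have lj : nm (g (z j)) < nm (g p) by apply: val_lt => //; rewrite ?nm_cis ?thm.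
split => // cmp.
set S := [set z | nm (g z) < nm (g p)] in cmp.
have oS : open S := sublevel_open hg.
have [B1 [kB cB BS B0 Bj]] := path_linked (open_connected_path (comp_open (z := z 0%N) oS) (comp_conn (G := S) (z := z 0%N)) (comp_refl l0) cmp).
have Bp : ~ B1 p by move=> /BS/comp_sub; rewrite /S /= ltxx.
have [dl dl0 hdl] := (openCP (~` B1)).1 (closed_openC (compact_closedC kB)) p Bp.
have /andP[tau0 taue] := te.
(* With [t < dl] the chord from [a0] to [a1] stays in a disc about [p] that avoids the connection
   [B1]; with [t < tau] it meets ray 0 in an inner point [x]. *)
have [t t0 [tt td]] : exists2 t : R, 0 < t & t < tau /\ t < dl.
  have tm0 : 0 < Num.min tau dl by rewrite lt_min tau0.
  exists (Num.min tau dl / 2); first by lin.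
  by apply/andP; rewrite -lt_min; clear -tm0; lin.
have tee : 0 < t <= e by rewrite t0 ltW // (lt_le_trans tt).
pose a0 := p + rc t * (v * cis al); pose a1 := p + rc t * (v * cis (- al)).
pose x := p + rc (t * cos al) * v.
have A0 : nm (g p) < nm (g a0) by apply: mnt_gt => //; rewrite ?nm_cis // cisX re_cis mal.
have A1 : nm (g p) < nm (g a1) by apply: mnt_gt => //; rewrite ?nm_cis // cisX re_cis mulrN cosN mal.
pose ray q := [set p + rc s * q | s in [set s : R | 0 <= s <= tau]].
pose K := B1 `|` (ray v `|` ray (v * cis (th j))).
have kK : compact K by apply: compactU => //; apply: compactU; apply: ray_compact; exact: ltW.
have Kg y : K y -> nm (g y) <= nm (g p).
  have rg q : nm q = 1 -> q ^+ m = 1 -> ray (v * q) y -> nm (g y) <= nm (g p).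
    move=> nq qm [s /= /andP[s0 st] <-].
    have [->|sn] := eqVneq s 0; first by rewrite mul0r addr0.
    by apply: ltW; apply: val_lt => //; rewrite lt_def sn s0 /=; lin.
  case=> [/BS/comp_sub/ltW //|[]]; last by apply: rg; rewrite ?nm_cis ?thm.
  by rewrite -[v in ray v]mulr1; apply: rg; rewrite ?nm1 ?expr1n.
have bK : bdd K := compact_bdd kK.
have un a : nm (g p) < nm (g a) -> ~ bdd (comp (~` K) a) by exact: mod_gt_unbounded kK hg Kg.
have nK a : nm (g p) < nm (g a) -> (~` K) a by move=> h /Kg; rewrite leNgt h.
have c01' : comp (~` K) a0 a1.
  by rewrite (unbounded_comp_eq bK (un _ A0) (un _ A1)); apply: comp_refl; exact: nK.
have v0 : v != 0 by rewrite -nm_gt0 nv.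
have cisE (s : R) : cis (- s) = rc (cos s) - iC * rc (sin s) by rewrite /cis cosN sinN rcN mulrN.
have a0x : a0 = x + v * (iC * rc (t * sin al)) by rewrite /a0 /x /cis !rcM; ring.
have a1x : a1 = x - v * (iC * rc (t * sin al)) by rewrite /a1 cisE /x !rcM; ring.
have wE (s : R) : (p + rc s * v - a0) / (p + rc s * v - a1) =
   (rc (s - t * cos al) - iC * rc (t * sin al)) / (rc (s - t * cos al) + iC * rc (t * sin al)).
  rewrite (_ : _ - a0 = v * (rc (s - t * cos al) - iC * rc (t * sin al))); last first.
    by rewrite /a0 /cis rcB !rcM; ring.
  rewrite (_ : _ - a1 = v * (rc (s - t * cos al) + iC * rc (t * sin al))); last first.
    by rewrite /a1 cisE rcB !rcM; ring.
  by rewrite invfM mulrACA mulfV // mul1r.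
have Kx : K x.
  right; left; exists (t * cos al) => //=; rewrite mulr_ge0 ?ltW //=.
  by apply: le_lt_trans tt; rewrite ler_piMr // ltW.
have ts0 : t * sin al != 0 by rewrite mulf_neq0 // gt_eqF.
apply: (@crosscut _ K a0 a1 x kK (nK _ A0) (nK _ A1) c01' Kx).
- rewrite /x wE subrr rc0 sub0r add0r mulNr divff ?reN; first by rewrite oppr_lt0; exact: ltr01.
  by rewrite mulf_neq0 // -?nm_gt0 ?nm_iC // nm_rc normr_gt0.
- move=> y Ky yx; apply: contrapT; rewrite /slit /=; set w := (y - a0) / (y - a1) => /negP; rewrite -leNgt => ws.
  have [mu [muE yx0]] : exists mu : R, `|mu| <= 1 /\ y = x + rc mu * (v * (iC * rc (t * sin al))).
    apply: slit_segment.
    - by rewrite -a0x => E; apply: (nK _ A0); rewrite -E.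
    - by rewrite -a1x => E; apply: (nK _ A1); rewrite -E.
    - by rewrite -a0x -a1x /slit /= -/w; apply/negP; rewrite -leNgt.
  have yE : y - p = v * (rc (t * cos al) + iC * rc (mu * (t * sin al))) by rewrite yx0 /x !rcM; ring.
  have yn : nm (y - p) <= t.
    rewrite yE nmM nv mul1r -ler_sqr ?nnegrE ?nm_ge0 ?(ltW t0) // nm_sqr.
    rewrite !(reD, imD, reM, imM) re_iC im_iC !re_rc !im_rc !(mul0r, mul1r, mulr0, subr0, add0r, addr0).
    have mu2 : mu ^+ 2 <= 1 by rewrite -[mu ^+ 2]real_normK ?num_real // exprn_ile1.
    have -> : t ^+ 2 = (t * cos al) ^+ 2 + (t * sin al) ^+ 2 by rewrite !exprMn -mulrDr cos2Dsin2 mulr1.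
    by rewrite lerD2l [X in X <= _]exprMn ler_piMl // sqr_ge0.
  have ray_re (q : R) (s : R) : y = p + rc s * (v * cis q) -> s * cos q = t * cos al.
    move=> E; move: yE; rewrite E addrAC subrr add0r mulrCA => /(mulfI v0) /(congr1 reC).
    rewrite reM re_rc im_rc mul0r subr0 re_cis => ->.
    by rewrite reD reM re_iC im_iC !re_rc !im_rc mul0r mulr0 subrr addr0.
  case: Ky => [By|[[s /= s01 E]|[s /= s01 E]]].
  + by apply: (hdl y) => //; exact: le_lt_trans yn td.
  + have := ray_re 0 s; rewrite cos0 mulr1 => /(_ _) H; move/eqP: yx; apply; rewrite -E /x -H //.
    by rewrite -E cis_cexp mulr0 cexp0 mulr1.
  + have H := ray_re (th j) s (esym E).
    have ns : nm (y - p) = s.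
      by rewrite -E addrAC subrr add0r !nmM nv nm_cis !mulr1 nm_rc ger0_norm //; case/andP: s01.
    have tc : 0 < t * cos al by rewrite mulr_gt0.
    have s0 : 0 < s.
      by rewrite lt_def; case/andP: s01 => -> _; rewrite andbT; apply/eqP => s0; move: H tc; rewrite s0 mul0r => <-; rewrite ltxx.
    have : s * cos (th j) < s * cos al by rewrite ltr_pM2l.
    have : s * cos al <= t * cos al by rewrite ler_pM2r // -ns.
    by rewrite -H leNgt => /negbTE ->.
- pose T1 := [set p + rc s * v | s in [set s : R | 0 <= s < t * cos al]].
  pose T2 := [set p + rc s * v | s in [set s : R | t * cos al < s <= tau]].
  have tc : 0 < t * cos al by rewrite mulr_gt0.
  have tct : t * cos al < tau by apply: le_lt_trans tt; rewrite ler_piMr // ltW.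
  have nx : nm (x - p) <= t.
    by rewrite /x addrAC subrr add0r nmM nv mulr1 nm_rc gtr0_norm // ler_piMr // ltW.
  have xB : ~ B1 x by move=> Bx; apply: (hdl x) => //; exact: le_lt_trans nx td.
  have xr : ~ ray (v * cis (th j)) x.
    move=> [s /= s01 xs].
    have E : s * cos (th j) = t * cos al.
      move: xs; rewrite /x => /addrI; rewrite mulrCA [rc (t * _) * v]mulrC => /(mulfI v0) /(congr1 reC).
      by rewrite re_rc reM re_rc im_rc mul0r subr0 re_cis.
    have ns : s = t * cos al.
      have /(congr1 (@nm R)) : x - p = rc s * (v * cis (th j)) by rewrite -xs addrAC subrr add0r.
      rewrite !nmM nv nm_cis !mulr1 nm_rc ger0_norm; last by case/andP: s01.
      by rewrite /x addrAC subrr add0r nmM nv mulr1 nm_rc gtr0_norm.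
    have : s * cos (th j) < s * cos al by rewrite ltr_pM2l // ns.
    have le : s * cos al <= s * 1 by rewrite ler_pM2l // ns.
    by rewrite E -ns ltNge -[X in _ <= X]mulr1 le.
  (* Removing [x] cuts ray 0 into [T1] at [p] and the outer piece [T2]. The remainder stays
     connected around the loop: [T1] meets ray [j] at [p], this meets [B1] at [z j], and [B1] meets
     [T2] at [z 0]. *)
  have KE : [set z | K z /\ z != x] = T1 `|` ray (v * cis (th j)) `|` B1 `|` T2.
    apply/seteqP; split=> [y [[By|[[s /= /andP[s0 s1] E]|ry]] yx]|y [[[[s /= /andP[s0 s1] <-]|ry]|By]|[s /= /andP[s0 s1] <-]]].
    - by left; right.
    - have [st|st|st] := ltrgtP s (t * cos al).
      + by left; left; left; exists s => //=; rewrite s0.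
      + by right; exists s => //=; rewrite st.
      + by move/eqP: yx; case; rewrite -E /x st.
    - by left; left; right.
    - split; first by right; left; exists s => //=; rewrite s0 ltW // (lt_trans s1).
      by rewrite /x (inj_eq (addrI p)) -subr_eq0 -mulrBl -rcB mulf_neq0 // rc_eq0 lt_eqF // subr_lt0.
    - split; first by right; right.
      by apply/eqP => E; apply: xr; rewrite -E.
    - split; first by left.
      by apply/eqP => E; apply: xB; rewrite -E.
    - split; first by right; left; exists s => //=; rewrite s1 andbT ltW // (lt_trans tc).
      by rewrite /x (inj_eq (addrI p)) -subr_eq0 -mulrBl -rcB mulf_neq0 // rc_eq0 gt_eqF // subr_gt0.
  rewrite KE; apply: (@connectedUU _ _ _ (z 0%N)).
  + by right.
  + by exists tau => //=; rewrite tct lexx.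
  + apply: (@connectedUU _ _ _ (z j)) => //.
      by right; exists tau => //=; rewrite lexx ltW.
    apply: (@connectedUU _ _ _ p).
    * by exists 0 => /=; [rewrite lexx|rewrite rc0 mul0r addr0].
    * by exists 0 => /=; [rewrite lexx ltW|rewrite rc0 mul0r addr0].
    * apply: ray_image_connected => s u q /= /andP[s0 s1] /andP[u0 u1] q01; apply/andP; split.
        by case/andP: (itv_convex (introT andP (conj s0 (ltW s1))) (introT andP (conj u0 (ltW u1))) q01).
      exact: itv_convex_lt.
    * by apply: ray_image_connected => s u q; exact: itv_convex.
  + apply: ray_image_connected => s u q /= /andP[s0 s1] /andP[u0 u1] q01; apply/andP; split; last first.
      by case/andP: (itv_convex (introT andP (conj (ltW s0) s1)) (introT andP (conj (ltW u0) u1)) q01).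
    have := @itv_convex_lt (- (t * cos al)) (- s) (- u) q; rewrite !ltrN2 => /(_ s0 u0 q01); lin.
- move=> d d0; have tc : 0 < t * cos al by rewrite mulr_gt0.
  have tct : t * cos al < tau by apply: le_lt_trans tt; rewrite ler_piMr // ltW.
  pose q : R := Num.min d (Num.min (t * cos al) (tau - t * cos al)) / 2.
  have mq : 0 < Num.min d (Num.min (t * cos al) (tau - t * cos al)) by rewrite !lt_min d0 tc subr_gt0.
  have q0 : 0 < q by rewrite divr_gt0.
  have /and3P[qd q1 q2] : [&& q < d, q < t * cos al & q < tau - t * cos al].
    by rewrite -!lt_min /q; clear -mq; lin.
  have im (s : R) : imC ((p + rc s * v - a0) / (p + rc s * v - a1)) * ((s - t * cos al) ^+ 2 + (t * sin al) ^+ 2)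
      = - (2 * (s - t * cos al) * (t * sin al)).
    by rewrite wE cross_ratio_im // ltr_wpDl ?sqr_ge0 // exprn_gt0 // mulr_gt0.
  have dist (s : R) : nm (p + rc s * v - x) = `|s - t * cos al|.
    by rewrite /x opprD addrACA subrr add0r -mulrBl -rcB nmM nv mulr1 nm_rc.
  have nex (s : R) : s != t * cos al -> p + rc s * v != x.
    by move=> h; rewrite -subr_eq0 -nm_eq0 dist normr_eq0 subr_eq0.
  have tsa : 0 < t * sin al by rewrite mulr_gt0.
  have pos : 0 < q ^+ 2 + (t * sin al) ^+ 2 by rewrite ltr_wpDl ?sqr_ge0 // exprn_gt0.
  have hq : 0 < 2 * q * (t * sin al) by rewrite !mulr_gt0.
  exists (p + rc (t * cos al + q) * v), (p + rc (t * cos al - q) * v); split.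
  + split; last by apply: nex; rewrite gt_eqF // ltrDl.
    by right; left; exists (t * cos al + q) => //=; clear -q0 q2 tc; lin.
  + split; last by apply: nex; rewrite lt_eqF // gtrBl.
    by right; left; exists (t * cos al - q) => //=; clear -q0 q1 tct; lin.
  + by rewrite dist addrAC subrr add0r gtr0_norm.
  + by rewrite dist addrAC subrr add0r normrN gtr0_norm.
  + have imu (u : R) : imC ((p + rc (t * cos al + u) * v - a0) / (p + rc (t * cos al + u) * v - a1)) *
        (u ^+ 2 + (t * sin al) ^+ 2) = - (2 * u * (t * sin al)).
      by have := im (t * cos al + u); rewrite (_ : t * cos al + u - t * cos al = u) //; ring.
    split; first by rewrite -(pmulr_llt0 _ pos) imu oppr_lt0.
    by have := imu (- q); rewrite sqrrN => E; rewrite -(pmulr_lgt0 _ pos) E mulrN mulNr opprK.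
Qed.
End sector_separation.

(** * Components of sublevel sets and the levels at which they merge *)

Section ring_topology.
Context {R : realType}.
Local Notation C := (cplx R).
Implicit Types (f g : C -> C) (p q z w v : C) (A B D G N : set C).

Lemma connected_boundary G N a b : connected G -> open N -> G a -> N a -> G b -> ~ N b ->
  exists z, [/\ G z, closure N z & ~ N z].
Proof.
move=> cG oN Ga Na Gb nNb; apply: contrapT => h; apply: nNb.
apply: (connected_ind (P := N) cG) => //; first by exists a.
  by move=> z _ Nz; have [r r0 hr] := (openCP N).1 oN z Nz; exists r => // w _ /hr.
move=> z Gz hz; apply: contrapT => nNz; apply: h; exists z; split => //.
by apply/closureCP => e /hz[w [_ wz Nw]]; exists w.
Qed.

Lemma sublevel_comp_mono f (s t : R) z : s <= t -> nm (f z) < s ->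
  comp [set w | nm (f w) < s] z `<=` comp [set w | nm (f w) < t] z.
Proof.
move=> st zs; apply: comp_max; [exact: comp_refl| |exact: comp_conn].
by move=> w /comp_sub /= h; exact: lt_le_trans st.
Qed.

Lemma gt0_lb2 (x y : R) : 0 < x -> 0 < y -> exists2 q : R, 0 < q & q <= x /\ q <= y.
Proof. by move=> x0 y0; exists (Num.min x y); rewrite ?lt_min ?x0 // !ge_min !lexx orbT. Qed.

(* Strict differentiability at [p] makes [- f p / f' p] a descent direction of [|f|] uniformly near [p]. *)
Lemma descent f p : hol_on setT f -> f p != 0 -> dv f p != 0 ->
  exists rho sg v, [/\ 0 < rho, 0 < sg & forall z s, nm (z - p) < rho -> 0 < s <= sg ->
    nm (f (z + rc s * v)) < nm (f z)].
Proof.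
move=> hf fp dp; pose v := - f p / dv f p.
have hd := hol_dv (@openT C) hf.
have [M M0 hM] := compact_nm_bound (@cdisc_compact R p 2) (cont_on_sub (fun _ _ => I) (hol_cont hf)).
have f0 : 0 < nm (f p) by rewrite nm_gt0.
have v0 : 0 < nm v by rewrite nm_gt0 mulf_neq0 ?oppr_eq0 // invr_eq0.
have e1 : 0 < nm (f p) / 4 / nm v by rewrite !divr_gt0.
have e2 : 0 < nm (f p) / 4 by rewrite divr_gt0.
have [d1 d10 h1] := (hol_cont hd : cont_on setT _) p I _ e1.
have [d2 d20 h2] := (hol_cont hf : cont_on setT _) p I _ e2.
have [rho rho0 [rd1 rd2 rh]] : exists2 rho : R, 0 < rho & [/\ rho <= d1, rho <= d2 & rho <= 1 / 2].
  have [rho0 rho00 [r1 r2]] := gt0_lb2 d10 d20.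
  have half : 0 < 1 / 2 :> R by lin.
  have [rho rho0' [r3 r4]] := gt0_lb2 rho00 half.
  by exists rho => //; rewrite (le_trans r3 r1) (le_trans r3 r2).
have K0 : 0 < nm (f p) / 8 / (M * 2 * nm v ^+ 2).
  by rewrite divr_gt0 ?divr_gt0 ?mulr_gt0 ?exprn_gt0.
have k1 : 0 < 1 / 2 / nm v by rewrite divr_gt0.
have [sg sg0 [sK s1 sv]] : exists2 sg : R, 0 < sg & [/\ sg <= nm (f p) / 8 / (M * 2 * nm v ^+ 2), sg <= 1 & sg <= 1 / 2 / nm v].
  have [sg0 sg00 [s1 s2]] := gt0_lb2 K0 k1.
  have [sg sg0' [s3 s4]] := gt0_lb2 sg00 (ltr01 : 0 < 1 :> R).
  by exists sg => //; rewrite (le_trans s3 s1) (le_trans s3 s2).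
have zhalf z : nm (z - p) < rho -> nm (z - p) < 1 / 2 by move=> h; exact: lt_le_trans h rh.
exists rho, sg, v; split => // z s zp /andP[ss ssg].
have sK' := le_trans ssg sK; have s1' := le_trans ssg s1; have sv' := le_trans ssg sv.
have zp2 := zhalf z zp; have zd := lt_le_trans zp rd1; have zd2 := lt_le_trans zp rd2.
clear zhalf K0 k1 e1 e2 rh rd1 rd2 sK s1 sv ssg d10 d20 zp rho0 sg0.
pose h := rc s * v; have nh : nm h = s * nm v by rewrite nmM nm_rc gtr0_norm.
have nh2 : nm h <= 1 / 2 by rewrite nh -ler_pdivlMr.
(* Taylor estimate from the circle of radius 2 about [p]: as [nm (z - p)] and [nm h] are at most 1 /
   2, the denominator is at least 1. The bound chosen for [sg] supplies the factor 1 / 8. *)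
have nE : nm (f (z + h) - f z - dv f z * h) <= s * (nm (f p) / 8).
  apply: le_trans (@cauchy_taylor _ p 2 3 f z h M _ _ (hol_sub (fun _ _ => I) hf) _ _) _; rewrite ?ltr_nat //.
  - by move=> w wp; apply: hM; rewrite /cdisc /= wp.
  - lin.
  have den : 1 <= (2 - nm (z - p)) ^+ 2 * (2 - nm (z - p) - nm h).
    have a1 : 1 <= 2 - nm (z - p) by lin.
    by rewrite -[1]mulr1 ler_pM ?exprn_ege1 //; lin.
  have num : M * 2 * nm h ^+ 2 <= s * (nm (f p) / 8).
    move: sK'; rewrite ler_pdivlMr ?mulr_gt0 ?exprn_gt0 // => hs.
    have -> : M * 2 * nm h ^+ 2 = s * (s * (M * 2 * nm v ^+ 2)) by rewrite nh; ring.
    by rewrite ler_pM2l.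
  apply: le_trans num; rewrite ler_pdivrMr; last by lin.
  by rewrite ler_peMr // mulr_ge0 ?exprn_ge0 ?nm_ge0 // mulr_ge0 // ltW.
have dfz : nm (v * (dv f z - dv f p)) <= nm (f p) / 4.
  by have := h1 z I zd; rewrite ltr_pdivlMr // (nmM v) [nm v * _]mulrC => /ltW.
have fz : nm (f z - f p) < nm (f p) / 4 by exact: h2.
(* The errors beside (1 - s) f z add up to at most s (1/4 + 1/4 + 1/8) |f p|, and s |f z| is more
   than 3/4 s |f p|, so the modulus drops. *)
have E : f (z + h) = rc (1 - s) * f z + rc s * ((f z - f p) + v * (dv f z - dv f p)) + (f (z + h) - f z - dv f z * h).
  have dvv : v * dv f p = - f p by rewrite /v divfK.
  by rewrite mulrBr dvv rcB rc1 /h; ring.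
rewrite -/h E; apply: le_lt_trans (nmD _ _) _.
apply: le_lt_trans (lerD (nmD _ _) nE) _; rewrite !nmM !nm_rc ger0_norm ?subr_ge0 // ?gtr0_norm //.
have := nmB_ge' (f z) (f p) => fzp.
have : s * nm (f z - f p + v * (dv f z - dv f p)) <= s * (nm (f p) / 2).
  by rewrite ler_pM2l //; apply: le_trans (nmD _ _) _; lin.
have : s * (3 / 4 * nm (f p)) < s * nm (f z) by rewrite ltr_pM2l //; lin.
have : 0 < s * nm (f p) by rewrite mulr_gt0.
lin.
Qed.

Section level_sets.
Context (g : C -> C) (hg : hol_on setT g) (Rr : R) (z0 : C).
Let Om := comp [set z | nm (g z) < Rr] z0.
Context (bOm : bdd Om).

Lemma level_open : open Om. Proof. exact/comp_open/sublevel_open. Qed.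

Lemma level_lt z : Om z -> nm (g z) < Rr. Proof. by move/comp_sub. Qed.

Lemma level_compact (r : R) : r < Rr -> compact [set z | Om z /\ nm (g z) <= r].
Proof.
move=> rR; have [M M0 hM] := bOm; apply: (@closed_bounded_compact _ _ M); last by move=> z [/hM].
move=> z cz; have gz : nm (g z) <= r.
  rewrite leNgt; apply/negP => gr; have e0 : 0 < nm (g z) - r by lin.
  have [d d0 hd] := (rcont_nm (hol_cont hg) : rcont_on setT _) z I _ e0.
  have [w [_ wr] wz] := (closureCP _ _).1 cz d d0.
  by have := hd w I wz; rewrite ltr_norml; lin.
split => //; apply: comp_closure (sublevel_open hg) _ _; last by rewrite /=; lin.
by apply: closure_subset cz => w [].
Qed.

(* If the components of [y1] and [y2] merged at every level above [r], a frontier point of [N] of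
   least modulus on them would lie at level [r]. *)
Lemma separating_level (r : R) N y1 y2 : r < Rr -> open N ->
  (forall z, Om z -> nm (g z) <= r -> closure N z -> N z) ->
  Om y1 -> Om y2 -> nm (g y1) <= r -> nm (g y2) <= r -> N y1 -> ~ N y2 ->
  exists t, [/\ r < t, t < Rr & ~ comp [set z | nm (g z) < t] y1 y2].
Proof.
move=> rR oN sN O1 O2 g1 g2 N1 N2; apply: contrapT => hall.
have all t : r < t -> t < Rr -> comp [set z | nm (g z) < t] y1 y2.
  by move=> rt tR; apply: contrapT => h; apply: hall; exists t.
pose t0 := (r + Rr) / 2; have [rt0 t0R] : r < t0 /\ t0 < Rr by rewrite /t0; split; lin.
pose C0 := comp [set z | nm (g z) < t0] y1.
have C0Om : C0 `<=` [set z | Om z /\ nm (g z) <= t0].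
  move=> z Cz; split; last by apply: ltW; exact: (comp_sub Cz).
  apply: (comp_meet (comp_conn (G := [set z | nm (g z) < t0]) (z := y1)) _ _ O1 Cz) => [w /comp_sub /=|]; first by lin.
  by apply: comp_refl => /=; lin.
have kL := level_compact t0R.
have clC : closure C0 `<=` [set z | Om z /\ nm (g z) <= t0].
  have cl0 := compact_closedC kL.
  by rewrite [X in _ `<=` X](closure_id _).1 //; exact: closure_subset.
pose T := [set z | closure C0 z /\ closure N z /\ ~ N z].
have kT : compact T.
  apply: (subclosed_compact _ kL); last by move=> z [/clC].
  have -> : T = closure C0 `&` (closure N `&` ~` N) by [].
  by apply: closedI; [exact: closed_closure|apply: closedI; [exact: closed_closure|exact: open_closedC]].
have meet t : r < t -> t <= t0 -> exists2 z, T z & nm (g z) < t.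
  move=> rt tt; have c12 := all t rt ltac:(lin).
  have [|z [Cz nz Nz]] := connected_boundary (comp_conn (z := y1)) oN _ N1 c12 N2.
    by apply: comp_refl => /=; lin.
  exists z; last exact: (comp_sub Cz).
  split => //; apply: subset_closure; apply: sublevel_comp_mono Cz => //; lin.
have [z1 Tz1 _] := meet t0 rt0 (lexx _).
have [z Tz hz] := rcompact_min kT (ex_intro _ z1 Tz1) (rcont_nm (cont_on_sub (fun _ _ => I) (hol_cont hg))).
have gz : r < nm (g z).
  rewrite ltNge; apply/negP => gr; case: Tz => /clC[Oz _] [cz nz]; exact: nz (sN z Oz gr cz).
have [w Tw wz] : exists2 w, T w & nm (g w) < Num.min t0 (nm (g z)).
  by apply: meet; rewrite ?lt_min ?rt0 // ge_min lexx.
by have := hz w Tw; move: wz; rewrite lt_min => /andP[_]; lin.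
Qed.

(** The level is the infimum of those at which [y1] and [y2] are joined. A connection at level [t]
    is compact, so it persists at a lower level; hence the infimum itself does not join them. *)
Lemma merging_level (r : R) y1 y2 (t1 : R) : Om y1 -> Om y2 -> nm (g y1) <= r -> nm (g y2) <= r ->
  r < t1 -> ~ comp [set z | nm (g z) < t1] y1 y2 ->
  exists t, [/\ t1 <= t, t < Rr, ~ comp [set z | nm (g z) < t] y1 y2 &
    forall t', t < t' -> t' < Rr -> comp [set z | nm (g z) < t'] y1 y2].
Proof.
move=> O1 O2 g1 g2 rt1 n1.
have below t : r < t -> comp [set z | nm (g z) < t] y1 y2 -> exists t', [/\ r < t', t' < t & comp [set z | nm (g z) < t'] y1 y2].
  move=> rt c12; have y1t : nm (g y1) < t by lin.
  have oS := sublevel_open (s := t) hg.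
  have [B [kB cB BS B1 B2]] := path_linked (open_connected_path (comp_open (z := y1) oS) (comp_conn (z := y1)) (comp_refl (G := [set z | nm (g z) < t]) y1t) c12).
  have [z Bz hz] := rcompact_max kB (ex_intro _ y1 B1) (rcont_nm (cont_on_sub (fun _ _ => I) (hol_cont hg))).
  have gz : nm (g z) < t := comp_sub (BS z Bz).
  pose t' := Num.max ((r + t) / 2) ((nm (g z) + t) / 2); exists t'; split.
  - by rewrite lt_max; apply/orP; left; lin.
  - by rewrite gt_max; apply/andP; split; lin.
  have : B `<=` [set w | nm (g w) < t'].
    by move=> w /hz h /=; rewrite lt_max; apply/orP; right; lin.
  by move=> Bt; apply: (comp_max B1 Bt cB).
pose S := [set t | r < t /\ comp [set z | nm (g z) < t] y1 y2].
have y1R := level_lt O1.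
have cR : comp [set z | nm (g z) < Rr] y1 y2 by rewrite -(comp_eq O1).
have rR : r < Rr.
  rewrite ltNge; apply/negP => Rr1; apply: n1; apply: sublevel_comp_mono cR => //; lin.
have SR : S Rr by [].
have lb : lbound S t1.
  move=> t [rt ct]; rewrite leNgt; apply/negP => tt; apply: n1.
  by apply: sublevel_comp_mono ct; lin.
have hiS : has_inf S by split; [exists Rr|exists t1].
have t1i : t1 <= inf S by apply: lb_le_inf => //; exists Rr.
have nS : ~ comp [set z | nm (g z) < inf S] y1 y2.
  move=> /below[|t' [rt' t'i ct']]; first by lin.
  have : inf S <= t' by apply: ge_inf; [exact: hiS.2|].
  lin.
exists (inf S); split => //.
  rewrite lt_def; apply/andP; split; last by apply: ge_inf; [exact: hiS.2|].
  by apply/eqP => E; apply: nS; rewrite -E.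
move=> t' it' t'R; have e0 : 0 < t' - inf S by rewrite subr_gt0.
have [t [rt ct] tt] := inf_adherent e0 hiS.
by apply: sublevel_comp_mono ct; lin.
Qed.

(** At a regular point [p] of level [s] one descent vector pushes all nearby points of level at most
    [s] into the same small disc below [s]. So only one component accumulates at [p], and the
    closure of a component is open relative to the points of level at most [s]. *)
Lemma closure_sublevel_clopen (s : R) y p : s < Rr -> (forall z, Om z -> nm (g z) = s -> g z != 0 /\ dv g z != 0) ->
  Om y -> nm (g y) < s -> closure (comp [set z | nm (g z) < s] y) p ->
  exists2 rho, 0 < rho & forall z, Om z -> nm (g z) <= s -> nm (z - p) < rho ->
    closure (comp [set z | nm (g z) < s] y) z.
Proof.
move=> sR reg Oy ys; set S := [set z | nm (g z) < s]; set A := comp S y => cp.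
have oS : open S := sublevel_open hg.
have oA : open A := comp_open oS.
have AL : A `<=` [set z | Om z /\ nm (g z) <= s].
  move=> z Az; split; last by apply: ltW; exact: (comp_sub Az).
  apply: (comp_meet (comp_conn (G := S) (z := y)) _ _ Oy Az) => [w /comp_sub /=|]; first by rewrite /S /=; lin.
  exact: comp_refl.
have [Op gp] : Om p /\ nm (g p) <= s.
  have cl0 := compact_closedC (level_compact sR).
  by have := closure_subset AL cp; rewrite -(closure_id _).1.
have [gps|gps] := ltP (nm (g p)) s.
  have Ap : A p := comp_closure oS cp gps.
  have [rho rho0 hr] := (openCP A).1 oA p Ap; exists rho; first exact: rho0.
  by move=> z _ _ zp; apply: subset_closure; apply: hr.
have gpE : nm (g p) = s by lin.
have [gp0 dp0] := reg p Op gpE.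
have [rho [sg [v [rho0 sg0 hd]]]] := descent hg gp0 dp0.
have low z (u : R) : nm (z - p) < rho -> nm (g z) <= s -> 0 < u <= sg -> S (z + rc u * v).
  by move=> zp gz u0; apply: lt_le_trans gz; exact: hd.
have Sq : S (p + rc sg * v) by apply: low; rewrite ?subrr ?nm0 ?sg0 ?lexx.
have [eta eta0 he] := (openCP S).1 oS _ Sq.
have [rr rr0 [rr1 rr2]] := gt0_lb2 rho0 eta0.
have join z : S z -> nm (z - p) < rr -> comp S (p + rc sg * v) z.
  move=> Sz zp.
  have Dz : disc (p + rc sg * v) eta (z + rc sg * v).
    by rewrite /disc /= opprD addrACA subrr addr0; lin.
  have c1 : comp S (p + rc sg * v) (z + rc sg * v).
    by apply: (comp_max (disc_center _ eta0) he (convex_connected (@cvx_disc _ _ _))).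
  have cS : connected [set z + rc u * v | u in [set u : R | 0 <= u <= sg]].
    by apply: ray_image_connected => u u' q; exact: itv_convex.
  apply: (comp_meet cS _ _ c1).
  - move=> _ [u /= /andP[u0 us] <-]; have [->|un] := eqVneq u 0; first by rewrite rc0 mul0r addr0.
    by apply: low; rewrite ?lt_def ?un ?u0 ?us // ?ltW //; lin.
  - by exists sg => //=; rewrite lexx ltW.
  - by exists 0 => /=; rewrite ?lexx ?ltW // rc0 mul0r addr0.
have [w Aw wp] := (closureCP _ _).1 cp rr rr0.
have Aq : A (p + rc sg * v).
  have := join w (comp_sub Aw) wp => /comp_eq Eq.
  by rewrite /A (comp_eq Aw) -Eq; exact: comp_refl.
exists rr; first exact: rr0.
move=> z Oz gz zp; apply/closureCP => e e0.
have nv0 : 0 < 1 + nm v by have := nm_ge0 v; lin.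
have q0 : 0 < (rr - nm (z - p)) / (1 + nm v) by rewrite divr_gt0 //; lin.
have q1 : 0 < e / (1 + nm v) by rewrite divr_gt0.
have [u0 u00 [u1 u2]] := gt0_lb2 q0 q1; have [u uu [u3 u4]] := gt0_lb2 u00 sg0.
have un : u * nm v < rr - nm (z - p) /\ u * nm v < e.
  have : u <= (rr - nm (z - p)) / (1 + nm v) by lin.
  have : u <= e / (1 + nm v) by lin.
  by rewrite !ler_pdivlMr //; lin.
have nd : nm (z + rc u * v - z) = u * nm v by rewrite addrAC subrr add0r nmM nm_rc gtr0_norm.
have Sz : S (z + rc u * v) by apply: low => //; [lin|rewrite uu].
exists (z + rc u * v); last by rewrite nd; case: un.
rewrite /A (comp_eq Aq); apply: join => //.
by have := nmD3 z (z + rc u * v) p; lin.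
Qed.

(** If [N] separated the two points, they would merge first at a level [s > r]. There all points are
    regular, so the closure of the component of [y1] has a neighbourhood [N'] that still separates
    at level [s]; [separating_level] then separates slightly above [s], against the choice of
    [s]. *)
Lemma no_critical_no_separation (r : R) N y1 y2 : 0 <= r ->
  (forall z, Om z -> r < nm (g z) -> dv g z != 0) -> r < Rr -> open N ->
  (forall z, Om z -> nm (g z) <= r -> closure N z -> N z) ->
  Om y1 -> Om y2 -> nm (g y1) <= r -> nm (g y2) <= r -> N y1 -> N y2.
Proof.
move=> r0 reg rR oN sN O1 O2 g1 g2 N1; apply: contrapT => N2.
have [t1 [rt1 _ n1]] := separating_level rR oN sN O1 O2 g1 g2 N1 N2.
have [s [ts sR ns hs]] := merging_level O1 O2 g1 g2 rt1 n1.
have rs : r < s by lin.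
set S := [set z | nm (g z) < s] in ns *; set A := comp S y1.
have oS : open S := sublevel_open hg.
have y1s : nm (g y1) < s by lin.
have kL := level_compact sR.
have AL : closure A `<=` [set z | Om z /\ nm (g z) <= s].
  have cl0 := compact_closedC kL.
  rewrite [X in _ `<=` X](closure_id _).1 //; apply: closure_subset => z Az.
  split; last by apply: ltW; exact: (comp_sub Az).
  apply: (comp_meet (comp_conn (G := S) (z := y1)) _ _ O1 Az) => [w /comp_sub /=|]; first by rewrite /S /=; lin.
  exact: comp_refl.
have kA : compact (closure A) by apply: (subclosed_compact _ kL AL); exact: closed_closure.
have reg' z : Om z -> nm (g z) = s -> g z != 0 /\ dv g z != 0.
  by move=> Oz gz; split; [rewrite -nm_gt0; lin|apply: reg => //; lin].
have [eps eps0 he] : exists2 e : R, 0 < e & forall p, closure A p ->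
    forall z, Om z -> nm (g z) <= s -> nm (z - p) < e -> closure A z.
  apply: (compact_local (Q := fun p e => forall z, Om z -> nm (g z) <= s -> nm (z - p) < e -> closure A z)) => //.
    by move=> z e e' e'0 le h w Ow gw wz; apply: h => //; lin.
  move=> p cp; have [rho rho0 hr] := closure_sublevel_clopen sR reg' O1 y1s cp.
  exists (rho / 2); first by lin.
  by move=> w cw wp z Oz gz zw; apply: hr => //; have := nmD3 w z p; lin.
pose N' := [set z | exists2 a, closure A a & nm (z - a) < eps / 2].
have oN' : open N'.
  apply/openCP => z [a ca za]; exists (eps / 2 - nm (z - a)); first by lin.
  by move=> w; rewrite /disc /= => wz; exists a => //; have := nmD3 z w a; lin.
have sN' z : Om z -> nm (g z) <= s -> closure N' z -> N' z.
  move=> Oz gz /closureCP/(_ (eps / 2) ltac:(lin))[w [a ca wa] wz].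
  exists z; last by rewrite subrr nm0; lin.
  by apply: (he a ca z Oz gz); have := nmD3 w z a; have := nmBC w z; lin.
have n2 : ~ N' y2.
  have y2s : S y2 by rewrite /S /=; lin.
  move=> [a ca ya]; apply: ns; apply: (comp_closure oS _ y2s).
  by apply: (he a ca y2 O2); lin.
have n1' : N' y1.
  by exists y1; [apply: subset_closure; exact: comp_refl|rewrite subrr nm0; lin].
have [t [st tR nt]] := separating_level sR oN' sN' O1 O2 ltac:(lin) ltac:(lin) n1' n2.
exact: nt (hs t st tR).
Qed.

(** A bounded component of the complement of [E], the part of [Om] with |g| at most [r], would have
    |g| at most [r] by the maximum principle and touch [E] inside [Om], hence belong to [E]. So that
    complement is connected, and unicoherence gives its intersection with [Om]. *)
Lemma ring_connected (r : R) : r < Rr -> connected [set z | Om z /\ r < nm (g z)].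
Proof.
move=> rR; pose E := [set z | Om z /\ nm (g z) <= r].
have kE : compact E := level_compact rR.
have oE : open (~` E) by rewrite openC; exact: compact_closedC.
have -> : [set z | Om z /\ r < nm (g z)] = Om `&` ~` E.
  apply/seteqP; split=> z [Oz] => [gz|nE]; first by split => // -[_]; lin.
  by split => //; rewrite ltNge; apply/negP => gz; exact: nE.
have unb a : (~` E) a -> ~ bdd (comp (~` E) a).
  move=> Ea bD; pose D := comp (~` E) a; have oD : open D := comp_open oE.
  have low z : D z -> nm (g z) <= r.
    have [M M0 hM] := bD; apply: (max_modulus oD hM _ (hol_sub (fun _ _ => I) hg)).
      exact: cont_on_sub (hol_cont hg).
    move=> w cw nw; apply: contrapT => gw; apply: nw; apply: comp_closure => // -[_].
    exact: gw.
  have nO z : D z -> ~ Om z by move=> Dz Oz; exact: (comp_sub Dz) (conj Oz (low z Dz)).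
  have [M M0 hM] := bD.
  have [z [_ cz nz]] : exists z, [/\ setT z, closure D z & ~ D z].
    apply: (@connected_boundary setT D a (rc (M + 1))) => //; last 1 first.
    - by move=> /hM; rewrite nm_rc gtr0_norm; lin.
    - by have := convex_connected (S := @setT C); apply.
    - exact: comp_refl.
  have Ez : E z by apply: contrapT => nE; apply: nz; exact: comp_closure.
  have [d d0 hd] := (openCP Om).1 level_open z Ez.1.
  have [w Dw wz] := (closureCP _ _).1 cz d d0.
  by apply: (nO w Dw); exact: hd.
have cE : connected (~` E).
  have [[a Ea]|h] := pselect (exists a, (~` E) a).
    have -> : ~` E = comp (~` E) a.
      apply/seteqP; split=> [z Ez|z /comp_sub //].
      rewrite -(unbounded_comp_eq (compact_bdd kE) (unb z Ez) (unb a Ea)); exact: comp_refl.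
    exact: comp_conn.
  have -> : ~` E = set0 by apply/seteqP; split=> // z Ez; case: h; exists z.
  exact: connected0.
apply: plane_unicoherent => //; [exact: level_open|exact: comp_conn|].
by move=> z; have [Ez|Ez] := pselect (E z); [left; case: Ez|right].
Qed.

End level_sets.
End ring_topology.

(** * Components and quasi-components of compact Hausdorff spaces *)

Section quasi_components.

(** The intersection of all relatively clopen parts of [S] that contain [a] is connected: a
    splitting is thickened to disjoint open sets by normality, compactness finds a clopen part
    inside their union, and its trace on one of them is clopen again. *)
Lemma quasi_component (R : realType) (T : ptopologicalType) (S : set T) (a b : T) : hausdorff_space T -> compact [set: T] ->
  closed S -> S a -> S b -> ~ connected_component S a b ->
  exists P, [/\ closed P, closed (S `\` P), P `<=` S, P a & ~ P b].
Proof.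
move=> hT kT clS Sa Sb nab; apply: contrapT => hall; apply: nab.
pose Fam P := [/\ closed P, closed (S `\` P), P `<=` S & P a].
have FamS : Fam S by split => //; rewrite setDv; exact: closed0.
have FamI P Q : Fam P -> Fam Q -> Fam (P `&` Q).
  move=> [cP cSP PS Pa] [cQ cSQ QS Qa]; split => //; first exact: closedI.
    by rewrite setDIr; exact: closedU.
  by move=> x [/PS].
have bF P : Fam P -> P b by move=> [cP cSP PS Pa]; apply: contrapT => nb; apply: hall; exists P.
pose A := [set x | forall P, Fam P -> P x].
have AS : A `<=` S by move=> x /(_ S FamS).
have clA : closed A.
  have -> : A = \bigcap_(P in Fam) P by apply/seteqP; split => x h P /h.
  by apply: closed_bigI => P [].
have Aa : A a by move=> P [].
have split2 A1 A2 : closed A1 -> closed A2 -> A1 `&` A2 = set0 -> A `<=` A1 `|` A2 -> A1 a -> A `<=` A1.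
  move=> c1 c2 d12 A12 A1a.
  have [U1 [U2 [p1 p2 AO1 AO2 O12]]] := (@normal_openP R T).1 (compact_normal hT kT) A1 A2 c1 c2 d12.
  have [P FP PO] : exists2 P, Fam P & P `<=` U1 `|` U2.
    apply: contrapT => h.
    have ne P : Fam P -> (P `&` ~` (U1 `|` U2)) !=set0.
      move=> FP; apply: contrapT => e; apply: h; exists P => // x Px.
      by apply: contrapT => nx; apply: e; exists x.
    have FF : ProperFilter (filter_from Fam (fun P => P `&` ~` (U1 `|` U2))).
      apply: filter_from_proper => //; apply: filter_from_filter; first by exists S.
      move=> P Q FP FQ; exists (P `&` Q); first exact: FamI.
      by move=> x [[Px Qx] nx].
    have [x [_ cx]] := kT _ FF filterT.
    have inP P : Fam P -> (P `&` ~` (U1 `|` U2)) x.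
      move=> FP; have cl : closed (P `&` ~` (U1 `|` U2)).
        apply: closedI; first by case: FP.
        by apply: open_closedC; exact: openU.
      rewrite ((closure_id _).1 cl); move=> B nB; apply: cx => //.
      by exists P.
    have Ax : A x by move=> P /inP[].
    have [_ nx] := inP S FamS; apply: nx.
    by case: (A12 x Ax) => [/AO1|/AO2]; [left|right].
  have [cP cSP PS Pa] := FP.
  have FP1 : Fam (P `&` U1).
    split.
    - have -> : P `&` U1 = P `&` ~` U2.
        apply/seteqP; split=> x [Px h]; split => //.
          by move=> O2x; have : (U1 `&` U2) x by []; rewrite O12.
        by case: (PO x Px).
      by apply: closedI => //; exact: open_closedC.
    - have -> : S `\` (P `&` U1) = (S `\` P) `|` (P `&` ~` U1).
        apply/seteqP; split=> [x [Sx nx]|x [[Sx nP]|[Px nO]]].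
        + have [Px|nP] := pselect (P x); [right; split => // Ox; exact: nx|by left].
        + by split => // -[].
        + by split; [exact: PS|move=> []].
      by apply: closedU => //; apply: closedI => //; exact: open_closedC.
    - by move=> x [/PS].
    - by split => //; exact: AO1.
  move=> x Ax; case: (A12 x Ax) => // A2x.
  have [_ O1x] := Ax _ FP1.
  have : (U1 `&` U2) x by split => //; exact: AO2.
  by rewrite O12.
suff cA : connected A by apply: (connected_component_max Aa AS cA); move=> P /bF.
move=> B [x Bx] [D oD BD] [E cE BE].
have cB : closed B by rewrite BE; exact: closedI.
have cAB : closed (A `&` ~` D) by apply: closedI => //; exact: open_closedC.
have dis : B `&` (A `&` ~` D) = set0 by apply/seteqP; split=> // y; rewrite BD => -[[_ ?] []].
have cov : A `<=` B `|` (A `&` ~` D).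
  by move=> y Ay; have [Dy|nD] := pselect (D y); [left; rewrite BD|right].
have [Ba|nBa] := pselect (B a).
  apply/seteqP; split; first by rewrite BD => y [].
  exact: split2 cov Ba.
exfalso; have Aa' : (A `&` ~` D) a by case: (cov a Aa).
have sub : A `<=` A `&` ~` D by apply: (split2 _ B) => //; [rewrite setIC|rewrite setUC].
have Ax : A x by move: Bx; rewrite BD => -[].
by move: Bx (sub x Ax); rewrite BD => -[_ Dx] [].
Qed.

Lemma infinite_pick (T : choiceType) (X : set T) n : infinite_set X ->
  exists s : seq T, [/\ uniq s, size s = n & forall x, x \in s -> X x].
Proof.
move=> iX; elim: n => [|n [s [us ss sX]]]; first by exists [::].
have [x Xx xs] : exists2 x, X x & x \notin s.
  apply: contrapT => h; apply: iX; apply: (sub_finite_set _ (finite_seq s)) => x Xx /=.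
  by apply: contrapT => /negP xs; apply: h; exists x.
exists (x :: s); split => /=; rewrite ?us ?xs ?ss // => y; rewrite inE => /orP[/eqP->|/sX] //.
Qed.

Lemma counting_ge (R : realType) (T : choiceType) (X : set T) (n : nat) :
  (n%:R%:E <= (counting X : \bar R))%E <->
  exists s : seq T, [/\ uniq s, size s = n & forall x, x \in s -> X x].
Proof.
rewrite /counting; case: asboolP => fX; last by split=> _; [exact: infinite_pick|rewrite leey].
rewrite lee_fin ler_nat; split=> [nX|[s [us <- sX]]].
  exists (take n (finmap.enum_fset (fset_set X))); split.
  - exact/take_uniq/finmap.fset_uniq.
  - by rewrite size_takel.
  - by move=> x /mem_take; rewrite in_fset_set // inE.
apply: uniq_leq_size => // x /sX Xx.
by rewrite in_fset_set // inE.
Qed.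

End quasi_components.

(** * Clopen pieces of the complement and connectivity *)

Section holes.
Context {R : realType}.
Local Notation C := (cplx R).
Local Notation S2 := (one_point_compactification C).
Implicit Types (V Q : set C).

(* The components of a compact Hausdorff space are its quasi-components, so that [j] disjoint nonempty sets [Q]
   witness [j] bounded components of the complement of [V]. *)
Definition hole_clopen V Q := [/\ compact Q, forall z, Q z -> ~ V z & open (V `|` Q)].

Definition hole_family V (j : nat) := exists Q : nat -> set C,
  (forall i, (i < j)%N -> hole_clopen V (Q i) /\ Q i !=set0) /\
  forall i k z, (i < j)%N -> (k < j)%N -> Q i z -> Q k z -> i = k.

Lemma hole_clopenD V Q Q' : hole_clopen V Q -> hole_clopen V Q' -> hole_clopen V (Q `\` Q').
Proof.
move=> [kQ nQ oQ] [kQ' nQ' oQ']; split; first 2 last.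
- have -> : V `|` (Q `\` Q') = (V `|` Q) `&` ~` Q'.
    apply/seteqP; split=> [z [Vz|[Qz nz]]|z [[Vz|Qz] nz]]; try by [left|right].
      by split; [left|move=> /nQ'].
    by split; [right|].
  by apply: openI => //; apply: closed_openC; exact: compact_closedC.
- have -> : Q `\` Q' = Q `&` ~` (V `|` Q').
    apply/seteqP; split=> [z [Qz nz]|z [Qz nz]]; split => //; first by case=> // /(nQ z Qz).
    by move=> ?; apply: nz; right.
  by apply: compact_closedI => //; exact: open_closedC.
- by move=> z [/nQ].
Qed.

Lemma hole_clopenI V Q Q' : hole_clopen V Q -> hole_clopen V Q' -> hole_clopen V (Q `&` Q').
Proof.
by move=> h h'; rewrite -setDD; apply: hole_clopenD => //; exact: hole_clopenD.
Qed.

Lemma hole_family_le V i j : (i <= j)%N -> hole_family V j -> hole_family V i.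
Proof.
move=> ij [Q [h1 h2]]; exists Q; split=> [k ki|k l z ki li]; first by apply: h1; exact: leq_trans ij.
by apply: h2; exact: leq_trans ij.
Qed.

Lemma sphere_hausdorff : hausdorff_space S2.
Proof.
apply: one_point_compactification_hausdorff; last exact: hausC.
move=> z _; rewrite withinET; exists (cdisc z 1); last by split; [exact: (@cdisc_compact R z 1)|exact: (@cdisc_closed R z 1)].
by apply/nbhsCP; exists 1 => // w wz; exact: ltW.
Qed.

Lemma sphere_complement_closed V : open V -> closed (sphere_complement V : set S2).
Proof. by move=> oV; apply: open_closedC; exact: one_point_compactification_open_some. Qed.

(* A clopen part of the sphere complement missing the point at infinity is a [hole_clopen] set. *)
Lemma hole_clopenP V (P : set S2) : open V -> closed P -> closed (sphere_complement V `\` P) ->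
  P `<=` sphere_complement V -> ~ P None -> hole_clopen V [set z | P (Some z)].
Proof.
move=> oV cP cSP PS nN.
have opre (O : set S2) : open O -> open [set z : C | O (Some z)].
  by move=> oO; apply: (@open_comp _ _ (Some : C -> S2) O) => // z _; exact: one_point_compactification_some_continuous.
split.
- have oP : open (~` P) by rewrite openC.
  have : nbhs (None : S2) (~` P) by exact: open_nbhs_nbhs.
  case=> K [kK cK] KP; apply: (subclosed_compact _ kK).
    have -> : [set z | P (Some z)] = ~` [set z | (~` P) (Some z)].
      by apply/seteqP; split=> z /= h; [move=> /(_ h)|apply: contrapT].
    by apply: open_closedC; exact: opre.
  by move=> z Pz; apply: contrapT => nK; apply: (KP (Some z)) => //; left; exists z.
- by move=> z /PS nV Vz; apply: nV; exists z.
have -> : V `|` [set z | P (Some z)] = [set z | (~` (sphere_complement V `\` P)) (Some z)].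
  apply/seteqP; split=> [z [Vz|Pz] [nV nP]|z /= h]; first by apply: nV; exists z.
    exact: nP.
  have [Vz|nV] := pselect (V z); first by left.
  right; apply: contrapT => nP; apply: h; split => // -[w Vw [E]]; apply: nV.
  by rewrite -E.
by apply: opre; rewrite openC.
Qed.

(** The copy of [Q] in the sphere is relatively open because [V] together with [Q] is open, and
    closed because it is compact. A component that meets it stays in it. *)
Lemma hole_clopen_comp V Q z (x : S2) : open V -> hole_clopen V Q -> Q z ->
  connected_component (sphere_complement V) (Some z) x -> exists2 w, Q w & x = Some w.
Proof.
move=> oV [kQ nQ oQ] Qz cx; set K := connected_component _ _ in cx.
have zS : sphere_complement V (Some z) by move=> [w Vw [E]]; apply: (nQ z Qz); rewrite -E.
have KS : K `<=` sphere_complement V := @connected_component_sub _ _ _.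
have : (K `&` [set (Some w : S2) | w in Q]) = K.
  apply: (@component_connected _ (sphere_complement V) (Some z)).
  - by exists (Some z); split; [exact: connected_component_refl|exists z].
  - exists [set (Some w : S2) | w in V `|` Q]; first exact: one_point_compactification_open_some.
    apply/seteqP; split=> [y [Ky [w Qw E]]|y [Ky [w [Vw|Qw] E]]]; first by split; [exact: Ky|exists w => //; right].
    by exfalso; apply: (KS y Ky); exists w.
    by split; [exact: Ky|exists w].
  exists [set (Some w : S2) | w in Q] => //.
  apply: compact_closed; first exact: sphere_hausdorff.
  apply: continuous_compact => //; apply: continuous_subspaceT.
  exact: one_point_compactification_some_continuous.
by move=> E; move: cx; rewrite -E => -[_ [w Qw <-]]; exists w.
Qed.

Lemma comp_clopen_separation V (x y : S2) : open V -> sphere_complement V x -> sphere_complement V y ->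
  ~ connected_component (sphere_complement V) x y ->
  exists P, [/\ closed P, closed (sphere_complement V `\` P), P `<=` sphere_complement V, P x & ~ P y].
Proof.
move=> oV; apply: (@quasi_component R); [exact: sphere_hausdorff|exact: one_point_compactification_compact|].
exact: sphere_complement_closed.
Qed.

(** The shift by one is the component of the point at infinity, which no compact set [Q]
    contains. *)
Lemma connectivity_ge V (N : nat) : open V -> (N.+1%:R%:E <= connectivity V)%E <-> hole_family V N.
Proof.
move=> oV; rewrite /connectivity counting_ge; set S := sphere_complement V.
pose K x := connected_component S x.
have NS : S None by move=> [z].
split=> [[s [us ss sK]]|[Q [hQ dQ]]]; last first.
  have [a ha] : exists a : nat -> C, forall i, (i < N)%N -> Q i (a i).
    have h i : exists z, (i < N)%N -> Q i z.
      have [iN|iN] := ltnP i N; last by exists 0.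
      by have [_ [z Qz]] := hQ i iN; exists z.
    by exists (fun i => projT1 (cid (h i))) => i; case: cid.
  have aS i : (i < N)%N -> S (Some (a i)).
    move=> iN [w Vw [E]]; have [[_ nQ _] _] := hQ i iN.
    by apply: (nQ _ (ha i iN)); rewrite -E.
  have KE i x : (i < N)%N -> K (Some (a i)) x -> exists2 w, Q i w & x = Some w.
    by move=> iN; have [hc _] := hQ i iN; apply: hole_clopen_comp => //; exact: ha.
  exists (K None :: [seq K (Some (a i)) | i <- iota 0 N]); split.
  - rewrite cons_uniq; apply/andP; split.
      apply/negP => h0; have [k0] := elimT mapP h0; rewrite mem_iota add0n => /andP[_ iN] KNE.
      have : K (Some (a k0)) None by rewrite -KNE; exact: connected_component_refl.
      by move/(KE _ _ iN) => [].
    rewrite map_inj_in_uniq ?iota_uniq // => i k; rewrite !mem_iota !add0n => /andP[_ iN] /andP[_ kN] E.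
    have : K (Some (a i)) (Some (a k)) by rewrite E; apply: connected_component_refl; exact: aS.
    by move/(KE _ _ iN) => [w Qw [E']]; apply: (dQ i k w) => //; rewrite -E'; exact: ha.
  - by rewrite /= size_map size_iota.
  - move=> x; rewrite inE => /orP[/eqP->|h0]; first by exists None.
    have [k0] := elimT mapP h0; rewrite mem_iota add0n => /andP[_ iN] ->.
    by exists (Some (a k0)) => //; exact: aS.
pose s' := rem (K None) s.
have us' : uniq s' by exact: rem_uniq.
have ss' : (N <= size s')%N.
  rewrite /s'; have [h|h] := boolP (K None \in s); first by rewrite size_rem // ss.
  by rewrite rem_id // ss.
have nN : K None \notin s' by rewrite /s' mem_rem_uniq // inE eqxx.
have pick i : exists z, (i < N)%N -> S (Some z) /\ nth set0 s' i = K (Some z).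
  have [iN|iN] := ltnP i N; last by exists 0.
  have im : nth set0 s' i \in s' by apply: mem_nth; exact: leq_trans ss'.
  have [[z|] Sz zE] := sK _ (mem_rem im); first by exists z.
  by move: nN; rewrite /K zE im.
have [a ha] : exists a : nat -> C, forall i, (i < N)%N -> S (Some (a i)) /\ nth set0 s' i = K (Some (a i)).
  by exists (fun i => projT1 (cid (pick i))) => i; case: cid.
have diff i k : (i < N)%N -> (k < N)%N -> K (Some (a i)) (Some (a k)) -> i = k.
  move=> iN kN /(@same_connected_component _ S) E; apply/eqP.
  rewrite -(nth_uniq set0 _ _ us') ?(leq_trans _ ss') //.
  by rewrite (ha i iN).2 (ha k kN).2 /K E.
have diffN i : (i < N)%N -> ~ K (Some (a i)) None.
  move=> iN /(@same_connected_component _ S) E; move/negP: nN; apply.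
  have -> : K None = nth set0 s' i by rewrite (ha i iN).2 /K E.
  by apply: mem_nth; exact: leq_trans ss'.
(* [Q] separates [a i] from infinity and, when [k] is another valid index, also from [a k]. The
   implications make the choice total in [i] and [k]. *)
have sep i k : exists Q, [/\ (i < N)%N -> hole_clopen V Q, (i < N)%N -> Q (a i) &
    (i < N)%N -> (k < N)%N -> i <> k -> ~ Q (a k)].
  have [iN|iN] := ltnP i N; last by exists set0.
  have [P [cP cSP PS Pi nP]] := comp_clopen_separation oV (ha i iN).1 NS (diffN i iN).
  have h1 := hole_clopenP oV cP cSP PS nP.
  have [[kN ik]|nik] := pselect ((k < N)%N /\ i <> k); last first.
    by exists [set z | P (Some z)]; split => // _ kN ik; case: nik.
  have nd : ~ connected_component S (Some (a i)) (Some (a k)) by move=> /(diff i k iN kN).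
  have [P' [cP' cSP' PS' Pi' nP']] := comp_clopen_separation oV (ha i iN).1 (ha k kN).1 nd.
  exists [set z | (P `&` P') (Some z)]; split=> // [_|_ _ _ []//].
  apply: hole_clopenP => //; [exact: closedI|by rewrite setDIr; exact: closedU|by move=> x [/PS]|by move=> []].
pose q i k := projT1 (cid (sep i k)).
have qP i k := projT2 (cid (sep i k)).
(* Intersecting over [k] keeps only [a i] among the marked points; [D] then removes the earlier
   sets, which makes the family disjoint without losing any marked point. *)
pose P i := \big[setI/q i i]_(k < N) q i k.
pose D i := foldr (fun k X => X `\` P k) (P i) (iota 0 i).
have hP i : (i < N)%N -> hole_clopen V (P i).
  move=> iN; apply: (big_ind (hole_clopen V)) => [|X Y|k _]; first by case: (qP i i) => /(_ iN).
    exact: hole_clopenI.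
  by case: (qP i k) => /(_ iN).
have Pa i : (i < N)%N -> P i (a i).
  move=> iN; apply: (big_ind (fun X : set C => X (a i))) => [|X Y|k _]; first by case: (qP i i) => _ /(_ iN).
    by [].
  by case: (qP i k) => _ /(_ iN).
have nPa i k : (i < N)%N -> (k < N)%N -> i <> k -> ~ P i (a k).
  move=> iN kN ik; rewrite /P (bigD1 (Ordinal kN)) //= => -[+ _].
  by case: (qP i k) => _ _; apply.
have DP i z : D i z <-> P i z /\ forall k, (k < i)%N -> ~ P k z.
  rewrite /D; have : forall k, (k < i)%N <-> k \in iota 0 i by move=> k; rewrite mem_iota.
  move: (iota 0 i) => l hl; have {hl} -> : (forall k, (k < i)%N -> ~ P k z) <-> (forall k, k \in l -> ~ P k z).
    by split=> h k /hl; exact: h.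
  elim: l => [|k l IH] /=; first by split => [|[]].
  split=> [[/IH[Pz hz] nk]|[Pz hz]].
    by split=> // k'; rewrite inE => /orP[/eqP->//|]; exact: hz.
  split; last by apply: hz; rewrite mem_head.
  by apply/IH; split=> // k' kl; apply: hz; rewrite inE kl orbT.
exists D; split=> [i iN|i k z iN kN /DP[Pi hi] /DP[Pk hk]].
  split; last by exists (a i); apply/DP; split; [exact: Pa|move=> k ki; apply: nPa => //; [exact: ltn_trans iN|move=> E; move: ki; rewrite E ltnn]].
  rewrite /D; have : forall k, k \in iota 0 i -> (k < N)%N.
    by move=> k; rewrite mem_iota add0n => /ltn_trans; exact.
  elim: (iota 0 i) => [|k l IH] hl /=; first exact: hP.
  apply: hole_clopenD; first by apply: IH => k' kl; apply: hl; rewrite inE kl orbT.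
  by apply: hP; apply: hl; rewrite mem_head.
by have [/hk|/hi|] := ltngtP i k.
Qed.

End holes.

(** * Extending maps into a domain over the squares of a grid *)

Section extension.
Context {R : realType}.
Local Notation C := (cplx R).
Implicit Types (f g F : C -> C) (p a z w : C) (A B K G U : set C) (m n : int * int).

Lemma cont_on_paste A B f g : closed A -> closed B -> cont_on A f -> cont_on B g ->
  (forall z, A z -> B z -> f z = g z) ->
  cont_on (A `|` B) (fun z => if pselect (A z) then f z else g z).
Proof.
move=> cA cB fA gB fg z ABz e e0; pose h z := if pselect (A z) then f z else g z; rewrite -/(h z).
have hA x : A x -> h x = f x by exact: pif_true.
have hB x : B x -> h x = g x.
  by move=> Bx; rewrite /h; case: pselect => // Ax; exact: fg.
have far D x : closed D -> ~ D x -> exists2 r : R, 0 < r & forall w, D w -> ~ nm (w - x) < r.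
  by move=> cD nD; have [r r0 hr] := (openCP (~` D)).1 (closed_openC cD) x nD; exists r => // w Dw /hr.
have near D k : closed D -> cont_on D k -> (forall x, D x -> h x = k x) ->
    exists2 r : R, 0 < r & forall w, D w -> nm (w - z) < r -> nm (h w - h z) < e.
  move=> cD kD hD; have [Dz|nD] := pselect (D z); last first.
    by have [r r0 hr] := far D z cD nD; exists r => // w /hr.
  have [r r0 hr] := kD z Dz e e0; exists r => // w Dw wz.
  by rewrite (hD w Dw) (hD z Dz); exact: hr.
have [r1 r10 h1] := near A f cA fA hA; have [r2 r20 h2] := near B g cB gB hB.
have [r r0 [rr1 rr2]] := gt0_lb2 r10 r20; exists r => // w [Aw|Bw] wz.
  by apply: h1 => //; lin.
by apply: h2 => //; lin.
Qed.

Definition pcont (gam : R -> C) := forall (t e : R), 0 < e ->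
  exists2 d : R, 0 < d & forall s, `|s - t| < d -> nm (gam s - gam t) < e.

Lemma continuous_pcont (gam : R -> C) : continuous gam -> pcont gam.
Proof.
move=> cg t e e0; have : nbhs (gam t) (disc (gam t) e) by apply/nbhsCP; exists e.
move=> /cg/nbhs_ballP[d /= d0 hd]; exists d => // s st; apply: hd.
by rewrite /ball /= distrC.
Qed.

Lemma pcont_clamp (gam : R -> C) (b : R) : pcont gam -> pcont (fun t => gam (clamp (t - b))).
Proof.
move=> cg t e e0; have [d d0 hd] := cg (clamp (t - b)) e e0; exists d => // s st.
apply: hd; apply: le_lt_trans (clamp_lip _ _) _.
by rewrite (_ : s - b - (t - b) = s - t) //; ring.
Qed.

Lemma edge_extension U A f (x0 dx : C) u0 : open U -> connected U -> U u0 -> cont_on A f ->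
  (forall z, A z -> U (f z)) -> let E (t : R) := x0 + rc t * dx in
  (forall t, 0 <= t <= 1 -> A (E t)) \/ (forall t, 0 < t < 1 -> ~ A (E t)) ->
  exists gam : R -> C, [/\ pcont (fun t => gam (clamp t)), forall t, 0 <= t <= 1 -> U (gam t),
    forall t, 0 <= t <= 1 -> A (E t) -> gam t = f (E t) &
    gam 0 = (if pselect (A (E 0)) then f (E 0) else u0) /\
    gam 1 = (if pselect (A (E 1)) then f (E 1) else u0)].
Proof.
move=> oU cU Uu0 fA fU E [full|empty].
  have cl (t : R) : 0 <= clamp t <= 1 by rewrite clamp_ge0 clamp_le1.
  exists (fun t => f (E (clamp t))); split.
  - move=> t e e0; rewrite clamp_idem.
    have [d d0 hd] := fA (E (clamp t)) (full _ (cl t)) e e0.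
    have n0 : 0 < 1 + nm dx by have := nm_ge0 dx; lin.
    exists (d / (1 + nm dx)); first by rewrite divr_gt0.
    move=> s; rewrite ltr_pdivlMr // => st; rewrite clamp_idem; apply: hd; first exact: full.
    rewrite /E opprD addrACA subrr add0r -mulrBl -rcB nmM nm_rc.
    apply: le_lt_trans st; apply: ler_pM; rewrite ?nm_ge0 ?normr_ge0 ?clamp_lip //; lin.
  - by move=> t _; apply: fU; apply: full.
  - by move=> t t01 _; rewrite clampE.
  - by rewrite clamp0 clamp1; split; rewrite pif_true //; apply: full; rewrite ?lexx ?ler01.
pose b0 := if pselect (A (E 0)) then f (E 0) else u0; pose b1 := if pselect (A (E 1)) then f (E 1) else u0.
have U0 : U b0 by rewrite /b0; case: pselect => // A0; exact: fU.
have U1 : U b1 by rewrite /b1; case: pselect => // A1; exact: fU.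
have [gam [cg g0 g1 gU]] := open_connected_path oU cU U0 U1.
exists gam; split => //.
  have := pcont_clamp 0 (continuous_pcont cg).
  by move=> h t e /(h t)[d d0 hd]; exists d => // s /hd; rewrite !subr0.
move=> t /andP[t0 t1] At; have [t0E|n0] := eqVneq t 0.
  by rewrite t0E g0 /b0 pif_true // -t0E.
have [t1E|n1] := eqVneq t 1; first by rewrite t1E g1 /b1 pif_true // -t1E.
by case: (empty t) => //; rewrite !lt_def n0 t0 eq_sym n1.
Qed.

Lemma clamp_low (t : R) : t <= 0 -> clamp t = 0.
Proof. by move=> t0; rewrite /clamp min_l ?max_l //; lin. Qed.
Lemma clamp_high (t : R) : 1 <= t -> clamp t = 1.
Proof. by move=> t1; rewrite /clamp min_r // max_r. Qed.

(* In square coordinates [x, y], [1 + x + y (2 x - 1)] retracts the square onto the arc formed by the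
   left, bottom and right edges, parametrised by [0, 3]. *)
Lemma fill_square U A B f (p a : C) u0 : open U -> connected U -> U u0 -> closed A -> closed B -> a != 0 ->
  cont_on A f -> (forall z, A z -> U (f z)) -> let T (x y : R) := p + a * (rc x + iC * rc y) in
  (forall z, B z -> exists x y, [/\ 0 <= x <= 1, 0 <= y <= 1 & z = T x y]) ->
  (forall x y, 0 <= x <= 1 -> 0 <= y <= 1 -> A (T x y) -> [\/ x = 0, x = 1 | y = 0]) ->
  (forall y, 0 <= y <= 1 -> A (T 0 y)) \/ (forall y, 0 < y < 1 -> ~ A (T 0 y)) ->
  (forall x, 0 <= x <= 1 -> A (T x 0)) \/ (forall x, 0 < x < 1 -> ~ A (T x 0)) ->
  (forall y, 0 <= y <= 1 -> A (T 1 y)) \/ (forall y, 0 < y < 1 -> ~ A (T 1 y)) ->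
  exists F, [/\ cont_on (A `|` B) F, forall z, A z \/ B z -> U (F z) & forall z, A z -> F z = f z].
Proof.
move=> oU cU Uu0 clA clB a0 fA fU T hB h0 hl hb hr.
have TE x y : T x y = p + a * (rc x + iC * rc y) by [].
have EL (t : R) : (p + a * iC) + rc t * (- (a * iC)) = T 0 (1 - t) by rewrite TE rcB rc0 rc1; ring.
have EB (t : R) : p + rc t * a = T t 0 by rewrite TE rc0; ring.
have ER (t : R) : (p + a) + rc t * (a * iC) = T 1 t by rewrite TE rc1; ring.
have [|g0 [c0 U0 A0 [g00 g01]]] := @edge_extension U A f (p + a * iC) (- (a * iC)) u0 oU cU Uu0 fA fU.
  case: hl => h; [left|right] => t t01; rewrite EL; apply: h; move: t01 => /andP[]; rewrite ?subr_ge0 ?subr_gt0 => ? ?; lin.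
have [|g1 [c1 U1 A1 [g10 g11]]] := @edge_extension U A f p a u0 oU cU Uu0 fA fU.
  by case: hb => h; [left|right] => t t01; rewrite EB; apply: h.
have [|g2 [c2 U2 A2 [g20 g21]]] := @edge_extension U A f (p + a) (a * iC) u0 oU cU Uu0 fA fU.
  by case: hr => h; [left|right] => t t01; rewrite ER; apply: h.
rewrite EL subrr in g01; rewrite EB in g10; rewrite EB in g11; rewrite ER in g20.
have j1 : g0 1 = g1 0 by rewrite g01 g10.
have j2 : g1 1 = g2 0 by rewrite g11 g20.
pose gam (s : R) := g0 (clamp s) + (g1 (clamp (s - 1)) - g1 0) + (g2 (clamp (s - 2)) - g2 0).
have gam0 s : s <= 1 -> gam s = g0 (clamp s).
  by move=> s1; rewrite /gam (@clamp_low (s - 1)) ?(@clamp_low (s - 2)); [ring|lin|lin].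
have gam1 s : 1 <= s <= 2 -> gam s = g1 (clamp (s - 1)).
  by move=> s1; rewrite /gam (@clamp_high s) ?(@clamp_low (s - 2)); [rewrite j1; ring|lin|lin].
have gam2 s : 2 <= s -> gam s = g2 (clamp (s - 2)).
  by move=> s1; rewrite /gam (@clamp_high s) ?(@clamp_high (s - 1)); [rewrite j1 j2; ring|lin|lin].
have cl (t : R) : 0 <= clamp t <= 1 by rewrite clamp_ge0 clamp_le1.
have Ugam s : U (gam s).
  have [s1|s1] := lerP s 1; first by rewrite gam0 //; apply: U0.
  have [s2|s2] := lerP s 2; first by rewrite gam1; [apply: U1|lin].
  by rewrite gam2; [apply: U2|lin].
have cgam : pcont gam.
  have sh (q : R -> C) (b : R) : pcont (fun t => q (clamp t)) -> pcont (fun t => q (clamp (t - b))).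
    move=> cg t e e0; have [d d0 hd] := cg (t - b) e e0; exists d => // s st; apply: hd.
    by rewrite (_ : s - b - (t - b) = s - t) //; ring.
  move=> t e e0; have e3 : 0 < e / 3 by lin.
  have [d0 d00 h0'] := c0 t _ e3; have [d1 d10 h1'] := sh _ 1 c1 t _ e3; have [d2 d20 h2'] := sh _ 2 c2 t _ e3.
  have [d3 d30 [k1 k2]] := gt0_lb2 d00 d10; have [d d4 [k3 k4]] := gt0_lb2 d30 d20.
  exists d => // s st; have {}h0' := h0' s ltac:(lin); have {}h1' := h1' s ltac:(lin); have {}h2' := h2' s ltac:(lin).
  rewrite /gam (_ : _ - _ = (g0 (clamp s) - g0 (clamp t)) + (g1 (clamp (s - 1)) - g1 (clamp (t - 1))) +
    (g2 (clamp (s - 2)) - g2 (clamp (t - 2)))); last by ring.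
  by apply: le_lt_trans (nmD _ _) _; have := nmD (g0 (clamp s) - g0 (clamp t)) (g1 (clamp (s - 1)) - g1 (clamp (t - 1))); lin.
pose X z := reC ((z - p) / a); pose Y z := imC ((z - p) / a).
pose phi z := 1 + X z + Y z * (2 * X z - 1).
have XT x y : X (T x y) = x /\ Y (T x y) = y.
  rewrite /X /Y TE addrAC subrr add0r mulrAC divff // mul1r !reD !imD !reM !imM re_iC im_iC !re_rc !im_rc; split; ring.
have cdiv : cont_on B (fun z => (z - p) / a).
  move=> z _ e e0; have na : 0 < nm a by rewrite nm_gt0.
  exists (e * nm a); first by rewrite mulr_gt0.
  by move=> w _ wz; rewrite -mulrBl opprB addrA subrK nmM nmV ltr_pdivrMr.
have cG : cont_on B (fun z => gam (phi z)).
  have cX : cont_on B (fun z => rc (X z)).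
    by move=> z Bz e e0; have [d d0 hd] := rcont_re cdiv Bz e0; exists d => // w Bw wz; rewrite -rcB nm_rc; exact: hd.
  have cY : cont_on B (fun z => rc (Y z)).
    by move=> z Bz e e0; have [d d0 hd] := rcont_im cdiv Bz e0; exists d => // w Bw wz; rewrite -rcB nm_rc; exact: hd.
  have cphi : cont_on B (fun z => rc (phi z)).
    apply: (cont_on_ext (g := fun z => 1 + rc (X z) + rc (Y z) * (2 * rc (X z) + (-1)))).
      by move=> z _; rewrite /phi !rcD rcM rcB rcM rc1 -rcn.
    apply: cont_on_add; first by apply: cont_on_add => //; exact: cont_on_cst.
    apply: cont_on_mul => //; apply: cont_on_add; last exact: cont_on_cst.
    by apply: cont_on_mul => //; exact: cont_on_cst.
  move=> z Bz e e0; have [d d0 hd] := cgam (phi z) e e0.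
  have [r r0 hr'] := cphi z Bz d d0; exists r => // w Bw wz; apply: hd.
  by have := hr' w Bw wz; rewrite -rcB nm_rc.
exists (fun z => if pselect (A z) then f z else gam (phi z)); split.
- apply: cont_on_paste => // z Az Bz; have [x [y [x01 y01 zE]]] := hB z Bz.
  have [/andP[x0 x1] /andP[y0 y1]] := (x01, y01).
  move: Az; rewrite zE => AT; have [E1 E2] := XT x y; rewrite /phi E1 E2.
  have := h0 x y x01 y01 AT; case=> E; subst.
  + rewrite (_ : 1 + 0 + y * (2 * 0 - 1) = 1 - y); last by ring.
    have AE : A (p + a * iC + rc (1 - y) * - (a * iC)) by rewrite EL subKr.
    rewrite gam0 ?clampE; [|lin|lin]; rewrite A0 //; last by lin.
    by rewrite EL subKr.
  + rewrite (_ : 1 + 1 + y * (2 * 1 - 1) = y + 2); last by ring.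
    have AE : A (p + a + rc y * (a * iC)) by rewrite ER.
    rewrite gam2; last by lin.
    by rewrite addrK clampE // A2 // ER.
  + rewrite mul0r addr0 [1 + x]addrC gam1; last by lin.
    by rewrite addrK clampE // A1 // EB.
- by move=> z _; have [Az|nAz] := pselect (A z); [rewrite pif_true //; exact: fU|rewrite pif_false //; exact: Ugam].
- by move=> z Az; exact: pif_true.
Qed.

Definition sq (d : R) m : set C :=
  [set z | `|reC z - d * m.1%:~R| <= d / 2 /\ `|imC z - d * m.2%:~R| <= d / 2].
Definition grid (d : R) (L : seq (int * int)) : set C := [set z | exists2 m, m \in L & sq d m z].

Lemma sq_closed d m : closed (sq d m).
Proof.
move=> z /closureCP cz; split; apply/ler_addgt0Pr => e e0; have [w [w1 w2] wz] := cz e e0.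
  have := re_le_nm (w - z); rewrite reB; move: w1; rewrite !ler_norml; lin.
have := im_le_nm (w - z); rewrite imB; move: w2; rewrite !ler_norml; lin.
Qed.

Lemma grid_cons d m L : grid d (m :: L) = sq d m `|` grid d L.
Proof.
apply/seteqP; split=> [z [n]|z [mz|[n nL nz]]]; first by rewrite inE => /orP[/eqP->|nL] nz; [left|right; exists n].
  by exists m; rewrite ?mem_head.
by exists n; rewrite ?inE ?nL ?orbT.
Qed.

Lemma grid_closed d L : closed (grid d L).
Proof.
elim: L => [|m L IH]; last by rewrite grid_cons; apply: closedU => //; exact: sq_closed.
have -> : grid d [::] = set0 by apply/seteqP; split=> z // [].
exact: closed0.
Qed.

Lemma sq_diam d m z w : sq d m z -> sq d m w -> nm (w - z) <= 2 * d.
Proof.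
move=> [z1 z2] [w1 w2]; apply: le_trans (nm_le_reim _) _; rewrite reB imB.
have a1 : `|reC w - reC z| <= d by move: z1 w1; rewrite !ler_norml; lin.
have a2 : `|imC w - imC z| <= d by move: z2 w2; rewrite !ler_norml; lin.
lin.
Qed.

Lemma sq_compact d m : compact (sq d m).
Proof.
apply: (@closed_bounded_compact _ _ (`|d * m.1%:~R| + `|d * m.2%:~R| + `|d|)); first exact: sq_closed.
move=> z [z1 z2]; apply: le_trans (nm_le_reim _) _.
have d0 : 0 <= d by have := normr_ge0 (reC z - d * m.1%:~R); lin.
have := ler_normD (reC z - d * m.1%:~R) (d * m.1%:~R); rewrite subrK.
by have := ler_normD (imC z - d * m.2%:~R) (d * m.2%:~R); rewrite subrK [`|d|]ger0_norm //; lin.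
Qed.

Lemma grid_compact d L : compact (grid d L).
Proof.
elim: L => [|m L IH]; last by rewrite grid_cons; apply: compactU => //; exact: sq_compact.
have -> : grid d [::] = set0 by apply/seteqP; split=> z // [].
exact: compact0.
Qed.

Lemma near_int (x : R) (k : int) : 0 <= x <= 1 -> `|x - 1 / 2 - k%:~R| <= 1 / 2 ->
  [\/ k = 0, k = 1 /\ x = 1 | k = -1 /\ x = 0].
Proof.
rewrite ler_norml => x01 hk.
have k1 : k <= 1 by rewrite -(ler_int R); lin.
have k2 : -1 <= k by rewrite -(ler_int R) mulrN1z; lin.
case: k k1 k2 hk => [[|[|n]]|[|n]] // _ _ hk; first by constructor 1.
  by constructor 2; split => //; lin.
by constructor 3; split => //; move: hk; rewrite NegzE mulrN1z; lin.
Qed.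

Definition step (v : int * int) := v \in [:: (1, 0); (0, 1); (-1, 0); (0, -1)].

(** The origin of the frame in which [sq d t] is the unit square: its points are
    [corner + axis * (x + iy)] with x, y in [0, 1], and y grows in the direction [v]. *)
Definition corner (d : R) (t v : int * int) : C :=
  rc d * (rc t.1%:~R + iC * rc t.2%:~R) - rc d * (rc v.2%:~R - iC * rc v.1%:~R) * ((1 + iC) / 2).
Definition axis (d : R) (v : int * int) : C := rc d * (rc v.2%:~R - iC * rc v.1%:~R).
(* Position of the square [m] in the frame centred at [t] whose second axis is [v]. *)
Definition rel (t v m : int * int) : int * int :=
  (v.2 * (m.1 - t.1) - v.1 * (m.2 - t.2), v.1 * (m.1 - t.1) + v.2 * (m.2 - t.2)).

Lemma sq_frame d t v m (x y : R) : 0 < d -> step v ->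
  sq d m (corner d t v + axis d v * (rc x + iC * rc y)) <->
  `|x - 1 / 2 - (rel t v m).1%:~R| <= 1 / 2 /\ `|y - 1 / 2 - (rel t v m).2%:~R| <= 1 / 2.
Proof.
move=> d0 sv; set z := _ + _.
have half : 2^-1 = rc 2^-1 :> C by rewrite rcV -rcn.
have zE : z = rc d * ((rc t.1%:~R + iC * rc t.2%:~R) + (rc v.2%:~R - iC * rc v.1%:~R) * (rc (x - 1 / 2) + iC * rc (y - 1 / 2))).
  by rewrite /z /corner /axis half !rcB div1r; ring.
have reE : reC z = d * (t.1%:~R + v.2%:~R * (x - 1 / 2) + v.1%:~R * (y - 1 / 2)).
  rewrite zE; do !rewrite (reM, imM, reD, imD, reN, imN, re_iC, im_iC, re_rc, im_rc); ring.
have imE : imC z = d * (t.2%:~R + v.2%:~R * (y - 1 / 2) - v.1%:~R * (x - 1 / 2)).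
  rewrite zE; do !rewrite (reM, imM, reD, imD, reN, imN, re_iC, im_iC, re_rc, im_rc); ring.
have sc (q : R) k : (`|d * q - d * k%:~R| <= d / 2) = (`|q - k%:~R| <= 1 / 2).
  by rewrite -mulrBr normrM gtr0_norm // -[d / 2]/(d * 2^-1) ler_pM2l // div1r.
rewrite -[sq d m z]/(`|reC z - d * m.1%:~R| <= d / 2 /\ `|imC z - d * m.2%:~R| <= d / 2) reE imE !sc /rel /=.
move: sv; rewrite /step !inE => /or4P[] /eqP -> /=; rewrite ?mul0r ?mul1r ?mulN1r ?add0r ?addr0 ?sub0r ?subr0 ?opprK ?mulrN1z ?rmorphN /= ?rmorphB /= ?mulr0z ?mulr1z !ler_norml; split=> -[]; lin.
Qed.

(** The neighbour of [t] in the direction [v] is absent, so in the frame of [v] the top edge is free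
    and the other three edges are each either wholly covered or free inside; this is the situation
    of [fill_square]. *)
Lemma fill_step U d L t v f u0 : 0 < d -> open U -> connected U -> U u0 -> step v -> t \notin L ->
  (t.1 + v.1, t.2 + v.2) \notin L -> cont_on (grid d L) f -> (forall z, grid d L z -> U (f z)) ->
  exists F, [/\ cont_on (grid d (t :: L)) F, forall z, grid d (t :: L) z -> U (F z) & forall z, grid d L z -> F z = f z].
Proof.
move=> d0 oU cU Uu0 sv tL vL cf fU.
have va : axis d v != 0.
  apply: mulf_neq0; first by rewrite rc_eq0 gt_eqF.
  rewrite -nm_eq0 -sqrf_eq0 nm_sqr reB imB reM imM re_iC im_iC !re_rc !im_rc.
  move: sv; rewrite /step !inE => /or4P[] /eqP -> /=; rewrite ?mulr0z ?mulr1z ?mulrN1z; apply/eqP; lin.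
have sqt : rel t v t = (0, 0) by rewrite /rel !subrr !mulr0 ?subrr ?addr0.
have relv m : rel t v m = (0, 0) -> m = t.
  move: sv; rewrite /step !inE => /or4P[] /eqP ->; case: m t {tL vL sqt} => m1 m2 [t1 t2]; rewrite /rel /= => -[];
    rewrite ?mul0r ?mul1r ?mulN1r ?add0r ?addr0 ?sub0r ?subr0 ?opprK ?opprB => h1 h2; congr pair; apply/eqP; rewrite -subr_eq0; apply/eqP;
    by [|rewrite -opprB ?h1 ?h2 oppr0].
have rel1 m : rel t v m = (0, 1) -> m = (t.1 + v.1, t.2 + v.2).
  move: sv; rewrite /step !inE => /or4P[] /eqP ->; case: m t {tL vL sqt relv} => m1 m2 [t1 t2]; rewrite /rel /= => -[];
    rewrite ?mul0r ?mul1r ?mulN1r ?add0r ?addr0 ?sub0r ?subr0 ?opprK ?opprB => h1 h2; congr pair; lin.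
have nrel m : m \in L -> rel t v m <> (0, 0) /\ rel t v m <> (0, 1).
  by move=> mL; split=> [/relv|/rel1] E; move: mL; rewrite E; [rewrite (negbTE tL)|rewrite (negbTE vL)].
have frame (x y : R) := sq_frame t _ x y d0 sv.
have one : 0 <= (0 : R) <= 1 /\ 0 <= (1 : R) <= 1 by lin.
have grd m (x y : R) : m \in L -> `|x - 1 / 2 - (rel t v m).1%:~R| <= 1 / 2 -> `|y - 1 / 2 - (rel t v m).2%:~R| <= 1 / 2 ->
    grid d L (corner d t v + axis d v * (rc x + iC * rc y)).
  by move=> mL hx hy; exists m => //; apply/frame.
have [|||||F [cF FU Ff]] := @fill_square U (grid d L) (sq d t) f (corner d t v) (axis d v) u0 oU cU Uu0 (grid_closed (L := L)) (sq_closed (m := t)) va cf fU.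
- move=> z zt; pose q := (z - corner d t v) / axis d v; exists (reC q), (imC q).
  have E : z = corner d t v + axis d v * (rc (reC q) + iC * rc (imC q)).
    by rewrite -reimE /q mulrC divfK // addrC subrK.
  have := (frame t (reC q) (imC q)).1; rewrite -E sqt /= => /(_ zt); rewrite !ler_norml; split => //; lin.
- move=> x y x01 y01 [m mL /frame[hx hy]]; have [n0 n1] := nrel m mL.
  have [ex|[ex xE]|[ex xE]] := near_int x01 hx; [|by constructor 2|by constructor 1].
  have [ey|[ey yE]|[ey yE]] := near_int y01 hy; last by constructor 3.
    by case: n0; rewrite (surjective_pairing (rel t v m)) ex ey.
  by case: n1; rewrite (surjective_pairing (rel t v m)) ex ey.
- have [[y0 [y01 [m mL /frame[hx hy]]]]|h] := pselect (exists y : R, 0 < y < 1 /\ grid d L (corner d t v + axis d v * (rc 0 + iC * rc y))).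
    left=> y y1; apply: (grd m) => //; have [n0 n1] := nrel m mL.
    have y0' : 0 <= y0 <= 1 by lin.
    have [ey|[_ yE]|[_ yE]] := near_int y0' hy; [rewrite ey ler_norml; lin|lin|lin].
  by right=> y y01 hy; apply: h; exists y.
- have [[x0 [x01 [m mL /frame[hx hy]]]]|h] := pselect (exists x : R, 0 < x < 1 /\ grid d L (corner d t v + axis d v * (rc x + iC * rc 0))).
    left=> x x1; apply: (grd m) => //; have [n0 n1] := nrel m mL.
    have x0' : 0 <= x0 <= 1 by lin.
    have [ex|[_ xE]|[_ xE]] := near_int x0' hx; [rewrite ex ler_norml; lin|lin|lin].
  by right=> x x01 hx; apply: h; exists x.
- have [[y0 [y01 [m mL /frame[hx hy]]]]|h] := pselect (exists y : R, 0 < y < 1 /\ grid d L (corner d t v + axis d v * (rc 1 + iC * rc y))).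
    left=> y y1; apply: (grd m) => //; have [n0 n1] := nrel m mL.
    have y0' : 0 <= y0 <= 1 by lin.
    have [ey|[_ yE]|[_ yE]] := near_int y0' hy; [rewrite ey ler_norml; lin|lin|lin].
  by right=> y y01 hy; apply: h; exists y.
exists F; split => //.
- by rewrite grid_cons setUC.
- by move=> z; rewrite grid_cons => -[zt|zL]; apply: FU; [right|left].
Qed.

(* The squares are removed starting from the last one, each having an edge outside the box or on a square removed
   before it. *)
Fixpoint peel (bx ky : pred (int * int)) (l : seq (int * int)) : Prop :=
  if l is t :: l' then [/\ bx t, ~~ ky t, t \notin l',
      exists2 v, step v & ~~ bx (t.1 + v.1, t.2 + v.2) \/ (t.1 + v.1, t.2 + v.2) \in l' & peel bx ky l']
  else True.

Lemma peel_uniq bx ky l : peel bx ky l -> uniq l /\ forall m, m \in l -> bx m /\ ~~ ky m.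
Proof.
elim: l => [|t l IH] //= [Bt Kt tl _ /IH[ul hl]]; split; first by rewrite tl.
by move=> m; rewrite inE => /orP[/eqP->|/hl].
Qed.

Lemma peel_maximal (b : seq (int * int)) ky : exists2 l, peel (mem b) ky l & forall t, ~ peel (mem b) ky (t :: l).
Proof.
apply: contrapT => h.
have ext l : peel (mem b) ky l -> exists t, peel (mem b) ky (t :: l).
  by move=> pl; apply: contrapT => nt; apply: h; exists l => // t pt; apply: nt; exists t.
have [l [pl sl]] : exists l, peel (mem b) ky l /\ size l = (size b).+1.
  elim: (size b).+1 => [|n [l [/ext[t pt] sl]]]; first by exists [::].
  by exists (t :: l); split=> //=; rewrite sl.
have [ul hl] := peel_uniq pl.
have := uniq_leq_size ul (fun m ml => (hl m ml).1 : m \in b); by rewrite sl ltnn.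
Qed.

(** The squares are put back in the opposite order. The head of the list was removed last, and when
    it returns, its edge towards [v] is still free. *)
Lemma peel_extension U (d : R) (b : seq (int * int)) ky (l : seq (int * int)) f u0 : 0 < d -> open U -> connected U -> U u0 -> peel (mem b) ky l ->
  cont_on (grid d [seq m <- b | m \notin l]) f -> (forall z, grid d [seq m <- b | m \notin l] z -> U (f z)) ->
  exists F, [/\ cont_on (grid d b) F, forall z, grid d b z -> U (F z) &
    forall z, grid d [seq m <- b | m \notin l] z -> F z = f z].
Proof.
move=> d0 oU cU Uu0; elim: l f => [|t l IH] f /=.
  have -> : [seq m <- b | m \notin [::]] = b by apply/all_filterP/allP.
  by move=> _ cf fU; exists f.
move=> [bt Kt tl [v sv nv] pl] cf fU; set L := [seq _ <- _ | _] in cf fU *.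
have tL : t \notin L by rewrite mem_filter inE eqxx.
have vL : (t.1 + v.1, t.2 + v.2) \notin L.
  rewrite mem_filter; case: nv => [/negbTE->|xl]; first by rewrite andbF.
  by rewrite inE xl orbT.
have [F [cF FU Ff]] := fill_step d0 oU cU Uu0 sv tL vL cf fU.
have E : grid d (t :: L) = grid d [seq m <- b | m \notin l].
  apply/seteqP; split=> z [m mL mz]; exists m => //; move: mL; rewrite inE !mem_filter inE.
    by case/orP => [/eqP->|/andP[/norP[_ ->] ->]//]; rewrite tl.
  by case/andP=> nl ->; rewrite (negbTE nl) orbF andbT; case: (m == t).
rewrite E in cF FU; have [F' [cF' FU' F'F]] := IH F pl cF FU.
exists F'; split => // z zL; rewrite F'F ?Ff // -E grid_cons; by right.
Qed.

End extension.

(** * Domains whose compact subsets enclose nothing outside are simply connected *)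

Section hole_free.
Context {R : realType}.
Local Notation C := (cplx R).
Implicit Types (f g F : C -> C) (z w : C) (A B K U : set C) (m n : int * int).

Lemma round_int (d x : R) : 0 < d -> exists k : int, `|x - d * k%:~R| <= d / 2.
Proof.
move=> d0; pose k := Num.floor (x / d + 1 / 2); exists k.
have /andP[k1 k2] : k%:~R <= x / d + 1 / 2 < (k + 1)%:~R by rewrite Num.Theory.floor_le_tmp // Num.Theory.floorD1_gt.
have E : x = d * (x / d) by rewrite mulrC divfK // gt_eqF.
rewrite {1}E -mulrBr normrM gtr0_norm // ler_pM2l //; move: k2; rewrite rmorphD /= ler_norml; lin.
Qed.

Lemma int_box (N : nat) : exists b : seq (int * int), forall m,
  `|m.1%:~R| <= N%:R :> R -> `|m.2%:~R| <= N%:R :> R -> m \in b.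
Proof.
pose L : seq int := [seq i%:Z | i <- iota 0 N.+1] ++ [seq - i%:Z | i <- iota 0 N.+1].
have inL (k : int) : `|k%:~R| <= N%:R :> R -> k \in L.
  rewrite -intr_norm -[N%:R]/(N%:Z%:~R) ler_int => kN; rewrite mem_cat.
  case: k kN => k kN.
    by apply/orP; left; apply/mapP; exists k => //; rewrite mem_iota add0n ltnS.
  by apply/orP; right; apply/mapP; exists k.+1; rewrite ?NegzE // mem_iota add0n ltnS.
exists [seq (i, j) | i <- L, j <- L] => m h1 h2; apply/allpairsP; exists m.
by split; [exact: inL|exact: inL|case: m {h1 h2}].
Qed.

Lemma grid_cover (d M : R) : 0 < d -> exists b : seq (int * int), forall z m, nm z <= M -> sq d m z -> m \in b.
Proof.
move=> d0; pose N := `|Num.ceil (`|M| / d + 1)|%N.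
have NM : `|M| / d + 1 <= N%:R.
  apply: le_trans (Num.Theory.ceil_ge _) _; rewrite -[N%:R]/(N%:Z%:~R) ler_int /N abszE; exact: ler_norm.
have [b hb] := int_box N; exists b => z m zM [h1 h2].
have bd (x : R) (k : int) : `|x| <= nm z -> `|x - d * k%:~R| <= d / 2 -> `|k%:~R| <= N%:R :> R.
  move=> xz h; apply: le_trans NM; rewrite -(ler_pM2l d0) mulrDr mulrCA divff ?gt_eqF // !mulr1.
  rewrite -{1}(gtr0_norm d0) -normrM; have := ler_normD (d * k%:~R - x) x; rewrite subrK distrC.
  have := ler_norm M; lin.
by apply: hb; [apply: bd h1; exact: re_le_nm|apply: bd h2; exact: im_le_nm].
Qed.

Lemma sq_cover (d : R) z : 0 < d -> exists m, sq d m z.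
Proof.
by move=> d0; have [k hk] := round_int (reC z) d0; have [l hl] := round_int (imC z) d0; exists (k, l).
Qed.

Lemma near_squares (d : R) w : 0 < d -> exists2 r : R, 0 < r & forall z m, nm (z - w) < r -> sq d m z -> sq d m w.
Proof.
move=> d0; have [b hb] := grid_cover (nm w + 1) d0.
pose L := [seq m <- b | ~~ `[< sq d m w >]].
have nw : ~ grid d L w by move=> [m]; rewrite mem_filter => /andP[/asboolPn].
have [r r0 hr] := (openCP (~` grid d L)).1 (closed_openC (grid_closed (L := L))) w nw.
have [q q0 [q1 q2]] := gt0_lb2 r0 (ltr01 : 0 < 1 :> R).
exists q => // z m zw mz; apply: contrapT => nm0; apply: (hr z); first by rewrite /disc /=; lin.
exists m => //; rewrite mem_filter; apply/andP; split; first exact/asboolPn.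
by apply: hb mz; have := nmB_ge z w; lin.
Qed.

Lemma sq_meet_step (d : R) m n w : 0 < d -> sq d m w -> sq d n w ->
  (n.1 = m.1 \/ step (n.1 - m.1, 0)) /\ (n.2 = m.2 \/ step (0, n.2 - m.2)).
Proof.
move=> d0 [m1 m2] [n1 n2].
have near (x : R) (k l : int) : `|x - d * k%:~R| <= d / 2 -> `|x - d * l%:~R| <= d / 2 -> [\/ l - k = 0, l - k = 1 | l - k = -1].
  move=> hk hl; have : `|d * (l - k)%:~R| <= d * 1.
    by rewrite rmorphB /= mulrBr; move: hk hl; rewrite !ler_norml; lin.
  rewrite normrM gtr0_norm // ler_pM2l // -intr_norm -[1]/(1%:~R) ler_int.
  case: (l - k) => [[|[|j]]|[|j]] // _; [by constructor 1|by constructor 2|by constructor 3].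
split; [case: (near _ _ _ m1 n1) => E|case: (near _ _ _ m2 n2) => E]; rewrite /step E ?inE //;
  by [left; apply/eqP; rewrite -subr_eq0 E|right].
Qed.

(** On the squares left by a maximal peeling the map is the identity. Those that do not meet [K]
    cannot be reached from outside the box, so they are enclosed by the squares [Kd] around [K] and
    lie in [U] by hypothesis; the peeled squares are then refilled with values in [U]. *)
Lemma hole_free_extension U K (u0 : C) (M : R) : open U -> connected U -> U u0 -> compact K -> K `<=` U ->
  (forall K' a, compact K' -> K' `<=` U -> ~ K' a -> bdd (comp (~` K') a) -> comp (~` K') a `<=` U) ->
  exists F, [/\ cont_on [set z | nm z <= M] F, forall z, nm z <= M -> U (F z) & forall z, K z -> F z = z].
Proof.
move=> oU cU Uu0 kK KU hf.
have [eps eps0 he] := compact_disc_nbhs kK oU KU.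
(* Squares have diameter at most [2 * d], less than [eps], so a square that meets [K] lies in
   [U]. *)
pose d := eps / 4; have d0 : 0 < d by rewrite /d; lin.
have [M1 M10 hM1] := compact_bdd kK.
have [b hb] := grid_cover (Num.max M M1) d0.
pose ky : pred (int * int) := fun m => `[< exists2 z, K z & sq d m z >].
have [l pl maxl] := peel_maximal b ky.
pose L := [seq m <- b | m \notin l].
pose Kd := grid d [seq m <- b | ky m].
have KdU : Kd `<=` U.
  move=> z [m]; rewrite mem_filter => /andP[/asboolP[w Kw mw] _] mz.
  by apply: (he w z Kw); have := sq_diam mw mz; rewrite /d; lin.
(* By maximality of the peeling every neighbour of a good square is in the box and not peeled; away
   from [Kd] it is good as well. Good squares thus cover a whole component of the complement of
   [Kd], which is therefore bounded. *)
pose good m := [/\ m \in b, m \notin l & ~~ ky m].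
have good_step m v w : ~ Kd w -> good m -> step v -> sq d (m.1 + v.1, m.2 + v.2) w -> good (m.1 + v.1, m.2 + v.2).
  move=> nK [mb ml mk] sv mw.
  have nb : ~ ((m.1 + v.1, m.2 + v.2) \notin b \/ (m.1 + v.1, m.2 + v.2) \in l).
    by move=> h; apply: (maxl m); split => //; exists v.
  have mb' : (m.1 + v.1, m.2 + v.2) \in b by apply: contrapT => /negP h; apply: nb; left.
  split => //; first by apply/negP => h; apply: nb; right.
  by apply/negP => km; apply: nK; exists (m.1 + v.1, m.2 + v.2) => //; rewrite mem_filter km.
have good_meet m n w : ~ Kd w -> good m -> sq d m w -> sq d n w -> good n.
  move=> nK gm mw nw; have [h1 h2] := sq_meet_step d0 mw nw.
  have mid : sq d (n.1, m.2) w by case: mw nw => m1 m2 [n1 n2].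
  have gmid : good (n.1, m.2).
    case: h1 => [->|sv]; first by rewrite -surjective_pairing.
    by have := @good_step m _ w nK gm sv; rewrite /= addr0 addrC subrK; apply.
  case: h2 => [E|sv]; first by rewrite (surjective_pairing n) E.
  by have := @good_step (n.1, m.2) _ w nK gmid sv; rewrite /= addr0 addrC subrK -surjective_pairing; apply.
have LU : grid d L `<=` U.
  move=> z [s]; rewrite mem_filter => /andP[sl sb] sz.
  have [ks|ks] := boolP (ky s); first by apply: KdU; exists s => //; rewrite mem_filter ks.
  apply: contrapT => nUz; have nKz : ~ Kd z by move=> /KdU.
  have kKd : compact Kd := grid_compact (L := _).
  have : bdd (comp (~` Kd) z).
    have [MB MB0 hMB] := compact_bdd (grid_compact (d := d) (L := b)).
    exists MB => // w Dw; apply: hMB.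
    suff [m [mb _ _] mw] : exists2 m, good m & sq d m w by exists m.
    apply: (connected_ind (P := fun w => exists2 m, good m & sq d m w) (comp_conn (G := ~` Kd) (z := z)) _ _ _ Dw).
    - by exists z; [exact: comp_refl|exists s].
    - move=> w1 /comp_sub nK1 [m gm mw1]; have [r r0 hr] := near_squares w1 d0; exists r => // w2 _ w21.
      have [n nw2] := sq_cover w2 d0; exists n => //.
      exact: good_meet gm mw1 (hr _ _ w21 nw2).
    move=> w1 _ h1; pose Lg := [seq m <- b | (m \notin l) && ~~ ky m].
    have : closure (grid d Lg) w1.
      apply/closureCP => e /h1[w2 [_ w21 [m [mb ml mk] mw2]]]; exists w2 => //; exists m => //.
      by rewrite mem_filter ml mk.
    rewrite -(closure_id _).1; last exact: grid_closed.
    by move=> [m]; rewrite mem_filter => /andP[/andP[ml mk] mb] mw1; exists m.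
  move=> /(hf Kd z kKd KdU nKz) h; apply: nUz; apply: h; exact: comp_refl.
have [F [cF FU Fid]] := @peel_extension R U d b ky l id u0 d0 oU cU Uu0 pl (cont_on_id (A := _)) LU.
have inb z : nm z <= Num.max M M1 -> grid d b z.
  by move=> zM; have [m mz] := sq_cover z d0; exists m => //; exact: hb mz.
exists F; split.
- by apply: cont_on_sub cF => z /= zM; apply: inb; rewrite le_max zM.
- by move=> z zM; apply: FU; apply: inb; rewrite le_max zM.
move=> z Kz; apply: Fid; have [m mz] := sq_cover z d0; exists m => //.
have km : ky m by apply/asboolP; exists z.
rewrite mem_filter (hb z m) ?andbT //; last by rewrite le_max hM1 ?orbT.
by apply/negP => ml; have [_ /(_ m ml)[_]] := peel_uniq pl; rewrite km.
Qed.

Lemma within_pcont (c : R -> C) : {within `[0, 1], continuous c} -> pcont (fun t => c (clamp t)).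
Proof.
move=> cc t e e0.
have cl (s : R) : `[0, 1]%classic (clamp s) by rewrite /= in_itv /= clamp_ge0 clamp_le1.
have := (subspace_continuousP _ _).1 cc (clamp t) (cl t).
move=> /(_ (disc (c (clamp t)) e)) h; have {h} : within `[0, 1] (nbhs (clamp t)) [set s | disc (c (clamp t)) e (c s)].
  by apply: h; apply/nbhsCP; exists e.
move=> /nbhs_ballP[d /= d0 hd]; exists d => // s st; apply: hd => //.
  by rewrite /ball /= distrC; apply: le_lt_trans (clamp_lip _ _) _.
exact: (cl s).
Qed.

(** The loop is contracted linearly in a disc, and the homotopy is composed with a map of that disc
    into [U] that fixes the loop. *)
Lemma hole_free_simply_connected U : open U -> connected U ->
  (forall K' a, compact K' -> K' `<=` U -> ~ K' a -> bdd (comp (~` K') a) -> comp (~` K') a `<=` U) ->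
  simply_connected U.
Proof.
move=> oU cU hf c cc cU' c01.
have cl (s : R) : 0 <= clamp s <= 1 by rewrite clamp_ge0 clamp_le1.
have clI (s : R) : `[0, 1]%classic (clamp s) by rewrite /= in_itv /= cl.
pose K := c @` `[0, 1].
have kK : compact K by apply: continuous_compact => //; exact: segment_compact.
have KU : K `<=` U by move=> _ [t t01 <-]; exact: cU'.
have Uc0 : U (c 0) by apply: cU'; rewrite /= in_itv /= lexx ler01.
have [M M0 hM] := compact_bdd kK.
have [F [cF FU Fid]] := hole_free_extension M oU cU Uc0 kK KU hf.
have Kc s : K (c (clamp s)) by exists (clamp s).
have K0 : K (c 0) by rewrite -clamp0; exact: Kc.
pose G (st : R * R) : C := rc (1 - clamp st.1) * c (clamp st.2) + rc (clamp st.1) * c 0.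
have GM st : nm (G st) <= M.
  apply: le_trans (nmD _ _) _; rewrite !nmM !nm_rc; have /andP[a1 a2] := cl st.1.
  rewrite !ger0_norm ?subr_ge0 //.
  have := hM _ (Kc st.2); have := hM _ K0 => h0 h1.
  have : (1 - clamp st.1) * nm (c (clamp st.2)) <= (1 - clamp st.1) * M by rewrite ler_wpM2l // subr_ge0.
  have : clamp st.1 * nm (c 0) <= clamp st.1 * M by rewrite ler_wpM2l.
  lin.
exists (fun st => F (G st)); split.
- apply: continuous_subspaceT => -[s t] B /nbhsCP[e e0 eB].
  have [d d0 hd] := cF (G (s, t)) (GM _) e e0.
  have d2 : 0 < d / 2 by lin.
  have [q q0 hq] := within_pcont cc t d2.
  have n0 : 0 < 2 * M + 1 by lin.
  have q1 : 0 < d / 2 / (2 * M + 1) by rewrite divr_gt0.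
  have [r r0 [r1 r2]] := gt0_lb2 q0 q1.
  apply/nbhs_ballP; exists r => // -[s' t'] [/= bs bt]; apply: eB; apply: hd; first exact: GM.
  have st : `|s' - s| < r by move: bs; rewrite /ball /= distrC.
  have tt : nm (c (clamp t') - c (clamp t)) < d / 2.
    by apply: hq; move: bt; rewrite /ball /= distrC; lin.
  rewrite /G /= (_ : _ - _ = rc (1 - clamp s') * (c (clamp t') - c (clamp t)) + rc (clamp s' - clamp s) * (c 0 - c (clamp t))); last first.
    by rewrite !rcB rc1; ring.
  apply: le_lt_trans (nmD _ _) _; rewrite !nmM !nm_rc; have /andP[a1 a2] := cl s'.
  rewrite [`|1 - _|]ger0_norm ?subr_ge0 //.
  have h1 : (1 - clamp s') * nm (c (clamp t') - c (clamp t)) <= nm (c (clamp t') - c (clamp t)).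
    by rewrite ler_piMl ?nm_ge0 //; lin.
  have h2 : `|clamp s' - clamp s| * nm (c 0 - c (clamp t)) <= `|s' - s| * (2 * M + 1).
    apply: ler_pM; rewrite ?nm_ge0 ?normr_ge0 ?clamp_lip //.
    by apply: le_trans (nmB _ _) _; have := hM _ (Kc t); have := hM _ K0; lin.
  have : `|s' - s| * (2 * M + 1) < d / 2 by rewrite -ltr_pdivlMr //; lin.
  lin.
- by move=> s t _ _; apply: FU; exact: GM.
- move=> t; rewrite /= in_itv /= => t01; rewrite /G /= clamp0 subr0 rc1 rc0 mul1r mul0r addr0 clampE // Fid //.
  by exists t => //=; rewrite in_itv.
- by move=> t _; rewrite /G /= clamp1 subrr rc1 rc0 mul1r mul0r add0r Fid.
- move=> s _; rewrite /G /= clamp0 clamp1 -c01 -mulrDl -rcD subrK rc1 mul1r; by rewrite Fid.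
Qed.

End hole_free.

(** * Normality of the iterates as a dichotomy between small and large *)

Section fatou.
Context {R : realType}.
Local Notation C := (cplx R).
Implicit Types (f g : C -> C) (z w : C) (A D K V W : set C).

Lemma rc_pos (e : C) : 0 < e -> 0 < reC e /\ e = rc (reC e).
Proof.
move=> e0; have E : e = rc (reC e).
  have : 0 <= e by exact: ltW.
  rewrite lecE /= => /andP[/eqP i0 _]; apply: C_ext => //=; by rewrite im_rc /imC i0.
by split => //; move: e0; rewrite E -rc0 rc_lt.
Qed.

Lemma nm_rc_lt (x : R) z : (rc x < `|z|) = (x < nm z).
Proof. by rewrite -rc_nm rc_lt. Qed.

Lemma uniform_cvgP W (u : nat -> C -> C) g : {uniform W, u @ \oo --> g} <->
  forall e : R, 0 < e -> exists N, forall n w, (N <= n)%N -> W w -> nm (u n w - g w) < e.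
Proof.
split=> [h e e0|h P].
  have e0' : 0 < rc e :> C by rewrite -rc0 rc_lt.
  have : nbhs (g : {uniform` W -> C}) [set k | forall y, W y -> ball (g y) (rc e) (k y)].
    apply/uniform_nbhs; exists [set xy | ball xy.1 (rc e) xy.2]; split => //.
    by rewrite -entourage_ballE; exists (rc e).
  move=> /h[N _ hN]; exists N => n w Nn Ww; have := hN n Nn w Ww.
  by rewrite /ball /= -rc_nm rc_lt nmBC.
move=> /uniform_nbhs[E [entE EP]]; move: entE; rewrite -entourage_ballE => -[e /= e0 eE].
have [e1 eR] := rc_pos e0; have [N hN] := h _ e1.
exists N => // n Nn; apply: EP => y Wy; apply: eE => /=.
by rewrite /ball /= eR -rc_nm rc_lt nmBC; exact: hN.
Qed.

Lemma derivable_dC f z : derivable f z 1 -> dC f z ('D_1 f z).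
Proof.
move=> df e e0; have e0' : 0 < rc e :> C by rewrite -rc0 rc_lt.
have := df; rewrite /derivable => /cvgrPdist_lt/(_ _ e0').
rewrite -[lim _]/('D_1 f z) => /nbhs_ballP[r /= r0 hr].
have [r1 rE] := rc_pos r0; exists (reC r) => // w wz.
have [->|wn] := eqVneq w 0; first by rewrite addr0 subrr mulr0 subr0 nm0 mulr0.
have : ball (0 : C) r w by rewrite /ball /= sub0r normrN rE -rc_nm rc_lt.
move=> /hr/(_ wn); rewrite /= -rc_nm rc_lt [w%:A]mulr1 [w + z]addrC => h.
have -> : f (z + w) - f z - 'D_1 f z * w = - ('D_1 f z - w^-1 * (f (z + w) - f z)) * w.
  by rewrite mulNr mulrBl mulrAC mulVf // mul1r opprB.
by rewrite nmM nmN ler_wpM2r ?nm_ge0 // ltW.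
Qed.

Lemma critical_pointsE f z : entire f -> critical_points f z <-> dv f z = 0.
Proof. by move=> hf; rewrite /critical_points /= derive1E (dvE (derivable_dC (hf z))). Qed.

Lemma entire_hol f : entire f -> hol_on setT f.
Proof. by move=> hf z _; exists ('D_1 f z); exact: derivable_dC. Qed.

Lemma hol_iter f n : hol_on setT f -> hol_on setT (iter n f).
Proof.
move=> hf; elim: n => [|n IH] z _; first by exists 1; exact: dC_id.
have [b hb] := IH z I; have [a ha] := hf (iter n f z) I.
by exists (a * b); exact: (dC_comp (g := iter n f) ha hb).
Qed.

(** The passage from limits along an ultrafilter back to subsequences, as the definition of a normal
    family demands: sets of the ultrafilter are unbounded because it refines the filter at
    infinity. *)
Lemma increasing_pick (I0 : set_system nat) (Q : nat -> nat -> Prop) : UltraFilter I0 -> \oo `<=` I0 ->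
  (forall k, I0 [set n | Q k n]) ->
  exists s : nat -> nat, {homo s : i j / (i < j)%N} /\ forall k, Q k (s k).
Proof.
move=> UF oo hQ; have PF := @ultra_proper _ _ UF.
have pick k m : exists n, (m < n)%N /\ Q k n.
  have : I0 ([set n | Q k n] `&` [set n | (m < n)%N]).
    by apply: filterI => //; apply: oo; exists m.+1.
  by move=> /filter_ex[n [qn mn]]; exists n.
pose nx k m := projT1 (cid (pick k m)); have nxP k m := projT2 (cid (pick k m)).
pose s := fix s k := if k is k'.+1 then nx k (s k') else nx 0%N 0%N.
exists s; split; last by case=> [|k]; [have [] := nxP 0%N 0%N|have [] := nxP k.+1 (s k)].
apply: homo_ltn => [|k]; first by move=> ? ? ?; exact: ltn_trans.
by have [] := nxP k.+1 (s k).
Qed.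

(** If it failed, some iterates would exceed every bound at one point of a compact disc and stay
    below [M] at another. No subsequence of them converges locally uniformly, to a finite limit or
    to infinity. *)
Lemma fatou_dichotomy f z : hol_on setT f -> fatou_set f z -> exists2 r : R, 0 < r &
  forall M : R, exists M' : R, forall n,
    (forall w, disc z r w -> nm (iter n f w) <= M') \/ (forall w, disc z r w -> M <= nm (iter n f w)).
Proof.
move=> hf [V [oV Vz] nV]; have [r r0 hr] := (openCP V).1 oV z Vz.
exists (r / 2); first by lin.
have kD := @cdisc_compact R z (r / 2).
have DV : cdisc z (r / 2) `<=` V by move=> w; rewrite /cdisc /= => wz; apply: hr; rewrite /disc /=; lin.
move=> M; apply: contrapT => nM.
have ch (i : nat) : exists n, [/\ (0 < n)%N, exists2 w, cdisc z (r / 2) w & i%:R < nm (iter n f w) &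
    exists2 w, cdisc z (r / 2) w & nm (iter n f w) < M].
  (* The second entry of the maximum takes care of the iterate 0, which does not belong to the
     normal family. *)
  apply: contrapT => nn; apply: nM; exists (Num.max i%:R (nm z + r)) => n.
  have [->|n0] := posnP n.
    left=> w; rewrite /disc /= => wz; rewrite le_max; apply/orP; right.
    by have := nmB_ge w z; lin.
  have [[w1 D1 h1]|n1] := pselect (exists2 w, cdisc z (r / 2) w & i%:R < nm (iter n f w)); last first.
    left=> w wz; rewrite le_max; apply/orP; left; rewrite leNgt; apply/negP => h; apply: n1; exists w => //.
    exact: ltW.
  right=> w wz; rewrite leNgt; apply/negP => h; apply: nn; exists n; split => //; first by exists w1.
  by exists w => //; exact: ltW.
pose u i := projT1 (cid (ch i)); have uP i := projT2 (cid (ch i)).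
have [|s [smono cv]] := nV (fun i => iter (u i) f).
  by move=> i; exists (u i) => //=; have [] := uP i.
have sge i : (i <= s i)%N by elim: i => // i IH; apply: leq_ltn_trans (smono _ _ (ltnSn i)).
have inv (x : R) : 0 < x -> 0 < x^-1 /\ x^-1^-1 = x by move=> x0; rewrite invr_gt0 x0 invrK.
case: cv => [[g hg]|hinf].
  (* The number [e^-1] is at once the bound and the index from which it holds, so that one small
     parameter makes both uniform over the disc. *)
  have [||e e0 he] := @compact_local R _ (fun w e => forall i, e^-1 <= i%:R -> nm (iter (u (s i)) f w) <= e^-1) kD.
  - move=> w e e' e'0 le h i hi; have a : e^-1 <= e'^-1 by rewrite lef_pV2 ?posrE //; lin.
    by apply: (le_trans _ a); apply: h; exact: le_trans a hi.
  - move=> w Dw; have [W nW /uniform_cvgP cW] := hg w (DV w Dw).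
    have [N hN] := cW 1 ltr01; have [q q0 hq] := (nbhsCP _ _).1 nW.
    have [d d0 hd] := (hol_cont (hol_iter (u (s N)) hf) : cont_on setT _) w I _ (ltr01 : 0 < 1 :> R).
    pose B := nm (iter (u (s N)) f w) + N%:R + 3.
    have B0 : 0 < B by rewrite /B; have := nm_ge0 (iter (u (s N)) f w); have : 0 <= N%:R :> R by []; lin.
    have [Bi BE] := inv _ B0; have [p p0 [p1 p2]] := gt0_lb2 q0 d0; have [p' p'0 [p3 p4]] := gt0_lb2 p0 Bi.
    exists p'^-1^-1; first by rewrite invrK.
    rewrite invrK => w' _ w'w i pi.
    have BN : B <= p'^-1 by rewrite -[B]invrK lef_pV2 ?posrE.
    have Ni : (N <= i)%N.
      rewrite -(ler_nat R); move: pi BN; rewrite /B; have := nm_ge0 (iter (u (s N)) f w); lin.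
    have Ww' : W w' by apply: hq; lin.
    have := hN i w' Ni Ww'; have := hN N w' (leqnn N) Ww'; rewrite /= => h1 h2.
    have := hd w' I ltac:(lin) => h3.
    apply: (le_trans _ BN); rewrite /B.
    have := nmB_ge (iter (u (s i)) f w') (iter (u (s N)) f w').
    have := nmB_ge (iter (u (s N)) f w') (iter (u (s N)) f w).
    have := nmD3 (g w') (iter (u (s i)) f w') (iter (u (s N)) f w').
    have := nmBC (g w') (iter (u (s N)) f w'); have : 0 <= N%:R :> R by [].
    lin.
  pose i := `|Num.ceil (e^-1)|%N.
  have ei : e^-1 <= i%:R.
    apply: le_trans (Num.Theory.ceil_ge _) _; rewrite -[i%:R]/(i%:Z%:~R) ler_int /i abszE; exact: ler_norm.
  have [_ [w Dw hw] _] := uP (s i); have := he w Dw i ei.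
  have : i%:R <= (s i)%:R :> R by rewrite ler_nat.
  lin.
have [||e e0 he] := @compact_local R _ (fun w e => forall i, e^-1 <= i%:R -> M < nm (iter (u (s i)) f w)) kD.
- move=> w e e' e'0 le h i hi; have a : e^-1 <= e'^-1 by rewrite lef_pV2 ?posrE //; lin.
  by apply: h; exact: le_trans a hi.
- move=> w Dw; have [W nW hW] := hinf w (DV w Dw); have [q q0 hq] := (nbhsCP _ _).1 nW.
  have [N _ hN] := hW M.
  have B0 : 0 < (N%:R + 1 : R) by have : 0 <= N%:R :> R by []; lin.
  have [Bi BE] := inv _ B0; have [p p0 [p1 p2]] := gt0_lb2 q0 Bi.
  exists p => // w' _ w'w i pi.
  have BN : N%:R + 1 <= p^-1 by rewrite -[N%:R + 1]invrK lef_pV2 ?posrE.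
  have Ni : (N <= i)%N by rewrite -(ler_nat R); lin.
  by rewrite -nm_rc_lt; apply: hN => //; apply: hq; lin.
pose i := `|Num.ceil (e^-1)|%N.
have ei : e^-1 <= i%:R.
  apply: le_trans (Num.Theory.ceil_ge _) _; rewrite -[i%:R]/(i%:Z%:~R) ler_int /i abszE; exact: ler_norm.
have [_ _ [w Dw hw]] := uP (s i); have := he w Dw i ei; lin.
Qed.

(** Montel applies to the members bounded by [M], or else to the reciprocals, which are bounded by
    1. In the second case Hurwitz decides: a nonvanishing limit gives a finite holomorphic limit,
    and the limit 0 gives convergence to infinity. *)
Lemma dichotomy_fatou f z (r M : R) : hol_on setT f -> 0 < r ->
  (forall n, (forall w, disc z r w -> nm (iter n f w) <= M) \/ (forall w, disc z r w -> 1 <= nm (iter n f w))) ->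
  fatou_set f z.
Proof.
move=> hf r0 dich; exists (disc z (r / 2)).
  by split; [exact: disc_open|apply: disc_center; lin].
move=> u hu.
have ch i : exists n, u i = iter n f by have [n _ nE] := hu i; exists n.
pose a i := projT1 (cid (ch i)); have aE i : u i = iter (a i) f := projT2 (cid (ch i)).
have ud i : (forall w, disc z r w -> nm (u i w) <= M) \/ (forall w, disc z r w -> 1 <= nm (u i w)).
  by rewrite aE.
have hui i : hol_on (disc z r) (u i) by rewrite aE; exact: hol_sub (hol_iter _ hf).
have [I0 [UF ooI]] := ultraFilterLemma (eventually_filter).
have PF := @ultra_proper _ _ UF.
have kD := @cdisc_compact R z (r / 2).
have DD : cdisc z (r / 2) `<=` disc z r by move=> w; rewrite /cdisc /disc /=; lin.
have sD : disc z (r / 2) `<=` cdisc z (r / 2) by move=> w; rewrite /cdisc /disc /=; lin.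
have DO := @disc_open R z r.
have extract (Q : nat -> nat -> Prop) : (forall k, I0 [set n | Q k n]) ->
    exists s : nat -> nat, {homo s : i j / (i < j)%N} /\ forall k, Q k (s k) by exact: increasing_pick.
have finite_limit Phi : fcvg (F := I0) u (disc z r) Phi -> exists s : nat -> nat, {homo s : i j / (i < j)%N} /\
    ((exists g, locally_uniform_cvg (disc z (r / 2)) (u \o s) g) \/ locally_uniform_cvg_infty (disc z (r / 2)) (u \o s)).
  move=> cv; have [|s [smono hs]] := extract (fun k n => forall w, cdisc z (r / 2) w -> nm (u n w - Phi w) < k.+1%:R^-1).
    by move=> k; apply: (cv _ kD DD); rewrite invr_gt0.
  exists s; split => //; left; exists Phi => w Dw; exists (disc z (r / 2)).
    by apply: open_nbhs_nbhs; split => //; exact: disc_open.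
  apply/uniform_cvgP => e e0; pose N := `|Num.ceil (e^-1)|%N.
  have eN : e^-1 <= N%:R.
    apply: le_trans (Num.Theory.ceil_ge _) _; rewrite -[N%:R]/(N%:Z%:~R) ler_int /N abszE; exact: ler_norm.
  exists N => n w' Nn Dw'; apply: lt_le_trans (hs n w' (sD _ Dw')) _.
  rewrite -[e]invrK lef_pV2 ?posrE ?invr_gt0 //; apply: le_trans eN _.
  by rewrite ler_nat; exact: leqW.
have [bA|bA] := in_ultra_setVsetC [set i | forall w, disc z r w -> nm (u i w) <= M] UF.
  pose v i := if pselect (forall w, disc z r w -> nm (u i w) <= M) then u i else (fun=> 0).
  have [||Phi cPhi] := @montel R _ I0 UF v (disc z r) DO.
  - move=> i w Dw; rewrite /v; case: pselect => [h|h]; first exact: hui.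
    by exists 0; exact: dC_cst.
  - move=> w Dw; have [q q0 hq] := (openCP _).1 DO w Dw; exists q, (Num.max M 0); split => // i w' w'w.
    rewrite /v; case: pselect => h; first by rewrite le_max h //; exact: hq w' w'w.
    by rewrite nm0 le_max lexx orbT.
  apply: (finite_limit Phi) => K kK KD e e0; apply: filterS2 bA (cPhi K kK KD e e0) => i hi hv w Kw.
  by have := hv w Kw; rewrite /v pif_true.
have bB : I0 [set i | forall w, disc z r w -> 1 <= nm (u i w)].
  by apply: filterS bA => i /= nb; case: (ud i).
pose v i := if pselect (forall w, disc z r w -> 1 <= nm (u i w)) then (fun w => (u i w)^-1) else (fun=> 1).
have hv i : hol_on (disc z r) (v i).
  move=> w Dw; rewrite /v; case: pselect => [h|h]; last by exists 0; exact: dC_cst.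
  have [d hd] := hui i w Dw; eexists; apply: (dC_inv hd).
  by rewrite -nm_gt0; have := h w Dw; lin.
have vn0 i w : disc z r w -> v i w != 0.
  move=> Dw; rewrite /v; case: pselect => [h|h]; last exact: oner_neq0.
  by rewrite invr_eq0 -nm_gt0; have := h w Dw; lin.
have [|Phi cPhi] := @montel R _ I0 UF v (disc z r) DO hv.
  move=> w Dw; have [q q0 hq] := (openCP _).1 DO w Dw; exists q, 1; split => // i w' w'w.
  rewrite /v; case: pselect => [h|h]; last by rewrite nm1.
  have h1 := h w' (hq _ w'w); rewrite nmV invf_le1 //; lin.
have vu i w : (forall w, disc z r w -> 1 <= nm (u i w)) -> v i w = (u i w)^-1 by move=> h; rewrite /v pif_true.
have holv : I0 [set i | hol_on (disc z r) (v i)] by apply: filterS filterT => i _; exact: hv.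
have nzv : I0 [set i | forall w, disc z r w -> v i w != 0] by apply: filterS filterT => i _ w; exact: vn0.
have [Pn|P0] := hurwitz PF DO (convex_connected (@cvx_disc _ z r)) holv cPhi nzv.
  apply: (finite_limit (fun w => (Phi w)^-1)) => K kK KD e e0.
  have cK := fcvg_cont PF holv cPhi kK KD.
  have [m m0 hm] := compact_nm_min kK cK (fun w Kw => Pn w (KD w Kw)).
  have m2 : 0 < m / 2 by lin.
  have e1 : 0 < e * (m * m / 2) by rewrite !mulr_gt0 // divr_gt0 // mulr_gt0.
  apply: filterS3 bB (cPhi K kK KD _ m2) (cPhi K kK KD _ e1) => i hi h1 h2 w Kw.
  have := h1 w Kw; have := h2 w Kw; rewrite vu // => {}h2 {}h1.
  have u0 : u i w != 0 by rewrite -nm_gt0; have := hi w (KD w Kw); lin.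
  have P0 := Pn w (KD w Kw); have hmw := hm w Kw.
  have lo : m / 2 < nm (u i w)^-1 by have := nmB_ge' (u i w)^-1 (Phi w); lin.
  have -> : u i w - (Phi w)^-1 = ((u i w)^-1 - Phi w) * - (u i w / Phi w) by field; rewrite u0 P0.
  rewrite nmM nmN nmM nmV; move: lo; rewrite nmV => lo.
  have un : 0 < nm (u i w) by rewrite nm_gt0.
  have Pp : 0 < nm (Phi w) by rewrite nm_gt0.
  rewrite mulrA ltr_pdivrMr //.
  have a1 : nm ((u i w)^-1 - Phi w) * nm (u i w) < e * (m * m / 2) * nm (u i w) by rewrite ltr_pM2r.
  have a2 : m / 2 * nm (u i w) <= 1 by rewrite -ler_pdivlMr // div1r ltW.
  have a3 : e * m * (m / 2 * nm (u i w)) <= e * m by rewrite ler_piMr // mulr_ge0 // ltW.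
  have a4 : e * m <= e * nm (Phi w) by rewrite ler_pM2l.
  lin.
have [|s [smono hs]] := extract (fun k n => forall w, cdisc z (r / 2) w -> k%:R < nm (u n w)).
  move=> k; have e0 : 0 < (k%:R + 1)^-1 :> R by rewrite invr_gt0; have : 0 <= k%:R :> R by []; lin.
  apply: filterS2 bB (cPhi _ kD DD _ e0) => i hi h1 w Dw.
  have := h1 w Dw; rewrite vu // P0 ?subr0; last exact: DD.
  have un : 0 < nm (u i w) by have := hi w (DD w Dw); lin.
  have kp : 0 < k%:R + 1 :> R by have : 0 <= k%:R :> R by []; lin.
  by rewrite nmV ltf_pV2 ?posrE // => h2; lin.
exists s; split => //; right => w Dw; exists (disc z (r / 2)).
  by apply: open_nbhs_nbhs; split => //; exact: disc_open.
move=> M0; pose N := `|Num.ceil M0|%N.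
have MN : M0 <= N%:R.
  apply: le_trans (Num.Theory.ceil_ge _) _; rewrite -[N%:R]/(N%:Z%:~R) ler_int /N abszE; exact: ler_norm.
exists N => // n Nn w' Dw'; rewrite nm_rc_lt; apply: le_lt_trans (hs n w' (sD _ Dw')).
by apply: le_trans MN _; rewrite ler_nat.
Qed.

Lemma fatou_open f : open (fatou_set f).
Proof.
apply/openCP => z [V [oV Vz] nV]; have [r r0 hr] := (openCP V).1 oV z Vz.
by exists r => // w /hr Vw; exists V.
Qed.

Lemma fatou_preimage f z : hol_on setT f -> fatou_set f (f z) -> fatou_set f z.
Proof.
move=> hf /(fatou_dichotomy hf)[r r0 /(_ 1)[M hM]].
have [d d0 hd] := (hol_cont hf : cont_on setT _) z I _ r0.
apply: (dichotomy_fatou (r := d) (M := Num.max M (nm z + d)) hf d0) => -[|n].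
  left=> w wz; rewrite le_max; apply/orP; right; have := nmB_ge w z; move: wz; rewrite /disc /=; lin.
have fd w : disc z d w -> disc (f z) r (f w) by move=> wz; exact: hd.
case: (hM n) => h; [left|right] => w /fd /h; rewrite -iterSr //.
by move=> h'; rewrite le_max h'.
Qed.

Lemma fatou_image f z : hol_on setT f -> nonconst f -> fatou_set f z -> fatou_set f (f z).
Proof.
move=> hf nf /(fatou_dichotomy hf)[r r0 /(_ 1)[M hM]].
have [d d0 hd] := open_mapping (@openT C) hf I (nonconst_not_loc (c := z) hf nf) r0.
apply: (dichotomy_fatou (r := d) (M := M) hf d0) => n.
case: (hM n.+1) => h; [left|right] => w /hd[x [_ xz <-]]; rewrite -iterSr; exact: h.
Qed.

Lemma fatou_iter f n z : hol_on setT f -> nonconst f -> fatou_set f (iter n f z) <-> fatou_set f z.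
Proof.
move=> hf nf; elim: n => [|n IH] //=; rewrite -IH; split; first exact: fatou_preimage.
exact: fatou_image.
Qed.

End fatou.

(** * Iteration of a Fatou continuum that surrounds a Julia point *)

Section orbits.
Context {R : realType}.
Local Notation C := (cplx R).
Implicit Types (f g : C -> C) (z w : C) (A D K : set C).

Lemma iter_nonconst f n : hol_on setT f -> nonconst f -> nonconst (iter n f).
Proof.
move=> hf nf; elim: n => [|n IH] /=.
  by exists 0, 1; rewrite eq_sym oner_neq0.
have nl := nonconst_not_loc (c := 0) (hol_iter n hf) IH.
have [d d0 hd] := open_mapping (@openT C) (hol_iter n hf) I nl ltr01.
apply: contrapT => h; apply: (nonconst_not_loc (c := iter n f 0) hf nf); exists d => // w /hd[x [_ _ <-]].
by apply/eqP; apply: contrapT => /negP ne; apply: h; exists x, 0.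
Qed.

Lemma iter_dv f n z : hol_on setT f -> dv (iter n.+1 f) z = dv f (iter n f z) * dv (iter n f) z.
Proof.
move=> hf; apply: dvE; apply: (dC_comp (g := iter n f)); first exact: dvP (hf _ I).
exact: dvP (hol_iter n hf I).
Qed.

Lemma open_image g D : hol_on setT g -> nonconst g -> open D -> open (g @` D).
Proof.
move=> hg ng oD; apply/openCP => _ [z Dz <-].
have [d d0 hd] := open_mapping oD (hol_sub (fun _ _ => I) hg) Dz (nonconst_not_loc (c := z) hg ng) ltr01.
by exists d => // w /hd[x [Dx _ <-]]; exists x.
Qed.

Lemma bounded_boundary D : open D -> bdd D -> D !=set0 -> exists2 z, closure D z & ~ D z.
Proof.
move=> oD [M M0 hM] [a Da].
have [z [_ cz nz]] : exists z, [/\ setT z, closure D z & ~ D z].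
  apply: (@connected_boundary R setT D a (rc (M + 1))) => //.
    by have := convex_connected (S := @setT C); apply.
  by move=> /hM; rewrite nm_rc gtr0_norm; lin.
by exists z.
Qed.

Lemma iterate_control f K : hol_on setT f -> compact K -> connected K -> K `<=` fatou_set f ->
  forall M : R, exists M' : R, forall n a b, K a -> K b -> nm (iter n f a) <= M -> nm (iter n f b) <= M'.
Proof.
move=> hf kK cK KF M.
have [|M' h] := @chain_control R nat (fun=> True) (fun n z => nm (iter n f z)) K kK cK _ M; last by exists M' => n; exact: h.
move=> z /KF/(fatou_dichotomy hf)[r r0 h]; exists r => // M1; have [M' hM'] := h (M1 + 1); exists M' => n _ a b _ _ Da Db aM.
by case: (hM' n) => [/(_ b Db)//|/(_ a Da)]; lin.
Qed.

(* [K] surrounds a Julia point inside [D]. *)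
Definition fatou_ring f K D := [/\ [/\ compact K, connected K, K !=set0 & K `<=` fatou_set f], open D, bdd D,
  (forall z, closure D z -> ~ D z -> K z) & exists2 z, D z & ~ fatou_set f z].

Section ring_dynamics.
Context (f : C -> C) (hf : hol_on setT f) (nf : nonconst f).

Lemma ring_max g K D M : hol_on setT g -> fatou_ring f K D -> (forall z, K z -> nm (g z) <= M) ->
  forall z, D z -> nm (g z) <= M.
Proof.
move=> hg [_ oD [B B0 hB] bD _] KM; apply: (max_modulus oD hB _ (hol_sub (fun _ _ => I) hg)).
  exact: cont_on_sub (hol_cont hg).
by move=> z cz nz; apply: KM; exact: bD.
Qed.

(** If no iterate were large on [K] and small somewhere in [D], then [iterate_control] and the
    maximum principle would give the dichotomy on [D] and make the Julia point a Fatou point. For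
    such an iterate the image of [D] swallows the disc. *)
Lemma ring_pierce K D (rho : R) : fatou_ring f K D -> 1 <= rho ->
  exists m, (forall z, K z -> rho < nm (iter m f z)) /\ forall w, nm w <= rho -> exists2 z, D z & iter m f z = w.
Proof.
move=> rK rho1; have [[kK cK [a Ka] KF] oD bD hbD [j Dj nj]] := rK.
have [M' hM'] := iterate_control hf kK cK KF rho.
have [m [Km [z Dz zr]]] : exists m, (forall z, K z -> rho < nm (iter m f z)) /\ exists2 z, D z & nm (iter m f z) <= rho.
  apply: contrapT => h; apply: nj; have [r r0 hr] := (openCP D).1 oD j Dj.
  apply: (dichotomy_fatou (r := r) (M := M') hf r0) => n.
  have [[b Kb bn]|nb] := pselect (exists2 z, K z & nm (iter n f z) <= rho).
    by left=> w /hr; apply: (ring_max (hol_iter n hf) rK) => z Kz; exact: hM' Kb Kz bn.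
  right=> w /hr Dw; apply: le_trans rho1 _; rewrite leNgt; apply/negP => lt; apply: h; exists n; split.
    by move=> z Kz; rewrite ltNge; apply/negP => le; apply: nb; exists z.
  by exists w => //; exact: ltW.
exists m; split => // w wr.
apply: (@swallow R (iter m f) D (cdisc 0 rho) (hol_iter m hf) (iter_nonconst m hf nf) oD bD (convex_connected (@cvx_cdisc _ 0 rho))).
- by move=> x cx nx; rewrite /cdisc /= subr0; have := Km x (hbD x cx nx); lin.
- by exists z => //; rewrite /cdisc /= subr0.
- by rewrite /cdisc /= subr0.
Qed.

(** If f^n is small on [K] for some large n, then |f^n| is at most M' on [D], while f^m(D) covers
    the disc of radius [rho > M']. So f^(n-m) maps that disc, which contains a neighbourhood of the
    Julia point, into itself, and all orbits from there are bounded. *)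
Lemma ring_tends K D : fatou_ring f K D -> forall M : R, exists N, forall n z, (N <= n)%N -> K z -> M < nm (iter n f z).
Proof.
move=> rK M; have [[kK cK [a Ka] KF] oD [B B0 hB] hbD [j Dj nj]] := rK.
apply: contrapT => h.
have low N : exists n, (N <= n)%N /\ exists2 z, K z & nm (iter n f z) <= M.
  apply: contrapT => h'; apply: h; exists N => n z Nn Kz; rewrite ltNge; apply/negP => le.
  by apply: h'; exists n; split => //; exists z.
have [M' hM'] := iterate_control hf kK cK KF M.
pose rho := Num.max (M' + 1) (B + 1).
have [r1 r2] : M' + 1 <= rho /\ B + 1 <= rho by rewrite !le_max !lexx orbT.
have [m [Km mD]] := ring_pierce rK (ltac:(lin) : 1 <= rho).
have [n [mn [b Kb bM]]] := low m.+1.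
pose k := (n - m)%N; have k0 : (0 < k)%N by rewrite subn_gt0.
have kmap w : nm w <= rho -> nm (iter k f w) <= rho.
  move=> /mD[x Dx <-]; rewrite -iterD subnK; last exact: ltnW.
  have : nm (iter n f x) <= M'; last by lin.
  by apply: (ring_max (hol_iter n hf) rK) Dx => y Ky; exact: hM' Kb Ky bM.
have qmap q w : nm w <= rho -> nm (iter (q * k) f w) <= rho.
  by elim: q => [//|q IH] wr; rewrite mulSn iterD; apply: kmap; exact: IH.
have [B' hB'] : exists B' : R, forall i w, (i < k)%N -> nm w <= rho -> nm (iter i f w) <= B'.
  elim: (k) => [|i [B' hB']]; first by exists 0.
  have [B2 _ hB2] := compact_nm_bound (@cdisc_compact R 0 rho) (cont_on_sub (fun _ _ => I) (hol_cont (hol_iter i hf))).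
  exists (Num.max B' B2) => l w; rewrite ltnS leq_eqVlt => /orP[/eqP->|li] wr; rewrite le_max.
    by rewrite hB2 ?orbT // /cdisc /= subr0.
  by rewrite hB'.
apply: nj; apply: (dichotomy_fatou (r := 1) (M := B') hf ltr01) => l; left=> w wj.
rewrite (divn_eq l k) addnC iterD; apply: hB'; first by rewrite ltn_mod.
by apply: qmap; have := hB j Dj; have := nmB_ge w j; move: wj; rewrite /disc /=; lin.
Qed.

(** For some m the set f^m(D) covers [D]; following preimages inside [D] shows that every iterate
    takes on [D] a value below a bound independent of n. With the image of [K] kept outside, the
    image of [D] must swallow the disc. *)
Lemma ring_swallow K D : fatou_ring f K D -> exists B : R, forall n s, B < s -> (forall z, K z -> s <= nm (iter n f z)) ->
  forall w, nm w < s -> exists2 z, D z & iter n f z = w.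
Proof.
move=> rK; have [[kK cK [a Ka] KF] oD [B B0 hB] hbD [j Dj nj]] := rK.
have rho1 : 1 <= Num.max 1 B by rewrite le_max lexx.
have [m [Km mD]] := ring_pierce rK rho1.
have m0 : (0 < m)%N.
  case: m Km mD => // Km _; have [q cq nq] := bounded_boundary oD (ex_intro2 _ _ B B0 hB) (ex_intro _ j Dj).
  have := Km q (hbD q cq nq); have := closureC_bounded hB cq; rewrite /= gt_max => ? /andP[]; lin.
have mD' z : D z -> exists2 z', D z' & iter m f z' = z.
  by move=> /hB zB; apply: mD; rewrite le_max zB orbT.
have [B' hB'] : exists B' : R, forall i, (i < m)%N -> nm (iter i f j) <= B'.
  elim: (m) => [|i [B' hB']]; first by exists 0.
  exists (Num.max B' (nm (iter i f j))) => l; rewrite ltnS leq_eqVlt le_max => /orP[/eqP->|li].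
    by rewrite lexx orbT.
  by rewrite hB'.
have small n : exists2 z, D z & nm (iter n f z) <= B'.
  rewrite (divn_eq n m) addnC; have := hB' (n %% m)%N (ltn_pmod n m0).
  move: (n %% m)%N => i iB; elim: (n %/ m)%N => [|q [z Dz zB]]; first by exists j; rewrite // mul0n addn0.
  have [z' Dz' zE] := mD' z Dz; exists z' => //.
  by rewrite mulSn addnCA addnC iterD zE.
exists B' => n s Bs Ks w ws.
apply: (@swallow R (iter n f) D (disc 0 s) (hol_iter n hf) (iter_nonconst n hf nf) oD (ex_intro2 _ _ B B0 hB) (convex_connected (@cvx_disc _ 0 s))).
- by move=> x cx nx; rewrite /disc /= subr0; have := Ks x (hbD x cx nx); lin.
- by have [z Dz zB] := small n; exists z => //; rewrite /disc /= subr0; lin.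
- by rewrite /disc /= subr0.
Qed.

Lemma ring_image K D n : fatou_ring f K D -> fatou_ring f (iter n f @` K) (iter n f @` D).
Proof.
move=> [[kK cK [a Ka] KF] oD bD hbD [j Dj nj]]; have hg := hol_iter n hf.
have cg A : cont_on A (iter n f) by exact: cont_on_sub (hol_cont hg).
have kD := cont_compact (closure_compact bD) (cg (closure D)).
split.
- split; [exact: cont_compact|exact: cont_connected|by exists (iter n f a), a|].
  by move=> _ [z Kz <-]; apply/(fatou_iter n z hf nf); exact: KF.
- exact: open_image hg (iter_nonconst n hf nf) oD.
- have [M M0 hM] := compact_bdd kD; exists M => // _ [z Dz <-]; apply: hM; exists z => //.
  exact: subset_closure.
- move=> y cy ny; have : closure (iter n f @` closure D) y.
    by apply: closure_subset cy => _ [z Dz <-]; exists z => //; exact: subset_closure.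
  rewrite -(closure_id _).1; last exact: compact_closedC.
  move=> [z cz zy]; exists z => //; apply: hbD => // Dz; apply: ny; by exists z.
- by exists (iter n f j); [exists j|move/(fatou_iter n j hf nf)].
Qed.

Definition fcomp (z0 : C) n := comp (fatou_set f) (iter n f z0).

(** Disjointness is the usable form of not being eventually periodic: two Fatou components that meet
    coincide, and so do all their successors. *)
Definition wander z0 := fatou_set f z0 /\ forall i j w, (i < j)%N -> fcomp z0 i w -> ~ fcomp z0 j w.

Lemma fcomp_shift z0 n k : fcomp (iter k f z0) n = fcomp z0 (n + k).
Proof. by rewrite /fcomp iterD. Qed.

Lemma wander_shift z0 k : wander z0 -> wander (iter k f z0).
Proof.
move=> [Fz h]; split; first exact/(fatou_iter k z0 hf nf).
by move=> i j w ij; rewrite !fcomp_shift; apply: h; rewrite ltn_add2r.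
Qed.

Lemma fcomp_open z0 n : open (fcomp z0 n). Proof. exact/comp_open/fatou_open. Qed.

Lemma fcomp_iter z0 n k w : fatou_set f z0 -> fcomp z0 n w -> fcomp z0 (n + k) (iter k f w).
Proof.
move=> Fz nw; have Fn : fatou_set f (iter n f z0) by apply/(fatou_iter n z0 hf nf).
have cim : connected (iter k f @` fcomp z0 n).
  by apply: cont_connected (comp_conn (z := _)) _; exact: cont_on_sub (hol_cont (hol_iter k hf)).
have im : (iter k f @` fcomp z0 n) (iter (n + k) f z0).
  by exists (iter n f z0); [exact: comp_refl|rewrite -iterD addnC].
have imF : iter k f @` fcomp z0 n `<=` fatou_set f.
  by move=> _ [x /comp_sub Fx <-]; apply/(fatou_iter k x hf nf).
by apply: (comp_max im imF cim); exists w.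
Qed.

Lemma fcomp_boundary z0 n w : closure (fcomp z0 n) w -> ~ fcomp z0 n w -> ~ fatou_set f w.
Proof. by move=> cw nw Fw; apply: nw; apply: comp_closure => //; exact: fatou_open. Qed.

(** For large k > n the set f^k(D) contains f^n(z0), and its frontier lies in f^k(K), hence in the
    k-th component. The n-th component is disjoint from that one, so it cannot leave f^k(D). *)
Lemma fcomp_bdd z0 K D n : wander z0 -> fatou_ring f K D -> K `<=` fcomp z0 0 -> bdd (fcomp z0 n).
Proof.
move=> wz rK K0; have [[kK cK [a Ka] KF] oD bD hbD [j Dj nj]] := rK.
have [B hB] := ring_swallow rK.
pose s := Num.max (B + 1) (nm (iter n f z0) + 1).
have [s1 s2] : B + 1 <= s /\ nm (iter n f z0) + 1 <= s by rewrite !le_max !lexx orbT.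
have [N hN] := ring_tends rK s.
pose k := maxn N n.+1; have Nk : (N <= k)%N by exact: leq_maxl.
have nk : (n < k)%N by exact: leq_maxr.
have kD := cont_compact (closure_compact bD) (cont_on_sub (fun _ _ => I) (hol_cont (hol_iter k hf))).
have [M M0 hM] := compact_bdd kD; exists M => // w Ww.
have [z Dz <-] : exists2 z, D z & iter k f z = w.
  apply: (@swallow R (iter k f) D (fcomp z0 n) (hol_iter k hf) (iter_nonconst k hf nf) oD bD (comp_conn (z := _))) => //.
    move=> x cx nx Wx; apply: (wz.2 n k _ nk Wx).
    by have := fcomp_iter k wz.1 (K0 x (hbD x cx nx)); rewrite add0n.
  have [|||z Dz zE] := hB k s _ _ (iter n f z0); [lin| |lin|].
    by move=> z Kz; apply: ltW; exact: hN.
  by exists z => //; rewrite zE; apply: comp_refl; apply/(fatou_iter n z0 hf nf); exact: wz.1.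
by apply: hM; exists z => //; exact: subset_closure.
Qed.

Lemma fcomp_onto z0 n w : wander z0 -> bdd (fcomp z0 n) -> fcomp z0 n.+1 w -> exists2 z, fcomp z0 n z & f z = w.
Proof.
move=> [Fz _] bV; apply: (@swallow R f _ _ hf nf (fcomp_open (n := n)) bV (comp_conn (z := _))).
  by move=> x cx nx /comp_sub/(fatou_preimage hf); exact: fcomp_boundary cx nx.
have Fn : fatou_set f (iter n f z0) by apply/(fatou_iter n z0 hf nf).
exists (iter n f z0); first exact: comp_refl.
by have := fcomp_iter 1 Fz (comp_refl Fn : fcomp z0 n _); rewrite addn1.
Qed.

Lemma fcomp_image z0 K D n : wander z0 -> fatou_ring f K D -> K `<=` fcomp z0 0 -> iter n f @` fcomp z0 0 = fcomp z0 n.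
Proof.
move=> wz rK K0; apply/seteqP; split=> [_ [z Wz <-]|].
  by have := fcomp_iter n wz.1 Wz; rewrite add0n.
elim: n => [w Ww|n IH w Ww]; first by exists w.
have [_ /IH[x Wx <-] <-] := fcomp_onto wz (@fcomp_bdd _ _ _ n wz rK K0) Ww.
by exists x.
Qed.

(** A compact set in [U] has a bounded complementary component [D] not contained in [U]. If [D] had
    no Julia point, it would be a connected part of the Fatou set adjacent to [U], hence inside
    [U]. *)
Lemma multiply_connected_ring z0 : fatou_set f z0 -> multiply_connected (fcomp z0 0) ->
  exists K D, fatou_ring f K D /\ K `<=` fcomp z0 0.
Proof.
move=> Fz nsc; set U := fcomp z0 0; have oU : open U by exact: fcomp_open.
have cU : connected U := comp_conn (z := _).
have [K' [a [kK' KU nKa bD nDU]]] : exists K' a, [/\ compact K', K' `<=` U, ~ K' a, bdd (comp (~` K') a) & ~ (comp (~` K') a `<=` U)].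
  apply: contrapT => h; apply: nsc; apply: hole_free_simply_connected => // K' a kK KU nKa bD.
  by apply: contrapT => n; apply: h; exists K', a.
pose D := comp (~` K') a; have oK : open (~` K') by rewrite openC; exact: compact_closedC.
have oD : open D := comp_open oK.
have Uz0 : U z0 by exact: comp_refl.
have [K [kK cK K'K KU' _]] := compact_connected_hull oU cU Uz0 kK' KU.
have bdK z : closure D z -> ~ D z -> K' z.
  by move=> cz nz; apply: contrapT => nK; apply: nz; exact: comp_closure.
have [q cq nq] := bounded_boundary oD bD (ex_intro _ a (comp_refl nKa)).
exists K, D; split => //; split => //.
- split => //; first by exists q; apply: K'K; exact: bdK.
  by move=> z /KU'/comp_sub.
- by move=> z cz nz; apply: K'K; exact: bdK.
apply: contrapT => nJ; apply: nDU => b Db.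
have DF : D `<=` fatou_set f by move=> z Dz; apply: contrapT => nz; apply: nJ; exists z.
have [r r0 hr] := (openCP U).1 oU q (KU q (bdK q cq nq)).
have [x Dx xq] := (closureCP _ _).1 cq r r0.
exact: (comp_meet (comp_conn (z := a)) DF Dx (hr x xq)).
Qed.

Lemma fatou_orbitE z0 n : fatou_set f z0 -> fatou_orbit f (fcomp z0 0) n = fcomp z0 n.
Proof.
move=> Fz; have Fn : fatou_set f (iter n f z0) by apply/(fatou_iter n z0 hf nf).
rewrite /fatou_orbit; have := @getPex _ [set V | fatou_component f V /\ iter n f @` (fcomp z0 0) `<=` V].
move=> /(_ (ex_intro _ (fcomp z0 n) (conj _ _)))[|_ [x Wx <-]|].
- by exists (iter n f z0).
- by have := fcomp_iter n Fz Wx; rewrite add0n.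
set V := get _ => -[y Fy VE] sub.
have : V (iter n f z0) by apply: sub; exists z0 => //; exact: comp_refl.
by rewrite VE => /comp_eq.
Qed.

Lemma wandering_wander U : wandering_domain f U -> exists z0, U = fcomp z0 0 /\ wander z0.
Proof.
move=> [[z0 Fz UE] np]; exists z0; split => //; split => // i j w ij iw jw; apply: np.
have Fk k : fatou_set f (iter k f z0) by apply/(fatou_iter k z0 hf nf).
have E k : fcomp z0 (i + k) = fcomp z0 (j + k).
  have h1 := fcomp_iter k Fz iw; have h2 := fcomp_iter k Fz jw.
  by rewrite /fcomp (comp_eq h1) (comp_eq h2).
exists i, (j - i)%N; split; first by rewrite subn_gt0.
move=> n le_in; have UE' : U = fcomp z0 0 by [].
rewrite UE' !fatou_orbitE // -(subnKC le_in) E; congr fcomp.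
by rewrite addnAC subnKC ?(ltnW ij) // addnC.
Qed.

End ring_dynamics.
End orbits.

(** * Images of the domain contain full circles *)

Section annuli.
Context {R : realType}.
Local Notation C := (cplx R).
Implicit Types (g : C -> C) (z w : C) (A D K : set C).
Context (f : C -> C) (hf : hol_on setT f) (nf : nonconst f).

Lemma fcomp_avoid z0 w : wander f z0 -> exists N, forall k, (N <= k)%N -> ~ fcomp f z0 k w.
Proof.
move=> [_ dis]; have [[i Vi]|h] := pselect (exists i, fcomp f z0 i w).
  by exists i.+1 => k ik; exact: dis ik Vi.
by exists 0%N => k _ Vk; apply: h; exists k.
Qed.

Lemma iterate_tends z0 K D K' : wander f z0 -> fatou_ring f K D -> K `<=` fcomp f z0 0 -> compact K' -> K' `<=` fcomp f z0 0 ->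
  forall M : R, exists N, forall n z, (N <= n)%N -> K' z -> M < nm (iter n f z).
Proof.
move=> wz rK K0 kK' K'0 M; have [[kK cK [a Ka] KF] _ _ _ _] := rK.
have [K2 [kK2 cK2 sub K2V _]] := compact_connected_hull (fcomp_open (f := f) (z0 := z0) (n := 0%N)) (comp_conn (z := _)) (K0 a Ka) kK' K'0.
have [K3 [kK3 cK3 sub3 K3V K3a]] := compact_connected_hull (fcomp_open (f := f) (z0 := z0) (n := 0%N)) (comp_conn (z := _)) (K0 a Ka) kK2 K2V.
have K3F : K3 `<=` fatou_set f by move=> z /K3V/comp_sub.
have [M' hM'] := iterate_control hf kK3 cK3 K3F M.
have [N hN] := ring_tends hf nf rK M'; exists N => n z Nn K'z; rewrite ltNge; apply/negP => le.
have := hM' n z a (sub3 _ (sub _ K'z)) K3a le; have := hN n a Nn Ka; lin.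
Qed.

(** The exponent [p.-1] is recorded too: writing a point of [D] as f^(p-1)(x') turns one further
    application of [f] after t - p iterations into exactly f^t(x'). *)
Lemma ring_cover z0 K D : wander f z0 -> fatou_ring f K D -> K `<=` fcomp f z0 0 ->
  exists2 p, (0 < p)%N & forall w, D w \/ fcomp f z0 0 w -> (exists2 z, D z & iter p.-1 f z = w) /\ (exists2 z, D z & iter p f z = w).
Proof.
move=> wz rK K0; have [_ _ [M M0 hM] _ _] := rK.
have [B hB] := ring_swallow hf nf rK; have [M' M'0 hM'] := @fcomp_bdd _ f hf nf z0 K D 0%N wz rK K0.
pose s := Num.max (B + 1) (Num.max (M + 1) (M' + 1)).
have [s1 [s2 s3]] : B + 1 <= s /\ M + 1 <= s /\ M' + 1 <= s by rewrite !le_max !lexx !orbT.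
have [N hN] := ring_tends hf nf rK s; exists N.+1 => // w Dw.
have ws : nm w < s by case: Dw => [/hM|/hM']; lin.
split; apply: (hB _ s) => //; try lin; move=> z Kz; apply: ltW; apply: hN => //; exact: leqW.
Qed.

Lemma annulus_in_fcomp z0 K D K' : (forall a b, ~ forall z, f z = a + b * z) -> wander f z0 -> fatou_ring f K D ->
  K `<=` fcomp f z0 0 -> compact K' -> K' `<=` fcomp f z0 0 ->
  exists N, forall k z w, (N <= k)%N -> K' z -> nm w = nm (iter k f z) -> fcomp f z0 k w.
Proof.
move=> naff wz rK K0 kK' K'0; apply: contrapT => hN.
have [[kK cK [a Ka] KF] oD bD hbD [j Dj nj]] := rK.
set V := fcomp f z0 in K0 K'0 hN *; have oV n : open (V n) by exact: fcomp_open.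
have cV n : connected (V n) by exact: comp_conn.
have [Q [kQ cQ K'KQ QV Qa]] : exists Q, [/\ compact Q, connected Q, K' `|` K `<=` Q, Q `<=` V 0%N & Q a].
  apply: compact_connected_hull => //; [exact: K0|exact: compactU|by move=> z [/K'0|/K0]].
have KQ : K `<=` Q by move=> z Kz; apply: K'KQ; right.
have [p p0 cover] := ring_cover wz rK K0.
have [N0 av0] := fcomp_avoid 0 wz.
have bad N : exists t, (N <= t)%N /\ exists zw : C * C, [/\ K' zw.1, nm zw.2 = nm (iter t f zw.1) & ~ V t zw.2].
  apply: contrapT => h; apply: hN; exists N => k z w Nk Kz ww; apply: contrapT => nV; apply: h.
  by exists k; split => //; exists (z, w).
(* [N0] makes the components of index [t0 N - p] and [t0 N] avoid 0, [p] makes the subtraction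
   meaningful, and [N] sends the indices to infinity. *)
have [t0 ht0] : exists t0 : nat -> nat, forall N, (N0 + p + N <= t0 N)%N /\
    exists zw : C * C, [/\ K' zw.1, nm zw.2 = nm (iter (t0 N) f zw.1) & ~ V (t0 N) zw.2].
  by exists (fun N => projT1 (cid (bad (N0 + p + N)%N))) => N; exact: (projT2 (cid (bad _))).
pose zw N := projT1 (cid (ht0 N).2); have zwP N := projT2 (cid (ht0 N).2).
pose w N := (zw N).2.
have t0N N : (N0 + p + N <= t0 N)%N := (ht0 N).1.
have tp N : (p <= t0 N)%N by apply: leq_trans (t0N N); rewrite -addnA addnCA leq_addr.
have tN N : (N0 <= t0 N - p)%N by rewrite leq_subRL // addnC; apply: leq_trans (t0N N); rewrite leq_addr.
have tinf N : (N <= t0 N - p)%N.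
  by rewrite leq_subRL //; apply: leq_trans (t0N N); rewrite -addnA leq_addl.
have V0 z n : V 0%N z -> V n (iter n f z) by move=> Vz; have := fcomp_iter hf nf n wz.1 Vz; rewrite add0n.
have Vp z N : V p z -> V (t0 N) (iter (t0 N - p) f z).
  by move=> Vz; have := fcomp_iter hf nf (t0 N - p) wz.1 Vz; rewrite subnKC.
have nVw N : ~ V (t0 N) (w N) by case: (zwP N).
have w0 N : w N != 0.
  apply/eqP => E; case: (zwP N) => K'z; rewrite -/(w N) E nm0 => /esym/nm0_eq E2 _.
  by apply: (av0 (t0 N)); [apply: leq_trans (tN N) _; exact: leq_subr|rewrite -E2; apply: V0; exact: K'0].
have hdivw N n A : hol_on A (fun z => iter n f z / w N).
  move=> z _; have [d hd] := hol_iter n hf (I : setT z); exists ((w N)^-1 * d).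
  by apply: (dC_ext ltr01 (fun x _ => mulrC _ _)); exact: dC_scale.
have omit N n A : (forall z, A z -> V (t0 N) (iter n f z)) ->
    forall z, A z -> iter n f z / w N != 0 /\ iter n f z / w N != 1.
  move=> AV z Az; split.
    rewrite mulf_neq0 ?invr_eq0 //; apply/eqP => E; apply: (av0 (t0 N)); last by rewrite -E; exact: AV.
    by apply: leq_trans (tN N) _; exact: leq_subr.
  by apply/eqP => /divr1_eq E; apply: (nVw N); rewrite -E; exact: AV.
(* The bound 0 at the starting point: by the choice of [w N] the quotient has modulus 1 at the point
   of [K'] that goes with it. *)
have [M1 hM1] := schottky_control (oV 0%N) kQ cQ QV 0.
have KB N b : K b -> `|ln (nm (iter (t0 N) f b / w N))| <= M1.
  move=> Kb; case: (zwP N) => K'z nz _.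
  apply: (hM1 (fun z => iter (t0 N) f z / w N) (hdivw _ _ _) (omit N (t0 N) _ (fun z => V0 z (t0 N))) (zw N).1 b).
  - by apply: K'KQ; left.
  - exact: KQ.
  - by rewrite nmM nmV nz divff ?ln1 ?normr0 // -nz nm_eq0; exact: w0.
have lnE (x M : R) : 0 < x -> `|ln x| <= M -> expR (- M) <= x <= expR M.
  by move=> x0; rewrite ler_norml => /andP[h1 h2]; rewrite -{1 2}[x]lnK ?posrE // !ler_expR h1 h2.
have KC N b : K b -> expR (- M1) <= nm (iter (t0 N) f b / w N) <= expR M1.
  move=> Kb; apply: lnE (KB N b Kb); rewrite nm_gt0.
  by have [] := omit N (t0 N) _ (fun z => V0 z (t0 N)) b (K0 b Kb).
pose Cc := expR M1; have Cc0 : 0 < Cc := expR_gt0 _.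
have rKp := ring_image hf nf p rK; set Kp := iter p f @` K in rKp; set Dp := iter p f @` D in rKp.
have [[kKp cKp _ KpF] oDp bDp hbDp _] := rKp.
(* Same quotient, read [p] iterations later. It is bounded on [Dp], which contains [V 0], by the
   maximum principle, and controlled on [V p] by Schottky since there it omits 0 and 1. *)
pose F2 N z := iter (t0 N - p) f z / w N.
have F2p N b : F2 N (iter p f b) = iter (t0 N) f b / w N by rewrite /F2 -iterD subnK.
have KpC N y : Kp y -> expR (- M1) <= nm (F2 N y) <= Cc by move=> [b Kb <-]; rewrite F2p; exact: KC.
have DpC N y : Dp y -> nm (F2 N y) <= Cc.
  apply: (ring_max (hdivw N (t0 N - p)%N setT) rKp) => z Kz; by case/andP: (KpC N z Kz).
have KpV : Kp `<=` V p by move=> _ [b Kb <-]; apply: V0; exact: K0.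
have Vz0 : V 0%N z0 by apply: comp_refl; exact: wz.1.
have V0Dp : V 0%N `<=` Dp by move=> y Vy; have [_ [z Dz zE]] := cover y (or_intror Vy); exists z.
pose E := comp Dp z0; have oE : open E by exact: comp_open.
have V0E : V 0%N `<=` E by apply: comp_max Vz0 V0Dp (cV 0%N).
(* The frontier of [E] lies in [Kp], inside [V p], so [G] is connected. It links [V 0], where the
   limit must not vanish, with [Kp], where a lower bound is known. *)
pose G := E `|` V p; have oG : open G by exact: openU.
have cG : connected G.
  have [M M0 hM] := bDp.
  have [q cq nq] : exists2 z, closure E z & ~ E z.
    by apply: bounded_boundary => //; [exists M => // z /comp_sub/hM|exists z0; exact: V0E].
  have qK : Kp q.
    apply: hbDp; first by apply: closure_subset cq; exact: comp_sub.
    by move=> Dq; apply: nq; apply: comp_closure.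
  have [r r0 hr] := (openCP _).1 (oV p) q (KpV q qK).
  have [x Ex xq] := (closureCP _ _).1 cq r r0.
  by apply: (connectedUU Ex) => //; [exact: hr|exact: comp_conn].
have lb : loc_bounded F2 G.
  move=> z [Ez|Vz].
    have [r r0 hr] := (openCP _).1 oE z Ez; exists r, Cc; split => // N y yz.
    by apply: DpC; exact: (comp_sub (hr y yz)).
  have [r r0 hr] := (openCP _).1 (oV p) z Vz.
  have kc := @cdisc_compact R z (r / 2).
  have cdV : cdisc z (r / 2) `<=` V p by move=> y; rewrite /cdisc /= => yz; apply: hr; rewrite /disc /=; lin.
  have [Y [kY cY sY YV _]] := compact_connected_hull (oV p) (cV p) Vz (compactU kKp kc) (fun y => or_ind (KpV y) (cdV y)).
  have [M2 hM2] := schottky_control (oV p) kY cY YV M1.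
  exists (r / 2), (expR M2); split; first by lin.
  move=> N y yz; have yc : cdisc z (r / 2) y by apply: ltW.
  have om := omit N (t0 N - p)%N _ (fun x => Vp x N).
  have Yy : Y y by apply: sY; right.
  have ky : Kp (iter p f a) by exists a.
  have := hM2 (F2 N) (hdivw _ _ _) om (iter p f a) y (sY _ (or_introl ky)) Yy.
  rewrite F2p => /(_ (KB N a Ka)); have y0 : 0 < nm (F2 N y) by rewrite nm_gt0; have [] := om y (cdV y yc).
  by move=> /(lnE _ _ y0) /andP[].
have [I0 [UF ooI]] := ultraFilterLemma (eventually_filter).
have PF := @ultra_proper _ _ UF.
have [Phi cPhi] := @montel R _ I0 UF F2 G oG (fun N => hdivw N _ G) lb.
have holF A : I0 [set N | hol_on A (F2 N)] by apply: filterS filterT => N _; exact: hdivw.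
have cPhiV : fcvg (F := I0) F2 (V 0%N) Phi.
  by move=> X kX XV; apply: cPhi => // z /XV/V0E; left.
have nzF : I0 [set N | forall z, V 0%N z -> F2 N z != 0].
  apply: filterS filterT => N _ z Vz; rewrite /F2 mulf_neq0 ?invr_eq0 //; apply/eqP => E0.
  by apply: (av0 _ (tN N)); rewrite -E0; exact: V0.
(* By Hurwitz the limit on [V 0] is zero-free or identically 0. In the latter case it vanishes on
   all of [G], in particular on [Kp], against the bound from below by [expR (- M1)]. *)
have PhiV : forall z, V 0%N z -> Phi z != 0.
  have [//|P0] := hurwitz PF (oV 0%N) (cV 0%N) (holF _) cPhiV nzF.
  exfalso; have [r r0 hr] := (openCP _).1 (oV 0%N) z0 Vz0.
  have PG : forall z, G z -> Phi z = 0.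
    have Gz0 : G z0 by left; exact: V0E.
    move=> z; rewrite -(P0 z0 Vz0); move: z.
    apply: (identity_theorem oG cG (weierstrass PF oG (holF G) cPhi) Gz0 r0) => z _ /hr/P0 ->.
    by rewrite P0.
  have ky : Kp (iter p f a) by exists a.
  have e0 : 0 < expR (- M1) by exact: expR_gt0.
  have sub : Kp `<=` G by move=> y /KpV; right.
  have [N hNs] := filter_ex (cPhi Kp kKp sub _ e0).
  have := hNs _ ky; rewrite PG ?subr0; last exact: sub.
  by case/andP: (KpC N _ ky); lin.
have KV : K `<=` V 0%N by [].
have [c c0 hc] := compact_nm_min kK (fcvg_cont PF (holF _) cPhiV kK KV) (fun z Kz => PhiV z (K0 z Kz)).
have c20 : 0 < c / 2 by lin.
have [B hB] := ring_swallow hf nf rK.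
have Mp : 0 < 2 * Cc / (c / 2) by rewrite divr_gt0 ?mulr_gt0.
(* On [K] the iterate f^(t-p) is at least |w| c / 2, so its image of [D] covers that disc. A point
   there is f^(t-p)(x) with x = f^(p-1)(x'), whence |f z| = |f^t(x')| is at most Cc |w|. The radius
   is halved for strict inequality, which explains the constant 2 Cc / (c / 2). *)
have xy : forall z, f z = f 0 + dv f 0 * z.
  apply: (affine_growth hf Mp) => L.
  pose S := Num.max (`|L| + 1) (`|B| + 1).
  have [S1 S2] : `|L| + 1 <= S /\ `|B| + 1 <= S by rewrite !le_max !lexx orbT.
  have [N1 hN1] := iterate_tends wz rK K0 kK' K'0 (S / (c / 2) * 2).
  have largeN : I0 [set N | (N1 <= N)%N] by apply: ooI; exists N1.
  have [N [hNs N1N]] := filter_ex (filterI (cPhi K kK (fun z Kz => or_introl (V0E z (K0 z Kz))) _ c20) largeN).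
  have wn : 0 < nm (w N) by rewrite nm_gt0.
  have wbig : S / (c / 2) * 2 < nm (w N).
    case: (zwP N) => K'z -> _; apply: hN1 => //; apply: leq_trans N1N _; apply: leq_trans (tinf N) _; exact: leq_subr.
  have wS : S < nm (w N) * (c / 2) / 2.
    by rewrite ltr_pdivlMr // -ltr_pdivrMr // mulrAC.
  exists (nm (w N) * (c / 2) / 2); first by have := ler_norm L; lin.
  move=> z zr.
  have [|y Ky||x Dx xz] := hB (t0 N - p)%N (nm (w N) * (c / 2)) _ _ z; first by have := ler_norm B; have := normr_ge0 B; lin.
    have := hNs y Ky; have := hc y Ky; have := nmB_ge' (F2 N y) (Phi y); rewrite /F2 !nmM nmV => h1 h2 h3.
    have : c / 2 <= nm (iter (t0 N - p) f y) / nm (w N) by lin.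
    by rewrite ler_pdivlMr // mulrC.
  - by have := normr_ge0 B; lin.
  have [[x' Dx' x'E] _] := cover x (or_introl Dx).
  have -> : f z = iter (t0 N) f x'.
    have E' : ((t0 N - p).+1 + p.-1 = t0 N)%N by rewrite addSn -addnS prednK // subnK.
    by rewrite -xz -x'E -iterS -iterD E'.
  have : nm (iter (t0 N) f x' / w N) <= Cc.
    by apply: (ring_max (hdivw N (t0 N) setT) rK) Dx' => b Kb; case/andP: (KC N b Kb).
  rewrite nmM nmV ler_pdivrMr // => h; apply: le_trans h _; rewrite le_eqVlt; apply/orP; left; apply/eqP.
  by field; rewrite !gt_eqF.
exact: naff xy.
Qed.

End annuli.

(** * The domain between two levels of one iterate; existence and uniqueness of a hole *)

Section holes_of_components.
Context {R : realType}.
Local Notation C := (cplx R).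
Implicit Types (g : C -> C) (z w : C) (A D K Q : set C).

(* Minimum principle: a zero exists in a bounded component of a sublevel set. *)
Lemma sublevel_comp_zero g (s : R) z : hol_on setT g -> bdd (comp [set w | nm (g w) < s] z) -> nm (g z) < s ->
  exists2 w, comp [set w | nm (g w) < s] z w & g w = 0.
Proof.
move=> hg [M M0 hM] zs; set X := comp _ z; apply: contrapT => h.
have n0 w : X w -> g w != 0 by move=> Xw; apply/eqP => E; apply: h; exists w.
have oX : open X by exact/comp_open/sublevel_open.
have Xz : X z by exact: comp_refl.
have bdE w : closure X w -> ~ X w -> s <= nm (g w).
  move=> cw nw; rewrite leNgt; apply/negP => gw; apply: nw; apply: comp_closure => //; exact: sublevel_open.
have s0 : 0 < s by apply: le_lt_trans zs; exact: nm_ge0.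
have cn0 w : closure X w -> g w != 0.
  move=> cw; have [/n0//|nX] := pselect (X w); rewrite -nm_gt0; have := bdE w cw nX; lin.
have : nm ((g z)^-1) <= s^-1.
  apply: (@max_modulus R X (fun w => (g w)^-1) s^-1 M oX hM) => //.
  - by apply: cont_on_inv => //; exact: cont_on_sub (hol_cont hg).
  - move=> w Xw; have [d hd] := hg w I; eexists; apply: (dC_inv hd); exact: n0.
  - move=> w cw nw; rewrite nmV lef_pV2 ?posrE //; first exact: bdE.
    by rewrite nm_gt0; exact: cn0.
rewrite nmV lef_pV2 ?posrE //; first by lin.
by rewrite nm_gt0; exact: n0.
Qed.

Lemma hole_clopen_surround V Q : open V -> hole_clopen V Q -> exists N, [/\ open N, bdd N, Q `<=` N &
  closure N `<=` V `|` Q].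
Proof.
move=> oV [kQ nQ oQ].
have [e e0 he] := compact_disc_nbhs kQ oQ (fun z Qz => or_intror Qz).
exists [set z | exists2 a, Q a & nm (z - a) < e / 2]; split.
- apply/openCP => z [a Qa za]; exists (e / 2 - nm (z - a)); first by lin.
  by move=> w; rewrite /disc /= => wz; exists a => //; have := nmD3 z w a; lin.
- have [M M0 hM] := compact_bdd kQ; exists (M + e); first by lin.
  by move=> z [a Qa za]; have := hM a Qa; have := nmB_ge z a; lin.
- by move=> z Qz; exists z => //; rewrite subrr nm0; lin.
- move=> z /closureCP/(_ (e / 2) ltac:(lin))[w [a Qa wa] wz]; apply: (he a z Qa).
  by have := nmD3 w z a; have := nmBC w z; lin.
Qed.

(* By the maximum principle the components of [N] lie in a sublevel set containing the frontier of [N]. *)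
Lemma surround_in_level g (Rr : R) z1 (N : set C) y : hol_on setT g -> open N -> bdd N -> N y ->
  (forall z, closure N z -> ~ N z -> comp [set w | nm (g w) < Rr] z1 z) -> comp [set w | nm (g w) < Rr] z1 y.
Proof.
move=> hg oN bN Ny hb; set Om := comp _ z1.
pose E := comp N y; have oE : open E by exact: comp_open.
have [M M0 hM] := bN.
have bE : bdd E by exists M => // z /comp_sub/hM.
have [q cq nq] := bounded_boundary oE bE (ex_intro _ y (comp_refl Ny)).
have EN z : closure E z -> ~ E z -> closure N z /\ ~ N z.
  move=> cz nz; split; first by apply: closure_subset cz; exact: comp_sub.
  by move=> Nz; apply: nz; exact: comp_closure.
have kdE : compact (closure E `&` ~` E).
  apply: (subclosed_compact _ (closure_compact bE)); last by move=> z [].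
  by apply: closedI; [exact: closed_closure|exact: open_closedC].
have [x [cx nx] hx] := rcompact_max kdE (ex_intro _ q (conj cq nq)) (rcont_nm (cont_on_sub (fun _ _ => I) (hol_cont hg))).
have gx : nm (g x) < Rr by have [c1 n1] := EN x cx nx; exact: (comp_sub (hb x c1 n1)).
have ER : E `<=` [set w | nm (g w) < Rr].
  move=> z Ez /=; apply: le_lt_trans gx.
  apply: (max_modulus oE (fun w Ew => hM w (comp_sub Ew)) _ (hol_sub (fun _ _ => I) hg)) Ez.
    exact: cont_on_sub (hol_cont hg).
  by move=> w cw nw; apply: hx.
have [c1 n1] := EN q cq nq; have Oq := hb q c1 n1.
have [d d0 hd] := (openCP Om).1 (comp_open (sublevel_open hg)) q Oq.
have [w Ew wq] := (closureCP _ _).1 cq d d0.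
by apply: (comp_meet (comp_conn (z := y)) ER Ew (hd w wq)); exact: comp_refl.
Qed.

Context (f : C -> C) (hf : hol_on setT f) (nf : nonconst f) (naff : forall a b, ~ forall z, f z = a + b * z).

Definition wandering_ring z0 := wander f z0 /\ exists K D, fatou_ring f K D /\ K `<=` fcomp f z0 0.

Lemma wring_shift z0 n : wandering_ring z0 -> wandering_ring (iter n f z0).
Proof.
move=> [wz [K [D [rK K0]]]]; split; first exact: wander_shift.
exists (iter n f @` K), (iter n f @` D); split; first exact: ring_image.
by move=> _ [z Kz <-]; rewrite fcomp_shift; have := fcomp_iter hf nf n wz.1 (K0 z Kz).
Qed.

Lemma wring_bdd z0 n : wandering_ring z0 -> bdd (fcomp f z0 n).
Proof. by move=> [wz [K [D [rK K0]]]]; exact: (@fcomp_bdd _ f hf nf z0 K D n wz rK K0). Qed.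

Lemma wring_tends z0 K : wandering_ring z0 -> compact K -> K `<=` fcomp f z0 0 ->
  forall M : R, exists N, forall n z, (N <= n)%N -> K z -> M < nm (iter n f z).
Proof. by move=> [wz [K' [D [rK K0]]]] kK KV; exact: (iterate_tends hf nf wz rK K0 kK KV). Qed.

Lemma wring_annulus z0 K : wandering_ring z0 -> compact K -> K `<=` fcomp f z0 0 ->
  exists N, forall k z w, (N <= k)%N -> K z -> nm w = nm (iter k f z) -> fcomp f z0 k w.
Proof. by move=> [wz [K' [D [rK K0]]]] kK KV; exact: (annulus_in_fcomp hf nf naff wz rK K0 kK KV). Qed.

Lemma modulus_ivt g K a b (s : R) : hol_on setT g -> connected K -> K a -> K b -> nm (g a) <= s <= nm (g b) ->
  exists2 z, K z & nm (g z) = s.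
Proof.
move=> hg cK Ka Kb /andP[sa sb]; have [E|na] := eqVneq (nm (g a)) s; first by exists a.
have [z [Kz cz nz]] := connected_boundary cK (sublevel_open (s := s) hg) Ka ltac:(rewrite /=; lin) Kb ltac:(rewrite /=; lin).
exists z => //; apply/eqP; rewrite eq_le; apply/andP; split; last by rewrite leNgt; apply/negP.
rewrite leNgt; apply/negP => gz; have e0 : 0 < nm (g z) - s by lin.
have [d d0 hd] := (rcont_nm (hol_cont hg) : rcont_on setT _) z I _ e0.
have [w /= ws wz] := (closureCP _ _).1 cz d d0.
by have := hd w I wz; rewrite ltr_norml; lin.
Qed.

Lemma radial w (s : R) : w != 0 -> exists2 x : C, nm x = `|s| & nm (w - x) = `|nm w - s|.
Proof.
move=> w0; have n0 : nm w != 0 by rewrite nm_eq0.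
exists (rc (s / nm w) * w); first by rewrite nmM nm_rc normrM normfV (ger0_norm (nm_ge0 w)) divfK.
rewrite -{1}[w]mul1r -mulrBl -rc1 -rcB nmM nm_rc -{2}(ger0_norm (nm_ge0 w)) -normrM mulrBl mul1r divfK //.
Qed.

(** The circles through the values of f^k on [K] fill a closed annulus in [V k], and compactness
    leaves room for [r] below and [Rr] above. The part of [Om] above [r] is connected by
    [ring_connected], maps into that annulus and meets [K], so it lies in the Fatou component. *)
Lemma level_setup z0 K N0 : wandering_ring z0 -> compact K -> connected K -> K !=set0 -> K `<=` fcomp f z0 0 ->
  exists k r Rr, [/\ (N0 <= k)%N, 0 < r, r < Rr, (forall z, K z -> r < nm (iter k f z) < Rr) & ~ fcomp f z0 k 0] /\
    forall z1, K z1 -> let Om := comp [set w | nm (iter k f w) < Rr] z1 in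
      [/\ bdd Om, K `<=` Om & forall z, Om z -> r < nm (iter k f z) -> fcomp f z0 0 z].
Proof.
move=> wr kK cK [a0 Ka0] KV; have [wz [KD [D [rK KD0]]]] := wr.
have [p p0 cover] := ring_cover hf nf wz rK KD0.
have [N1 an1] := wring_annulus wr kK KV.
have rKp := ring_image hf nf p rK; set Kp := iter p f @` KD in rKp; set Dp := iter p f @` D in rKp.
have [[kKp cKp [y0 Kpy0] _] oDp bDp hbDp _] := rKp.
have KpV : Kp `<=` fcomp f (iter p f z0) 0.
  by move=> _ [z Kz <-]; rewrite fcomp_shift; have := fcomp_iter hf nf p wz.1 (KD0 z Kz).
have [N2 an2] := wring_annulus (wring_shift p wr) kKp KpV.
have [N3 td] := wring_tends wr kK KV 1.
have [N4 av] := fcomp_avoid 0 wz.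
pose k := (N0 + (N1 + (N2 + (N3 + N4))))%N.
have k0 : (N0 <= k)%N by rewrite leq_addr.
have k1 : (N1 <= k)%N by rewrite /k addnCA leq_addr.
have k2 : (N2 <= k)%N by rewrite /k (addnCA N1) addnCA leq_addr.
have k3 : (N3 <= k)%N by rewrite /k (addnCA N2) (addnCA N1) addnCA leq_addr.
have k4 : (N4 <= k)%N by rewrite /k !addnA leq_addl.
set g := iter k f; have hg : hol_on setT g := hol_iter k hf.
have cg A : rcont_on A (fun z => nm (g z)) by apply: rcont_nm; exact: cont_on_sub (hol_cont hg).
have [b Kb hb] := rcompact_max kK (ex_intro _ a0 Ka0) (cg K).
have [a Ka ha] := rcompact_min kK (ex_intro _ a0 Ka0) (cg K).
have [ym Kym hym] := rcompact_min kKp (ex_intro _ y0 Kpy0) (cg Kp).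
have [yM KyM hyM] := rcompact_max kKp (ex_intro _ y0 Kpy0) (cg Kp).
have V0Dp : fcomp f z0 0 `<=` Dp by move=> y Vy; have [_ [z Dz zE]] := cover y (or_intror Vy); exists z.
(* Otherwise the maximum of |g| on [Kp] is below its value at [b], against the maximum principle on
   [Dp], or the modulus of [g b] also occurs on [Kp]. Then [g b] would lie in both [V k] and
   [V (k + p)]. *)
have above : nm (g b) < nm (g ym).
  rewrite ltNge; apply/negP => le.
  have [lt|ge] := ltP (nm (g yM)) (nm (g b)).
    have := ring_max hg rKp hyM (V0Dp b (KV b Kb)); lin.
  have [y Ky yE] := modulus_ivt hg cKp Kym KyM (introT andP (conj le ge)).
  apply: (wz.2 k (k + p)%N (g b)); first by rewrite -addn1 leq_add2l.
    exact: an1 k1 Kb erefl.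
  by have := an2 k y (g b) k2 Ky (esym yE); rewrite fcomp_shift.
have ab : nm (g a) <= nm (g b) := hb a Ka.
have a1 : 1 < nm (g a) := td k a k3 Ka.
pose A := [set w : C | nm (g a) <= nm w <= nm (g b)].
have kA : compact A.
  apply: (@closed_bounded_compact _ _ (nm (g b))); last by move=> w /andP[].
  move=> w /closureCP cw; apply/andP; split; apply/ler_addgt0Pr => e /cw[x /andP[x1 x2] xw].
    by have := nmB_ge x w; lin.
  by have := nmB_ge' x w; lin.
have AV : A `<=` fcomp f z0 k.
  by move=> w /(modulus_ivt hg cK Ka Kb)[z Kz zE]; exact: an1 k1 Kz (esym zE).
have [eps eps0 he] := compact_disc_nbhs kA (fcomp_open (z0 := z0) (n := k) (f := f)) AV.
have gap : 0 < nm (g ym) - nm (g b) by rewrite subr_gt0.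
have [q0 q00 [q1 q2]] := gt0_lb2 eps0 (ltr01 : 0 < 1 :> R); have [e e0 [q3 q4]] := gt0_lb2 q00 gap.
pose r := nm (g a) - e / 2; pose Rr := nm (g b) + e / 2.
have rpos : 0 < r by rewrite /r; lin.
have rR : r < Rr by rewrite /r /Rr; lin.
have annV w : r <= nm w <= Rr -> fcomp f z0 k w.
  move=> /andP[w1 w2]; have w0 : w != 0 by rewrite -nm_gt0; lin.
  have [l1|l1] := ltP (nm w) (nm (g a)).
    have [x xn xw] := radial (nm (g a)) w0; apply: (he x).
      by rewrite /A /= xn ger0_norm ?lexx //= nm_ge0.
    by rewrite xw ltr_norml /r in w1 *; lin.
  have [l2|l2] := ltP (nm (g b)) (nm w).
    have [x xn xw] := radial (nm (g b)) w0; apply: (he x).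
      by rewrite /A /= xn ger0_norm ?ab ?lexx //= nm_ge0.
    by rewrite xw ltr_norml /Rr in w2 *; lin.
  by apply: AV; rewrite /A /= l1 l2.
have Kg z : K z -> r < nm (g z) < Rr.
  by move=> Kz; have := ha z Kz; have := hb z Kz; rewrite /r /Rr => h1 h2; apply/andP; split; lin.
exists k, r, Rr; split; first by split => //; exact: av.
move=> z1 Kz1 Om.
(* On the frontier of [Dp] the modulus is at least that at [ym], which exceeds [Rr], so [Om] cannot
   cross it and is bounded. *)
have OmD : Om `<=` Dp.
  move=> z Oz; apply: contrapT => nD.
  have Oz1 : Om z1 by apply: comp_refl; case/andP: (Kg z1 Kz1).
  have [x [Ox cx nx]] := connected_boundary (comp_conn (z := z1)) oDp Oz1 (V0Dp _ (KV _ Kz1)) Oz nD.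
  have := hym x (hbDp x cx nx); have := comp_sub Ox; rewrite /= -/g /Rr; lin.
have bOm : bdd Om by have [M M0 hM] := bDp; exists M => // z /OmD/hM.
have KOm : K `<=` Om by apply: (comp_max Kz1 _ cK) => z /Kg/andP[].
split => // z Oz rz.
have cW := ring_connected hg bOm rR.
have WF : [set z | Om z /\ r < nm (g z)] `<=` fatou_set f.
  move=> x [Ox rx]; apply/(fatou_iter k x hf nf); apply: (@comp_sub _ _ (iter k f z0)); apply: annV.
  by rewrite (ltW rx) ltW //; exact: (comp_sub Ox).
apply: (comp_meet cW WF (w := z1) _ (KV z1 Kz1)) => //.
by split; [exact: KOm|case/andP: (Kg z1 Kz1)].
Qed.

Section one_component.
Context (z0 : C) (wr : wandering_ring z0).
Local Notation V := (fcomp f z0).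
Let oV n : open (V n). Proof. exact: fcomp_open. Qed.
Let Fz : fatou_set f z0 := wr.1.1.

Let Vimage z : V 0%N z -> V 1%N (f z).
Proof. by move=> Vz; have := fcomp_iter hf nf 1 Fz Vz; rewrite add0n. Qed.

Lemma hole_closure Q z : hole_clopen (V 0%N) Q -> closure (V 0%N `|` Q) z -> ~ (V 0%N `|` Q) z -> closure (V 0%N) z.
Proof.
move=> [kQ _ _] cz nz; move: cz; rewrite closureU => -[//|].
by rewrite -(closure_id _).1; [move=> Qz; case: nz; right|exact: compact_closedC].
Qed.

(** The maximum principle for the identity on the open set formed by [V 0] and [Q], whose frontier
    lies in the closure of [V 0]. *)
Lemma hole_bounded (M : R) Q : hole_clopen (V 0%N) Q -> (forall z, V 0%N z -> nm z <= M) -> forall z, Q z -> nm z <= M.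
Proof.
move=> hQ hM z Qz; have [kQ nQ oQ] := hQ; have [M' M'0 hM'] := compact_bdd kQ.
apply: (@max_modulus R (V 0%N `|` Q) id M (Num.max M M') oQ) => //; last by right.
- by move=> w [/hM|/hM'] h; rewrite le_max h ?orbT.
- exact: cont_on_id.
- by move=> w _; exists 1; exact: dC_id.
- by move=> w cw nw; apply: (closureC_bounded hM); exact: hole_closure hQ cw nw.
Qed.

(* A component of the Fatou set inside [Q] mapping onto [V 1] would carry the point of [closure (V 1)] of
   largest modulus, against the maximum principle on [V 0 `|` Q]. *)
Lemma hole_not_over Q z : hole_clopen (V 0%N) Q -> Q z -> ~ V 1%N (f z).
Proof.
move=> hQ Qz V1z; have [kQ nQ oQ] := hQ.
have Fzz : fatou_set f z by apply: (fatou_preimage hf); exact: (comp_sub V1z).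
pose W := comp (fatou_set f) z; have oW : open W by apply: comp_open; exact: fatou_open.
have nWV w : W w -> ~ V 0%N w.
  move=> Ww Vw; apply: (nQ z Qz); rewrite /fcomp (comp_eq Vw) -(comp_eq Ww); exact: comp_refl.
have WQ : W `<=` Q.
  apply: (connected_ind (P := Q) (comp_conn (z := z))); first by exists z => //; exact: comp_refl.
    move=> w Ww Qw; have [r r0 hr] := (openCP _).1 oQ w (or_intror Qw); exists r => // x Wx xw.
    by case: (hr x xw) => // /(nWV x Wx).
  move=> w Ww h; have : closure Q w by apply/closureCP => e /h[x [_ xw Qx]]; exists x.
  by rewrite -(closure_id _).1 //; exact: compact_closedC.
have [MQ MQ0 hMQ] := compact_bdd kQ.
have bW : bdd W by exists MQ => // w /WQ/hMQ.
have onto w : V 1%N w -> exists2 x, W x & f x = w.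
  apply: (swallow hf nf oW bW (comp_conn (z := _))); last by exists z => //; exact: comp_refl.
  move=> x cx nx /comp_sub/(fatou_preimage hf) Fx; apply: nx; apply: comp_closure => //; exact: fatou_open.
have kV := closure_compact (wring_bdd 1 wr).
have ne : closure (V 1%N) !=set0 by exists (f z); exact: subset_closure.
have [s cs hs] := rcompact_max kV ne (rcont_nm (@cont_on_id _ (closure (V 1%N)))).
have [y Qy yE] : exists2 y, Q y & f y = s.
  have cl := compact_closedC (cont_compact kQ (cont_on_sub (fun _ _ => I) (hol_cont hf))).
  have : closure (f @` Q) s.
    by apply: closure_subset cs => w /onto[x /WQ Qx <-]; exists x.
  by rewrite -(closure_id _).1 // => -[y Qy yE]; exists y.
have bound x : (V 0%N `|` Q) x -> nm (f x) <= nm s.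
  have [M0' M00 hM0] := wring_bdd 0 wr.
  apply: (@max_modulus R (V 0%N `|` Q) f (nm s) (Num.max M0' MQ) oQ).
  - by move=> w [/hM0|/hMQ] h; rewrite le_max h ?orbT.
  - exact: cont_on_sub (hol_cont hf).
  - exact: hol_sub hf.
  - move=> w cw nw; apply: hs; have cV := hole_closure hQ cw nw.
    have := cont_compact (closure_compact (wring_bdd 0 wr)) (cont_on_sub (fun _ _ => I) (hol_cont hf)) => _.
    apply/closureCP => e e0; have [d d0 hd] := (hol_cont hf : cont_on setT _) w I _ e0.
    by have [x' Vx xw] := (closureCP _ _).1 cV d d0; exists (f x'); [exact: Vimage|exact: hd].
have [d d0 hd] := open_mapping oQ (hol_sub (fun _ _ => I) hf) (or_intror Qy) (nonconst_not_loc (c := y) hf nf) ltr01.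
have [x xn xs] : exists2 x : C, nm s < nm x & nm (x - s) < d.
  have [->|s0] := eqVneq s 0.
    by exists (rc (d / 2)); rewrite ?subr0 nm_rc ?nm0 gtr0_norm; lin.
  have [x xn xw] := radial (nm s + d / 2) s0; exists x; last first.
    by rewrite nmBC xw ltr_norml; lin.
  by rewrite xn gtr0_norm; have := nm_ge0 s; lin.
have [v [Vv _ vE]] := hd x ltac:(by rewrite /disc /= yE).
by have := bound v Vv; rewrite vE; lin.
Qed.

Lemma hole_image Q : hole_clopen (V 0%N) Q -> hole_clopen (V 1%N) (f @` Q).
Proof.
move=> hQ; have [kQ nQ oQ] := hQ; split.
- by apply: cont_compact => //; exact: cont_on_sub (hol_cont hf).
- by move=> _ [z Qz <-]; exact: hole_not_over hQ Qz.
have [wz [KD [D [rK KD0]]]] := wr.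
have <- : f @` (V 0%N `|` Q) = V 1%N `|` f @` Q.
  by rewrite image_setU; congr setU; have := fcomp_image hf nf 1 wz rK KD0.
exact: open_image.
Qed.

Lemma wring_nonempty : V 0%N z0. Proof. exact: comp_refl. Qed.

Lemma hole_clopen_level k r Rr z1 : 0 < r -> V 0%N z1 -> ~ V k 0 ->
  let Om := comp [set w | nm (iter k f w) < Rr] z1 in r < Rr -> bdd Om ->
  (forall z, Om z -> r < nm (iter k f z) -> V 0%N z) -> V 0%N `|` Om = V 0%N `|` (Om `\` V 0%N) /\
  hole_clopen (V 0%N) (Om `\` V 0%N).
Proof.
move=> r0 V1 nV0 Om rR bOm OmV; set g := iter k f in Om OmV bOm *.
have hg : hol_on setT g := hol_iter k hf.
have E : V 0%N `|` Om = V 0%N `|` (Om `\` V 0%N).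
  apply/seteqP; split=> z [Vz|]; [by left| |by left|by case; right].
  by move=> Oz; have [Vz|nV] := pselect (V 0%N z); [left|right].
split => //; split; [|by move=> z []|by rewrite -E; apply: openU => //; exact/comp_open/sublevel_open].
have kE := level_compact hg bOm rR.
have -> : Om `\` V 0%N = [set z | Om z /\ nm (g z) <= r] `&` ~` V 0%N.
  apply/seteqP; split=> z [Oz nV]; last by split => //; case: Oz.
  by split => //; split => //; rewrite leNgt; apply/negP => /(OmV z Oz).
by apply: compact_closedI => //; exact: open_closedC.
Qed.

(** The bounded component [Om] contains a zero of f^k by the minimum principle. As 0 is not in
    [V k], this zero lies in [Om] outside the domain. *)
Lemma has_hole : hole_family (V 0%N) 1.
Proof.
have kK : compact [set z0] by exact: compact_set1.
have cK : connected [set z0] by exact: connected1.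
have KV : [set z0] `<=` V 0%N by move=> _ ->; exact: wring_nonempty.
have [k [r [Rr [[_ r0 rR Kg nV0] lev]]]] := level_setup 0 wr kK cK (ex_intro _ z0 erefl) KV.
have [bOm KOm OmV] := lev z0 erefl.
have [_ hH] := hole_clopen_level r0 wring_nonempty nV0 rR bOm OmV.
have [w Ow w0] := sublevel_comp_zero (hol_iter k hf) bOm ltac:(by case/andP: (Kg z0 erefl)).
exists (fun=> comp [set w | nm (iter k f w) < Rr] z0 `\` V 0%N); split => [i _|[|i] [|j]//].
split => //; exists w; split => // Vw; apply: nV0; rewrite -w0.
by have := fcomp_iter hf nf k Fz Vw; rewrite add0n.
Qed.

Lemma iter_dv_neq0 k z : V 0%N z -> (forall n w, V n w -> dv f w != 0) -> dv (iter k f) z != 0.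
Proof.
move=> Vz nc; elim: k => [|k IH]; first by rewrite (dvE (dC_id z)) oner_neq0.
rewrite iter_dv // mulf_neq0 //; apply: (nc k).
by have := fcomp_iter hf nf k Fz Vz; rewrite add0n.
Qed.

(** The frontiers of neighbourhoods of both sets are put into [K], so they lie above level [r],
    while the points of the sets lie at or below [r]. The neighbourhood [N1] is then a separation
    that [no_critical_no_separation] rules out. *)
Lemma no_critical_one_hole : (forall n w, V n w -> dv f w != 0) -> ~ hole_family (V 0%N) 2.
Proof.
move=> nc [Q [hQ dQ]].
have [h0 [y1 Qy1]] := hQ 0%N isT; have [h1 [y2 Qy2]] := hQ 1%N isT.
have [N1 [oN1 bN1 QN1 cN1]] := hole_clopen_surround (@oV 0%N) h0.
have [N2 [oN2 bN2 QN2 cN2]] := hole_clopen_surround (@oV 0%N) h1.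
have fr N Q' : open N -> bdd N -> Q' `<=` N -> closure N `<=` V 0%N `|` Q' ->
    compact (closure N `&` ~` N) /\ closure N `&` ~` N `<=` V 0%N.
  move=> oN bN QN cN; split.
    apply: (subclosed_compact _ (closure_compact bN)); last by move=> z [].
    by apply: closedI; [exact: closed_closure|exact: open_closedC].
  by move=> z [/cN[//|/QN]].
have [k1 s1] := fr _ _ oN1 bN1 QN1 cN1; have [k2 s2] := fr _ _ oN2 bN2 QN2 cN2.
have [K [kK cK sK KV Kz0]] := compact_connected_hull (@oV 0%N) (comp_conn (z := _)) wring_nonempty (compactU k1 k2)
  (fun z => or_ind (s1 z) (s2 z)).
have [k [r [Rr [[_ r0 rR Kg nV0] lev]]]] := level_setup 0 wr kK cK (ex_intro _ z0 Kz0) KV.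
have [bOm KOm OmV] := lev z0 Kz0; have hg := hol_iter k hf.
set Om := comp _ z0 in bOm KOm OmV.
have O1 : Om y1.
  apply: (surround_in_level hg oN1 bN1 (QN1 _ Qy1)) => z cz nz; apply: KOm; apply: sK; by left.
have O2 : Om y2.
  apply: (surround_in_level hg oN2 bN2 (QN2 _ Qy2)) => z cz nz; apply: KOm; apply: sK; by right.
have [_ nQ1 _] := h0; have [_ nQ2 _] := h1.
have g1 : nm (iter k f y1) <= r by rewrite leNgt; apply/negP => /(OmV _ O1); exact: nQ1.
have g2 : nm (iter k f y2) <= r by rewrite leNgt; apply/negP => /(OmV _ O2); exact: nQ2.
have : N1 y2.
  apply: (no_critical_no_separation hg bOm (ltW r0) _ rR oN1 _ O1 O2 g1 g2 (QN1 _ Qy1)).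
    by move=> z Oz rz; apply: iter_dv_neq0 nc; exact: OmV.
  move=> z Oz zr cz; apply: contrapT => nz.
  have Kz : K z by apply: sK; left.
  by case/andP: (Kg z Kz) => h _; move: zr; rewrite leNgt h.
by move=> /subset_closure/cN1[/(nQ2 _ Qy2)//|Qy]; have := dQ 0%N 1%N y2 isT isT Qy Qy2.
Qed.

End one_component.
End holes_of_components.

(** * Local behaviour of a composition at a critical point *)

Section critical_points.
Context {R : realType}.
Local Notation C := (cplx R).
Implicit Types (f g h : C -> C) (z w p : C) (A B V K Q X : set C).

Lemma cexpX z n : cexp (n%:R * z) = cexp z ^+ n :> C.
Proof. by elim: n => [|n IH]; rewrite ?mul0r ?cexp0 // -natr1 mulrDl mul1r cexpD IH exprSr. Qed.

Lemma unit_root (c : C) n : (0 < n)%N -> nm c = 1 -> exists2 v : C, nm v = 1 & v ^+ n = c.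
Proof.
move=> n0 nc; have c0 : c != 0 by rewrite -nm_gt0 nc.
have [l [lc rl _]] := cexp_surj c0; have nR : n%:R != 0 :> C by rewrite pnatr_eq0 -lt0n.
exists (cexp (l / n%:R)); last by rewrite -cexpX mulrC divfK.
rewrite nm_cexp -rcn -rcV reM re_rc im_rc mulr0 subr0 rl nc ln1 mul0r expR0; exact: erefl.
Qed.

Lemma critical_order f p : hol_on setT f -> nonconst f -> dv f p = 0 ->
  exists m k, exists2 r : R, (1 < m)%N /\ 0 < r &
    hol_on (disc p r) k /\ forall z, disc p r z -> k z != 0 /\ f z = f p + (z - p) ^+ m * k z.
Proof.
move=> hf nf dp.
have [lc|[m [k [r [m0 r0 _] [hk hr]]]]] := zero_factor (ltr01 : 0 < 1 :> R) (hol_sub (fun _ _ => I) hf : hol_on (disc p 1) f).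
  by case: (nonconst_not_loc (c := p) hf nf).
exists m, k; exists r => //; split => //; rewrite ltn_neqAle m0 andbT; apply/eqP => m1.
have Dp := disc_center p r0; have [k0 _] := hr p Dp; have [d hd] := hk p Dp.
have : dC f p (0 + (1 * k p + (p - p) * d)).
  apply: (dC_ext (g := fun z => f p + (z - p) * k z) r0).
    by move=> w /hr[_ ->]; rewrite -m1 expr1.
  by apply: dC_add; [exact: dC_cst|apply: dC_mul => //; exact: dC_shift].
move=> /dvE; rewrite dp add0r subrr mul0r addr0 mul1r => E.
by move: k0; rewrite -E eqxx.
Qed.

Lemma cont_ratio_near k p (r : R) : 0 < r -> hol_on (disc p r) k -> k p != 0 ->
  exists2 d : R, 0 < d /\ d <= r & forall z, disc p d z -> nm (k z / k p - 1) < 1 / 5.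
Proof.
move=> r0 hk k0; have e0 : 0 < nm (k p) / 5 by rewrite divr_gt0 // nm_gt0.
have [d d0 hd] := hol_cont hk (disc_center p r0) e0.
have [q q0 [q1 q2]] := gt0_lb2 d0 r0; exists q => // z; rewrite /disc /= => zq.
rewrite -(divff k0) -mulrBl nmM nmV ltr_pdivrMr ?nm_gt0 // mulrC mul1r.
by apply: hd => //; rewrite /disc /=; lin.
Qed.

Lemma near_one_mul (a b : C) : nm (a - 1) < 1 / 5 -> nm (b - 1) < 1 / 5 -> nm (a * b - 1) < 1 / 2.
Proof.
move=> ha hb; rewrite (_ : a * b - 1 = (a - 1) * (b - 1) + ((a - 1) + (b - 1))); last by ring.
apply: le_lt_trans (nmD _ _) _; have := nmD (a - 1) (b - 1); rewrite nmM => h.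
have : nm (a - 1) * nm (b - 1) <= 1 / 5 * (1 / 5) by apply: ler_pM; rewrite ?nm_ge0 // ltW.
lin.
Qed.

(* Two descending directions of [h \o f] at a critical point of [f] which [f] maps to the same direction. *)
Lemma critical_sectors f h p (rho : R) : hol_on setT f -> hol_on setT h -> nonconst f -> nonconst h ->
  0 < rho -> dv f p = 0 -> h (f p) != 0 -> let s := nm (h (f p)) in
  exists z1 z2, [/\ disc p rho z1, disc p rho z2, nm (h (f z1)) < s, nm (h (f z2)) < s &
    ~ comp [set z | nm (h (f z)) < s] z1 z2] /\ comp [set z | nm (h z) < s] (f z1) (f z2).
Proof.
move=> hf hh nf nh rho0 dp g0 s.
have [m [k1 [r1 [m1 r10] [hk1 hr1]]]] := critical_order hf nf dp.
have [lc|[mu [k2 [r2 [mu0 r20 _] [hk2 hr2]]]]] := zero_factor (ltr01 : 0 < 1 :> R) (hol_sub (fun _ _ => I) hh : hol_on (disc (f p) 1) h).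
  by case: (nonconst_not_loc (c := f p) hh nh).
have m0 : (0 < m)%N by apply: ltn_trans m1.
have k10 : k1 p != 0 by case: (hr1 p (disc_center p r10)).
have k20 : k2 (f p) != 0 by case: (hr2 (f p) (disc_center _ r20)).
have [d1 d10 hd1] := (hol_cont hf : cont_on setT _) p I _ r20.
have [r3 r30 [r31 r32]] := gt0_lb2 r10 d10.
(* Orders multiply: [f] has order [m] at [p] and [h] has order [mu] at [f p], so the composition has
   [M] valleys at [p]. *)
pose M := (m * mu)%N; pose kk z := k1 z ^+ mu * k2 (f z).
have hkk : hol_on (disc p r3) kk.
  move=> z zr; have [a ha] := hk1 z (lt_le_trans zr r31).
  have [b hb] := hk2 (f z) (hd1 z I (lt_le_trans zr r32)); have [c hc] := hf z I.
  eexists; apply: dC_mul; first exact: dC_pow ha.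
  exact: (dC_comp (g := f) hb hc).
have gk z : disc p r3 z -> h (f z) = h (f p) + (z - p) ^+ M * kk z.
  move=> zr; have [_ fz] := hr1 z (lt_le_trans zr r31); have [_ ->] := hr2 (f z) (hd1 z I (lt_le_trans zr r32)).
  by rewrite {1}fz addrAC subrr add0r exprMn -exprM /kk mulrA.
have kk0 : kk p != 0 by rewrite /kk mulf_neq0 // expf_neq0.
set n := nm (kk p / h (f p)); have n0 : 0 < n by rewrite nm_gt0 mulf_neq0 // invr_eq0.
have M1 : (1 < M)%N by rewrite /M; apply: leq_trans m1 _; rewrite leq_pmulr.
have [v nv vM] : exists2 v : C, nm v = 1 & v ^+ M = - rc n / (kk p / h (f p)).
  by apply: unit_root; [exact: ltnW|rewrite nmM nmN nm_rc gtr0_norm // nmV -/n divff // gt_eqF].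
have vM' : v ^+ M * (kk p / h (f p)) = - rc n.
  by rewrite vM divfK // mulf_neq0 // invr_eq0.
(* Valley [mu] makes the angle 2 pi / m with valley 0, and its direction has the same m-th power. So
   [f] sends both valleys in the same direction from [f p]. *)
have jM : (0 < mu < M)%N by rewrite mu0 /M -{1}[mu]mul1n ltn_pmul2r.
have hg : hol_on setT (fun z => h (f z)).
  by move=> z _; have [a ha] := hh (f z) I; have [b hb] := hf z I; eexists; exact: (dC_comp (g := f) ha hb).
have [e /andP[e0 er3] sep] := sector_separation hg r30 hkk gk kk0 g0 M1 nv vM' jM.
pose q1 (w : C) := w ^+ mu.
have hq1 : hol_on (disc (k1 p) 1) q1 by move=> w _; eexists; apply: dC_pow; exact: dC_id.
have [d2 [d20 _] hd2] := cont_ratio_near (ltr01 : 0 < 1 :> R) hq1 (expf_neq0 mu k10).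
have [d3 [d30 d3r] hd3] := cont_ratio_near r20 hk2 k20.
have [d4 d40 hd4] := hol_cont hk1 (disc_center p r10) d20.
have c0 : 0 < nm (k1 p) + d2 by have := nm_ge0 (k1 p); lin.
have d30' : 0 < d3 / (nm (k1 p) + d2) by rewrite divr_gt0.
have n0' : 0 < n^-1 by rewrite invr_gt0.
have [tau tau0 [te tau1 td4 td3 [tn trho]]] : exists2 tau : R, 0 < tau &
    [/\ tau < e, tau <= 1, tau < d4, tau < d3 / (nm (k1 p) + d2) & tau < n^-1 /\ tau < rho].
  have [t1 t10 [t11 t12]] := gt0_lb2 e0 (ltr01 : 0 < 1 :> R).
  have [t2 t20 [t21 t22]] := gt0_lb2 t10 d40.
  have [t3 t30 [t31 t32]] := gt0_lb2 t20 d30'.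
  have [t4 t40 [t41 t42]] := gt0_lb2 t30 n0'.
  have [t5 t50 [t51 t52]] := gt0_lb2 t40 rho0.
  clear -t50 t51 t52 t41 t42 t31 t32 t21 t22 t11 t12.
  by exists (t5 / 2); [lin|split; [lin|lin|lin|lin|split; lin]].
have taue : 0 < tau <= e by rewrite tau0 ltW.
have pw i : (0 < i)%N -> 0 < tau ^+ i /\ tau ^+ i <= tau.
  by move=> i0; rewrite exprn_gt0 //; split => //; rewrite -{2}[tau]expr1 ler_wiXn2l // ltW.
pose z (i : nat) := p + rc tau * (v * cis (i%:R * (pi *+ 2 / M%:R))).
have [l0 lj ncomp] : [/\ nm (h (f (z 0%N))) < s, nm (h (f (z mu))) < s &
    ~ comp [set z | nm (h (f z)) < s] (z 0%N) (z mu)] := sep tau taue.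
have zp i : z i - p = rc tau * (v * cis (i%:R * (pi *+ 2 / M%:R))) by rewrite /z addrAC subrr add0r.
have nz i : nm (z i - p) = tau by rewrite zp !nmM nv nm_cis !mulr1 nm_rc gtr0_norm.
have zD i (r : R) : tau < r -> disc p r (z i) by rewrite /disc /= nz.
have cm i : i = 0%N \/ i = mu -> cis (i%:R * (pi *+ 2 / M%:R)) ^+ m = 1 :> C.
  have mR : m%:R != 0 :> R by rewrite pnatr_eq0 -lt0n.
  have muR : mu%:R != 0 :> R by rewrite pnatr_eq0 -lt0n.
  case=> ->; first by rewrite mul0r cis_cexp mulr0 cexp0 expr1n.
  rewrite cisX (_ : m%:R * _ = pi *+ 2); last by rewrite /M natrM; field; rewrite ?mR ?muR.
  rewrite cis_cexp (_ : iC * _ = tpi) ?cexp_tpi // /tpi; ring.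
pose a := rc (tau ^+ m) * v ^+ m.
have fz i : i = 0%N \/ i = mu -> f (z i) = f p + a * k1 (z i).
  move=> im; have [|_ ->] := hr1 (z i); first by apply: zD; exact: lt_le_trans te (le_trans er3 r31).
  by rewrite zp !exprMn cm // mulr1 /a rcX.
have kz i : disc (k1 p) d2 (k1 (z i)).
  by apply: hd4; rewrite ?nz //; apply: zD; exact: lt_le_trans te (le_trans er3 r31).
have na : nm a = tau ^+ m by rewrite nmM nm_rc nmX nv expr1n mulr1 gtr0_norm // exprn_gt0.
(* Both image points have the form [f p + a * x] with [x] in a disc about [k1 p]. On all of this
   convex set the value of [h] stays below [s], so the set joins them. *)
have low x : disc (k1 p) d2 x -> nm (h (f p + a * x)) < s.
  move=> xd; have nx : nm x <= nm (k1 p) + d2 by have := nmB_ge x (k1 p); move: xd; rewrite /disc /=; lin.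
  have Dw : disc (f p) d3 (f p + a * x).
    rewrite /disc /= addrAC subrr add0r nmM na.
    have [_ le] := pw m m0.
    have a1 : tau ^+ m * nm x <= tau * (nm (k1 p) + d2).
      by apply: ler_pM; rewrite ?nm_ge0 ?exprn_ge0 // ltW.
    by apply: le_lt_trans a1 _; rewrite -ltr_pdivlMr.
  have [_ ->] := hr2 _ (lt_le_trans Dw d3r); rewrite addrAC subrr add0r.
  have b1 := hd2 x xd; have b2 := hd3 _ Dw; have b3 := near_one_mul b1 b2.
  set y := tau ^+ M * n; have y0 : 0 < y by rewrite mulr_gt0 // exprn_gt0.
  have y1 : y <= 1.
    rewrite /y -ler_pdivlMr // div1r; have [_ le] := pw M (ltnW M1); exact: le_trans le (ltW tn).
  set w := f p + a * x in b2 b3 *.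
  set th := q1 x / q1 (k1 p) * (k2 w / k2 (f p)) in b3.
  have E : h (f p) + (a * x) ^+ mu * k2 w = h (f p) * (rc (1 - y) + rc y * - (th - 1)).
    have -> : (a * x) ^+ mu * k2 w = rc (tau ^+ M) * (v ^+ M * kk p) * th.
      rewrite [(a * x) ^+ mu]exprMn /a [(rc _ * _) ^+ mu]exprMn !rcX -!exprM -/M /th /q1 /kk; field.
      by rewrite k20 expf_neq0.
    have -> : v ^+ M * kk p = - rc n * h (f p) by rewrite -vM' -mulrA divfK.
    by rewrite rcB rc1 /y rcM; ring.
  rewrite E nmM gtr_pMr ?nm_gt0 //; apply: le_lt_trans (nmD _ _) _; rewrite nmM nmN !nm_rc ger0_norm ?subr_ge0 // gtr0_norm //.
  have : y * nm (th - 1) < y * (1 / 2) by rewrite ltr_pM2l.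
  clear -y0 b3; lin.
exists (z 0%N), (z mu); split.
  by split => //; exact: zD.
pose S := [set f p + a * x | x in disc (k1 p) d2].
have cS : connected S.
  apply: cont_connected; first exact: convex_connected (@cvx_disc _ _ _).
  apply: cont_on_add; first exact: cont_on_cst.
  by apply: cont_on_mul; [exact: cont_on_cst|exact: cont_on_id].
have SS : S `<=` [set x | nm (h x) < s] by move=> _ [x xd <-]; exact: low.
have S0 : S (f (z 0%N)) by rewrite fz; [exists (k1 (z 0%N)) => //; exact: kz|left].
have Sm : S (f (z mu)) by rewrite fz; [exists (k1 (z mu)) => //; exact: kz|right].
exact: (comp_max S0 SS cS).
Qed.

(** Each point of [B] has a neighbourhood covered by the image of one closed disc in [V], by the
    open mapping theorem; compactness needs finitely many of them. *)
Lemma compact_lift g V B : hol_on setT g -> nonconst g -> open V -> compact B -> B `<=` g @` V ->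
  exists K, [/\ compact K, K `<=` V & B `<=` g @` K].
Proof.
move=> hg ng oV kB BV.
have : exists K, [/\ compact K, K `<=` V & B `&` B `<=` g @` K]; last by rewrite setIid.
apply: (compact_induction (K := B) (Q := fun A => exists K, [/\ compact K, K `<=` V & A `&` B `<=` g @` K])) => //.
- by exists set0; split => //; [exact: compact0|move=> z []].
- move=> A A' [K [kK KV AK]] [K' [kK' KV' AK']]; exists (K `|` K'); split; first exact: compactU.
    by move=> z [/KV|/KV'].
  move=> z [[Az|Az] Bz].
    by have [x Kx <-] := AK z (conj Az Bz); exists x => //; left.
  by have [x Kx <-] := AK' z (conj Az Bz); exists x => //; right.
- by move=> A A' AA [K [kK KV AK]]; exists K; split => // z [/AA Az Bz]; exact: AK.
move=> _ /BV[v Vv <-]; have [r r0 hr] := (openCP V).1 oV v Vv.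
have r2 : 0 < r / 2 by lin.
have [d d0 hd] := open_mapping (@openT C) hg I (nonconst_not_loc (c := v) hg ng) r2.
exists d => //; exists (cdisc v (r / 2)); split; first exact: cdisc_compact.
  by move=> w; rewrite /cdisc /= => wv; apply: hr; rewrite /disc /=; lin.
by move=> w [/hd[x [_ xv <-]] _]; exists x => //; exact: ltW.
Qed.

End critical_points.

(** * Pulling families of holes back, with a gain at critical points *)

Section counting_holes.
Context {R : realType}.
Local Notation C := (cplx R).
Implicit Types (g h : C -> C) (z w p : C) (A B K Q X : set C).

Lemma open_preimageC g A : hol_on setT g -> open A -> open [set z | A (g z)].
Proof.
move=> hg oA; apply/openCP => z Az; have [r r0 hr] := (openCP A).1 oA _ Az.
have [d d0 hd] := (hol_cont hg : cont_on setT _) z I _ r0.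
by exists d => // w wz; apply: hr; exact: hd.
Qed.

Lemma closed_preimageC g A : hol_on setT g -> closed A -> closed [set z | A (g z)].
Proof.
move=> hg cA; have -> : [set z | A (g z)] = ~` [set z | (~` A) (g z)].
  by apply/seteqP; split=> z /= h; [move=> /(_ h)|apply: contrapT].
by apply: open_closedC; apply: open_preimageC => //; exact: closed_openC.
Qed.

Lemma hole_family_add V j (Q : nat -> set C) P x : 
  (forall i, (i < j)%N -> hole_clopen V (Q i) /\ Q i !=set0) ->
  (forall i k z, (i < j)%N -> (k < j)%N -> Q i z -> Q k z -> i = k) ->
  hole_clopen V P -> P x -> (forall i, (i < j)%N -> ~ Q i x) -> hole_family V j.+1.
Proof.
move=> hQ dQ hP Px nx.
have [P' [hP' P'x P'Q]] : exists P', [/\ hole_clopen V P', P' x & forall i z, (i < j)%N -> Q i z -> ~ P' z].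
  have : forall l, (l <= j)%N -> exists P', [/\ hole_clopen V P', P' x & forall i z, (i < l)%N -> Q i z -> ~ P' z].
    elim=> [|l IH] lj; first by exists P.
    have [P' [hP' P'x P'Q]] := IH (ltnW lj); exists (P' `\` Q l); split.
    - by apply: hole_clopenD => //; case: (hQ l lj).
    - by split => //; exact: nx.
    - by move=> i z; rewrite ltnS leq_eqVlt => /orP[/eqP->|il] Qz [P'z nQ] //; exact: (P'Q i z).
  by move=> /(_ j (leqnn j)).
exists (fun i => if i == j then P' else Q i); split=> [i|i k z].
  rewrite ltnS leq_eqVlt => /orP[/eqP->|ij]; first by rewrite eqxx; split => //; exists x.
  by rewrite ltn_eqF //; exact: hQ.
rewrite !ltnS [(i <= _)%N]leq_eqVlt [(k <= _)%N]leq_eqVlt => /orP[/eqP->|ij] /orP[/eqP->|kj]; rewrite ?eqxx ?(ltn_eqF ij) ?(ltn_eqF kj) //.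
- by move=> P'z Qz; case: (P'Q k z kj Qz).
- by move=> Qz P'z; case: (P'Q i z ij Qz).
- exact: dQ.
Qed.

Lemma hole_family_split V j (Q : nat -> set C) P i0 x y :
  (forall i, (i < j)%N -> hole_clopen V (Q i) /\ Q i !=set0) ->
  (forall i k z, (i < j)%N -> (k < j)%N -> Q i z -> Q k z -> i = k) ->
  hole_clopen V P -> (i0 < j)%N -> Q i0 x -> Q i0 y -> P x -> ~ P y -> hole_family V j.+1.
Proof.
move=> hQ dQ hP i0j Qx Qy Px nPy; have [h0 _] := hQ i0 i0j.
apply: (@hole_family_add V j (fun i => if i == i0 then Q i0 `\` P else Q i) (Q i0 `&` P) x).
- move=> i ij; case: eqP => [_|_]; last exact: hQ.
  by split; [exact: hole_clopenD|exists y].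
- move=> i k z ij kj; case: eqP => [->|_]; case: eqP => [->|_] //.
  + by move=> [Qz _]; exact: dQ.
  + by move=> Qz [Qz' _]; exact: dQ Qz Qz'.
  + exact: dQ.
- exact: hole_clopenI.
- by split.
- move=> i ij; case: eqP => [_ [_]|ne Qi]; first exact.
  by apply: ne; exact: dQ Qi Qx.
Qed.

Context (f : C -> C) (hf : hol_on setT f) (nf : nonconst f) (naff : forall a b, ~ forall z, f z = a + b * z).

Lemma sublevel_comp_map k (s : R) z w : nm (iter k.+1 f z) < s -> comp [set w | nm (iter k.+1 f w) < s] z w ->
  comp [set w | nm (iter k f w) < s] (f z) (f w).
Proof.
move=> zs zw; set X := comp [set w | nm (iter k.+1 f w) < s] z in zw.
have cX : connected (f @` X) by apply: cont_connected (comp_conn (z := _)) _; exact: cont_on_sub (hol_cont hf).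
have Xz : (f @` X) (f z) by exists z => //; exact: comp_refl.
have XS : f @` X `<=` [set w | nm (iter k f w) < s].
  by move=> _ [x /comp_sub /= Xx <-]; rewrite -iterSr.
by apply: (comp_max Xz XS cX); exists w.
Qed.

Lemma sublevel_comp_onto k (s : R) z : nm (iter k.+1 f z) < s -> bdd (comp [set w | nm (iter k.+1 f w) < s] z) ->
  forall w, comp [set w | nm (iter k f w) < s] (f z) w ->
  exists2 x, comp [set w | nm (iter k.+1 f w) < s] z x & f x = w.
Proof.
move=> zs bX; have hg := hol_iter k.+1 hf.
apply: (swallow hf nf (comp_open (sublevel_open hg)) bX (comp_conn (z := _))).
  move=> x cx nx /comp_sub /=; rewrite -iterSr => xs; apply: nx; apply: comp_closure => //; exact: sublevel_open.
exists z; first exact: comp_refl.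
by apply: comp_refl; rewrite /= -iterSr.
Qed.

Section pull.
Context (z0 : C) (wr : wandering_ring f z0).
Local Notation V := (fcomp f z0).

Lemma frontier_cover j (Q' : nat -> set C) : (forall i, (i < j)%N -> hole_clopen (V 1%N) (Q' i)) ->
  exists B, [/\ compact B, B `<=` V 1%N & forall i, (i < j)%N -> exists N, [/\ open N, bdd N, Q' i `<=` N &
    forall z, closure N z -> ~ N z -> B z]].
Proof.
elim: j => [|j IH] hQ; first by exists set0; split => //; exact: compact0.
have [B [kB BV hB]] := IH (fun i ij => hQ i (ltnW ij)).
have [N [oN bN QN cN]] := hole_clopen_surround (fcomp_open (f := f) (z0 := z0) (n := 1%N)) (hQ j (ltnSn j)).
exists (B `|` (closure N `&` ~` N)); split.
- apply: compactU => //; apply: (subclosed_compact _ (closure_compact bN)); last by move=> z [].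
  by apply: closedI; [exact: closed_closure|exact: open_closedC].
- by move=> z [/BV//|[/cN[//|/QN]]].
- move=> i; rewrite ltnS leq_eqVlt => /orP[/eqP->|ij].
    by exists N; split => // z cz nz; right.
  by have [N' [oN' bN' QN' h]] := hB i ij; exists N'; split => // z cz nz; left; exact: h.
Qed.

(** [K] is chosen in [V 0] so that its image contains the frontiers of neighbourhoods of all [Q' i];
    the image of [Om] then contains every [Q' i]. The part of [Om] off [V 0] never maps into [V 1],
    by [hole_not_over], so the preimage of [Q' i] in it is relatively clopen. *)
Lemma hole_pull j (Q' : nat -> set C) p : V 0%N p -> (forall i, (i < j)%N -> hole_clopen (V 1%N) (Q' i) /\ Q' i !=set0) ->
  exists k r Rr, [/\ 0 < r, r < Rr, r < nm (iter k.+1 f p) < Rr, ~ V k.+1 0 &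
    let Om := comp [set w | nm (iter k.+1 f w) < Rr] p in
    [/\ bdd Om, (forall z, Om z -> r < nm (iter k.+1 f z) -> V 0%N z), hole_clopen (V 0%N) (Om `\` V 0%N) &
      forall i, (i < j)%N -> let Q := [set z | (Om `\` V 0%N) z /\ Q' i (f z)] in hole_clopen (V 0%N) Q /\ Q !=set0]].
Proof.
move=> Vp hQ'; have [wz [KD [D [rK KD0]]]] := wr.
have [B [kB BV hB]] := @frontier_cover j Q' (fun i ij => (hQ' i ij).1).
have im := fcomp_image hf nf 1 wz rK KD0.
have BfV : B `<=` f @` V 0%N by rewrite im.
have [K1 [kK1 K1V BK1]] := compact_lift hf nf (fcomp_open (f := f) (z0 := z0) (n := 0%N)) kB BfV.
have [K [kK cK K1K KV Kp]] := compact_connected_hull (fcomp_open (f := f) (z0 := z0) (n := 0%N)) (comp_conn (z := _)) Vp kK1 K1V.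
have [k' [r [Rr [[k0 r0 rR Kg nV0] lev]]]] := level_setup hf nf naff 1 wr kK cK (ex_intro _ p Kp) KV.
case: k' k0 Kg nV0 lev => // k _ Kg nV0 lev; have [bOm KOm OmV] := lev p Kp.
exists k, r, Rr; split => //; first exact: Kg.
move=> Om; have [_ hH] := hole_clopen_level hf r0 Vp nV0 rR bOm OmV.
have pR : nm (iter k.+1 f p) < Rr by case/andP: (Kg p Kp).
split => // i ij Q; have [hQi [x Qx]] := hQ' i ij; have [kQ' nQ' oQ'] := hQi; have [kH nH oH] := hH.
split; last first.
  have [N [oN bN QN cN]] := hB i ij.
  have Ox : comp [set w | nm (iter k f w) < Rr] (f p) x.
    apply: (surround_in_level (hol_iter k hf) oN bN (QN x Qx)) => z cz nz.
    have [y Ky <-] := BK1 z (cN z cz nz); apply: sublevel_comp_map pR _; apply: KOm; exact: K1K.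
  have [y Oy yx] := sublevel_comp_onto pR bOm Ox; exists y; rewrite /Q /= yx; split => //; split => // Vy.
  by apply: (nQ' x Qx); rewrite -yx -im; exists y.
split.
- have -> : Q = (Om `\` V 0%N) `&` [set z | Q' i (f z)] by [].
  by apply: compact_closedI => //; apply: closed_preimageC => //; exact: compact_closedC.
- by move=> z [[_ nV] _].
have -> : V 0%N `|` Q = (V 0%N `|` (Om `\` V 0%N)) `&` [set z | (V 1%N `|` Q' i) (f z)].
  apply/seteqP; split=> z.
    case=> [Vz|[Hz Qz]]; last by split; right.
    by split; left => //; rewrite -im; exists z.
  move=> [[Vz|Hz] [Vf|Qf]]; [by left|by left| |by right].
  by case: (hole_not_over hf nf wr hH Hz Vf).
by apply: openI => //; exact: open_preimageC.
Qed.

Lemma hole_family_pull j : hole_family (V 1%N) j -> hole_family (V 0%N) j.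
Proof.
move=> [Q' [hQ' dQ']]; have [k [r [Rr [r0 rR gp nV0 [bOm OmV hH hQ]]]]] := hole_pull (wring_nonempty wr) hQ'.
set Om := comp _ _ in bOm OmV hH hQ.
exists (fun i => [set z | (Om `\` V 0%N) z /\ Q' i (f z)]); split; first exact: hQ.
by move=> i l z ij lj [_ h1] [_ h2]; exact: dQ' h1 h2.
Qed.

Lemma hole_family_critical j p : V 0%N p -> dv f p = 0 -> hole_family (V 1%N) j -> hole_family (V 0%N) j.+1.
Proof.
move=> Vp dp [Q' [hQ' dQ']]; have [k [r [Rr [r0 rR /andP[rp pR] nV0 [bOm OmV hH hQ]]]]] := hole_pull Vp hQ'.
set Om := comp _ _ in bOm OmV hH hQ; set H := Om `\` V 0%N in hH hQ.
have hg := hol_iter k.+1 hf; have hh := hol_iter k hf.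
have oOm : open Om by exact/comp_open/sublevel_open.
have Op : Om p by exact: comp_refl.
have [rho rho0 hrho] := (openCP Om).1 oOm p Op.
have gE z : iter k f (f z) = iter k.+1 f z by rewrite -iterSr.
have g0 : iter k f (f p) != 0 by rewrite gE -nm_gt0; lin.
have [z1 [z2 [[D1 D2 l1 l2 nc] cf]]] := critical_sectors hf hh nf (iter_nonconst k hf nf) rho0 dp g0.
set s := nm (iter k f (f p)) in l1 l2 nc cf; have sE : s = nm (iter k.+1 f p) by rewrite /s gE.
have SE : [set z | nm (iter k f (f z)) < s] = [set z | nm (iter k.+1 f z) < s].
  by apply/seteqP; split=> z /=; rewrite gE.
rewrite SE in nc; rewrite gE in l1; rewrite gE in l2.
pose X z := comp [set z | nm (iter k.+1 f z) < s] z.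
have XOm z : Om z -> nm (iter k.+1 f z) < s -> X z `<=` Om.
  move=> Oz zs; apply: (comp_meet (comp_conn (z := z)) _ _ Oz); last exact: comp_refl.
  by move=> w /comp_sub /=; rewrite sE; lin.
have O1 := hrho _ D1; have O2 := hrho _ D2.
have [MO MO0 hMO] := bOm.
have bX z : Om z -> nm (iter k.+1 f z) < s -> bdd (X z) by move=> Oz zs; exists MO => // w /(XOm z Oz zs)/hMO.
have bX' : bdd (comp [set z | nm (iter k f z) < s] (f z1)).
  have kc := cont_compact (closure_compact (bX z1 O1 l1)) (cont_on_sub (fun _ _ => I) (hol_cont hf)).
  have [M M0 hM] := compact_bdd kc; exists M => // w /(sublevel_comp_onto l1 (bX z1 O1 l1))[x Xx <-].
  by apply: hM; exists x => //; exact: subset_closure.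
have l1' : nm (iter k f (f z1)) < s by rewrite gE.
(* Downstairs the two valleys belong to one component and share the zero [zeta]. Upstairs each of
   the two components maps onto it, so [zeta] has a preimage in each. *)
have [zeta Xz z0E] := sublevel_comp_zero hh bX' l1'.
have [x1 X1 x1E] := sublevel_comp_onto l1 (bX z1 O1 l1) Xz.
have Xz2 : comp [set z | nm (iter k f z) < s] (f z2) zeta by rewrite -(comp_eq cf).
have [x2 X2 x2E] := sublevel_comp_onto l2 (bX z2 O2 l2) Xz2.
have inH x : Om x -> f x = zeta -> H x.
  move=> Ox xE; split => // Vx; apply: nV0; rewrite -z0E -xE gE.
  by have := fcomp_iter hf nf k.+1 wr.1.1 Vx; rewrite add0n.
have H1 : H x1 by apply: inH => //; exact: XOm X1.
have H2 : H x2 by apply: inH => //; exact: XOm X2.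
have oX : open (X z1) by exact/comp_open/sublevel_open.
(* Closedness holds because a limit of [X z1] outside it has level [s], which is above [r], and such
   points of [Om] lie in the domain rather than in [H]. *)
pose P := H `&` X z1.
have hP : hole_clopen (V 0%N) P.
  have [kH nH oH] := hH; split; last 1 first.
  - have -> : V 0%N `|` P = V 0%N `|` X z1.
      apply/seteqP; split=> z [Vz|]; [by left|by case; right|by left|].
      move=> Xz'; have [Vz|nV] := pselect (V 0%N z); first by left.
      by right; split => //; split => //; exact: XOm Xz'.
    by apply: openU => //; exact: fcomp_open.
  - have -> : P = H `&` closure (X z1).
      apply/seteqP; split=> z [Hz Xz']; split => //; first exact: subset_closure.
      have Oz : Om z by case: Hz.
      apply: comp_closure => //; first exact: sublevel_open.
      have cS : nm (iter k.+1 f z) <= s.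
        rewrite leNgt; apply/negP => gz; have e0 : 0 < nm (iter k.+1 f z) - s by lin.
        have [d d0 hd] := (rcont_nm (hol_cont hg) : rcont_on setT _) z I _ e0.
        have [w /comp_sub /= ws wz] := (closureCP _ _).1 Xz' d d0.
        by have := hd w I wz; rewrite ltr_norml /=; lin.
      rewrite /= lt_neqAle cS andbT; apply/eqP => E.
      by case: (nH z Hz); apply: OmV => //; rewrite E sE.
    by apply: compact_closedI => //; exact: closed_closure.
  - by move=> z [/nH].
have P1 : P x1 by [].
have P2 : ~ P x2.
  move=> [_ X12]; apply: nc; have E2 := comp_eq X12; have E3 := comp_eq X2.
  by rewrite E2 -E3; exact: comp_refl.
pose Q i := [set z | H z /\ Q' i (f z)].
have dQ i l z : (i < j)%N -> (l < j)%N -> Q i z -> Q l z -> i = l.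
  by move=> ij lj [_ h1] [_ h2]; exact: dQ' h1 h2.
(* If [zeta] lies in some [Q' i], the pulled-back set contains [x1] and [x2] and is cut in two by
   [P]; otherwise [x1] is in none of them, and [P] supplies the additional set. *)
have [[i ij Qi]|nQ] := pselect (exists2 i, (i < j)%N & Q' i zeta).
  apply: (@hole_family_split (V 0%N) j Q P i x1 x2) => //.
    by split => //; rewrite x1E.
  by split => //; rewrite x2E.
apply: (@hole_family_add (V 0%N) j Q P x1) => // i ij [_]; rewrite x1E => Qi.
by apply: nQ; exists i.
Qed.

End pull.

Lemma hole_image_iter z0 m Q : wandering_ring f z0 -> hole_clopen (fcomp f z0 0) Q -> hole_clopen (fcomp f z0 m) (iter m f @` Q).
Proof.
move=> wr hQ; elim: m => [|m IH].
  by rewrite (_ : _ @` Q = Q) //; apply/seteqP; split=> [_ [z Qz <-]|z Qz] //; exists z.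
have wm := wring_shift hf nf m wr.
have := @hole_image R f hf nf _ wm (iter m f @` Q); rewrite !fcomp_shift => /(_ IH).
rewrite add1n (_ : f @` _ = iter m.+1 f @` Q) //.
by apply/seteqP; split=> [_ [_ [z Qz <-] <-]|_ [z Qz <-]]; [exists z|exists (iter m f z) => //; exists z].
Qed.

Lemma finite_preimage g K y : hol_on setT g -> nonconst g -> compact K -> finite_set [set z | K z /\ g z = y].
Proof.
move=> hg ng kK; have -> : [set z | K z /\ g z = y] = K `&` [set z | K z /\ g z = y].
  by apply/seteqP; split=> [z [Kz zy]|z []].
apply: (compact_induction (K := K) (Q := fun A => finite_set (A `&` [set z | K z /\ g z = y]))) => //.
- by rewrite set0I; exact: finite_set0.
- by move=> A B fA fB; rewrite setIUl finite_setU.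
- by move=> A B AB; apply: sub_finite_set => z [/AB].
move=> z Kz; have [lc|[m [k [r [m0 r0 _] [_ hr]]]]] := zero_factor (ltr01 : 0 < 1 :> R) (hol_sub (fun _ _ => I) hg : hol_on (disc z 1) g).
  by case: (nonconst_not_loc (c := z) hg ng).
have [E|ne] := eqVneq (g z) y.
  exists r => //; apply: (sub_finite_set _ (finite_set1 z)) => w [wz [_ wy]] /=.
  have [k0 wE] := hr w wz; apply/eqP; apply: contraT => wn; move/eqP: wE.
  rewrite wy E -subr_eq0 opprD addrA subrr sub0r oppr_eq0 mulf_eq0 (negbTE k0) orbF expf_eq0 subr_eq0 (negbTE wn) andbF //.
have e0 : 0 < nm (y - g z) by rewrite nm_gt0 subr_eq0 eq_sym.
have [d d0 hd] := (hol_cont hg : cont_on setT _) z I _ e0; exists d => //.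
apply: (sub_finite_set _ (finite_set0 _)) => w [wz [_ wy]].
by have := hd w I wz; rewrite wy ltxx.
Qed.

Lemma one_hole_finite z0 m : wandering_ring f z0 -> ~ hole_family (fcomp f z0 m) 2 -> exists d, ~ hole_family (fcomp f z0 0) d.
Proof.
move=> wr n2; apply: contrapT => hall.
have fam d : hole_family (fcomp f z0 0) d by apply: contrapT => h; apply: hall; exists d.
(* When two disjoint nonempty sets are impossible, any two nonempty ones coincide; so all images
   under f^m contain the common point [y]. *)
have uniq_hole H H' z : hole_clopen (fcomp f z0 m) H -> hole_clopen (fcomp f z0 m) H' -> H' !=set0 -> H z -> H' z.
  move=> hH hH' [x H'x] Hz; apply: contrapT => nz; apply: n2.
  exists (fun i => if i == 0%N then H' else H `\` H'); split=> [[|[|i]]//= _|[|[|i]] [|[|l]]//= w _ _].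
  - by split => //; exists x.
  - by split; [exact: hole_clopenD|exists z].
  - by move=> H'w [].
  - by move=> [].
have [Q1 [hQ1 _]] := fam 1%N; have [h1 [x1 Qx1]] := hQ1 0%N isT.
pose y := iter m f x1.
have hit Q : hole_clopen (fcomp f z0 0) Q -> Q !=set0 -> exists2 x, Q x & iter m f x = y.
  move=> hQ [x Qx]; have : (iter m f @` Q) y; last by case=> x' Qx' <-; exists x'.
  apply: (uniq_hole (iter m f @` Q1 0%N)); [exact: hole_image_iter|exact: hole_image_iter| |by exists x1].
  by exists (iter m f x), x.
have [M M0 hM] := wring_bdd hf nf 0 wr.
have fin := finite_preimage y (hol_iter m hf) (iter_nonconst m hf nf) (@cdisc_compact R 0 M).
set S := [set z | _] in fin.
pose d := (size (finmap.enum_fset (fset_set S))).+1; have [Q [hQ dQ]] := fam d.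
have pick i : exists x, (i < d)%N -> Q i x /\ iter m f x = y.
  have [id|id] := ltnP i d; last by exists 0.
  by have [h ne] := hQ i id; have [x Qx xy] := hit _ h ne; exists x.
pose x i := projT1 (cid (pick i)); have xP i := projT2 (cid (pick i)).
have ux : uniq [seq x i | i <- iota 0 d].
  rewrite map_inj_in_uniq ?iota_uniq // => i k; rewrite !mem_iota !add0n => /andP[_ id] /andP[_ kd] E.
  have [Qi _] := xP i id; have [Qk _] := xP k kd.
  by apply: (dQ i k (x i)) => //; rewrite E.
have sub : {subset [seq x i | i <- iota 0 d] <= finmap.enum_fset (fset_set S)}.
  move=> w wl; have [i il ->] := elimT mapP wl; move: il; rewrite mem_iota add0n => /andP[_ id].
  have [Qi iy] := xP i id; rewrite in_fset_set // inE; split => //.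
  rewrite /cdisc /= subr0; apply: (hole_bounded _ hM Qi); by case: (hQ i id).
have := uniq_leq_size ux sub; rewrite size_map size_iota /d; by rewrite ltnn.
Qed.

End counting_holes.

(** * Counting critical indices and concluding *)

Section trichotomy.
Context {R : realType}.
Local Notation C := (cplx R).
Implicit Types (z p : C).

Lemma connectivity_cases (G : set C) : connectivity G = +oo%E \/ exists k : nat, connectivity G = k%:R%:E.
Proof. by rewrite /connectivity /counting; case: asboolP => _; [right; eexists|left]. Qed.

Context (f : C -> C) (hf : hol_on setT f) (nf : nonconst f) (naff : forall a b, ~ forall z, f z = a + b * z).
Context (z0 : C) (wr : wandering_ring f z0).
Local Notation V := (fcomp f z0).

Let critical (m : nat) := `[< exists2 p, V m p & dv f p = 0 >].

Lemma V_shift m k : fcomp f (iter m f z0) k = V (k + m). Proof. exact: fcomp_shift. Qed.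

(** Going back from index n + l to n, each index with a critical point adds one set to the single
    one that always exists; the others lose none. *)
Lemma hole_family_count l n : hole_family (V n) (count critical (iota n l)).+1.
Proof.
elim: l n => [|l IH] n.
  by have := has_hole hf nf naff (wring_shift hf nf n wr); rewrite V_shift add0n.
have wn := wring_shift hf nf n wr; have := IH n.+1.
have -> : V n.+1 = fcomp f (iter n f z0) 1 by rewrite V_shift add1n.
have -> : V n = fcomp f (iter n f z0) 0 by rewrite V_shift.
rewrite /= /critical; case: asboolP => [[p Vp dp]|_] h; last exact: (hole_family_pull hf nf naff wn h).
by rewrite add1n; apply: (hole_family_critical hf nf naff wn _ dp h); rewrite V_shift.
Qed.

(** Needed so that critical points are isolated and each bounded domain contains finitely many. *)
Lemma dv_nonconst : nonconst (dv f).
Proof.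
apply: contrapT => h; have cst z : dv f z = dv f 0.
  by apply/eqP; apply: contrapT => /negP ne; apply: h; exists z, 0.
apply: (naff (a := f 0) (b := dv f 0)) => z.
have key w : disc 0 (nm z + 1) w -> dC (fun u => f u - dv f 0 * u) w 0.
  move=> _; apply: dC_eq (dC_sub (dvP (hf I)) (dC_scale (dv f 0) (dC_id w))) _.
  by rewrite (cst w) mulr1 subrr.
have Dz : disc 0 (nm z + 1) z by rewrite /disc /= subr0 ltrDl ltr01.
have D0 : disc (0 : C) (nm z + 1) 0 by apply: disc_center; rewrite ltr_wpDl ?nm_ge0 ?ltr01.
by have := deriv0_cst key Dz D0; rewrite mulr0 subr0 => <-; rewrite subrK.
Qed.

Let crit n := (\bigcup_(m in [set m | (n <= m)%N]) V m) `&` [set p | dv f p = 0].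
Let levels n := [set m | (n <= m)%N /\ critical m].

(** The domains are disjoint, so distinct critical indices give distinct critical points; conversely
    each index contributes only the finitely many zeros of f' in a compact closure. *)
Lemma levels_finite n : finite_set (crit n) <-> finite_set (levels n).
Proof.
split=> fin.
  have pick m : exists p, critical m -> V m p /\ dv f p = 0.
    by have [/asboolP[p Vp dp]|_] := boolP (critical m); [exists p|exists 0].
  pose c m := projT1 (cid (pick m)); have cP m := projT2 (cid (pick m)).
  apply: contrapT => inf; have [s [us ss sL]] := infinite_pick (size (finmap.enum_fset (fset_set (crit n)))).+1 inf.
  have uc : uniq [seq c m | m <- s].
    rewrite map_inj_in_uniq // => i k /sL[_ ci] /sL[_ ck] E.
    have [Vi _] := cP i ci; have [Vk _] := cP k ck; rewrite -/(c i) in Vi; rewrite -/(c k) -E in Vk.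
    have [ik|ik|//] := ltngtP i k; first by case: (wr.1.2 i k _ ik Vi Vk).
    by case: (wr.1.2 k i _ ik Vk Vi).
  have sub : {subset [seq c m | m <- s] <= finmap.enum_fset (fset_set (crit n))}.
    move=> w wl; have [m ms ->] := elimT mapP wl; have [nm0 cm] := sL m ms; have [Vm dm] := cP m cm.
    by rewrite in_fset_set // inE; split => //; exists m.
  by have := uniq_leq_size uc sub; rewrite size_map ss ltnn.
apply: (sub_finite_set (B := \bigcup_(m in levels n) (closure (V m) `&` [set p | dv f p = 0]))).
  move=> p [[m nm0 Vp] dp]; exists m; last by split => //; exact: subset_closure.
  by split => //; apply/asboolP; exists p.
apply: bigcup_finite => // m _.
exact: (finite_preimage 0 (hol_dv (@openT C) hf) dv_nonconst (closure_compact (wring_bdd hf nf m wr))).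
Qed.

Lemma no_critical_level n : (forall m, (n <= m)%N -> ~~ critical m) -> ~ hole_family (V n) 2.
Proof.
move=> h; have -> : V n = fcomp f (iter n f z0) 0 by rewrite V_shift.
apply: (no_critical_one_hole hf nf naff (wring_shift hf nf n wr)) => m p; rewrite V_shift => Vp.
by apply/eqP => dp; have /asboolP := h (m + n)%N (leq_addl _ _); apply; exists p.
Qed.

Lemma connectivity_two n : crit n = set0 -> ~ hole_family (V n) 2.
Proof.
move=> c0; apply: no_critical_level => m nm0; apply/asboolP => -[p Vp dp].
have : crit n p by split => //; exists m.
by rewrite c0.
Qed.

Lemma connectivity_three n : crit n !=set0 -> hole_family (V n) 2.
Proof.
move=> [p [[m nm0 Vp] dp]]; apply: hole_family_le (hole_family_count (m - n).+1 n).
rewrite ltnS -has_count; apply/hasP; exists m; first by rewrite mem_iota nm0 addnS subnKC // ltnSn.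
by apply/asboolP; exists p.
Qed.

Lemma connectivity_finite n : finite_set (crit n) -> exists d, ~ hole_family (V n) d.
Proof.
(* [b] exceeds every critical index from [n] on, so the domain of index [n + b] has a forward orbit
   without critical points and exactly one hole; [one_hole_finite] brings finiteness back to index
   [n]. *)
move=> /levels_finite fin; pose b := (\max_(i <- finmap.enum_fset (fset_set (levels n))) i).+1.
have hb m : (n + b <= m)%N -> ~~ critical m.
  move=> bm; apply/negP => cm.
  have : m \in finmap.enum_fset (fset_set (levels n)).
    by rewrite in_fset_set // inE; split => //; apply: leq_trans bm; exact: leq_addr.
  move=> /leq_bigmax_seq; move=> /(_ xpredT id isT) /= le; move: bm; rewrite leqNgt /b addnS ltnS (leq_trans le) //.
  exact: leq_addl.
have n2 := no_critical_level hb.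
have [d nd] : exists d, ~ hole_family (fcomp f (iter n f z0) 0) d.
  by apply: (one_hole_finite hf nf (m := b) (wring_shift hf nf n wr)); rewrite V_shift addnC.
by exists d; move: nd; rewrite V_shift.
Qed.

Lemma connectivity_infinite n d : infinite_set (crit n) -> hole_family (V n) d.
Proof.
move=> inf; have infL : infinite_set (levels n) by move=> /levels_finite.
have [s [us ss sL]] := infinite_pick d infL.
pose l := (\max_(i <- s) i).+1; apply: hole_family_le (hole_family_count l n).
apply: leqW; rewrite -size_filter -ss; apply: uniq_leq_size => // m ms.
have [nm0 cm] := sL m ms; rewrite mem_filter cm mem_iota nm0 /=.
by rewrite /l addnS ltnS; apply: leq_trans (leq_addl _ _); exact: (leq_bigmax_seq (P := xpredT) (F := id)).
Qed.

Lemma connectivity_trichotomy n : let c := (connectivity (V n) : \bar R) in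
  [/\ c = 2%:E <-> crit n = set0, (2%:E < c < +oo)%E <-> (finite_set (crit n) /\ crit n !=set0) &
      c = +oo%E <-> infinite_set (crit n)].
Proof.
move=> c; have oV : open (V n) by exact: fcomp_open.
have ge N : (N.+1%:R%:E <= c)%E <-> hole_family (V n) N by exact: connectivity_ge.
have c2 : (2%:E <= c)%E.
  by apply/(ge 1%N); have := hole_family_count 0 n.
have cs : c = +oo%E \/ exists k : nat, c = k%:R%:E by exact: connectivity_cases.
have two : crit n = set0 -> c = 2%:E.
  move=> c0; have n3 : ~ (3%:R%:E <= c)%E by move=> /(ge 2%N); exact: connectivity_two c0.
  case: cs => [E|[k E]]; first by case: n3; rewrite E leey.
  move: c2 n3; rewrite E !lee_fin !ler_nat => k2 /negP; rewrite -ltnNge => k3.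
  by congr (_%:R%:E); apply/eqP; rewrite eqn_leq k2 -ltnS k3.
have three : crit n !=set0 -> (2%:E < c)%E.
  move=> ne; apply: (@lt_le_trans _ _ 3%:R%:E); first by rewrite lte_fin ltr_nat.
  by apply/(ge 2%N); exact: connectivity_three.
have fin : finite_set (crit n) -> (c < +oo)%E.
  move=> /connectivity_finite[d nd]; rewrite lt_neqAle leey andbT; apply/eqP => E.
  by apply: nd; apply/ge; rewrite E leey.
have inf : infinite_set (crit n) -> c = +oo%E.
  move=> i; case: cs => [//|[k E]].
  by have := (ge k).2 (connectivity_infinite k i); rewrite E lee_fin ler_nat ltnn.
split; split=> [h|].
- by apply/seteqP; split=> // p cp; have := three (ex_intro _ p cp); rewrite h ltxx.
- exact: two.
- case/andP: h => h1 h2; split.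
    by apply: contrapT => i; move: h2; rewrite inf // ltxx.
  by apply: contrapT => /set0P/negP/negPn/eqP c0; move: h1; rewrite two // ltxx.
- by move=> [f1 ne]; rewrite three // fin.
- by move=> fi; have := fin fi; rewrite h ltxx.
- exact: inf.
Qed.

End trichotomy.

Theorem theorem1p7 (R : realType) (f : cplx R -> cplx R) (U : set (cplx R))
    (f_transcendental : transcendental_entire f)
    (U_wandering : wandering_domain f U)
    (U_multiply_connected : multiply_connected U)
    (n : nat) (n_gt0 : (0 < n)%N) :
  let U_ (m : nat) : set (cplx R) := iter m f @` U in
  let crit : set (cplx R) := (\bigcup_(m >= n) U_ m) `&` critical_points f in
  [/\ connectivity (U_ n) = 2%:E <-> crit = set0,
      (2%:E < connectivity (U_ n) < +oo)%E <->
        (finite_set crit /\ crit !=set0) &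
      connectivity (U_ n) = +oo%E <-> infinite_set crit].
Proof.
have [ef npoly] := f_transcendental; have hf := entire_hol ef.
have naff a b : ~ forall z, f z = a + b * z.
  move=> E; apply: npoly; exists (a%:P + b%:P * 'X) => z.
  by rewrite E !hornerE.
have nf : nonconst f.
  apply: contrapT => h; apply: (naff (f 0) 0) => z; rewrite mul0r addr0.
  by apply/eqP; apply: contrapT => /negP ne; apply: h; exists z, 0.
have [z0 [UE wz]] := wandering_wander hf nf U_wandering; subst U.
have [K [D [rK K0]]] := multiply_connected_ring wz.1 U_multiply_connected.
have wr : wandering_ring f z0 by split => //; exists K, D.
move=> U_ crit; have UE m : U_ m = fcomp f z0 m := fcomp_image hf nf m wz rK K0.
have -> : crit = (\bigcup_(m in [set m | (n <= m)%N]) fcomp f z0 m) `&` [set p | dv f p = 0].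
  apply/seteqP; split=> p [[m nm0 Up] cp]; (split; last exact/critical_pointsE); exists m => //.
    by rewrite -UE.
  by rewrite UE.
by rewrite UE; exact: (connectivity_trichotomy hf nf naff wr n).
Qed.
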